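(* Let $\mathcal{M}$ be a finite-dimensional Hadamard manifold of bounded sectional curvature, and let $f:\mathcal{N}\subset\mathcal{M}\to\mathbb{R}$ be a function that is g-convex in a compact g-convex set $\mathcal{X}\subset\mathcal{N}$ of diameter $D$. Let $\lambda\in\mathbb{R}_{>0}$, $x_0\in\mathcal{X}$, $x^\ast\in\arg\min_{x\in\mathcal{X}}f(x)$, and $R_0=d(x_0,x^\ast)$. For any $\varepsilon>0$, the algorithm Riemacon (described in the context) yields an $\varepsilon$-minimizer $y_T\in\mathcal{X}$ of $f$ in $\mathcal{X}$ after $$T=O\left(\zeta_D\sqrt{\frac{R_0^2}{\lambda\varepsilon}}\right)$$ iterations. If in addition $f$ is $\mu$-strongly g-convex in $\mathcal{X}$ (with $\mu>0$) then, via a sequence of restarts of Riemacon, an $\varepsilon$-minimizer is obtained in $$O\left(\left(\zeta_D\sqrt{\frac{1}{\lambda\mu}}+1\right)\log\left(\frac{\mu R_0^2}{\varepsilon}\right)\right)$$ iterations.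
   Context: A Hadamard manifold is a complete simply connected Riemannian manifold of non-positive sectional curvature. Sectional curvatures of $\mathcal{M}$ lie in $[\kappa_{\min},\kappa_{\max}]$ with $\kappa_{\max}\le 0$. $d$ is the Riemannian distance, $\exp_x$ the exponential map, $\exp_x^{-1}$ its inverse, and $\Gamma_{x}^{y}:T_x\mathcal{M}\to T_y\mathcal{M}$ is parallel transport along the unique geodesic from $x$ to $y$. $\mathcal{N}$ is an open set. For $D\ge 0$, $\zeta_D= D\sqrt{|\kappa_{\min}|}\coth(D\sqrt{|\kappa_{\min}|})$ (equal to $1$ when $D\sqrt{|\kappa_{\min}|}=0$). $O(\cdot)$ hides universal constants only. $f$ is $\mu$-strongly g-convex in $\mathcal{X}$ if for all $x,y\in\mathcal{X}$, $t\in[0,1]$: $f(\exp_x((1-t)\exp_x^{-1}(y)))\le t f(x)+(1-t)f(y)-\frac{t(1-t)\mu}{2}d(x,y)^2$; it is g-convex if this holds with $\mu=0$. A $\sigma$-minimizer of a function $F$ in $\mathcal{X}$ is a point $y\in\mathcal{X}$ with $F(y)\le\min_{\mathcal{X}}F+\sigma$. Riemacon. Parameters: $\xi=4\zeta_{2D}-3$; $a_k=2\lambda\frac{k+32\xi}{5}$ for $k\ge1$; $A_0=200\lambda\xi$ and $A_k=A_{k-1}+a_k/\xi$; $\eta_k=a_k/\xi$; $\Delta_k=\frac{1}{(k+1)^2}$. Let $h_k(y)=f(y)+\frac{1}{2\lambda}d(x_k,y)^2$, $y_k^\ast=\arg\min_{y\in\mathcal{X}}h_k(y)$, and $\sigma_k=\frac{\Delta_k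 d(x_k,y_k^\ast)^2}{78\lambda}$. Initialization: $y_0\in\mathcal{X}$ is any $\sigma_0$-minimizer of $h_0$ in $\mathcal{X}$; $z_0^{y_0}=\bar z_0^{y_0}=0\in T_{y_0}\mathcal{M}$. For $k=1,2,\dots,T$: (1) $x_k=\exp_{y_{k-1}}\left(\frac{a_k}{A_{k-1}+a_k}\bar z_{k-1}^{y_{k-1}}\right)$; (2) $y_k\in\mathcal{X}$ is any $\sigma_k$-minimizer of $h_k$ in $\mathcal{X}$; (3) $v_k^x=-\exp_{x_k}^{-1}(y_k)/\lambda\in T_{x_k}\mathcal{M}$; (4) $z_k^{x_k}=\exp_{x_k}^{-1}(\exp_{y_{k-1}}(\bar z_{k-1}^{y_{k-1}}))-\eta_k v_k^x\in T_{x_k}\mathcal{M}$; (5) $z_k^{y_k}=\Gamma_{x_k}^{y_k}(z_k^{x_k})+\exp_{y_k}^{-1}(x_k)\in T_{y_k}\mathcal{M}$; (6) $\bar z_k^{y_k}$ is the Euclidean projection of $z_k^{y_k}$ onto the closed ball of center $0$ and radius $D$ in $T_{y_k}\mathcal{M}$. Output: $y_T$. Restarts (strongly g-convex case): Riemacon is run in stages, each stage starting from the output of the previous one. A stage with bound $R$ on the distance from its initial point to $x^\ast$ is run for the number of iterations that guarantees accuracy $\mu R^2/8$, which guarantees that the distance to $x^\ast$ is at most $R/2$; the next stage uses the bound $R/2$. The first stage uses $R=R_0$. The number of iterations counted is the total over all stages.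
   Formalization: In the strongly g-convex bound, log(μR_0²/ε) is replaced by max(1, log(μR_0²/ε)), since the literal bound is zero or negative when μR_0² ≤ ε, although iterations may still be needed. *)

(* Defs.v *)
From HB Require Import structures.
From mathcomp Require Import all_boot all_order all_algebra.
From mathcomp Require Import all_classical all_reals all_analysis.

Set Implicit Arguments.
Unset Strict Implicit.
Unset Printing Implicit Defensive.

Import Order.TTheory GRing.Theory Num.Theory.
Import numFieldNormedType.Exports.

Local Open Scope classical_set_scope.
Local Open Scope ring_scope.

(** * Smooth functions on open subsets of R^n *)

Section smooth.
Context {R : realType} {n : nat}.

Definition partial (i : 'I_n) (f : 'rV[R]_n -> R) : 'rV[R]_n -> R :=
  fun p => 'D_(delta_mx 0 i) f p.

Fixpoint Ck (k : nat) (U : set 'rV[R]_n) (f : 'rV[R]_n -> R) : Prop :=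
  (forall p, U p -> {for p, continuous f}) /\
  if k is k'.+1 then
    forall i : 'I_n,
      (forall p, U p -> derivable f p (delta_mx 0 i)) /\ Ck k' U (partial i f)
  else True.

Definition smooth (U : set 'rV[R]_n) (f : 'rV[R]_n -> R) : Prop :=
  forall k, Ck k U f.

(* The differential at p of a map into R^n, acting on row vectors by right
   multiplication. *)
Definition jacobian_mx (F : 'rV[R]_n -> 'rV[R]_n) (p : 'rV[R]_n) : 'M[R]_n :=
  \matrix_(i, j) partial i (fun q => F q 0 j) p.

End smooth.

(** * Riemannian manifolds *)

(* [mchart c] is a chart with domain [mdom c] and inverse [minv c]; its values
   outside [mdom c], and those of [minv c] outside the image, are irrelevant.
   Each point has a preferred chart [chart_at], which is used below to
   represent its tangent space. *)
Record riemannianManifold (R : realType) (n : nat) := RiemannianManifold {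
  mcarrier :> topologicalType;
  mhausdorff : hausdorff_space mcarrier;
  msecond_countable : @second_countable mcarrier;
  mindex : Type;
  mdom : mindex -> set mcarrier;
  mchart : mindex -> mcarrier -> 'rV[R]_n;
  minv : mindex -> 'rV[R]_n -> mcarrier;
  chart_at : mcarrier -> mindex;
  mem_chart_at : forall x, mdom (chart_at x) x;
  mdom_open : forall c, open (mdom c);
  mimage_open : forall c, open (mchart c @` mdom c);
  mchartK : forall c x, mdom c x -> minv c (mchart c x) = x;
  mchart_continuous : forall c x, mdom c x -> {for x, continuous (mchart c)};
  minv_continuous : forall c p, (mchart c @` mdom c) p ->
    {for p, continuous (minv c)};
  mtransition_smooth : forall c c' (k : 'I_n),
    smooth (mchart c @` (mdom c `&` mdom c'))
      (fun p => mchart c' (minv c p) 0 k);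
  mmetric : mindex -> 'rV[R]_n -> 'M[R]_n;
  mmetric_smooth : forall c (i j : 'I_n),
    smooth (mchart c @` mdom c) (fun p => mmetric c p i j);
  mmetric_sym : forall c p, (mchart c @` mdom c) p ->
    (mmetric c p)^T = mmetric c p;
  mmetric_pos : forall c p (v : 'rV[R]_n), (mchart c @` mdom c) p -> v != 0 ->
    0 < (v *m mmetric c p *m v^T) 0 0;
  mmetric_compat : forall c c' x, mdom c x -> mdom c' x ->
    let J := jacobian_mx (mchart c' \o minv c) (mchart c x) in
    mmetric c (mchart c x) = J *m mmetric c' (mchart c' x) *m J^T
}.

Unset Implicit Arguments.

Section riemannian.
Context {R : realType} {n : nat} {M : riemannianManifold R n}.

(* T_x M: the row vector v stands for the tangent vector with components v
   in the chart [chart_at x]. *)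
Definition tangent (x : M) : Type := 'rV[R]_n.

Definition tangent_in (c : mindex M) (x : M) (v : tangent x) : 'rV[R]_n :=
  v *m jacobian_mx (mchart c \o minv (chart_at x))
                   (mchart (chart_at x) x).

Definition inner (x : M) (u v : tangent x) : R :=
  (u *m mmetric (chart_at x) (mchart (chart_at x) x) *m v^T) 0 0.

Definition tnorm (x : M) (v : tangent x) : R := Num.sqrt (inner x v v).

(* christoffel c p k i j = \Gamma^k_{ij}(p) in the chart c. *)
Definition christoffel (c : mindex M) (p : 'rV[R]_n) (k i j : 'I_n) : R :=
  2^-1 * \sum_l invmx (mmetric c p) k l *
    (partial i (fun q => mmetric c q j l) p
     + partial j (fun q => mmetric c q i l) p
     - partial l (fun q => mmetric c q i j) p).

(* R(d_i, d_j) d_k = \sum_l (riemann_coef c p l i j k) d_l, with the convention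
   R(U,V)W = \nabla_U \nabla_V W - \nabla_V \nabla_U W - \nabla_[U,V] W. *)
Definition riemann_coef (c : mindex M) (p : 'rV[R]_n) (l i j k : 'I_n) : R :=
  partial i (fun q => christoffel c q l j k) p
  - partial j (fun q => christoffel c q l i k) p
  + \sum_m (christoffel c p l i m * christoffel c p m j k
            - christoffel c p l j m * christoffel c p m i k).

Definition curvature (x : M) (u v w : tangent x) : tangent x :=
  \row_l \sum_i \sum_j \sum_k
    u 0 i * v 0 j * w 0 k *
    riemann_coef (chart_at x) (mchart (chart_at x) x) l i j k.

Definition sectional_curvature (x : M) (u v : tangent x) : R :=
  inner x (curvature x u v v) u /
  (inner x u u * inner x v v - inner x u v ^+ 2).

Definition curve_coord (c : mindex M) (g : R -> M) (k : 'I_n) : R -> R :=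
  fun t => mchart c (g t) 0 k.

Definition velocity_in (c : mindex M) (g : R -> M) (t : R) : 'rV[R]_n :=
  \row_k derive1 (curve_coord c g k) t.

Definition velocity (g : R -> M) (t : R) : tangent (g t) :=
  velocity_in (chart_at (g t)) g t.

Definition C1_curve (g : R -> M) : Prop :=
  continuous g /\
  forall t c, mdom c (g t) -> forall k : 'I_n,
    derivable (curve_coord c g k) t 1 /\
    {for t, continuous (derive1 (curve_coord c g k))}.

Definition curve_length (g : R -> M) : R :=
  \int[@lebesgue_measure R]_(t in `[0, 1]%classic) tnorm (g t) (velocity g t).

(* Some piecewise C^1 curve from x to y has length l. The pieces are restrictions
   to [0, 1] of C^1 curves defined on R, concatenated without reparametrization. *)
Inductive joined_by_length : M -> M -> R -> Prop :=
| joined_C1 (g : R -> M) :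
    C1_curve g -> joined_by_length (g 0) (g 1) (curve_length g)
| joined_cat x y z l l' :
    joined_by_length x y l -> joined_by_length y z l' ->
    joined_by_length x z (l + l').

Definition dist (x y : M) : R := inf [set l | joined_by_length x y l].

Definition diam (X : set M) : R :=
  sup [set r | exists x y, [/\ X x, X y & r = dist x y]].

Definition geodesic (g : R -> M) : Prop :=
  continuous g /\
  forall t c, mdom c (g t) -> forall k : 'I_n,
    [/\ derivable (curve_coord c g k) t 1,
        derivable (derive1 (curve_coord c g k)) t 1 &
        derive1 (derive1 (curve_coord c g k)) t =
        - \sum_i \sum_j christoffel c (mchart c (g t)) k i j *
            velocity_in c g t 0 i * velocity_in c g t 0 j].

(* V t is a tangent vector at g t. *)
Definition parallel_along (g : R -> M) (V : forall t, tangent (g t)) : Prop :=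
  forall t c, mdom c (g t) -> forall k : 'I_n,
    let W s := tangent_in c (g s) (V s) in
    derivable (fun s => W s 0 k) t 1 /\
    derive1 (fun s => W s 0 k) t =
    - \sum_i \sum_j christoffel c (mchart c (g t)) k i j *
        velocity_in c g t 0 i * W t 0 j.

(* The exponential map, its inverse and parallel transport are given by their
   defining relations; the default values of xget are never reached on a
   Hadamard manifold. *)
Definition rexp (x : M) (v : tangent x) : M :=
  xget x [set y | exists g,
    [/\ geodesic g, g 0 = x, velocity g 0 = v & g 1 = y]].

Definition rlog (x y : M) : tangent x :=
  xget (0 : 'rV[R]_n) [set v | rexp x v = y].

Definition ptransport (x y : M) (v : tangent x) : tangent y :=
  xget (0 : 'rV[R]_n) [set w : 'rV[R]_n | exists g (V : R -> 'rV[R]_n),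
    [/\ geodesic g, g 0 = x, g 1 = y, parallel_along g V &
        V 0 = v /\ V 1 = w]].

End riemannian.

(** * Hadamard manifolds *)

Section hadamard.
Context {R : realType} {n : nat}.

Definition simply_connected (T : topologicalType) : Prop :=
  (forall x y : T, exists g : R -> T,
     [/\ {within `[0, 1], continuous g}, g 0 = x & g 1 = y]) /\
  (forall g : R -> T, {within `[0, 1], continuous g} -> g 0 = g 1 ->
     exists H : R * R -> T,
       [/\ {within `[0, 1] `*` `[0, 1], continuous H},
           (forall t, t \in `[0, 1] -> H (0, t) = g t),
           (forall t, t \in `[0, 1] -> H (1, t) = g 0) &
           (forall s, s \in `[0, 1] -> H (s, 0) = g 0 /\ H (s, 1) = g 0)]).

(* Every geodesic is defined for all times. *)
Definition complete_manifold (M : riemannianManifold R n) : Prop :=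
  forall (x : M) (v : tangent x), exists g : R -> M,
    [/\ geodesic g, g 0 = x & velocity g 0 = v].

Definition all_sectional_curvatures (M : riemannianManifold R n)
    (P : R -> Prop) : Prop :=
  forall (x : M) (u v : tangent x), row_free (col_mx u v) ->
    P (sectional_curvature x u v).

Definition hadamard (M : riemannianManifold R n) : Prop :=
  [/\ complete_manifold M, simply_connected M &
      all_sectional_curvatures M (fun K => K <= 0)].

End hadamard.

(** * Geodesic convexity and approximate minimizers *)

Section gconvex.
Context {R : realType} {n : nat} {M : riemannianManifold R n}.
Implicit Types (X : set M) (f : M -> R).

Definition gconvex_set X : Prop :=
  forall x y (t : R), X x -> X y -> t \in `[0, 1] ->
    X (rexp x (t *: rlog x y)).

Definition strongly_gconvex (mu : R) X f : Prop :=
  forall x y (t : R), X x -> X y -> t \in `[0, 1] ->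
    f (rexp x ((1 - t) *: rlog x y)) <=
    t * f x + (1 - t) * f y - t * (1 - t) * mu / 2 * dist x y ^+ 2.

Definition gconvex X f : Prop := strongly_gconvex 0 X f.

Definition argmin X (F : M -> R) : set M :=
  [set y | X y /\ forall z, X z -> F y <= F z].

Definition approx_minimizer X (F : M -> R) (sigma : R) (y : M) : Prop :=
  X y /\ exists2 m, argmin X F m & F y <= F m + sigma.

End gconvex.

Definition coth {R : realType} (r : R) : R :=
  (expR r + expR (- r)) / (expR r - expR (- r)).

Definition zeta {R : realType} (kmin D : R) : R :=
  let r := D * Num.sqrt `|kmin| in if r == 0 then 1 else r * coth r.

(** * Riemacon *)

Section riemacon.
Context {R : realType} {n : nat} {M : riemannianManifold R n}.
Variables (kmin D lam : R) (X : set M) (f : M -> R).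

Definition rc_xi : R := 4 * zeta kmin (2 * D) - 3.
Definition rc_a (k : nat) : R := 2 * lam * ((k%:R + 32 * rc_xi) / 5).
Fixpoint rc_A (k : nat) : R :=
  if k is k'.+1 then rc_A k' + rc_a k / rc_xi else 200 * lam * rc_xi.
Definition rc_eta (k : nat) : R := rc_a k / rc_xi.
Definition rc_Delta (k : nat) : R := 1 / (k%:R + 1) ^+ 2.
Definition rc_h (xk y : M) : R := f y + 1 / (2 * lam) * dist xk y ^+ 2.

(* y is a sigma_k-minimizer of h_k, where x_k = xk. *)
Definition approx_prox (k : nat) (xk y : M) : Prop :=
  exists2 ystar, argmin X (rc_h xk) ystar &
    approx_minimizer X (rc_h xk)
      (rc_Delta k * dist xk ystar ^+ 2 / (78 * lam)) y.

Definition ball_projection (y : M) (z zbar : tangent y) : Prop :=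
  tnorm y zbar <= D /\
  forall w : tangent y, tnorm y w <= D ->
    tnorm y (z - zbar) <= tnorm y (z - w).

Definition riemacon_step (k : nat)
    (yprev : M) (zprev : tangent yprev) (xk yk : M) (zk : tangent yk) : Prop :=
  let v : tangent xk := - (lam^-1 *: rlog xk yk) in
  let zx : tangent xk := rlog xk (rexp yprev zprev) - rc_eta k *: v in
  let zy : tangent yk := ptransport xk yk zx + rlog yk xk in
  [/\ xk = rexp yprev ((rc_a k / (rc_A k.-1 + rc_a k)) *: zprev),
      approx_prox k xk yk &
      ball_projection yk zy zk].

(* yT is a possible output of T iterations of the algorithm started at x0. *)
Definition riemacon (T : nat) (x0 yT : M) : Prop :=
  exists (x y : nat -> M) (zbar : forall k, tangent (y k)),
    [/\ x 0%N = x0, approx_prox 0 x0 (y 0%N), zbar 0%N = 0,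
        forall k, (1 <= k <= T)%N ->
          riemacon_step k (y k.-1) (zbar k.-1) (x k) (y k) (zbar k) &
        yT = y T].

(* T iterations, from any point at distance at most r of xstar, guarantee
   accuracy delta. *)
Definition riemacon_guarantees (xstar : M) (r delta : R) (T : nat) : Prop :=
  forall x0 yT, X x0 -> dist x0 xstar <= r -> riemacon T x0 yT ->
    approx_minimizer X f delta yT.

(* y is a possible output of J successive stages of respective numbers of
   iterations T 0, ..., T (J - 1), the first one being started at x0. *)
Definition restarted_riemacon (J : nat) (T : nat -> nat) (x0 y : M) : Prop :=
  exists p : nat -> M,
    [/\ p 0%N = x0,
        forall j, (j < J)%N -> riemacon (T j) (p j) (p j.+1) &
        y = p J].

End riemacon.

(* Main.v *)
(* In non-positive curvature a Jacobi field J along a geodesic that vanishes at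
   time 0 satisfies |J|(1) >= |J'|(0), so that exp_p is a local diffeomorphism
   which does not shrink lengths. Hence it lifts paths and homotopies and, M
   being simply connected, it is a bijection whose inverse log_p does not increase
   distances; in particular d(x, y) = |log_x y|. Moreover |J|^2 <= <J', J> and
   |J' - J| <= (zeta - 1) |J| at time 1, where the last bound compares J with the
   solution of phi'' = |kmin| phi. These are bounds on the Hessian of d(., p)^2 / 2,
   which give the two cosine inequalities and bound the variation of
   <U, log p> for U parallel along a geodesic.

   With p = xstar and xi = 4 zeta_{2D} - 3, the potential
     A_k (f(y_k) - f(p)) + |z_k - log_{y_k} p|^2 / 2 + (xi - 1) |z_k|^2 / 2
   grows at most by the factor 1 + Delta_k at step k: (xi - 1) |z|^2 / 2 pays for
   moving z from the tangent space at x_k to the one at y_k, and the error of the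
   approximate proximal step is paid for by the factor. The product of these
   factors is below 2, and A_T >= lam T^2 / (5 xi), hence
     f(y_T) - f(p) <= 1040 xi^2 R_0^2 / (lam T^2).
   In the strongly convex case this halves the bound on the distance to p in each
   stage. *)
Require Import Defs.
From HB Require Import structures.
From mathcomp Require Import all_boot all_order all_algebra.
From mathcomp Require Import all_classical all_reals all_analysis.
From mathcomp Require Import ring lra.

Set Implicit Arguments.
Unset Strict Implicit.
Unset Printing Implicit Defensive.

Import Order.TTheory GRing.Theory Num.Theory.
Import numFieldNormedType.Exports.

Local Open Scope classical_set_scope.
Local Open Scope ring_scope.

(** Calculus rests on strict differentiability at a point: it follows from continuous partial
    derivatives, survives composition and inversion, and determines its derivative, so objects
    obtained by choice (differential of the geodesic flow, logarithm) can be identified.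
    Completeness hands over geodesics for all times; hence only linear equations have to be solved,
    and what remains is differentiable dependence of given solutions on initial data. The obstacle
    is that charts are local: flow boxes and the gluing of local solutions carry each statement
    along a whole curve.

    Constants: [zeta] is taken at 2D because x_k may leave X but stays within D of y_{k-1}, hence
    within 2D of p. With s = zeta_{2D} - 1 one has xi = 1 + 4 s; changing the base point then
    produces - 4 s <z, b>, b = log_{x_k} y_k, and since z contains rho b with rho = a_k / (lam xi)
    >= 12.8, this pays for the other multiples of s |b|^2. The 32 in a_k gives this 12.8; the 200 in
    A_0 gives a_k^2 <= 0.9 A_{k-1} lam xi, which keeps the quadratic error of the mirror step below
    the gain of the proximal step. *)

Ltac mxdistr :=
  repeat match goal with
  | |- context[(?A + ?B) *m ?C] => rewrite (mulmxDl A B C)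
  | |- context[?C *m (?A + ?B)] => rewrite (mulmxDr C A B)
  | |- context[(- ?A) *m ?C] => rewrite (mulNmx A C)
  | |- context[?C *m (- ?A)] => rewrite (mulmxN C A)
  | |- context[(?a *: ?A) *m ?C] => rewrite -(scalemxAl a A C)
  | |- context[?C *m (?a *: ?A)] => rewrite -(scalemxAr a C A)
  | |- context[?A *m (?B *m ?C)] => rewrite (mulmxA A B C)
  end.

(** Noncommutative identities: after expansion each remaining matrix product becomes an opaque atom,
    so that [ring] can decide the equality entrywise. *)
Ltac mxring := mxdistr;
  repeat (let u := fresh in set u := (_ *m _); clearbody u);
  apply/matrixP => ? ?; rewrite !mxE; ring.

(** * Strict differentiability *)

Section norms.
Context {R : realType}.

Lemma mx_entry_le m k (A : 'M[R]_(m, k)) i j : `|A i j| <= `|A|.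
Proof.
rewrite [`|A|]mx_normrE.
exact: (le_bigmax _ (fun ij : 'I_m * 'I_k => `|A ij.1 ij.2|) (i, j)).
Qed.

Lemma mx_norm_le m k (A : 'M[R]_(m, k)) (e : R) :
  0 <= e -> (forall i j, `|A i j| <= e) -> `|A| <= e.
Proof. by move=> e0 h; rewrite [`|A|]mx_normrE; apply: bigmax_le => // -[i j] _; apply: h. Qed.

Lemma mulmx_norm_le m k l (A : 'M[R]_(m, k)) (B : 'M[R]_(k, l)) :
  `|A *m B| <= k%:R * `|A| * `|B|.
Proof.
apply: mx_norm_le => [|i j]; first by rewrite !mulr_ge0.
rewrite mxE (le_trans (ler_norm_sum _ _ _))//.
rewrite (@le_trans _ _ (\sum_(u < k) `|A| * `|B|))//; last first.
  by rewrite sumr_const card_ord -mulrA mulr_natl.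
by apply: ler_sum => u _; rewrite normrM ler_pM// mx_entry_le.
Qed.

(** Clearing the quotient removes the exception at the increment 0; most derivatives below are built
    or used in this form. *)
Lemma is_derive_epsP (V W : normedModType R) (f : V -> W) (p v : V) (df : W) :
  is_derive p v f df <->
  forall e : R, 0 < e -> exists2 d : R, 0 < d &
    forall h : R, `|h| < d -> `|f (p + h *: v) - f p - h *: df| <= e * `|h|.
Proof.
split=> [fp e e0|h].
- have [df1 df2] := fp.
  move: df1; rewrite /derivable => /cvg_ex[l hl].
  have le : l = df.
    by rewrite -df2 /derive; apply/esym/cvg_lim.
  subst l; move/cvgrPdist_le: hl => /(_ e e0) /nbhs_ballP [d /= d0 hd].
  exists d => // h hhd.
  have [->|h0] := eqVneq h 0.
    by rewrite !scale0r addr0 subrr subr0 !normr0 mulr0.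
  have /= := hd h; rewrite -ball_normE /= sub0r normrN => /(_ hhd h0) h1.
  rewrite distrC (_ : _ - _ = h *: (df - h^-1 *: (f (h *: v + p) - f p))); last first.
    by rewrite scalerBr scalerA divff// scale1r [_ + p]addrC.
  by rewrite normrZ mulrC ler_wpM2r.
- suff hl : h0^-1 *: ((f \o shift p) (h0 *: v) - f p) @[h0 --> 0^'] --> df.
    by apply: DeriveDef; [apply/cvg_ex; exists df|exact/cvg_lim].
  apply/cvgrPdist_le => e e0; have [d d0 hd] := h e e0.
  apply/nbhs_ballP; exists d => //= x; rewrite -ball_normE /= sub0r normrN => xd x0.
  have := hd x xd.
  rewrite distrC (_ : _ - _ = x *: (df - x^-1 *: (f (x *: v + p) - f p))); last first.
    by rewrite scalerBr scalerA divff// scale1r [_ + p]addrC.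
  by rewrite normrZ mulrC ler_pM2r// normr_gt0.
Qed.

Lemma is_derive_mxP m k (M : R -> 'M[R]_(m, k)) (t : R) (M' : 'M[R]_(m, k)) :
  is_derive t 1 M M' <-> forall i j, is_derive t 1 (fun s => M s i j) (M' i j).
Proof.
split=> [h i j|h].
- apply/is_derive_epsP => e e0; have /is_derive_epsP/(_ e e0)[d d0 hd] := h.
  exists d => // s sd; have := hd s sd; apply: le_trans.
  by apply: le_trans (mx_entry_le _ i j); rewrite !mxE.
- apply: DeriveDef; first by apply/derivable_mxP => i j; have [] := h i j.
  rewrite derive_mx; last by apply/derivable_mxP => i j; have [] := h i j.
  by apply/matrixP => i j; rewrite mxE; have [] := h i j.
Qed.

Lemma is_derive1E (W : normedModType R) (f : R -> W) (t : R) df :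
  is_derive t 1 f df -> derive1 f t = df.
Proof. by move=> h; rewrite derive1E; case: h. Qed.

Lemma derivable1_is_derive (W : normedModType R) (f : R -> W) t :
  derivable f t 1 -> is_derive t 1 f (derive1 f t).
Proof. by move=> h; apply: DeriveDef => //; rewrite derive1E. Qed.

Lemma is_derive_uniq (V W : normedModType R) (f : V -> W) p v a b :
  is_derive p v f a -> is_derive p v f b -> a = b.
Proof. by case=> _ <- [_ <-]. Qed.

Lemma is_derive_cont (W : normedModType R) (f : R -> W) (t : R) df :
  is_derive t 1 f df -> {for t, continuous f}.
Proof. by case=> h _; apply: differentiable_continuous; apply/derivable1_diffP. Qed.

Lemma is_derive_cst1 (W : normedModType R) (w : W) (t : R) : is_derive t 1 (fun=> w) 0.
Proof. exact: is_derive_cst. Qed.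

Lemma is_derive_mulr (f g : R -> R) (t f' g' : R) :
  is_derive t 1 f f' -> is_derive t 1 g g' ->
  is_derive t 1 (fun s => f s * g s) (f' * g t + f t * g').
Proof.
move=> hf hg; apply: (is_derive_eq (is_deriveM hf hg)).
by rewrite /GRing.scale /= addrC [g t * _]mulrC.
Qed.

Lemma is_derive_add (W : normedModType R) (f g : R -> W) (t : R) f' g' :
  is_derive t 1 f f' -> is_derive t 1 g g' ->
  is_derive t 1 (fun s => f s + g s) (f' + g').
Proof. by move=> hf hg; apply: is_deriveD. Qed.

Lemma is_derive_sub (W : normedModType R) (f g : R -> W) (t : R) f' g' :
  is_derive t 1 f f' -> is_derive t 1 g g' ->
  is_derive t 1 (fun s => f s - g s) (f' - g').
Proof. by move=> hf hg; apply: is_deriveB. Qed.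

Lemma is_derive_opp (W : normedModType R) (f : R -> W) (t : R) f' :
  is_derive t 1 f f' -> is_derive t 1 (fun s => - f s) (- f').
Proof. by move=> hf; apply: is_deriveN. Qed.

Lemma is_derive_big (W : normedModType R) k (F : 'I_k -> R -> W) (t : R) F' :
  (forall i, is_derive t 1 (F i) (F' i)) ->
  is_derive t 1 (fun s => \sum_i F i s) (\sum_i F' i).
Proof.
elim: k F F' => [|k IH] F F' h.
  rewrite big_ord0; rewrite (_ : (fun s => _) = fun=> 0); last first.
    by apply/funext => s; rewrite big_ord0.
  exact: is_derive_cst1.
rewrite big_ord_recl (_ : (fun s => _) = fun s => F ord0 s + \sum_i F (lift ord0 i) s); last first.
  by apply/funext => s; rewrite big_ord_recl.
by apply: is_derive_add => //; apply: IH.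
Qed.

Lemma is_derive_mulmx m k l (A : R -> 'M[R]_(m, k)) (B : R -> 'M[R]_(k, l)) (t : R) A' B' :
  is_derive t 1 A A' -> is_derive t 1 B B' ->
  is_derive t 1 (fun s => A s *m B s) (A' *m B t + A t *m B').
Proof.
move=> /is_derive_mxP hA /is_derive_mxP hB; apply/is_derive_mxP => i j.
rewrite !mxE -big_split /=.
rewrite (_ : (fun s => _) = fun s => \sum_u (A s i u * B s u j)); last first.
  by apply/funext => s; rewrite mxE.
by apply: is_derive_big => u; apply: is_derive_mulr.
Qed.

Lemma is_derive_trmx m k (A : R -> 'M[R]_(m, k)) (t : R) A' :
  is_derive t 1 A A' -> is_derive t 1 (fun s => (A s)^T) A'^T.
Proof.
move=> /is_derive_mxP h; apply/is_derive_mxP => i j; rewrite mxE.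
by rewrite (_ : (fun s => _) = fun s => A s j i)//; apply/funext => s; rewrite mxE.
Qed.

Lemma is_derive_entry m k (A : R -> 'M[R]_(m, k)) (t : R) A' i j :
  is_derive t 1 A A' -> is_derive t 1 (fun s => A s i j) (A' i j).
Proof. by move=> /is_derive_mxP. Qed.

Lemma is_derive_row_mx m k l (A : R -> 'M[R]_(m, k)) (B : R -> 'M[R]_(m, l)) (t : R) A' B' :
  is_derive t 1 A A' -> is_derive t 1 B B' ->
  is_derive t 1 (fun s => row_mx (A s) (B s)) (row_mx A' B').
Proof.
move=> /is_derive_mxP hA /is_derive_mxP hB; apply/is_derive_mxP => i j.
rewrite -[j]splitK; case: (fintype.split j) => u /=.
  rewrite row_mxEl (_ : (fun s => _) = fun s => A s i u)//.
  by apply/funext => s; rewrite row_mxEl.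
rewrite row_mxEr (_ : (fun s => _) = fun s => B s i u)//.
by apply/funext => s; rewrite row_mxEr.
Qed.

Lemma is_derive_scalev (W : normedModType R) (f : R -> R) (w : W) (t : R) f' :
  is_derive t 1 f f' -> is_derive t 1 (fun s => f s *: w) (f' *: w).
Proof.
move=> /is_derive_epsP h; apply/is_derive_epsP => e e0.
have w1 : 0 < `|w| + 1 by rewrite ltr_wpDl.
have [d d0 hd] := h (e / (`|w| + 1)) (divr_gt0 e0 w1); exists d => // s sd.
rewrite scalerA -!scalerBl normrZ.
apply: le_trans (ler_wpM2r (normr_ge0 _) (hd s sd)) _.
rewrite mulrAC ler_wpM2r// -mulrA ler_piMr ?(ltW e0)// ler_pdivrMl// mulr1.
by rewrite lerDl.
Qed.

(** The norm is a maximum of entries, so the scalar mean value theorem applies to each entry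
    separately. *)
Lemma mvt_curve m k (M M' : R -> 'M[R]_(m, k)) (a b K : R) : a <= b -> 0 <= K ->
  (forall s, a <= s <= b -> is_derive s 1 M (M' s)) ->
  (forall s, a <= s <= b -> `|M' s| <= K) ->
  `|M b - M a| <= K * (b - a).
Proof.
move=> ab K0 hM hK; apply: mx_norm_le => [|i j]; first by rewrite mulr_ge0// subr_ge0.
have h s : a <= s <= b -> is_derive s 1 (fun s => M s i j) (M' s i j).
  by move=> /hM /is_derive_mxP.
have [||c cab eq] := @MVT_segment R (fun s => M s i j) (fun s => M' s i j) a b ab.
- by move=> x; rewrite in_itv/= => /andP[ax xb]; apply: h; rewrite !ltW.
- apply: continuous_in_subspaceT => x; rewrite inE /= in_itv/= => xab.
  exact: is_derive_cont (h x xab).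
move: cab; rewrite in_itv/= => cab.
rewrite !mxE eq normrM [`|b - a|]ger0_norm ?subr_ge0//.
by rewrite ler_wpM2r ?subr_ge0// (le_trans (mx_entry_le _ i j))// hK.
Qed.

Lemma mvt_curve2 m k (M M' : R -> 'M[R]_(m, k)) (a b K s t : R) : 0 <= K ->
  (forall s, a <= s <= b -> is_derive s 1 M (M' s)) ->
  (forall s, a <= s <= b -> `|M' s| <= K) ->
  a <= s <= b -> a <= t <= b ->
  `|M s - M t| <= K * `|s - t|.
Proof.
move=> K0 hM hK /andP[as_ sb] /andP[at_ tb].
wlog st : s t as_ sb at_ tb / t <= s.
  move=> H; have [/H|/ltW/H] := leP t s; first exact.
  by rewrite distrC [`|t - s|]distrC; apply.
rewrite [`|s - t|]ger0_norm ?subr_ge0//.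
apply: mvt_curve st K0 _ _ => u /andP[tu us]; [apply: hM|apply: hK];
  by rewrite (le_trans at_ tu) (le_trans us sb).
Qed.

End norms.

Lemma eq_le_r {R : numDomainType} (a b : R) : a = b -> a <= b.
Proof. by move=> ->. Qed.

Lemma absorb_le {R : realFieldType} (a c : R) : 0 <= a -> 0 <= c -> a * (c / (a + 1)) <= c.
Proof.
move=> a0 c0; rewrite mulrCA ler_piMr// ler_pdivrMr ?ltr_wpDl// mul1r.
by rewrite lerDl.
Qed.

Section strong_differentiability.
Context {R : realType}.

(* Strict differentiability, with the gradient [g] as a column vector; unlike
   plain differentiability it survives the inversion of a map. *)
Definition sdr {m} (f : 'rV[R]_m -> R) (p : 'rV[R]_m) (g : 'cV[R]_m) :=
  forall e : R, 0 < e -> exists2 d : R, 0 < d &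
    forall x y : 'rV[R]_m, `|x - p| < d -> `|y - p| < d ->
      `|f x - f y - ((x - y) *m g) 0 0| <= e * `|x - y|.

Definition sd {m k} (f : 'rV[R]_m -> 'rV[R]_k) (p : 'rV[R]_m) (D : 'M[R]_(m, k)) :=
  forall e : R, 0 < e -> exists2 d : R, 0 < d &
    forall x y : 'rV[R]_m, `|x - p| < d -> `|y - p| < d ->
      `|f x - f y - (x - y) *m D| <= e * `|x - y|.

(** Finitely many conditions that survive shrinking the radius have a common radius. *)
Lemma fin_min_pos k (P : 'I_k -> R -> Prop) :
  (forall i d d', 0 < d' -> d' <= d -> P i d -> P i d') ->
  (forall i, exists2 d, 0 < d & P i d) -> exists2 d, 0 < d & forall i, P i d.
Proof.
move=> mono; elim: k P mono => [|k IH] P mono h; first by exists 1 => // -[].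
have [|i|d d0 hd] := IH (fun i => P (lift ord0 i)).
- by move=> i d d'; apply: mono.
- exact: h.
have [d1 d10 hd1] := h ord0.
have m0 : 0 < Num.min d d1 by rewrite lt_min d0 d10.
exists (Num.min d d1) => // i; have [->|] := eqVneq i ord0.
  by apply: mono hd1 => //; rewrite ge_min lexx orbT.
rewrite eq_sym => /unlift_some[j -> _]; apply: mono (hd j) => //.
by rewrite ge_min lexx.
Qed.

Lemma sdP m k (f : 'rV[R]_m -> 'rV[R]_k) p D :
  sd f p D <-> forall j, sdr (fun x => f x 0 j) p (col j D).
Proof.
split=> [h j e e0|h e e0].
  have [d d0 hd] := h e e0; exists d => // x y xp yp.
  apply: le_trans (hd x y xp yp); apply: le_trans (mx_entry_le _ 0 j).
  by rewrite !mxE; under eq_bigr do rewrite !mxE; under [in leRHS]eq_bigr do rewrite !mxE.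
have [||d d0 hd] := @fin_min_pos k (fun j d =>
  forall x y : 'rV[R]_m, `|x - p| < d -> `|y - p| < d ->
   `|f x 0 j - f y 0 j - ((x - y) *m col j D) 0 0| <= e * `|x - y|).
- move=> j d d' d'0 d'd hd x y xp yp; apply: hd;
  exact: lt_le_trans d'd.
- by move=> j; apply: h.
exists d => // x y xp yp; apply: mx_norm_le => [|i j]; first by rewrite mulr_ge0// ltW.
have := hd j x y xp yp; rewrite ord1 !mxE.
by under eq_bigr do rewrite !mxE; under [in X in _ -> X]eq_bigr do rewrite !mxE.
Qed.

Lemma sdr_lip m (f : 'rV[R]_m -> R) p g : sdr f p g ->
  exists2 L : R, 0 < L & exists2 d : R, 0 < d &
    forall x y : 'rV[R]_m, `|x - p| < d -> `|y - p| < d -> `|f x - f y| <= L * `|x - y|.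
Proof.
move=> /(_ 1 ltr01)[d d0 hd]; exists (1 + m%:R * `|g|).
  by rewrite ltr_wpDr// mulr_ge0.
exists d => // x y xp yp.
rewrite -[f x - f y](subrK (((x - y) *m g) 0 0)) mulrDl.
apply: le_trans (ler_normD _ _) _; apply: lerD; first exact: hd.
apply: le_trans (mx_entry_le _ _ _) _.
by apply: le_trans (mulmx_norm_le _ _) _; rewrite mulrAC.
Qed.

Lemma sd_lip m k (f : 'rV[R]_m -> 'rV[R]_k) p D : sd f p D ->
  exists2 L : R, 0 < L & exists2 d : R, 0 < d &
    forall x y : 'rV[R]_m, `|x - p| < d -> `|y - p| < d -> `|f x - f y| <= L * `|x - y|.
Proof.
move=> /(_ 1 ltr01)[d d0 hd]; exists (1 + m%:R * `|D|).
  by rewrite ltr_wpDr// mulr_ge0.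
exists d => // x y xp yp.
rewrite -[f x - f y](subrK ((x - y) *m D)) mulrDl.
apply: le_trans (ler_normD _ _) _; apply: lerD; first exact: hd.
by apply: le_trans (mulmx_norm_le _ _) _; rewrite mulrAC.
Qed.

Lemma lip_cont m (W : normedModType R) (f : 'rV[R]_m -> W) (p : 'rV[R]_m) (L d : R) : 0 < L -> 0 < d ->
  (forall x y : 'rV[R]_m, `|x - p| < d -> `|y - p| < d -> `|f x - f y| <= L * `|x - y|) ->
  {for p, continuous f}.
Proof.
move=> L0 d0 h; apply/(@cvgrPdist_le _ _ _ _ (nbhs_filter p)) => e e0.
apply/(@nbhs_normP _ _ p).
exists (Num.min d (e / L)) => /=; first by rewrite lt_min d0 divr_gt0.
move=> y /=; rewrite lt_min distrC => /andP[yd ye].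
rewrite distrC; apply: le_trans (h y p yd _) _; first by rewrite subrr normr0.
by rewrite mulrC -ler_pdivlMr// ltW.
Qed.

Lemma sdr_cont m (f : 'rV[R]_m -> R) p g : sdr f p g -> {for p, continuous f}.
Proof. by move=> /sdr_lip[L L0 [d d0 h]]; apply: lip_cont h. Qed.

Lemma sd_cont m k (f : 'rV[R]_m -> 'rV[R]_k) p D : sd f p D -> {for p, continuous f}.
Proof. by move=> /sd_lip[L L0 [d d0 h]]; apply: lip_cont h. Qed.

Lemma sdr_near m (f h : 'rV[R]_m -> R) p g (d : R) : 0 < d ->
  (forall x, `|x - p| < d -> f x = h x) -> sdr f p g -> sdr h p g.
Proof.
move=> d0 fh hf e e0; have [d1 d10 hd1] := hf e e0.
exists (Num.min d d1); first by rewrite lt_min d0.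
move=> x y; rewrite !lt_min => /andP[xd xd1] /andP[yd yd1].
by rewrite -!fh//; apply: hd1.
Qed.

Lemma sd_near m k (f h : 'rV[R]_m -> 'rV[R]_k) p g (d : R) : 0 < d ->
  (forall x, `|x - p| < d -> f x = h x) -> sd f p g -> sd h p g.
Proof.
move=> d0 fh hf e e0; have [d1 d10 hd1] := hf e e0.
exists (Num.min d d1); first by rewrite lt_min d0.
move=> x y; rewrite !lt_min => /andP[xd xd1] /andP[yd yd1].
by rewrite -!fh//; apply: hd1.
Qed.

Lemma sdr_cst m (c : R) (p : 'rV[R]_m) : sdr (fun=> c) p 0.
Proof.
move=> e e0; exists 1 => // x y _ _.
by rewrite mulmx0 mxE !subrr normr0 mulr_ge0// ltW.
Qed.

Lemma sdr_lin m (g : 'cV[R]_m) (p : 'rV[R]_m) : sdr (fun x => (x *m g) 0 0) p g.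
Proof.
move=> e e0; exists 1 => // x y _ _.
rewrite mulmxBl (_ : (x *m g - y *m g) 0 0 = (x *m g) 0 0 - (y *m g) 0 0).
  by rewrite subrr normr0 mulr_ge0 ?(ltW e0).
by rewrite [LHS]mxE; congr (_ + _); rewrite mxE.
Qed.

Lemma sdr_coord m (i : 'I_m) (p : 'rV[R]_m) : sdr (fun x => x 0 i) p (delta_mx i 0).
Proof.
apply: sdr_near (sdr_lin _ p) => [|x _]; first exact: (@ltr01 R).
by rewrite -colE mxE.
Qed.

Lemma sdrD m (f h : 'rV[R]_m -> R) p g g' :
  sdr f p g -> sdr h p g' -> sdr (fun x => f x + h x) p (g + g').
Proof.
move=> hf hh e e0; have e2 : 0 < e / 2 by rewrite divr_gt0.
have [d d0 hd] := hf _ e2; have [d1 d10 hd1] := hh _ e2.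
exists (Num.min d d1); first by rewrite lt_min d0.
move=> x y; rewrite !lt_min => /andP[xd xd1] /andP[yd yd1].
have := lerD (hd x y xd yd) (hd1 x y xd1 yd1).
rewrite -mulrDl -splitr; apply: le_trans; apply: le_trans (ler_normD _ _).
rewrite le_eqVlt; apply/orP; left; apply/eqP; congr `|_|.
by rewrite mulmxDr mxE; ring.
Qed.

Lemma sdrM m (f h : 'rV[R]_m -> R) p g g' :
  sdr f p g -> sdr h p g' ->
  sdr (fun x => f x * h x) p (h p *: g + f p *: g').
Proof.
move=> hf hh e e0.
have [Lf Lf0 [df df0 hLf]] := sdr_lip hf; have [Lh Lh0 [dh dh0 hLh]] := sdr_lip hh.
(* [K] bounds both functions near [p] as well as both linear forms relative to |x - y|. *)
pose K := `|f p| + `|h p| + Lf * 1 + Lh * 1 + 2 + m%:R * `|g| + m%:R * `|g'|.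
have K0 : 0 < K.
  rewrite /K !mulr1; have := normr_ge0 (f p); have := normr_ge0 (h p).
  have : 0 <= m%:R * `|g| by rewrite mulr_ge0.
  have : 0 <= m%:R * `|g'| by rewrite mulr_ge0.
  lra.
pose r := e / (4 * K); have r0 : 0 < r by rewrite divr_gt0// mulr_gt0.
have [d d0 hd] := hf _ r0; have [d1 d10 hd1] := hh _ r0.
pose rr := e / (4 * K * (Lf + Lh)).
have rr0 : 0 < rr by rewrite divr_gt0// !mulr_gt0// addr_gt0.
pose D := Num.min (Num.min (Num.min d d1) (Num.min df dh)) (Num.min rr 1).
exists D; first by rewrite !lt_min d0 d10 df0 dh0 rr0 ltr01.
move=> x y; rewrite !lt_min -!andbA => /and5P[xd xd1 xdf xdh /andP[xr x1]] /and5P[yd yd1 ydf ydh /andP[yr y1]].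
have pp : forall a : R, 0 < a -> `|p - p| < a by move=> a a0; rewrite subrr normr0.
have fx := hLf x p xdf (pp _ df0); have hy := hLh y p ydh (pp _ dh0).
set u := ((x - y) *m g) 0 0 in hd *; set w := ((x - y) *m g') 0 0 in hd1 *.
have -> : ((x - y) *m (h p *: g + f p *: g')) 0 0 = h p * u + f p * w.
  by rewrite mulmxDr -!scalemxAr [LHS]mxE; congr (_ + _); rewrite mxE.
have Hu : `|u| <= K * `|x - y|.
  apply: le_trans (mx_entry_le _ _ _) _; apply: le_trans (mulmx_norm_le _ _) _.
  rewrite mulrAC ler_wpM2r// /K !mulr1.
  have := normr_ge0 (f p); have := normr_ge0 (h p).
  have : 0 <= m%:R * `|g'| by rewrite mulr_ge0.
  lra.
have Hw : `|w| <= K * `|x - y|.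
  apply: le_trans (mx_entry_le _ _ _) _; apply: le_trans (mulmx_norm_le _ _) _.
  rewrite mulrAC ler_wpM2r// /K !mulr1.
  have := normr_ge0 (f p); have := normr_ge0 (h p).
  have : 0 <= m%:R * `|g| by rewrite mulr_ge0.
  lra.
(* Four products of a bounded and a small factor; each is allotted a quarter of [e]. *)
have -> : f x * h x - f y * h y - (h p * u + f p * w) =
  h y * (f x - f y - u) + f x * (h x - h y - w) + (h y - h p) * u + (f x - f p) * w by ring.
have Hhy : `|h y| <= K.
  have -> : h y = (h y - h p) + h p by rewrite subrK.
  apply: le_trans (ler_normD _ _) _; rewrite /K.
  have : Lh * `|y - p| <= Lh * 1 by rewrite ler_wpM2l ?(ltW Lh0) ?(ltW y1).
  have : 0 <= m%:R * `|g| by rewrite mulr_ge0.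
  have : 0 <= m%:R * `|g'| by rewrite mulr_ge0.
  have := normr_ge0 (f p); lra.
have Hfx : `|f x| <= K.
  have -> : f x = (f x - f p) + f p by rewrite subrK.
  apply: le_trans (ler_normD _ _) _; rewrite /K.
  have : Lf * `|x - p| <= Lf * 1 by rewrite ler_wpM2l ?(ltW Lf0) ?(ltW x1).
  have : 0 <= m%:R * `|g| by rewrite mulr_ge0.
  have : 0 <= m%:R * `|g'| by rewrite mulr_ge0.
  have := normr_ge0 (h p); lra.
have E1 : `|h y * (f x - f y - u)| <= e / 4 * `|x - y|.
  rewrite normrM; apply: le_trans (ler_pM _ _ Hhy (hd x y xd yd)) _ => //.
  by rewrite /r; apply: eq_le_r; field; rewrite gt_eqF.
have E2 : `|f x * (h x - h y - w)| <= e / 4 * `|x - y|.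
  rewrite normrM; apply: le_trans (ler_pM _ _ Hfx (hd1 x y xd1 yd1)) _ => //.
  by rewrite /r; apply: eq_le_r; field; rewrite gt_eqF.
have q1 : `|h y - h p| <= e / 4 / K.
  apply: le_trans hy _; apply: (@le_trans _ _ ((Lf + Lh) * rr)).
    by apply: ler_pM; rewrite ?(ltW Lh0) ?(ltW yr)// lerDr ltW.
  by rewrite /rr; apply: eq_le_r; field; rewrite !gt_eqF// addr_gt0.
have q2 : `|f x - f p| <= e / 4 / K.
  apply: le_trans fx _; apply: (@le_trans _ _ ((Lf + Lh) * rr)).
    by apply: ler_pM; rewrite ?(ltW Lf0) ?(ltW xr)// lerDl ltW.
  by rewrite /rr; apply: eq_le_r; field; rewrite !gt_eqF// addr_gt0.
have E3 : `|(h y - h p) * u| <= e / 4 * `|x - y|.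
  rewrite normrM; apply: le_trans (ler_pM _ _ q1 Hu) _ => //.
  by apply: eq_le_r; field; rewrite gt_eqF.
have E4 : `|(f x - f p) * w| <= e / 4 * `|x - y|.
  rewrite normrM; apply: le_trans (ler_pM _ _ q2 Hw) _ => //.
  by apply: eq_le_r; field; rewrite gt_eqF.
apply: le_trans (ler_normD _ _) _.
have := le_trans (ler_normD (h y * (f x - f y - u) + f x * (h x - h y - w)) ((h y - h p) * u))
  (lerD (ler_normD _ _) (lexx _)).
have : e * `|x - y| = e / 4 * `|x - y| + e / 4 * `|x - y| + e / 4 * `|x - y| + e / 4 * `|x - y|.
  by field.
lra.
Qed.

Lemma sdrZ m (c : R) (f : 'rV[R]_m -> R) p g : sdr f p g -> sdr (fun x => c * f x) p (c *: g).
Proof.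
move=> hf; have := sdrM (sdr_cst c p) hf.
by rewrite scaler0 add0r.
Qed.

Lemma sdrN m (f : 'rV[R]_m -> R) p g : sdr f p g -> sdr (fun x => - f x) p (- g).
Proof.
move=> /(sdrZ (-1)); rewrite scaleN1r; apply: sdr_near (ltr01) _ => x _.
by rewrite mulN1r.
Qed.

Lemma sdrB m (f h : 'rV[R]_m -> R) p g g' :
  sdr f p g -> sdr h p g' -> sdr (fun x => f x - h x) p (g - g').
Proof. by move=> hf /sdrN; apply: sdrD. Qed.

Lemma sdr_sum m (I : Type) (s : seq I) (F : I -> 'rV[R]_m -> R) p G :
  (forall i, sdr (F i) p (G i)) ->
  sdr (fun x => \sum_(i <- s) F i x) p (\sum_(i <- s) G i).
Proof.
move=> h; elim: s => [|a s IH].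
  rewrite big_nil; apply: sdr_near (sdr_cst 0 p) => [|x _]; first exact: (@ltr01 R).
  by rewrite big_nil.
rewrite big_cons; apply: sdr_near (sdrD (h a) IH) => [|x _]; first exact: (@ltr01 R).
by rewrite big_cons.
Qed.

Lemma delta_norm m k (i : 'I_m) (j : 'I_k) : `|delta_mx i j : 'M[R]_(m, k)| <= 1.
Proof.
apply: mx_norm_le => // a b; rewrite mxE.
by case: (_ && _); rewrite ?normr1 ?normr0 ?ler01.
Qed.

(** Both linear maps are tested on multiples of the basis vectors short enough for both
    estimates. *)
Lemma sd_uniq m k (f : 'rV[R]_m -> 'rV[R]_k) p D E : sd f p D -> sd f p E -> D = E.
Proof.
move=> hD hE; apply/row_matrixP => i; apply/eqP; rewrite -subr_eq0 -normr_le0.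
apply/ler_addgt0Pr => e e0; rewrite add0r.
have e2 : 0 < e / 2 by rewrite divr_gt0.
have [d d0 hd] := hD _ e2; have [d1 d10 hd1] := hE _ e2.
pose r := Num.min d d1 / 2.
have r0 : 0 < r by rewrite divr_gt0// lt_min d0.
have rd : r < Num.min d d1 by rewrite /r ltr_pdivrMr// ltr_pMr ?lt_min ?d0// ltr1n.
move: rd; rewrite lt_min => /andP[rd rd1].
pose v : 'rV[R]_m := r *: delta_mx 0 i.
have nv : `|v| <= r.
  rewrite normrZ gtr0_norm// -[leRHS]mulr1 ler_wpM2l ?(ltW r0)//.
  exact: delta_norm.
have h1 := hd (p + v) p; have h2 := hd1 (p + v) p.
have aux (a : R) : r < a -> `|p + v - p| < a by move=> ra; rewrite addrC addKr (le_lt_trans nv).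
rewrite subrr normr0 in h1 h2.
have {}h1 := h1 (aux _ rd) d0; have {}h2 := h2 (aux _ rd1) d10.
have := le_trans (ler_normB _ _) (lerD h2 h1).
rewrite [p + v]addrC addrK.
have -> : f (v + p) - f p - v *m E - (f (v + p) - f p - v *m D) = v *m D - v *m E by mxring.
rewrite -mulrDl -splitr -mulmxBr /v -scalemxAl -rowE normrZ gtr0_norm//.
rewrite [X in _ <= e * X -> _]normrZ gtr0_norm// => h.
have : r * `|row i (D - E)| <= r * e.
  apply: le_trans h _; rewrite mulrA [r * e]mulrC ler_piMr ?(ltW e0)//; last exact: delta_norm.
  by rewrite mulr_ge0 ?(ltW r0) ?(ltW e0).
by rewrite ler_pM2l// linearB.
Qed.

Lemma sd_comp m k l (f : 'rV[R]_m -> 'rV[R]_k) (h : 'rV[R]_k -> 'rV[R]_l) p D E :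
  sd f p D -> sd h (f p) E -> sd (h \o f) p (D *m E).
Proof.
move=> hf hh e e0; have [L L0 [dL dL0 hL]] := sd_lip hf.
have c0 : 0 < k%:R * `|E| + 1 by rewrite ltr_wpDl// mulr_ge0.
have [d d0 hd] := hh (e / 2 / L) (divr_gt0 (divr_gt0 e0 (ltr0Sn _ 1)) L0).
have [d1 d10 hd1] := hf (e / 2 / (k%:R * `|E| + 1)) (divr_gt0 (divr_gt0 e0 (ltr0Sn _ 1)) c0).
exists (Num.min (Num.min dL (d / L)) d1); first by rewrite !lt_min dL0 d10 divr_gt0.
move=> x y; rewrite !lt_min -!andbA => /and3P[xL xd xd1] /and3P[yL yd yd1].
have pp : `|p - p| < dL by rewrite subrr normr0.
have fx : `|f x - f p| < d.
  by apply: le_lt_trans (hL x p xL pp) _; rewrite mulrC -ltr_pdivlMr.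
have fy : `|f y - f p| < d.
  by apply: le_lt_trans (hL y p yL pp) _; rewrite mulrC -ltr_pdivlMr.
have -> : (h \o f) x - (h \o f) y - (x - y) *m (D *m E) =
  (h (f x) - h (f y) - (f x - f y) *m E) + (f x - f y - (x - y) *m D) *m E.
  by rewrite /=; mxring.
apply: le_trans (ler_normD _ _) _.
rewrite [e]splitr mulrDl; apply: lerD.
  apply: le_trans (hd _ _ fx fy) _.
  apply: le_trans (ler_wpM2l _ (hL x y xL yL)) _.
    by rewrite !divr_ge0// ltW.
  by rewrite mulrA divfK// gt_eqF.
apply: le_trans (mulmx_norm_le _ _) _; rewrite mulrAC.
apply: le_trans (ler_wpM2l _ (hd1 x y xd1 yd1)) _; first by rewrite mulr_ge0.
by rewrite mulrA ler_wpM2r// absorb_le ?mulr_ge0 ?divr_ge0 ?(ltW e0).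
Qed.

Lemma is_derive_lip (W : normedModType R) (z : R -> W) (t : R) z' :
  is_derive t 1 z z' -> exists2 d : R, 0 < d &
   forall h : R, `|h| < d -> `|z (t + h) - z t| <= (`|z'| + 1) * `|h|.
Proof.
move=> /is_derive_epsP/(_ 1 ltr01)[d d0 hd]; exists d => // h hhd.
rewrite -[z _ - _](subrK (h *: z')) addrC mulrDl.
apply: le_trans (ler_normD _ _) _; apply: lerD; first by rewrite normrZ mulrC.
by have := hd h hhd; rewrite [h *: 1]mulr1.
Qed.

Lemma sd_curve m k (f : 'rV[R]_m -> 'rV[R]_k) (z : R -> 'rV[R]_m) (t : R) D z' :
  sd f (z t) D -> is_derive t 1 z z' -> is_derive t 1 (fun s => f (z s)) (z' *m D).
Proof.
move=> hf hz; apply/is_derive_epsP => e e0.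
have [dl dl0 hl] := is_derive_lip hz.
have K0 : 0 < `|z'| + 1 by rewrite ltr_wpDl.
have c0 : 0 < m%:R * `|D| + 1 by rewrite ltr_wpDl// mulr_ge0.
have [d d0 hd] := hf (e / 2 / (`|z'| + 1)) (divr_gt0 (divr_gt0 e0 (ltr0Sn _ 1)) K0).
have /is_derive_epsP/(_ (e / 2 / (m%:R * `|D| + 1)) (divr_gt0 (divr_gt0 e0 (ltr0Sn _ 1)) c0)) [d1 d10 hd1] := hz.
exists (Num.min (Num.min dl d1) (d / (`|z'| + 1))).
  by rewrite !lt_min dl0 d10 divr_gt0.
move=> h; rewrite !lt_min -!andbA => /and3P[hl1 hd11 hdd].
have zz : `|z (t + h) - z t| < d.
  by apply: le_lt_trans (hl _ hl1) _; rewrite mulrC -ltr_pdivlMr.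
have z0 : `|z t - z t| < d by rewrite subrr normr0.
have -> : f (z (t + h *: 1)) - f (z t) - h *: (z' *m D) =
  (f (z (t + h)) - f (z t) - (z (t + h) - z t) *m D) + (z (t + h) - z t - h *: z') *m D.
  by rewrite [h%:A]mulr1; mxring.
apply: le_trans (ler_normD _ _) _; rewrite [e]splitr mulrDl; apply: lerD.
  apply: le_trans (hd _ _ zz z0) _.
  apply: le_trans (ler_wpM2l _ (hl _ hl1)) _; first by rewrite !divr_ge0// ltW.
  by rewrite mulrA divfK// gt_eqF.
apply: le_trans (mulmx_norm_le _ _) _; rewrite mulrAC.
have := hd1 h hd11; rewrite [h *: 1]mulr1 => H.
apply: le_trans (ler_wpM2l _ H) _; first by rewrite mulr_ge0.
by rewrite mulrA ler_wpM2r// absorb_le ?mulr_ge0 ?divr_ge0 ?(ltW e0).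
Qed.

Lemma sdr_sd1 m (f : 'rV[R]_m -> R) p g : sdr f p g <-> sd (fun x => (f x)%:M : 'rV_1) p g.
Proof.
rewrite sdP; split=> [h j|/(_ 0)].
  rewrite (_ : col j g = g); last by apply/matrixP => a b; rewrite !mxE !ord1.
  by apply: sdr_near h => [|x _]; [exact: (@ltr01 R)|rewrite mxE ord1 eqxx].
rewrite (_ : col 0 g = g); last by apply/matrixP => a b; rewrite !mxE !ord1.
by apply: sdr_near => [|x _]; [exact: (@ltr01 R)|rewrite mxE eqxx].
Qed.

Lemma sdr_comp m k (f : 'rV[R]_m -> 'rV[R]_k) (h : 'rV[R]_k -> R) p D g :
  sd f p D -> sdr h (f p) g -> sdr (h \o f) p (D *m g).
Proof. by move=> hf /sdr_sd1 hh; apply/sdr_sd1; apply: sd_comp hf hh. Qed.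

Lemma sdr_curve m (f : 'rV[R]_m -> R) (z : R -> 'rV[R]_m) (t : R) g z' :
  sdr f (z t) g -> is_derive t 1 z z' -> is_derive t 1 (fun s => f (z s)) ((z' *m g) 0 0).
Proof.
move=> /sdr_sd1 hf hz; have /is_derive_mxP/(_ 0 0) := sd_curve hf hz.
by rewrite (_ : (fun s => _) = (fun s => f (z s)))//; apply/funext => s; rewrite mxE eqxx.
Qed.

Lemma sd_id m (p : 'rV[R]_m) : sd id p 1%:M.
Proof.
move=> e e0; exists 1 => // x y _ _; rewrite mulmx1 subrr normr0.
by rewrite mulr_ge0// ltW.
Qed.

Lemma sdr_derive m (f : 'rV[R]_m -> R) p g (v : 'rV[R]_m) :
  sdr f p g -> is_derive p v f ((v *m g) 0 0).
Proof.
move=> hf; apply/is_derive_epsP => e e0.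
have c0 : 0 < `|v| + 1 by rewrite ltr_wpDl.
have [d d0 hd] := hf (e / (`|v| + 1)) (divr_gt0 e0 c0).
exists (d / (`|v| + 1)); first by rewrite divr_gt0.
move=> h hh; have := hd (p + h *: v) p.
rewrite addrC addKr subrr normr0 => /(_ _ d0).
rewrite normrZ -scalemxAl mxE => H.
have := H _; rewrite addrC => {}H; apply: le_trans (H _) _.
  apply: le_lt_trans (_ : `|h| * (`|v| + 1) < _); last by rewrite -ltr_pdivlMr.
  by rewrite ler_wpM2l// lerDl.
rewrite [`|h| * _]mulrC mulrA ler_wpM2r// -mulrA ler_piMr ?(ltW e0)//.
by rewrite ler_pdivrMl// mulr1 lerDl.
Qed.

Lemma sdr_partial m (f : 'rV[R]_m -> R) p g i : sdr f p g ->
  derivable f p (delta_mx 0 i) /\ partial i f p = g i 0.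
Proof.
by move=> /(sdr_derive (delta_mx 0 i)) [h1 h2]; split=> //; rewrite /partial h2 -rowE mxE.
Qed.

End strong_differentiability.

(** * Continuously differentiable functions and the symmetry of second derivatives *)

Section C1.
Context {R : realType} {n : nat}.
Implicit Types (U : set 'rV[R]_n) (f : 'rV[R]_n -> R) (p : 'rV[R]_n).

Lemma open_ballP U p : open U -> U p -> exists2 d : R, 0 < d & forall q, `|q - p| < d -> U q.
Proof.
move=> oU Up; have : nbhs p U by apply: open_nbhs_nbhs.
move=> /(@nbhs_normP _ _ p) [d /= d0 h]; exists d => // q qd; apply: h.
by rewrite /= distrC.
Qed.

Lemma cont_ballP (f : 'rV[R]_n -> R) p (e : R) : {for p, continuous f} -> 0 < e ->
  exists2 d : R, 0 < d & forall q, `|q - p| < d -> `|f q - f p| < e.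
Proof.
move=> /(@cvgrPdist_lt _ _ _ _ (nbhs_filter p)) h e0.
have /(@nbhs_normP _ _ p) [d /= d0 hd] := h e e0; exists d => // q qd.
by rewrite distrC; apply: hd; rewrite /= distrC.
Qed.

Lemma line_derive f (q : 'rV[R]_n) i (s : R) :
  derivable f (q + s *: delta_mx 0 i) (delta_mx 0 i) ->
  is_derive s 1 (fun s => f (q + s *: delta_mx 0 i)) (partial i f (q + s *: delta_mx 0 i)).
Proof.
move=> hd; have /is_derive_epsP h : is_derive (q + s *: delta_mx 0 i) (delta_mx 0 i) f
    (partial i f (q + s *: delta_mx 0 i)) by apply: DeriveDef.
apply/is_derive_epsP => e e0; have [d d0 H] := h e e0; exists d => // u ud.
by have := H u ud; rewrite [u *: 1]mulr1 scalerDl addrA.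
Qed.

Lemma coord_mvt f (q : 'rV[R]_n) i (a : R) :
  (forall s, `|s| <= `|a| -> derivable f (q + s *: delta_mx 0 i) (delta_mx 0 i)) ->
  exists2 s, `|s| <= `|a| & f (q + a *: delta_mx 0 i) - f q = a * partial i f (q + s *: delta_mx 0 i).
Proof.
move=> hd; pose F s := f (q + s *: delta_mx 0 i).
pose F' s := partial i f (q + s *: delta_mx 0 i).
have hF (s : R) : `|s| <= `|a| -> is_derive s 1 F (F' s) by move=> /hd /line_derive.
have F0 : F 0 = f q by rewrite /F scale0r addr0.
have [a0|a0] := leP 0 a.
  have [||c cab eq] := @MVT_segment R F F' 0 a a0.
  - move=> x; rewrite in_itv/= => /andP[x0 xa]; apply: hF.
    by rewrite gtr0_norm// ger0_norm// ltW.
  - apply: continuous_in_subspaceT => x; rewrite inE /= in_itv/= => /andP[x0 xa].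
    by apply: (is_derive_cont (hF x _)); rewrite !ger0_norm.
  move: cab; rewrite in_itv/= => /andP[c0 ca].
  exists c; first by rewrite !ger0_norm.
  by rewrite -F0 [LHS]eq subr0 mulrC.
have [||c cab eq] := @MVT_segment R F F' a 0 (ltW a0).
- move=> x; rewrite in_itv/= => /andP[x0 xa]; apply: hF.
  by rewrite ltr0_norm// ltr0_norm// lerN2 ltW.
- apply: continuous_in_subspaceT => x; rewrite inE /= in_itv/= => /andP[x0 xa].
  by apply: (is_derive_cont (hF x _)); rewrite !ler0_norm ?(ltW a0)// lerN2.
move: cab; rewrite in_itv/= => /andP[c0 ca].
exists c; first by rewrite !ler0_norm ?(ltW a0)// lerN2.
by apply/eqP; rewrite -F0 -opprB eq sub0r mulrN opprK mulrC.
Qed.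

(** Going from y to x one coordinate at a time, each step is governed by the mean value theorem for
    one partial derivative, which is nearly constant close to p. *)
Lemma Ck1_sdr U f p : open U -> U p -> Ck 1 U f -> sdr f p (\col_i partial i f p).
Proof.
move=> oU Up [_ hf] e e0.
have [dU dU0 hU] := open_ballP oU Up.
pose e' := e / (n%:R + 1).
have e'0 : 0 < e' by rewrite divr_gt0// ltr_wpDl.
have [||d d0 hd] := @fin_min_pos R n (fun i d => forall q, `|q - p| < d ->
    `|partial i f q - partial i f p| < e').
- by move=> i d d' _ d'd h q qd; apply: h; apply: lt_le_trans d'd.
- by move=> i; apply: cont_ballP => //; have [_ [h _]] := hf i; apply: h.
(* A mixed point is within r of p and is moved by at most |x_k - y_k| <= 2 r; hence the third. *)
pose r := Num.min dU d / 3.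
have m0 : 0 < Num.min dU d by rewrite lt_min dU0.
have r0 : 0 < r by rewrite divr_gt0.
exists r => // x y xr yr.
(* [w k] has the first k coordinates of x and the others of y. *)
pose w (k : nat) : 'rV[R]_n := \row_i if (i < k)%N then x 0 i else y 0 i.
have w0 : w 0%N = y by apply/rowP => i; rewrite mxE.
have wn : w n = x by apply/rowP => i; rewrite mxE ltn_ord.
have wS (k : 'I_n) : w k.+1 = w k + (x 0 k - y 0 k) *: delta_mx 0 k.
  apply/rowP => i; rewrite !mxE eqxx /= ltnS leq_eqVlt.
  have [->|ik] := eqVneq i k; first by rewrite eqxx ltnn mulr1 addrC subrK.
  by rewrite (inj_eq val_inj) (negPf ik) mulr0 addr0.
have near (k : 'I_n) (s : R) : `|s| <= `|x 0 k - y 0 k| ->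
    `|w k + s *: delta_mx 0 k - p| < Num.min dU d.
  move=> hs; apply: (@le_lt_trans _ _ (r * 3 - (r - Num.max `|x - p| `|y - p|))); last first.
    rewrite /r divfK ?pnatr_eq0// ltrBlDr ltrDl subr_gt0 -/r.
    by rewrite gt_max xr yr.
  have xyk : `|x 0 k - y 0 k| <= r + r.
    rewrite (_ : x 0 k - y 0 k = (x - p) 0 k - (y - p) 0 k); last by rewrite !mxE; ring.
    apply: le_trans (ler_normB _ _) _; apply: lerD.
      by apply: le_trans (mx_entry_le _ _ _) (ltW xr).
    by apply: le_trans (mx_entry_le _ _ _) (ltW yr).
  have mx : `|x - p| <= Num.max `|x - p| `|y - p| by rewrite le_max lexx.
  have my : `|y - p| <= Num.max `|x - p| `|y - p| by rewrite le_max lexx orbT.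
  move: (Num.max _ _) mx my => q xq yq.
  have wq i : `|w k 0 i - p 0 i| <= q.
    rewrite mxE; case: ifP => _.
      apply: le_trans xq; apply: le_trans (mx_entry_le _ 0 i).
      by rewrite !mxE.
    by apply: le_trans yq; apply: le_trans (mx_entry_le _ 0 i); rewrite !mxE.
  apply: (@le_trans _ _ (q + (r + r))); last by lra.
  apply: mx_norm_le => [|a i].
    by rewrite !addr_ge0 ?(ltW r0)//; apply: le_trans yq.
  rewrite ord1.
  rewrite (_ : (w k + s *: delta_mx 0 k - p) 0 i =
      (w k 0 i - p 0 i) + s * ((0 == 0 :> 'I_1) && (i == k))%:R); last first.
    by rewrite !mxE; ring.
  apply: le_trans (ler_normD _ _) _; apply: lerD => //.
  apply: le_trans xyk; apply: le_trans hs.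
  by rewrite normrM; case: (_ && _); rewrite ?normr1 ?normr0 ?mulr1 ?mulr0.
have step (k : 'I_n) : `|f (w k.+1) - f (w k) - (x 0 k - y 0 k) * partial k f p| <= e' * `|x - y|.
  have [|c hc] := @coord_mvt f (w k) k (x 0 k - y 0 k).
    by move=> s /near; rewrite lt_min => /andP[/hU /(proj1 (hf k))].
  rewrite -wS => ->; rewrite -mulrBr normrM mulrC.
  have := near _ _ hc; rewrite lt_min => /andP[_ /hd hc'].
  apply: ler_pM => //; first exact: ltW.
  by apply: le_trans (mx_entry_le _ 0 k); rewrite !mxE.
have -> : f x - f y = \sum_(k < n) (f (w k.+1) - f (w k)).
  rewrite -wn -w0 -(@telescope_sumr _ 0 n (fun k => f (w k)))//.
  by rewrite big_mkord.
have -> : ((x - y) *m \col_i partial i f p) 0 0 = \sum_(k < n) (x 0 k - y 0 k) * partial k f p.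
  by rewrite mxE; apply: eq_bigr => k _; rewrite !mxE.
rewrite -sumrB; apply: le_trans (ler_norm_sum _ _ _) _.
apply: le_trans (_ : _ <= \sum_(k < n) e' * `|x - y|) _; first exact: ler_sum.
rewrite sumr_const card_ord -mulr_natl mulrA ler_wpM2r//.
by rewrite /e' absorb_le ?ler0n ?(ltW e0).
Qed.

Lemma Ck1_sd k U (F : 'rV[R]_n -> 'rV[R]_k) p : open U -> U p ->
  (forall j, Ck 1 U (fun q => F q 0 j)) ->
  sd F p (\matrix_(i, j) partial i (fun q => F q 0 j) p).
Proof.
move=> oU Up hF; apply/sdP => j.
rewrite (_ : col j _ = \col_i partial i (fun q => F q 0 j) p); first exact: Ck1_sdr (hF j).
by apply/colP => i; rewrite !mxE.
Qed.

(** The second difference of f over a square of side r equals r^2 times either mixed derivative up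
    to e r^2 / 2, and it does not depend on the order of the two directions. *)
Lemma schwarz f p (d : R) (i j : 'I_n) (gi gj : 'cV[R]_n) : 0 < d ->
  (forall q k, `|q - p| < d -> derivable f q (delta_mx 0 k)) ->
  sdr (partial i f) p gi -> sdr (partial j f) p gj ->
  partial i (partial j f) p = partial j (partial i f) p.
Proof.
move=> d0 hf hi hj; apply/eqP; rewrite -subr_eq0 -normr_le0.
apply/ler_addgt0Pr => e e0; rewrite add0r.
have e2 : 0 < e / 2 by rewrite divr_gt0.
have [di di0 hdi] := hi _ e2; have [dj dj0 hdj] := hj _ e2.
pose r := Num.min (Num.min d di) dj / 4.
have r0 : 0 < r by rewrite divr_gt0// !lt_min d0 di0 dj0.
have : 2 * r < Num.min (Num.min d di) dj.
  rewrite /r mulrC -mulrA gtr_pMr ?lt_min ?d0 ?di0 ?dj0//.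
  by rewrite mulrC ltr_pdivrMr//; lra.
rewrite !lt_min -andbA => /and3P[rd rdi rdj].
have key (a b : 'I_n) g da : sdr (partial a f) p g -> 0 < da -> 2 * r < da ->
   (forall x y : 'rV[R]_n, `|x - p| < da -> `|y - p| < da ->
     `|partial a f x - partial a f y - ((x - y) *m g) 0 0| <= e / 2 * `|x - y|) ->
   `|f (p + r *: delta_mx 0 a + r *: delta_mx 0 b) - f (p + r *: delta_mx 0 a)
    - f (p + r *: delta_mx 0 b) + f p - r ^+ 2 * partial b (partial a f) p| <= e / 2 * r ^+ 2.
  move=> hg da0 rda hda.
  have nd (s u : R) : `|s| <= r -> `|u| <= r -> forall q, 2 * r < q ->
      `|p + u *: delta_mx 0 b + s *: delta_mx 0 a - p| < q.
    move=> sr ur q rq; apply: le_lt_trans rq; rewrite addrAC addrC.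
    rewrite [p + _]addrC addrK; apply: le_trans (ler_normD _ _) _.
    rewrite mulrDl !mul1r !normrZ; apply: lerD.
      by rewrite -[leRHS]mulr1 ler_pM// delta_norm.
    by rewrite -[leRHS]mulr1 ler_pM// delta_norm.
  (* The difference of f across the side b, as a function of the position along a: the mean value
     theorem turns the second difference into a first difference of [partial a f]. *)
  pose F s := f (p + r *: delta_mx 0 b + s *: delta_mx 0 a) - f (p + s *: delta_mx 0 a).
  pose F' s := partial a f (p + r *: delta_mx 0 b + s *: delta_mx 0 a) - partial a f (p + s *: delta_mx 0 a).
  have rr : `|r| <= r by rewrite gtr0_norm.
  have hF (s : R) : `|s| <= r -> is_derive s 1 F (F' s).
    move=> sr; apply: is_derive_sub; apply: line_derive; apply: hf.
      exact: nd.
    by have := nd s 0 sr _ _ rd; rewrite scale0r addr0 normr0; apply; apply: ltW.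
  have [||c cab] := @MVT_segment R F F' 0 r (ltW r0).
  - by move=> x; rewrite in_itv/= => /andP[x0 xa]; apply: hF; rewrite gtr0_norm// ltW.
  - apply: continuous_in_subspaceT => x; rewrite inE /= in_itv/= => /andP[x0 xa].
    by apply: (is_derive_cont (hF x _)); rewrite ger0_norm.
  move: cab; rewrite in_itv/= subr0 => /andP[c0 cr] eqF.
  have cc : `|c| <= r by rewrite ger0_norm.
  have -> : f (p + r *: delta_mx 0 a + r *: delta_mx 0 b) - f (p + r *: delta_mx 0 a)
    - f (p + r *: delta_mx 0 b) + f p = F r - F 0.
    by rewrite /F !scale0r !addr0 [p + r *: delta_mx 0 b + _]addrAC; ring.
  rewrite eqF; have [_ ->] := sdr_partial b hg.
  have -> : F' c * r - r ^+ 2 * g b 0 = r * (F' c - r * g b 0) by ring.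
  rewrite normrM gtr0_norm// [r ^+ 2]expr2 mulrCA ler_pM2l//.
  have := hda (p + r *: delta_mx 0 b + c *: delta_mx 0 a) (p + c *: delta_mx 0 a).
  have -> : p + r *: delta_mx 0 b + c *: delta_mx 0 a - (p + c *: delta_mx 0 a) = r *: delta_mx 0 b :> 'rV[R]_n.
    by rewrite addrAC addrC [p + c *: _]addrC; apply/matrixP => ? ?; rewrite !mxE; ring.
  rewrite -scalemxAl mxE -rowE mxE => H.
  apply: le_trans (H _ _) _.
  - exact: nd.
  - by have := nd c 0 cc _ _ rda; rewrite scale0r addr0 normr0; apply; apply: ltW.
  - rewrite ler_pM2l// normrZ gtr0_norm// -[leRHS]mulr1 ler_pM2l//.
    exact: delta_norm.
have k1 := key i j gi di hi di0 rdi hdi.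
have k2 := key j i gj dj hj dj0 rdj hdj.
have r2 : 0 < r ^+ 2 by rewrite exprn_gt0.
rewrite -(ler_pM2l r2) -[X in X * _]gtr0_norm// -normrM.
have -> : r ^+ 2 * (partial i (partial j f) p - partial j (partial i f) p) =
  (f (p + r *: delta_mx 0 i + r *: delta_mx 0 j) - f (p + r *: delta_mx 0 i)
    - f (p + r *: delta_mx 0 j) + f p - r ^+ 2 * partial j (partial i f) p) -
  (f (p + r *: delta_mx 0 j + r *: delta_mx 0 i) - f (p + r *: delta_mx 0 j)
    - f (p + r *: delta_mx 0 i) + f p - r ^+ 2 * partial i (partial j f) p).
  have aux (a b c d' u v s : R) : s * (v - u) = a - b - c + d' - s * u - (a - c - b + d' - s * v).
    by ring.
  by rewrite [p + r *: delta_mx 0 j + _]addrAC; apply: aux.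
apply: le_trans (ler_normB _ _) _; apply: le_trans (lerD k1 k2) _.
by rewrite -mulrDl -splitr mulrC.
Qed.

End C1.

(** * Ordinary differential equations *)

Section linear_ode.
Context {R : realType}.

Lemma interval_ball (t0 eta t : R) : `|t - t0| <= eta -> t0 - eta <= t <= t0 + eta.
Proof. by rewrite ler_norml => /andP[h1 h2]; apply/andP; split; lra. Qed.

Lemma ball_interval (t0 eta t : R) : t0 - eta <= t <= t0 + eta -> `|t - t0| <= eta.
Proof. by move=> /andP[h1 h2]; rewrite ler_norml; apply/andP; split; lra. Qed.

Lemma exists_primitive (f : R -> R) (a b : R) : continuous f ->
  exists F : R -> R, forall t, a < t < b -> is_derive t 1 F (f t).
Proof.
move=> cf; exists (fun x => \int[lebesgue_measure]_(t in `[a, x]) f t)%R => t /andP[at_ tb].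
have tu : t < t + 1 by rewrite ltrDl.
have [|h1 h2] := @continuous_FTC1_closed R f a t (t + 1) tu _ at_ (cf t).
  apply: continuous_compact_integrable; first exact: segment_compact.
  exact: continuous_subspaceT.
exact: (DeriveDef h1 (etrans (esym (derive1E _ _)) h2)).
Qed.

Lemma mx_cont m k (A : R -> 'M[R]_(m, k)) :
  (forall t, {for t, continuous A}) <-> forall i j t, {for t, continuous (fun s => A s i j)}.
Proof.
split=> [h i j t|h t].
  apply/cvgrPdist_le => e e0; have /cvgrPdist_le/(_ e e0) := h t.
  apply: filterS => s; apply: le_trans.
  by apply: le_trans (mx_entry_le _ i j); rewrite !mxE.
apply/cvgrPdist_le => e e0.
have H : \forall s \near t, forall (ij : 'I_m * 'I_k), `|A t ij.1 ij.2 - A s ij.1 ij.2| <= e.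
  apply: (@filter_forall R ('I_m * 'I_k)%type
    (fun ij s => `|A t ij.1 ij.2 - A s ij.1 ij.2| <= e) (nbhs t) _) => -[i j].
  by have /cvgrPdist_le/(_ e e0) := h i j t.
near=> s; apply: mx_norm_le (ltW e0) _ => i j; rewrite !mxE.
by have := near H s; rewrite /= => /(_ _ (i, j)); apply.
Unshelve. all: by end_near. Qed.

Lemma mulmx_cont m k l (A : R -> 'M[R]_(m, k)) (B : R -> 'M[R]_(k, l)) :
  (forall t, {for t, continuous A}) -> (forall t, {for t, continuous B}) ->
  (forall t, {for t, continuous (fun s => A s *m B s)}).
Proof.
move=> /mx_cont hA /mx_cont hB; apply/mx_cont => i j t.
rewrite (_ : (fun s => _) = (fun s => \sum_u A s i u * B s u j)); last first.
  by apply/funext => s; rewrite mxE.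
apply: cvg_big => [|u _]; first exact: add_continuous.
by apply: cvgM; [apply: hA|apply: hB].
Qed.

Lemma exists_primitive_mx m k (A : R -> 'M[R]_(m, k)) (a b t0 : R) (Y0 : 'M[R]_(m, k)) :
  (forall t, {for t, continuous A}) ->
  exists F : R -> 'M[R]_(m, k), F t0 = Y0 /\ forall t, a < t < b -> is_derive t 1 F (A t).
Proof.
move=> /mx_cont hA.
have h i j : exists F : R -> R, forall t, a < t < b -> is_derive t 1 F (A t i j).
  by apply: exists_primitive => t; apply: hA.
pose F i j := projT1 (cid (h i j)).
have hF i j t : a < t < b -> is_derive t 1 (F i j) (A t i j) by rewrite /F; case: cid => ? /=; apply.
exists (fun t => Y0 + \matrix_(i, j) (F i j t - F i j t0)); split.
  by apply/matrixP => i j; rewrite !mxE subrr addr0.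
move=> t tab; apply/is_derive_mxP => i j.
rewrite (_ : (fun s => _) = fun s => Y0 i j + (F i j s - F i j t0)); last first.
  by apply/funext => s; rewrite !mxE.
have := is_derive_add (is_derive_cst1 (Y0 i j) t)
  (is_derive_sub (hF i j t tab) (is_derive_cst1 (F i j t0) t)).
by rewrite subr0 add0r.
Qed.

(** The intervals of radius 2 D / 2^j around u_j are nested; the supremum of their left ends lies in
    all of them, which also gives the rate. *)
Lemma geometric_limit (u : nat -> R) (D : R) : 0 <= D ->
  (forall j, `|u j.+1 - u j| <= D / 2 ^+ j) ->
  exists l, forall j, `|u j - l| <= 2 * D / 2 ^+ j.
Proof.
move=> D0 hu; pose e j := 2 * D / 2 ^+ j.
have eS j : e j.+1 = e j - D / 2 ^+ j by rewrite /e exprS; field; rewrite expf_neq0.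
have step j : u j - e j <= u j.+1 - e j.+1 /\ u j.+1 + e j.+1 <= u j + e j.
  have := hu j; rewrite eS ler_norml => /andP[h1 h2]; split; lra.
have up i j : u i - e i <= u (i + j)%N - e (i + j)%N.
  elim: j => [|j IH]; first by rewrite addn0.
  by rewrite addnS; apply: le_trans IH _; have [] := step (i + j)%N.
have dn i j : u (i + j)%N + e (i + j)%N <= u i + e i.
  elim: j => [|j IH]; first by rewrite addn0.
  by rewrite addnS; apply: le_trans IH; have [] := step (i + j)%N.
have e0 j : 0 <= e j by rewrite divr_ge0 ?mulr_ge0 ?exprn_ge0.
have ab i j : u i - e i <= u j + e j.
  apply: le_trans (up i j) _; rewrite addnC.
  apply: le_trans (dn j i); apply: (@le_trans _ _ (u (j + i)%N)).
    by rewrite gerBl.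
  by rewrite lerDl.
pose S := [set x | exists j, x = u j - e j].
have S0 : S !=set0 by exists (u 0%N - e 0%N), 0%N.
have uS j : ubound S (u j + e j) by move=> _ [i ->].
exists (sup S) => j; rewrite distrC ler_norml; apply/andP; split.
  rewrite lerBrDl; apply: ub_le_sup; first by exists (u 0%N + e 0%N); apply: uS.
  by exists j.
by rewrite lerBlDl; apply: ge_sup.
Qed.

Lemma geometric_limit_mx m k (u : nat -> 'M[R]_(m, k)) (D : R) : 0 <= D ->
  (forall j, `|u j.+1 - u j| <= D / 2 ^+ j) ->
  exists l, forall j, `|u j - l| <= 2 * D / 2 ^+ j.
Proof.
move=> D0 hu.
have h a b : exists l, forall j, `|u j a b - l| <= 2 * D / 2 ^+ j.
  apply: geometric_limit => // j; apply: le_trans (hu j).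
  by apply: le_trans (mx_entry_le _ a b); rewrite !mxE.
exists (\matrix_(a, b) projT1 (cid (h a b))) => j.
apply: mx_norm_le => [|a b]; first by rewrite divr_ge0 ?mulr_ge0 ?exprn_ge0.
by rewrite !mxE; case: cid => l /=; apply.
Qed.

Lemma exp2_small (D e : R) : 0 <= D -> 0 < e -> exists j, D / 2 ^+ j < e.
Proof.
move=> D0 e0; pose j := Num.bound (D / e); exists j.
rewrite ltr_pdivrMr ?exprn_gt0// mulrC -ltr_pdivrMr//.
apply: lt_trans (archi_boundP (divr_ge0 D0 (ltW e0))) _.
by rewrite -natrX ltr_nat -/j ltn_expl.
Qed.

(** A retraction of the line onto the interval of radius eta about t0. Composition with it makes a
    function continuous on the interval continuous on R, as the existence of primitives requires. *)
Definition clamp (t0 eta t : R) : R := Num.max (t0 - eta) (Num.min (t0 + eta) t).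

Lemma clamp_id (t0 eta t : R) : `|t - t0| <= eta -> clamp t0 eta t = t.
Proof.
move=> /interval_ball/andP[h1 h2].
by rewrite /clamp (min_idPr _)// (max_idPr _).
Qed.

Lemma clamp_ball (t0 eta t : R) : 0 <= eta -> `|clamp t0 eta t - t0| <= eta.
Proof.
move=> e0; apply: ball_interval; rewrite /clamp le_max lexx /= ge_max.
rewrite ge_min lexx /= andbT.
by rewrite lerBlDr -addrA lerDl addr_ge0.
Qed.

Lemma clamp_cont (t0 eta t : R) : {for t, continuous (clamp t0 eta)}.
Proof.
apply: continuous_max; first exact: cvg_cst.
by apply: continuous_min; [exact: cvg_cst|exact: cvg_id].
Qed.

Lemma clamp_comp_cont (W : normedModType R) (F : R -> W) (t0 eta : R) : 0 <= eta ->
  (forall t, `|t - t0| <= eta -> {for t, continuous F}) ->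
  forall t, {for t, continuous (fun s => F (clamp t0 eta s))}.
Proof.
move=> e0 h t; apply: (@continuous_comp _ _ _ (clamp t0 eta) F); first exact: clamp_cont.
by apply: h; apply: clamp_ball.
Qed.

Lemma uniform_limit_cont m k (W : nat -> R -> 'M[R]_(m, k)) (Y : R -> 'M[R]_(m, k)) (D : R) :
  0 <= D ->
  (forall j t, {for t, continuous (W j)}) ->
  (forall j t, `|W j t - Y t| <= D / 2 ^+ j) ->
  forall t, {for t, continuous Y}.
Proof.
move=> D0 cW hW t; apply/cvgrPdist_le => e e0.
have [j hj] := @exp2_small D (e / 3) D0 (divr_gt0 e0 (ltr0Sn _ 2)).
have /cvgrPdist_le/(_ (e / 3) (divr_gt0 e0 (ltr0Sn _ 2))) := cW j t.
apply: filterS => s hs.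
have -> : Y t - Y s = - (W j t - Y t) + (W j t - W j s) + (W j s - Y s).
  by apply/matrixP => a b; rewrite !mxE; ring.
apply: le_trans (ler_normD _ _) _; apply: le_trans (lerD (ler_normD _ _) (lexx _)) _.
rewrite normrN; have h1 := hW j t; have h2 := hW j s.
have h1' := le_lt_trans h1 hj; have h2' := le_lt_trans h2 hj.
by lra.
Qed.

(** Picard iteration. The time eta is so short that one integration halves uniform distances, so no
    weighted norm is needed. *)
Lemma linear_ode_exists_cont m k (A : R -> 'M[R]_m) (t0 eta L : R) (Y0 : 'M[R]_(k, m)) :
  0 < eta -> 0 <= L -> m%:R * L * eta <= 2^-1 ->
  (forall t, {for t, continuous A}) -> (forall t, `|A t| <= L) ->
  exists G : R -> 'M[R]_(k, m), G t0 = Y0 /\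
    forall t, `|t - t0| <= eta -> is_derive t 1 G (G t *m A t).
Proof.
move=> eta0 L0 small cA bA.
have step (Z : R -> 'M[R]_(k, m)) : (forall t, {for t, continuous Z}) ->
  exists G : R -> 'M[R]_(k, m), G t0 = Y0 /\
    forall t, `|t - t0| <= eta -> is_derive t 1 G (Z t *m A t).
  move=> cZ; have [G [G0 hG]] := @exists_primitive_mx _ _ _ (t0 - 2 * eta) (t0 + 2 * eta) t0 Y0
    (mulmx_cont cZ cA).
  exists G; split=> // t /interval_ball/andP[h1 h2]; apply: hG; apply/andP; split; lra.
(* Iterates carry their proof of continuity, since the next primitive is chosen from it. *)
pose S := {Z : R -> 'M[R]_(k, m) | forall t, {for t, continuous Z}}.
pose GG (Z : S) := projT1 (cid (step (sval Z) (svalP Z))).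
have GGP (Z : S) : GG Z t0 = Y0 /\
    forall t, `|t - t0| <= eta -> is_derive t 1 (GG Z) (sval Z t *m A t).
  by rewrite /GG; case: cid.
have cG (Z : S) t : {for t, continuous (fun s => GG Z (clamp t0 eta s))}.
  apply: clamp_comp_cont (ltW eta0) _ t => t ht.
  exact: is_derive_cont ((GGP Z).2 t ht).
pose next (Z : S) : S := exist _ (fun s => GG Z (clamp t0 eta s)) (cG Z).
have close (Z Z' : S) (d : R) : 0 <= d -> (forall t, `|sval Z t - sval Z' t| <= d) ->
    forall t, `|t - t0| <= eta -> `|GG Z t - GG Z' t| <= d / 2.
  move=> d0 hZ t ht; have [Z0 hZ1] := GGP Z; have [Z'0 hZ'1] := GGP Z'.
  pose M s := GG Z s - GG Z' s; pose M' s := (sval Z s - sval Z' s) *m A s.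
  have hM s : t0 - eta <= s <= t0 + eta -> is_derive s 1 M (M' s).
    by move=> /ball_interval hs; rewrite /M' mulmxBl; apply: is_derive_sub; [apply: hZ1|apply: hZ'1].
  have bM s : t0 - eta <= s <= t0 + eta -> `|M' s| <= m%:R * d * L.
    move=> _; apply: le_trans (mulmx_norm_le _ _) _; apply: ler_pM => //.
    by apply: ler_wpM2l.
  have K0 : 0 <= m%:R * d * L by rewrite !mulr_ge0.
  have t0i : t0 - eta <= t0 <= t0 + eta by apply/andP; split; lra.
  have := mvt_curve2 K0 hM bM (interval_ball ht) t0i.
  rewrite {2}/M Z0 Z'0 subrr subr0 => H; apply: le_trans H _.
  apply: le_trans (ler_wpM2l K0 ht) _.
  have -> : m%:R * d * L * eta = d * (m%:R * L * eta) by ring.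
  by apply: ler_wpM2l.
have c0 (t : R) : {for t, continuous (fun _ : R => Y0)} by exact: cst_continuous.
pose Z0 : S := exist _ (fun=> Y0) c0.
pose W j := iter j next Z0.
pose D := `|Y0| / 2 + 1.
have D0 : 0 <= D by rewrite addr_ge0// divr_ge0.
have W1 t : `|sval (W 1%N) t - sval (W 0%N) t| <= D.
  have [G0 hG] := GGP Z0; rewrite /W /=.
  set c := clamp _ _ _; have hc : `|c - t0| <= eta by apply: clamp_ball; apply: ltW.
  rewrite -G0; pose M' s := Y0 *m A s.
  have hM s : t0 - eta <= s <= t0 + eta -> is_derive s 1 (GG Z0) (M' s).
    by move=> /ball_interval/hG.
  have bM s : t0 - eta <= s <= t0 + eta -> `|M' s| <= m%:R * `|Y0| * L.
    by move=> _; apply: le_trans (mulmx_norm_le _ _) _; apply: ler_wpM2l => //; rewrite mulr_ge0.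
  have K0 : 0 <= m%:R * `|Y0| * L by rewrite !mulr_ge0.
  have t0i : t0 - eta <= t0 <= t0 + eta by apply/andP; split; lra.
  have := mvt_curve2 K0 hM bM (interval_ball hc) t0i => H; apply: le_trans H _.
  apply: le_trans (ler_wpM2l K0 hc) _.
  have -> : m%:R * `|Y0| * L * eta = `|Y0| * (m%:R * L * eta) by ring.
  by apply: le_trans (ler_wpM2l (normr_ge0 _) small) _; rewrite /D lerDl.
have WS j t : `|sval (W j.+1) t - sval (W j) t| <= D / 2 ^+ j.
  elim: j t => [|j IH] t; first by rewrite expr0 divr1.
  rewrite (_ : D / 2 ^+ j.+1 = D / 2 ^+ j / 2); last by rewrite exprS; field; rewrite expf_neq0.
  apply: (close _ _ _ _ IH); first by rewrite divr_ge0// exprn_ge0.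
  exact/clamp_ball/ltW.
have hl t : exists l, forall j, `|sval (W j) t - l| <= 2 * D / 2 ^+ j.
  exact: geometric_limit_mx (fun j => WS j t).
pose Y t := projT1 (cid (hl t)).
have hY j t : `|sval (W j) t - Y t| <= 2 * D / 2 ^+ j by rewrite /Y; case: cid.
have DD : 0 <= 2 * D by rewrite mulr_ge0.
have cY t : {for t, continuous Y}.
  by apply: (uniform_limit_cont DD _ hY) => j s; apply: (svalP (W j)).
pose ZY : S := exist _ Y cY.
have [G0 hG] := GGP ZY.
(* The limit is its own primitive: both are limits of the same iterates, because taking primitives
   contracts. *)
have GY t : `|t - t0| <= eta -> GG ZY t = Y t.
  move=> ht; apply/eqP; rewrite -subr_eq0 -normr_le0; apply/ler_addgt0Pr => e e0; rewrite add0r.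
  have [j hj] := exp2_small DD e0.
  have h1 : `|GG (W j) t - GG ZY t| <= 2 * D / 2 ^+ j / 2.
    apply: close ht; first by rewrite divr_ge0// exprn_ge0.
    exact: hY.
  have h2 := hY j.+1 t; rewrite /W /= -/(W j) clamp_id// in h2.
  have -> : GG ZY t - Y t = - (GG (W j) t - GG ZY t) + (GG (W j) t - Y t).
    by apply/matrixP => a b; rewrite !mxE; ring.
  apply: le_trans (ler_normD _ _) _; rewrite normrN.
  have : 2 * D / 2 ^+ j.+1 = 2 * D / 2 ^+ j / 2 by rewrite exprS; field; rewrite expf_neq0.
  by lra.
exists (GG ZY); split=> // t ht; rewrite GY//; exact: hG.
Qed.

Lemma linear_ode_exists m k (A : R -> 'M[R]_m) (t0 eta L : R) (Y0 : 'M[R]_(k, m)) :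
  0 < eta -> 0 <= L -> m%:R * L * eta <= 2^-1 ->
  (forall t, `|t - t0| <= eta -> {for t, continuous A}) ->
  (forall t, `|t - t0| <= eta -> `|A t| <= L) ->
  exists G : R -> 'M[R]_(k, m), G t0 = Y0 /\
    forall t, `|t - t0| <= eta -> is_derive t 1 G (G t *m A t).
Proof.
move=> eta0 L0 small cA bA.
have [G [G0 hG]] := @linear_ode_exists_cont m k (fun s => A (clamp t0 eta s)) t0 eta L Y0 eta0 L0 small
  (clamp_comp_cont (ltW eta0) cA) (fun t => bA _ (clamp_ball _ _ (ltW eta0))).
by exists G; split=> // t ht; have := hG t ht; rewrite clamp_id.
Qed.

(** Gronwall without exponentials: where |d| is maximal on the interval, the mean value inequality
    bounds |d| by half of itself plus the data. *)
Lemma short_time_bound m (d d' : R -> 'rV[R]_m) (t0 eta L E : R) :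
  0 < eta -> 0 <= L -> L * eta <= 2^-1 -> 0 <= E ->
  (forall t, `|t - t0| <= eta -> is_derive t 1 d (d' t)) ->
  (forall t, `|t - t0| <= eta -> `|d' t| <= L * `|d t| + E) ->
  forall t, `|t - t0| <= eta -> `|d t| <= 2 * `|d t0| + 2 * eta * E.
Proof.
move=> eta0 L0 small E0 hd bd t ht.
have le_ : t0 - eta <= t0 + eta by lra.
have [|c] := @EVT_max R (fun s => `|d s|) _ _ le_.
  apply: continuous_in_subspaceT => x; rewrite inE /= in_itv/= => /ball_interval hx.
  apply: (@continuous_comp _ _ _ d Num.norm); first exact: is_derive_cont (hd x hx).
  exact: norm_continuous.
rewrite in_itv/= => cab hmax.
have {}hmax s : `|s - t0| <= eta -> `|d s| <= `|d c|.
  by move=> /interval_ball hs; apply: hmax; rewrite in_itv.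
have K0 : 0 <= L * `|d c| + E by rewrite addr_ge0// mulr_ge0.
have bd' s : t0 - eta <= s <= t0 + eta -> `|d' s| <= L * `|d c| + E.
  move=> /ball_interval hs; apply: le_trans (bd s hs) _; rewrite lerD2r.
  by apply: ler_wpM2l => //; apply: hmax.
have t0i : t0 - eta <= t0 <= t0 + eta by apply/andP; split; lra.
have := mvt_curve2 K0 (fun s hs => hd s (ball_interval hs)) bd' cab t0i => H.
have H2 : `|d c - d t0| <= `|d c| / 2 + eta * E.
  apply: le_trans H _; apply: le_trans (ler_wpM2l K0 (ball_interval cab)) _.
  rewrite mulrDl [E * eta]mulrC lerD2r.
  have -> : L * `|d c| * eta = `|d c| * (L * eta) by ring.
  exact: ler_wpM2l.
have H3 : `|d c| <= `|d c - d t0| + `|d t0|.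
  by rewrite -{1}[d c](subrK (d t0)); apply: ler_normD.
have := hmax t ht; rewrite -mulrA; lra.
Qed.

End linear_ode.

(** * Differentiability of flows in the initial value *)

Section flow.
Context {R : realType}.

(** The estimate at p also controls pairs of points near q, which pins down the derivative at q.
    Thus strict derivatives, where they exist, vary continuously. *)
Lemma sd_grad_close m k (F : 'rV[R]_m -> 'rV[R]_k) (p q : 'rV[R]_m) D E (d e : R) :
  0 <= e ->
  (forall x y : 'rV[R]_m, `|x - p| < d -> `|y - p| < d -> `|F x - F y - (x - y) *m D| <= e * `|x - y|) ->
  `|q - p| < d -> sd F q E -> forall v : 'rV[R]_m, `|v *m (E - D)| <= e * `|v|.
Proof.
move=> e0 hD qd hE v; apply/ler_addgt0Pr => e1 e10.
have v1 : 0 < `|v| + 1 by rewrite ltr_wpDl.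
have [r r0 hr] := hE (e1 / (`|v| + 1)) (divr_gt0 e10 v1).
pose a := Num.min r (d - `|q - p|).
have a0 : 0 < a by rewrite lt_min r0 subr_gt0.
pose s := a / (`|v| + 1) / 2.
have s0 : 0 < s by rewrite !divr_gt0.
have sv : `|s *: v| < a.
  rewrite normrZ gtr0_norm// /s.
  have : a / (`|v| + 1) * `|v| <= a by rewrite mulrC absorb_le// ltW.
  have -> : a / (`|v| + 1) / 2 * `|v| = a / (`|v| + 1) * `|v| / 2 by ring.
  by move: (_ * `|v|) => u; move: a0; lra.
move: sv; rewrite lt_min => /andP[svr svd].
have qq : q + s *: v - q = s *: v by rewrite addrC addKr.
have h1 := hr (q + s *: v) q; rewrite qq subrr normr0 in h1.
have h2 := hD (q + s *: v) q; rewrite qq in h2.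
have {}h1 := h1 svr r0.
have {}h2 : `|F (q + s *: v) - F q - s *: v *m D| <= e * `|s *: v|.
  apply: h2 => //; have -> : q + s *: v - p = (q - p) + s *: v by rewrite addrAC.
  by apply: le_lt_trans (ler_normD _ _) _; rewrite -ltrBrDl.
have -> : v *m (E - D) = s^-1 *: (s *: v *m E - s *: v *m D).
  by rewrite -!scalemxAl -scalerBr scalerA mulVf ?gt_eqF// scale1r mulmxBr.
have -> : s *: v *m E - s *: v *m D =
  (F (q + s *: v) - F q - s *: v *m D) - (F (q + s *: v) - F q - s *: v *m E).
  by move: (s *: v *m E) (s *: v *m D) (F _ - F q) => A B C; apply/matrixP => ? ?; rewrite !mxE; ring.
rewrite normrZ gtr0_norm ?invr_gt0// ler_pdivrMl//.
apply: le_trans (ler_normB _ _) _; apply: le_trans (lerD h2 h1) _.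
rewrite normrZ gtr0_norm// mulrDr; apply: lerD; first by rewrite mulrCA.
by rewrite mulrC -mulrA ler_pM2l// absorb_le// ltW.
Qed.

Lemma sd_grad_close_norm m k (F : 'rV[R]_m -> 'rV[R]_k) (p q : 'rV[R]_m) D E (d e : R) :
  0 <= e ->
  (forall x y : 'rV[R]_m, `|x - p| < d -> `|y - p| < d -> `|F x - F y - (x - y) *m D| <= e * `|x - y|) ->
  `|q - p| < d -> sd F q E -> `|E - D| <= e.
Proof.
move=> e0 hD qd hE; have h := sd_grad_close e0 hD qd hE.
apply: mx_norm_le => // i j; have := h (delta_mx 0 i); rewrite -rowE => H.
apply: le_trans (_ : _ <= `|row i (E - D)|) _; last first.
  by apply: le_trans H _; rewrite ler_piMr// delta_norm.
by apply: le_trans (mx_entry_le _ 0 j); rewrite [row i _ 0 j]mxE.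
Qed.

Lemma sd_grad_cont m k (F : 'rV[R]_m -> 'rV[R]_k) (DF : 'rV[R]_m -> 'M[R]_(m, k))
    (z : R -> 'rV[R]_m) (t : R) :
  {for t, continuous z} -> (\forall s \near t, sd F (z s) (DF (z s))) ->
  {for t, continuous (fun s => DF (z s))}.
Proof.
move=> cz hF; apply/cvgrPdist_le => e e0.
have [d d0 hd] := nbhs_singleton hF e e0.
have /cvgrPdist_lt/(_ d d0) hz := cz.
apply: filterS2 hF hz => s h1 h2; rewrite distrC.
by apply: (sd_grad_close_norm (ltW e0) hd _ h1); rewrite distrC.
Qed.

(** By compactness of the time interval one radius serves all points of the curve; half of [e] is
    spent on the variation of the derivative between neighbouring times. *)
Lemma sd_uniform m k (F : 'rV[R]_m -> 'rV[R]_k) (DF : 'rV[R]_m -> 'M[R]_(m, k))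
    (z : R -> 'rV[R]_m) (a b : R) :
  (forall t, a <= t <= b -> {for t, continuous z}) ->
  (forall t, a <= t <= b -> \forall s \near t, sd F (z s) (DF (z s))) ->
  forall e : R, 0 < e -> exists2 d : R, 0 < d & forall t, a <= t <= b ->
    forall x y : 'rV[R]_m, `|x - z t| < d -> `|y - z t| < d ->
      `|F x - F y - (x - y) *m DF (z t)| <= e * `|x - y|.
Proof.
move=> cz hF e e0.
pose P (j : nat) (t : R) := forall x y : 'rV[R]_m, `|x - z t| < j.+1%:R^-1 -> `|y - z t| < j.+1%:R^-1 ->
      `|F x - F y - (x - y) *m DF (z t)| <= e * `|x - y|.
have := @segment_compact R a b => /compact_near_coveringP /(_ nat \oo P _) H.
have [|N _ hN] := H.
  move=> t; rewrite /= in_itv/= => tab.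
  have e2 : 0 < e / 2 by rewrite divr_gt0.
  have [d d0 hd] := (nbhs_singleton (hF t tab)) _ e2.
  have d2 : 0 < d / 2 by rewrite divr_gt0.
  have /cvgrPdist_lt/(_ (d / 2) d2) hz := cz t tab.
  have hj : \forall j \near \oo, j.+1%:R^-1 < d / 2 by apply: near_infty_natSinv_lt (PosNum d2).
  exists ([set s | `|z t - z s| < d / 2 /\ sd F (z s) (DF (z s))], [set j | j.+1%:R^-1 < d / 2]) => /=.
    by split=> //; apply: filterI => //; apply: hF.
  move=> [s j] /= [[zs sds] js] x y xs ys.
  have tri (w : 'rV[R]_m) : `|w - z s| < j.+1%:R^-1 -> `|w - z t| < d.
    move=> ws; rewrite -[w](subrK (z s)) -addrA (splitr d).
    apply: le_lt_trans (ler_normD _ _) _; apply: ltrD; first exact: lt_trans js.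
    by rewrite distrC.
  have h1 := hd x y (tri x xs) (tri y ys).
  have zsd : `|z s - z t| < d by rewrite distrC; apply: lt_trans zs _; rewrite ltr_pdivrMr// ltr_pMr// ltr1n.
  have h2 := sd_grad_close (ltW e2) hd zsd sds (x - y).
  have -> : F x - F y - (x - y) *m DF (z s) =
    (F x - F y - (x - y) *m DF (z t)) - (x - y) *m (DF (z s) - DF (z t)).
    by rewrite mulmxBr; apply/matrixP => ? ?; rewrite !mxE; ring.
  by apply: le_trans (ler_normB _ _) _; rewrite (splitr e) mulrDl; apply: lerD.
exists N.+1%:R^-1 => [|t tab]; first by rewrite invr_gt0.
by apply: (hN N) => //=; rewrite in_itv.
Qed.

(** [D] solves the variational equation. The difference of two solutions minus its linear prediction
    satisfies the same linear equation up to an error made small by strict differentiability along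
    [z0], and it starts at 0. The solutions are given, not constructed. *)
Lemma flow_sd m (F : 'rV[R]_m -> 'rV[R]_m) (DF : 'rV[R]_m -> 'M[R]_m)
    (z1 : 'rV[R]_m) (rho L t0 eta : R) (z0 : R -> 'rV[R]_m) :
  0 < eta -> 0 <= L -> L * eta <= 2^-1 -> m%:R * L * eta <= 2^-1 ->
  (forall z, `|z - z1| < rho -> sd F z (DF z)) ->
  (forall z, `|z - z1| < rho -> `|DF z| <= L) ->
  (forall x y, `|x - z1| < rho -> `|y - z1| < rho -> `|F x - F y| <= L * `|x - y|) ->
  (forall t, `|t - t0| <= eta -> `|z0 t - z1| < rho /\ is_derive t 1 z0 (F (z0 t))) ->
  exists D : R -> 'M[R]_m, [/\ D t0 = 1%:M,
    forall t, `|t - t0| <= eta -> is_derive t 1 D (D t *m DF (z0 t)) &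
    forall e : R, 0 < e -> exists2 d : R, 0 < d & forall z z' : R -> 'rV[R]_m,
      (forall t, `|t - t0| <= eta -> `|z t - z1| < rho /\ is_derive t 1 z (F (z t))) ->
      (forall t, `|t - t0| <= eta -> `|z' t - z1| < rho /\ is_derive t 1 z' (F (z' t))) ->
      `|z t0 - z0 t0| < d -> `|z' t0 - z0 t0| < d ->
      forall t, `|t - t0| <= eta ->
        `|z t - z' t - (z t0 - z' t0) *m D t| <= e * `|z t0 - z' t0|].
Proof.
move=> eta0 L0 small small' hF bF lF hz0.
have cz t : `|t - t0| <= eta -> {for t, continuous z0}.
  by move=> /hz0[_]; apply: is_derive_cont.
have nz t : `|t - t0| <= eta -> \forall s \near t, sd F (z0 s) (DF (z0 s)).
  move=> ht; have [h1 _] := hz0 t ht.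
  have r0 : 0 < rho - `|z0 t - z1| by rewrite subr_gt0.
  have /cvgrPdist_lt/(_ _ r0) := cz t ht.
  apply: filterS => s hs; apply: hF; rewrite -[z0 s](subrK (z0 t)) -addrA.
  by apply: le_lt_trans (ler_normD _ _) _; rewrite distrC -ltrBrDr.
have [D [D0 hD]] := @linear_ode_exists R m m (fun t => DF (z0 t)) t0 eta L 1%:M eta0 L0 small'
  (fun t ht => sd_grad_cont (cz t ht) (nz t ht)) (fun t ht => bF _ (hz0 t ht).1).
exists D; split=> // e e0.
(* A factor 2 is lost in the Lipschitz bound for two solutions, and 2 eta in [short_time_bound]. *)
have e4 : 0 < e / (4 * eta) by rewrite divr_gt0// mulr_gt0.
have [d d0 hd] := @sd_uniform m m F DF z0 (t0 - eta) (t0 + eta)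
  (fun t ht => cz t (ball_interval ht)) (fun t ht => nz t (ball_interval ht)) _ e4.
exists (d / 2); first by rewrite divr_gt0.
move=> z z' hz hz' zd z'd t ht.
have lip (w w' : R -> 'rV[R]_m) :
  (forall t, `|t - t0| <= eta -> `|w t - z1| < rho /\ is_derive t 1 w (F (w t))) ->
  (forall t, `|t - t0| <= eta -> `|w' t - z1| < rho /\ is_derive t 1 w' (F (w' t))) ->
  forall t, `|t - t0| <= eta -> `|w t - w' t| <= 2 * `|w t0 - w' t0|.
  move=> hw hw' s hs.
  have := @short_time_bound R m (fun t => w t - w' t) (fun t => F (w t) - F (w' t)) t0 eta L 0 eta0 L0 small.
  rewrite mulr0 addr0; apply=> // u hu; have [h1 h2] := hw u hu; have [h3 h4] := hw' u hu.
    exact: is_derive_sub.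
  by rewrite addr0; apply: lF.
have close (w : R -> 'rV[R]_m) :
  (forall t, `|t - t0| <= eta -> `|w t - z1| < rho /\ is_derive t 1 w (F (w t))) ->
  `|w t0 - z0 t0| < d / 2 -> forall t, `|t - t0| <= eta -> `|w t - z0 t| < d.
  move=> hw wd s hs; apply: le_lt_trans (lip _ _ hw hz0 s hs) _.
  by rewrite mulrC -ltr_pdivlMr.
pose v := z t0 - z' t0.
pose E s := z s - z' s - v *m D s.
pose E' s := F (z s) - F (z' s) - v *m (D s *m DF (z0 s)).
have mL0 : 0 <= m%:R * L by rewrite mulr_ge0.
have K0 : 0 <= e / (4 * eta) * (2 * `|v|) by rewrite !mulr_ge0// ?invr_ge0 ?mulr_ge0 ?ltW.
have := @short_time_bound R m E E' t0 eta (m%:R * L) _ eta0 mL0 small' K0 _ _ t ht.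
have -> : E t0 = 0 by rewrite /E D0 mulmx1 subrr.
rewrite normr0 mulr0 add0r => H; apply: le_trans (H _ _) _.
- move=> s hs; apply: is_derive_sub; first by apply: is_derive_sub; [apply: (hz s hs).2|apply: (hz' s hs).2].
  have := is_derive_mulmx (is_derive_cst1 v s) (hD s hs).
  by rewrite mul0mx add0r.
- move=> s hs.
  have -> : E' s = E s *m DF (z0 s) + (F (z s) - F (z' s) - (z s - z' s) *m DF (z0 s)).
    by rewrite /E' /E; mxring.
  apply: le_trans (ler_normD _ _) _; apply: lerD.
    apply: le_trans (mulmx_norm_le _ _) _; rewrite mulrAC ler_wpM2r//.
    by rewrite ler_wpM2l//; apply: bF; apply: (hz0 s hs).1.
  have := hd s (interval_ball hs) (z s) (z' s) (close z hz zd s hs) (close z' hz' z'd s hs).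
  move=> H'; apply: le_trans H' _; apply: ler_wpM2l; first by rewrite ltW.
  exact: lip.
- by apply: eq_le_r; field; rewrite gt_eqF.
Qed.

End flow.

(** * Charts, metric and curvature *)

Section charts.
Context {R : realType} {n : nat} {M : riemannianManifold R n}.
Implicit Types (C : mindex M) (x : M) (p : 'rV[R]_n).

Definition chart_img C := mchart C @` mdom C.

Lemma chart_img_in C x : mdom C x -> chart_img C (mchart C x).
Proof. by move=> ?; exists x. Qed.

Lemma chart_imgP C p : chart_img C p -> mdom C (minv C p) /\ mchart C (minv C p) = p.
Proof. by move=> [x hx <-]; rewrite mchartK. Qed.

Definition transition C C' p := mchart C' (minv C p).
Definition transition_dom C C' := mchart C @` (mdom C `&` mdom C').
Definition jac C C' x : 'M[R]_n := jacobian_mx (transition C C') (mchart C x).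

Lemma transition_dom_open C C' : open (transition_dom C C').
Proof.
rewrite openE => p [x [hx hx'] <-].
have h1 : nbhs (mchart C x) (chart_img C).
  by apply: open_nbhs_nbhs; split; [exact: mimage_open|exact: chart_img_in].
have h2 : nbhs (mchart C x) (minv C @^-1` mdom C').
  apply: (minv_continuous (chart_img_in hx)); rewrite mchartK//.
  by apply: open_nbhs_nbhs; split => //; exact: mdom_open.
apply: filterS2 h1 h2 => q /chart_imgP[q1 q2] q3.
by exists (minv C q).
Qed.

Lemma transition_domP C C' p : transition_dom C C' p ->
  [/\ mdom C (minv C p), mdom C' (minv C p) & mchart C (minv C p) = p].
Proof. by move=> [x [h1 h2] <-]; rewrite mchartK. Qed.

Lemma transition_dom_in C C' x : mdom C x -> mdom C' x -> transition_dom C C' (mchart C x).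
Proof. by move=> h h'; exists x. Qed.

Lemma transition_sd C C' p : transition_dom C C' p ->
  sd (transition C C') p (jacobian_mx (transition C C') p).
Proof.
move=> hp; apply: Ck1_sd (@transition_dom_open C C') hp _ => j.
exact: (@mtransition_smooth R n M C C' j 1%N).
Qed.

Lemma jac_sd C C' x : mdom C x -> mdom C' x ->
  sd (transition C C') (mchart C x) (jac C C' x).
Proof. by move=> h h'; apply: transition_sd; apply: transition_dom_in. Qed.

Lemma jac_id C x : mdom C x -> jac C C x = 1%:M.
Proof.
move=> hx; apply: sd_uniq (jac_sd hx hx) _.
have [d d0 hd] := open_ballP (@transition_dom_open C C) (transition_dom_in hx hx).
by apply: sd_near d0 _ (sd_id _) => q /hd /transition_domP[h1 _ h2].
Qed.

Lemma jac_comp C C' C'' x : mdom C x -> mdom C' x -> mdom C'' x ->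
  jac C C' x *m jac C' C'' x = jac C C'' x.
Proof.
move=> h h' h''; apply: sd_uniq (jac_sd h h'').
have [d d0 hd] := open_ballP (@transition_dom_open C C') (transition_dom_in h h').
have e : transition C C' (mchart C x) = mchart C' x by rewrite /transition mchartK.
have := @sd_comp R n n n (transition C C') (transition C' C'') (mchart C x)
  (jac C C' x) (jac C' C'' x) (jac_sd h h').
rewrite e => /(_ (jac_sd h' h'')); apply: sd_near d0 _ => q /hd /transition_domP[q1 q2 q3] /=.
by rewrite /transition mchartK.
Qed.

Lemma jacK C C' x : mdom C x -> mdom C' x -> jac C C' x *m jac C' C x = 1%:M.
Proof. by move=> h h'; rewrite jac_comp// jac_id. Qed.

Lemma near_dom (g : R -> M) (t : R) C : {for t, continuous g} -> mdom C (g t) ->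
  \forall s \near t, mdom C (g s).
Proof.
move=> cg hC; apply: (cg (mdom C)).
by apply: open_nbhs_nbhs; split => //; exact: mdom_open.
Qed.

Lemma near_ball (t : R) (P : R -> Prop) : (\forall s \near t, P s) ->
  exists2 d : R, 0 < d & forall s, `|s - t| < d -> P s.
Proof.
move=> /nbhs_normP[d /= d0 h]; exists d => // s st; apply: h.
by rewrite /= distrC.
Qed.

Lemma ball_near (t d : R) (P : R -> Prop) : 0 < d -> (forall s, `|s - t| < d -> P s) ->
  \forall s \near t, P s.
Proof.
move=> d0 h; apply/nbhs_normP; exists d => //= s; rewrite /= distrC; exact: h.
Qed.

Lemma near_is_derive (W : normedModType R) (f h : R -> W) (t : R) df :
  (\forall s \near t, f s = h s) -> is_derive t 1 f df -> is_derive t 1 h df.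
Proof. exact: near_eq_is_derive. Qed.

Lemma curve_transition (g : R -> M) (t : R) C C' u :
  {for t, continuous g} -> mdom C (g t) -> mdom C' (g t) ->
  is_derive t 1 (fun s => mchart C (g s)) u ->
  is_derive t 1 (fun s => mchart C' (g s)) (u *m jac C C' (g t)).
Proof.
move=> cg hC hC' hu; have := sd_curve (jac_sd hC hC') hu.
apply: near_is_derive; apply: filterS (near_dom cg hC) => s hs.
by rewrite /transition mchartK.
Qed.

Lemma velocity_inE C (g : R -> M) (t : R) u :
  is_derive t 1 (fun s => mchart C (g s)) u -> velocity_in C g t = u.
Proof.
move=> /is_derive_mxP h; apply/rowP => k; rewrite mxE.
exact: is_derive1E (h 0 k).
Qed.

Lemma tangent_inE C x (v : tangent x) : tangent_in C x v = v *m jac (chart_at x) C x.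
Proof. by []. Qed.

Lemma tangent_in_at x (v : tangent x) : tangent_in (chart_at x) x v = v.
Proof. by rewrite tangent_inE jac_id ?mulmx1//; exact: mem_chart_at. Qed.

Lemma tangent_in_jac C C' x (v : tangent x) : mdom C x -> mdom C' x ->
  tangent_in C x v *m jac C C' x = tangent_in C' x v.
Proof.
by move=> h h'; rewrite !tangent_inE -mulmxA jac_comp//; exact: mem_chart_at.
Qed.

Lemma tangent_in_velocity C (g : R -> M) (t : R) u :
  {for t, continuous g} -> mdom C (g t) ->
  is_derive t 1 (fun s => mchart C (g s)) u ->
  tangent_in C (g t) (velocity g t) = u.
Proof.
move=> cg hC hu; have ha := mem_chart_at (g t).
rewrite tangent_inE /velocity (velocity_inE (curve_transition cg hC ha hu)).
by rewrite -mulmxA jacK// mulmx1.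
Qed.

Definition dot (G : 'M[R]_n) (u v : 'rV[R]_n) : R := (u *m G *m v^T) 0 0.

Lemma innerE C x (u v : tangent x) : mdom C x ->
  inner x u v = dot (mmetric C (mchart C x)) (tangent_in C x u) (tangent_in C x v).
Proof.
move=> hC; have ha := mem_chart_at x.
by rewrite /inner /dot (mmetric_compat ha hC) !tangent_inE trmx_mul !mulmxA.
Qed.

Lemma transition_near C C' x : mdom C x -> mdom C' x ->
  exists2 d : R, 0 < d & forall q, `|q - mchart C x| < d -> transition_dom C C' q.
Proof. by move=> h h'; apply: open_ballP (@transition_dom_open C C') (transition_dom_in h h'). Qed.

(** The derivative of the Jacobian in the direction u: [w *m djac C C' x u] is the second
    differential of the coordinate change at (u, w). *)
Definition djac C C' x (u : 'rV[R]_n) : 'M[R]_n :=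
  \matrix_(j, k) \sum_i u 0 i * partial i (partial j (fun q => transition C C' q 0 k)) (mchart C x).

Lemma jac_entry_sdr C C' x (j k : 'I_n) : mdom C x -> mdom C' x ->
  sdr (partial j (fun q => transition C C' q 0 k)) (mchart C x)
    (\col_i partial i (partial j (fun q => transition C C' q 0 k)) (mchart C x)).
Proof.
move=> h h'; apply: Ck1_sdr (@transition_dom_open C C') (transition_dom_in h h') _.
have [_ H] := @mtransition_smooth R n M C C' k 2%N.
by have [_] := H j.
Qed.

Lemma jac_curve C C' (g : R -> M) (t : R) u :
  {for t, continuous g} -> mdom C (g t) -> mdom C' (g t) ->
  is_derive t 1 (fun s => mchart C (g s)) u ->
  is_derive t 1 (fun s => jac C C' (g s)) (djac C C' (g t) u).
Proof.
move=> cg hC hC' hu; apply/is_derive_mxP => j k.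
have := sdr_curve (jac_entry_sdr j k hC hC') hu.
have -> : (u *m \col_i partial i (partial j (fun q => transition C C' q 0 k)) (mchart C (g t))) 0 0 =
  djac C C' (g t) u j k by rewrite !mxE; apply: eq_bigr => i _; rewrite mxE.
by rewrite (_ : (fun s => jac C C' (g s) j k) =
  (fun s => partial j (fun q => transition C C' q 0 k) (mchart C (g s))))//;
  apply/funext => s; rewrite mxE.
Qed.

Lemma djac_sym C C' x u w : mdom C x -> mdom C' x ->
  w *m djac C C' x u = u *m djac C C' x w.
Proof.
move=> h h'; apply/rowP => k; rewrite !mxE.
under eq_bigr do rewrite mxE mulr_sumr; rewrite exchange_big /=.
apply: eq_bigr => i _; rewrite mxE mulr_sumr; apply: eq_bigr => j _.
have [d d0 hd] := transition_near h h'.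
rewrite (@schwarz R n (fun q => transition C C' q 0 k) _ d i j _ _ d0 _
  (jac_entry_sdr i k h h') (jac_entry_sdr j k h h')); first by rewrite mulrCA.
move=> q l /hd hq; have [_ H] := @mtransition_smooth R n M C C' k 1%N.
by have [H1 _] := H l; apply: H1.
Qed.

Lemma djacD C C' x u w : djac C C' x (u + w) = djac C C' x u + djac C C' x w.
Proof.
apply/matrixP => j k; rewrite !mxE -big_split; apply: eq_bigr => i _ /=.
by rewrite mxE mulrDl.
Qed.

End charts.

(** * Closure of strict differentiability under algebra and matrix inversion *)

Section sdr_closure.
Context {R : realType}.

(** Hiding the gradient lets differentiability of composite expressions be proved by structure
    alone; the gradient is recovered afterwards from the partial derivatives. *)
Definition has_sdr {m} (f : 'rV[R]_m -> R) p := exists g, sdr f p g.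

Lemma has_sdrM m (f h : 'rV[R]_m -> R) p :
  has_sdr f p -> has_sdr h p -> has_sdr (fun x => f x * h x) p.
Proof. by move=> [g hg] [g' hg']; eexists; apply: sdrM hg hg'. Qed.

Lemma has_sdr_sum m (I : Type) (s : seq I) (F : I -> 'rV[R]_m -> R) p :
  (forall i, has_sdr (F i) p) -> has_sdr (fun x => \sum_(i <- s) F i x) p.
Proof.
move=> h; exists (\sum_(i <- s) projT1 (cid (h i))); apply: sdr_sum => i.
by case: cid.
Qed.

Lemma has_sdr_near m (f h : 'rV[R]_m -> R) p (d : R) : 0 < d ->
  (forall x, `|x - p| < d -> f x = h x) -> has_sdr f p -> has_sdr h p.
Proof. by move=> d0 fh [g hg]; exists g; apply: sdr_near d0 fh hg. Qed.

Lemma has_sdr_ext m (f h : 'rV[R]_m -> R) p :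
  f =1 h -> has_sdr f p -> has_sdr h p.
Proof. by move=> /funext ->. Qed.

Lemma has_sdr_cst m (c : R) (p : 'rV[R]_m) : has_sdr (fun=> c) p.
Proof. by eexists; apply: sdr_cst. Qed.

Lemma has_sdr_prod m (I : Type) (s : seq I) (F : I -> 'rV[R]_m -> R) p :
  (forall i, has_sdr (F i) p) -> has_sdr (fun x => \prod_(i <- s) F i x) p.
Proof.
move=> h; elim: s => [|a s IH].
  by apply: has_sdr_ext (has_sdr_cst 1 p) => x; rewrite big_nil.
by apply: has_sdr_ext (has_sdrM (h a) IH) => x; rewrite big_cons.
Qed.

Lemma has_sdr_det m k (A : 'rV[R]_m -> 'M[R]_k) p :
  (forall i j, has_sdr (fun x => A x i j) p) -> has_sdr (fun x => \det (A x)) p.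
Proof.
move=> h; rewrite /determinant; apply: has_sdr_sum => s.
by apply: has_sdrM; [exact: has_sdr_cst|exact: has_sdr_prod].
Qed.

Lemma has_sdr_inv m (f : 'rV[R]_m -> R) p : f p != 0 -> has_sdr f p ->
  has_sdr (fun x => (f x)^-1) p.
Proof.
move=> fp [g hg]; exists (- (f p) ^- 2 *: g) => e e0.
have cf : {for p, continuous (fun x => (f x)^-1)}.
  by apply: (@continuous_comp _ _ _ f (@GRing.inv R)); [exact: sdr_cont hg|exact: inv_continuous].
pose a := (f p)^-1; pose K := `|a| + 1; pose Q := m%:R * `|g|.
have K0 : 0 < K by rewrite ltr_wpDl.
have Q0 : 0 <= Q by rewrite mulr_ge0.
have KK : 0 <= K * K by rewrite mulr_ge0// ltW.
have QK : 0 <= Q * (2 * K) by rewrite !mulr_ge0// ltW.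
have e2 : 0 < e / 2 by rewrite divr_gt0.
have e1 : 0 < e / 2 / (K * K + 1) by rewrite divr_gt0// ltr_wpDl.
(* The bound |a| keeps f away from 0: where f vanishes its inverse is 0 by convention, at distance
   exactly |a| from a. *)
have eta0 : 0 < Num.min (Num.min 1 `|a|) (e / 2 / (Q * (2 * K) + 1)).
  by rewrite !lt_min ltr01 normr_gt0 invr_eq0 fp divr_gt0// ltr_wpDl.
have [d d0 hd] := cont_ballP cf eta0; have [d1 d10 hd1] := hg _ e1.
exists (Num.min d d1); first by rewrite lt_min d0.
move=> x y; rewrite !lt_min => /andP[xd xd1] /andP[yd yd1].
have := hd x xd; have := hd y yd; rewrite -/a !lt_min -!andbA => /and3P[y1 ya y2] /and3P[x1 xa x2].
have H := hd1 x y xd1 yd1.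
set u := ((x - y) *m g) 0 0 in H.
have Hu : `|u| <= Q * `|x - y|.
  apply: le_trans (mx_entry_le _ _ _) _; apply: le_trans (mulmx_norm_le _ _) _.
  by rewrite mulrAC.
have -> : ((x - y) *m (- (f p) ^- 2 *: g)) 0 0 = - a ^+ 2 * u.
  by rewrite -scalemxAr mxE exprVn.
have Kb (z : R) : `|z - a| < 1 -> `|z| <= K.
  move=> za; rewrite -[z](subrK a); apply: le_trans (ler_normD _ _) _.
  by rewrite addrC lerD2l ltW.
have ix := Kb _ x1; have iy := Kb _ y1.
have aK : `|a| <= K by rewrite lerDl.
have nz (z : R) : `|z^-1 - a| < `|a| -> z != 0.
  by apply: contraTneq => ->; rewrite invr0 sub0r normrN ltxx.
have aux (X Y b v : R) : X != 0 -> Y != 0 -> X^-1 - Y^-1 - - b ^+ 2 * v =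
  - (X - Y - v) * (X^-1 * Y^-1) + v * (b * (b - Y^-1) + Y^-1 * (b - X^-1)).
  by move=> X0 Y0; field; rewrite X0 Y0.
have -> : (f x)^-1 - (f y)^-1 - - a ^+ 2 * u =
  - (f x - f y - u) * ((f x)^-1 * (f y)^-1) + u * (a * (a - (f y)^-1) + (f y)^-1 * (a - (f x)^-1)).
  exact: aux (nz _ xa) (nz _ ya).
apply: le_trans (ler_normD _ _) _; rewrite (splitr e) mulrDl; apply: lerD.
  rewrite normrM normrN normrM.
  have h1 := ler_pM (normr_ge0 _) (normr_ge0 _) ix iy.
  have h2 := ler_pM (normr_ge0 _) (mulr_ge0 (normr_ge0 _) (normr_ge0 _)) H h1.
  apply: le_trans h2 _; rewrite mulrAC ler_wpM2r// mulrC absorb_le//.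
  exact: ltW.
rewrite normrM.
have h1 : `|a * (a - (f y)^-1) + (f y)^-1 * (a - (f x)^-1)| <= 2 * K * (e / 2 / (Q * (2 * K) + 1)).
  apply: le_trans (ler_normD _ _) _; rewrite !normrM -[2 * K * _]mulrA mulrDl mul1r.
  apply: lerD; apply: ler_pM => //; rewrite distrC; exact: ltW.
apply: le_trans (ler_pM (normr_ge0 _) (normr_ge0 _) Hu h1) _.
rewrite mulrAC ler_wpM2r// [Q * (2 * K * _)]mulrA absorb_le//; exact: ltW.
Qed.

Lemma has_sdr_adj m k (A : 'rV[R]_m -> 'M[R]_k) p i j :
  (forall i j, has_sdr (fun x => A x i j) p) -> has_sdr (fun x => (\adj (A x)) i j) p.
Proof.
move=> h; apply: (@has_sdr_ext m (fun x => cofactor (A x) j i)); first by move=> x; rewrite mxE.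
apply: has_sdrM; first exact: has_sdr_cst.
apply: has_sdr_det => a b.
by apply: has_sdr_ext (h (lift j a) (lift i b)) => x; rewrite !mxE.
Qed.

(** Cramer's rule reduces the inverse to polynomials in the entries and one scalar inversion. *)
Lemma has_sdr_invmx m k (A : 'rV[R]_m -> 'M[R]_k) p i j (d : R) : 0 < d ->
  (forall x, `|x - p| < d -> A x \in unitmx) ->
  (forall i j, has_sdr (fun x => A x i j) p) -> has_sdr (fun x => (invmx (A x)) i j) p.
Proof.
move=> d0 hA h.
apply: (@has_sdr_near m (fun x => (\det (A x))^-1 * (\adj (A x)) i j) _ p d d0).
  by move=> x /hA hx; rewrite /invmx hx [RHS]mxE.
apply: has_sdrM; last exact: has_sdr_adj.
apply: has_sdr_inv; last exact: has_sdr_det.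
by rewrite -unitfE -unitmxE; apply: hA; rewrite subrr normr0.
Qed.

Lemma has_sdrP m (f : 'rV[R]_m -> R) p : has_sdr f p -> sdr f p (\col_i partial i f p).
Proof.
move=> [g hg]; suff -> : \col_i partial i f p = g by [].
by apply/colP => i; rewrite mxE; have [_ ->] := sdr_partial i hg.
Qed.

End sdr_closure.

(** * The metric and the Levi-Civita connection in a chart *)

Section metric.
Context {R : realType} {n : nat} {M : riemannianManifold R n}.
Implicit Types (C : mindex M) (x : M) (p u v w : 'rV[R]_n).

Notation G C p := (mmetric (C : mindex M) p).

Lemma chart_img_ball C p : chart_img C p ->
  exists2 d : R, 0 < d & forall q, `|q - p| < d -> chart_img C q.
Proof. by move=> hp; apply: (@open_ballP R n (chart_img C)) => //; exact: mimage_open. Qed.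

Lemma metric_sdr C p a b : chart_img C p -> has_sdr (fun q => G C q a b) p.
Proof.
move=> hp; eexists; apply: Ck1_sdr (@mimage_open R n M C) hp _.
exact: (@mmetric_smooth R n M C a b 1%N).
Qed.

Lemma metric_partial_sdr C p a b i : chart_img C p -> has_sdr (partial i (fun q => G C q a b)) p.
Proof.
move=> hp; eexists; apply: Ck1_sdr (@mimage_open R n M C) hp _.
have [_ H] := @mmetric_smooth R n M C a b 2%N.
by have [_] := H i.
Qed.

Lemma partial_near (f h : 'rV[R]_n -> R) p i (d : R) : 0 < d ->
  (forall q, `|q - p| < d -> f q = h q) -> has_sdr f p -> partial i f p = partial i h p.
Proof.
move=> d0 fh [g hg]; have [_ ->] := sdr_partial i hg.
by have [_ ->] := sdr_partial i (sdr_near d0 fh hg).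
Qed.

Lemma metric_symE C p a b : chart_img C p -> G C p a b = G C p b a.
Proof. by move=> hp; rewrite -[in LHS](mmetric_sym hp) mxE. Qed.

Lemma metric_partial_sym C p a b i : chart_img C p ->
  partial i (fun q => G C q a b) p = partial i (fun q => G C q b a) p.
Proof.
move=> hp; have [d d0 hd] := chart_img_ball hp.
apply: partial_near d0 _ (metric_sdr _ _ hp) => q /hd; exact: metric_symE.
Qed.

Lemma metric_unit C p : chart_img C p -> G C p \in unitmx.
Proof.
move=> hp; rewrite -row_free_unit; apply: inj_row_free => v hv.
apply/eqP; apply: contraT => v0; have := mmetric_pos hp v0.
by rewrite hv mul0mx mxE ltxx.
Qed.

Lemma christoffel_sdr C p k i j : chart_img C p -> has_sdr (fun q => christoffel C q k i j) p.
Proof.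
move=> hp; have [d d0 hd] := chart_img_ball hp.
rewrite /christoffel; apply: has_sdrM; first exact: has_sdr_cst.
apply: has_sdr_sum => l; apply: has_sdrM.
  apply: has_sdr_invmx d0 _ _ => [q /hd|a b]; [exact: metric_unit|exact: metric_sdr].
have [g hg] := metric_partial_sdr j l i hp; have [g' hg'] := metric_partial_sdr i l j hp.
have [g'' hg''] := metric_partial_sdr i j l hp.
by eexists; apply: sdrB (sdrD hg hg') hg''.
Qed.

(* Row vectors are acted upon from the right: w *m Gam C p i is the vector
   \Gamma(d_i, w). *)
Definition Gam C p (i : 'I_n) : 'M[R]_n := \matrix_(j, k) christoffel C p k i j.

Definition GamU C p u : 'M[R]_n := \sum_i u 0 i *: Gam C p i.

Definition dG C p (i : 'I_n) : 'M[R]_n := \matrix_(a, b) partial i (fun q => G C q a b) p.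

Lemma christoffel_sym C p k i j : chart_img C p -> christoffel C p k i j = christoffel C p k j i.
Proof.
move=> hp; rewrite /christoffel; congr (_ * _); apply: eq_bigr => l _; congr (_ * _).
by rewrite (metric_partial_sym i j l hp) [X in X - _]addrC.
Qed.

(** Lowering the upper index undoes the inverse metric and leaves the Christoffel symbols of the
    first kind. *)
Lemma Gam_metric C p i : chart_img C p -> Gam C p i *m G C p = 2^-1 *:
  \matrix_(j, l) (partial i (fun q => G C q j l) p + partial j (fun q => G C q i l) p
    - partial l (fun q => G C q i j) p).
Proof.
move=> hp; set S := \matrix_(j, l) _.
have -> : Gam C p i = 2^-1 *: (S *m (invmx (G C p))^T).
  apply/matrixP => j k; rewrite !mxE /christoffel; congr (_ * _).
  by apply: eq_bigr => l _; rewrite !mxE mulrC.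
rewrite trmx_inv mmetric_sym// -scalemxAl -mulmxA mulVmx ?mulmx1//.
exact: metric_unit.
Qed.

(** Compatibility of the connection with the metric: in the symmetrised lowered symbols the other
    two derivatives of the metric cancel. *)
Lemma dG_Gam C p i : chart_img C p -> dG C p i = Gam C p i *m G C p + G C p *m (Gam C p i)^T.
Proof.
move=> hp; rewrite -[in X in _ = _ + X](mmetric_sym hp) -trmx_mul Gam_metric//.
apply/matrixP => a b; rewrite !mxE.
rewrite (metric_partial_sym b a i hp) -mulrDr.
rewrite (_ : _ + _ = 2 * partial i (fun q => G C q a b) p); first by field.
ring.
Qed.

Lemma GamU_sym C p u w : chart_img C p -> w *m GamU C p u = u *m GamU C p w.
Proof.
move=> hp; rewrite !mulmx_sumr; apply/rowP => k; rewrite !summxE.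
under eq_bigr => i _ do rewrite -scalemxAr !mxE mulr_sumr.
under [RHS]eq_bigr => i _ do rewrite -scalemxAr !mxE mulr_sumr.
rewrite exchange_big /=; apply: eq_bigr => j _; apply: eq_bigr => i _.
by rewrite !mxE (christoffel_sym k i j hp) mulrCA.
Qed.

Lemma GamUD C p u v : GamU C p (u + v) = GamU C p u + GamU C p v.
Proof. by rewrite -big_split; apply: eq_bigr => i _; rewrite mxE scalerDl. Qed.

Lemma GamUZ C p (a : R) u : GamU C p (a *: u) = a *: GamU C p u.
Proof. by rewrite scaler_sumr; apply: eq_bigr => i _; rewrite mxE scalerA. Qed.

(** The derivative in the direction u of the matrix [GamU C p v], with v held constant. *)
Definition dGam C p u v : 'M[R]_n := \matrix_(j, k)
  \sum_i \sum_l u 0 i * v 0 l * partial i (fun q => christoffel C q k l j) p.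

Lemma GamUE C p u j k : GamU C p u j k = \sum_i u 0 i * christoffel C p k i j.
Proof. by rewrite summxE; apply: eq_bigr => i _; rewrite !mxE. Qed.

Lemma GamU_curve C (z v : R -> 'rV[R]_n) (t : R) u v' : chart_img C (z t) ->
  is_derive t 1 z u -> is_derive t 1 v v' ->
  is_derive t 1 (fun s => GamU C (z s) (v s)) (dGam C (z t) u (v t) + GamU C (z t) v').
Proof.
move=> hp hz hv; apply/is_derive_mxP => j k.
rewrite (_ : (fun s => _) = fun s => \sum_i v s 0 i * christoffel C (z s) k i j); last first.
  by apply/funext => s; rewrite GamUE.
have h i := is_derive_mulr (is_derive_entry 0 i hv)
  (sdr_curve (has_sdrP (christoffel_sdr k i j hp)) hz).
have := is_derive_big h; rewrite big_split /=.
set a := (X in is_derive _ _ _ X); set b := (X in _ -> is_derive _ _ _ X).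
suff -> : a = b by [].
rewrite /a /b [RHS]mxE addrC GamUE; congr (_ + _).
rewrite mxE exchange_big /=; apply: eq_bigr => l _.
by rewrite mxE mulr_sumr; apply: eq_bigr => i _; rewrite mxE; ring.
Qed.

Definition dGU C p u : 'M[R]_n := \sum_i u 0 i *: dG C p i.

Lemma dGU_GamU C p u : chart_img C p ->
  dGU C p u = GamU C p u *m G C p + G C p *m (GamU C p u)^T.
Proof.
move=> hp; rewrite /dGU (eq_bigr _ (fun i _ => congr1 _ (dG_Gam i hp))).
rewrite mulmx_suml linear_sum mulmx_sumr -big_split /=; apply: eq_bigr => i _.
by rewrite scalerDr -scalemxAl linearZ /= -scalemxAr.
Qed.

Lemma metric_curve C (z : R -> 'rV[R]_n) (t : R) u : chart_img C (z t) ->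
  is_derive t 1 z u -> is_derive t 1 (fun s => G C (z s)) (dGU C (z t) u).
Proof.
move=> hp hz; apply/is_derive_mxP => a b.
have := sdr_curve (has_sdrP (metric_sdr a b hp)) hz.
set c := (X in is_derive _ _ _ X); set d := (X in _ -> is_derive _ _ _ X).
suff -> : c = d by [].
by rewrite /c /d mxE summxE; apply: eq_bigr => i _; rewrite !mxE.
Qed.

Lemma metric_dot_curve C (z V W : R -> 'rV[R]_n) (t : R) u V' W' : chart_img C (z t) ->
  is_derive t 1 z u -> is_derive t 1 V V' -> is_derive t 1 W W' ->
  is_derive t 1 (fun s => dot (G C (z s)) (V s) (W s))
    (dot (G C (z t)) (V' + V t *m GamU C (z t) u) (W t)
     + dot (G C (z t)) (V t) (W' + W t *m GamU C (z t) u)).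
Proof.
move=> hp hz hV hW.
have := is_derive_entry 0 0 (is_derive_mulmx (is_derive_mulmx hV (metric_curve hp hz)) (is_derive_trmx hW)).
set a := (X in is_derive _ _ _ X); set b := (X in _ -> is_derive _ _ _ X).
suff -> : a = b by [].
transitivity (((V' + V t *m GamU C (z t) u) *m G C (z t) *m (W t)^T
  + V t *m G C (z t) *m (W' + W t *m GamU C (z t) u)^T) 0 0); last by rewrite mxE.
rewrite /a dGU_GamU//; congr (fun_of_matrix _ 0 0).
have -> : (W' + W t *m GamU C (z t) u)^T = W'^T + (GamU C (z t) u)^T *m (W t)^T.
  by rewrite linearD /= trmx_mul.
by mxring.
Qed.

End metric.

(** * Symmetries of the curvature tensor and sectional curvature *)

Section curvature_identities.
Context {R : realType} {n : nat} {M : riemannianManifold R n}.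
Implicit Types (C : mindex M) (x : M) (p u v w a y : 'rV[R]_n).

Notation G C p := (mmetric (C : mindex M) p).

(* w *m RU C p u v is R(u, v) w in the chart C. *)
Definition RU C p u v : 'M[R]_n :=
  dGam C p u v - dGam C p v u + GamU C p v *m GamU C p u - GamU C p u *m GamU C p v.

Lemma RUE C p u v k l :
  RU C p u v k l = \sum_i \sum_j u 0 i * v 0 j * riemann_coef C p l i j k.
Proof.
have ex (f : 'I_n -> 'I_n -> R) :
    \sum_i \sum_j v 0 i * u 0 j * f i j = \sum_i \sum_j u 0 i * v 0 j * f j i.
  rewrite exchange_big; apply: eq_bigr => i _; apply: eq_bigr => j _.
  by rewrite [v 0 j * _]mulrC.
  rewrite /RU !mxE.
  have -> : \sum_j GamU C p v k j * GamU C p u j l =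
      \sum_i \sum_j u 0 i * v 0 j * \sum_m christoffel C p l i m * christoffel C p m j k.
    under eq_bigr do rewrite !GamUE mulr_suml.
    rewrite exchange_big /=; under eq_bigr => j _ do (under eq_bigr do rewrite mulr_sumr).
    under eq_bigr do rewrite exchange_big /=.
    rewrite exchange_big /=; apply: eq_bigr => i _; apply: eq_bigr => j _.
    by rewrite mulr_sumr; apply: eq_bigr => m _; ring.
  have -> : \sum_j GamU C p u k j * GamU C p v j l =
      \sum_i \sum_j u 0 i * v 0 j * \sum_m christoffel C p l j m * christoffel C p m i k.
    under eq_bigr do rewrite !GamUE mulr_suml.
    rewrite exchange_big /=; under eq_bigr => j _ do (under eq_bigr do rewrite mulr_sumr).
    under eq_bigr do rewrite exchange_big /=.
    apply: eq_bigr => i _; apply: eq_bigr => j _.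
    by rewrite mulr_sumr; apply: eq_bigr => m _; ring.
  have -> : \sum_i \sum_l0 v 0 i * u 0 l0 * partial i (fun q => christoffel C q l l0 k) p =
    \sum_i \sum_j u 0 i * v 0 j * partial j (fun q => christoffel C q l i k) p.
    exact: (ex (fun i j => partial i (fun q => christoffel C q l j k) p)).
  rewrite -!sumrB -big_split -sumrB /=; apply: eq_bigr => i _.
  rewrite -!sumrB -big_split -sumrB /=; apply: eq_bigr => j _.
  rewrite /riemann_coef sumrB.
  generalize (partial i (fun q => christoffel C q l j k) p)
    (partial j (fun q => christoffel C q l i k) p) => A B.
  by ring.
Qed.

Lemma curvatureE x (u v w : tangent x) :
  curvature x u v w = w *m RU (chart_at x) (mchart (chart_at x) x) u v.
Proof.
apply/rowP => l; rewrite !mxE.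
under [RHS]eq_bigr do rewrite RUE mulr_sumr.
rewrite [RHS]exchange_big /=; apply: eq_bigr => i _.
under [RHS]eq_bigr do rewrite mulr_sumr.
rewrite [RHS]exchange_big /=; apply: eq_bigr => j _; apply: eq_bigr => k _.
by ring.
Qed.

Lemma line_is_derive p u (t : R) : is_derive t 1 (fun s => p + s *: u) u.
Proof.
have := is_derive_add (is_derive_cst1 p t) (is_derive_scalev u (@is_derive_id _ _ t 1)).
by rewrite add0r scale1r.
Qed.

(** Schwarz for the entries of the metric, stated as equality of two derivatives along lines so that
    it combines with the product rule. *)
Lemma ddG_sym C p u v : chart_img C p ->
  exists2 H : 'M[R]_n, is_derive (0 : R) 1 (fun s : R => dGU C (p + s *: u) v) H &
    is_derive (0 : R) 1 (fun s : R => dGU C (p + s *: v) u) H.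
Proof.
move=> hp.
pose H u v : 'M[R]_n := \matrix_(a, b) \sum_i v 0 i *
  \sum_j u 0 j * partial j (partial i (fun q => G C q a b)) p.
have hH u1 v1 : is_derive (0 : R) 1 (fun s : R => dGU C (p + s *: u1) v1) (H u1 v1).
  apply/is_derive_mxP => a b; rewrite mxE.
  rewrite (_ : (fun s => _) = fun s => \sum_i v1 0 i * partial i (fun q => G C q a b) (p + s *: u1)); last first.
    by apply/funext => s; rewrite summxE; apply: eq_bigr => i _; rewrite !mxE.
  apply: is_derive_big => i.
  have hz := line_is_derive p u1 0.
  have p0 : p + 0 *: u1 = p by rewrite scale0r addr0.
  have := @sdr_curve R n (partial i (fun q => G C q a b)) (fun s => p + s *: u1) 0 _ u1.
  rewrite p0 => /(_ _ (has_sdrP (metric_partial_sdr a b i hp)) hz) h.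
  have := is_derive_mulr (is_derive_cst1 (v1 0 i) (0 : R)) h.
  rewrite mul0r add0r mxE.
  by under eq_bigr do rewrite mxE.
exists (H u v); first exact: hH.
suff -> : H u v = H v u by exact: hH.
have [d d0 hd] := chart_img_ball hp.
apply/matrixP => a b; rewrite !mxE.
under eq_bigr do rewrite mulr_sumr; rewrite exchange_big /=; apply: eq_bigr => i _.
rewrite mulr_sumr; apply: eq_bigr => j _.
rewrite (@schwarz R n (fun q => G C q a b) p d i j _ _ d0 _
  (has_sdrP (metric_partial_sdr a b i hp)) (has_sdrP (metric_partial_sdr a b j hp))).
  by rewrite mulrCA.
move=> q k /hd hq; have [g hg] := metric_sdr a b hq.
by have [] := sdr_partial k hg.
Qed.

(** Differentiate the compatibility of metric and connection once more and antisymmetrise in u and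
    v: second derivatives of the metric cancel and what is left is R G + G R^T. *)
Lemma RU_skew C p u v : chart_img C p -> RU C p u v *m G C p + G C p *m (RU C p u v)^T = 0.
Proof.
move=> hp.
have E (u1 v1 : 'rV[R]_n) (H : 'M[R]_n) : is_derive (0 : R) 1 (fun s : R => dGU C (p + s *: u1) v1) H ->
  H = dGam C p u1 v1 *m G C p + GamU C p v1 *m (GamU C p u1 *m G C p + G C p *m (GamU C p u1)^T)
    + ((GamU C p u1 *m G C p + G C p *m (GamU C p u1)^T) *m (GamU C p v1)^T + G C p *m (dGam C p u1 v1)^T).
  move=> hH; apply: is_derive_uniq hH _.
  have hz := line_is_derive p u1 0; have p0 : p + 0 *: u1 = p by rewrite scale0r addr0.
  have hp' : chart_img C (p + 0 *: u1) by rewrite p0.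
  have := GamU_curve hp' hz (is_derive_cst1 v1 0).
  have := metric_curve hp' hz.
  rewrite p0 dGU_GamU// (_ : GamU C p 0 = 0) ?addr0; last first.
    by rewrite /GamU; apply: big1 => i _; rewrite mxE scale0r.
  move=> hG hGam.
  have hGT := is_derive_mulmx hG (is_derive_trmx hGam).
  have := is_derive_add (is_derive_mulmx hGam hG) hGT.
  rewrite p0; apply: near_is_derive.
  have [d d0 hd] := chart_img_ball hp.
  have cz : {for 0, continuous (fun s : R => p + s *: u1)} := is_derive_cont hz.
  have /cvgrPdist_lt/(_ d d0) := cz; rewrite p0; apply: filterS => s hs.
  by rewrite dGU_GamU//; apply: hd; rewrite distrC.
have [H h1 h2] := ddG_sym u v hp.
have e1 := E _ _ _ h1; have e2 := E _ _ _ h2.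
have : H - H = 0 by rewrite subrr.
rewrite {1}e1 e2 => <-.
rewrite /RU.
have -> : (dGam C p u v - dGam C p v u + GamU C p v *m GamU C p u - GamU C p u *m GamU C p v)^T =
  (dGam C p u v)^T - (dGam C p v u)^T + (GamU C p u)^T *m (GamU C p v)^T - (GamU C p v)^T *m (GamU C p u)^T.
  by rewrite !(linearB, linearD) /= !trmx_mul.
by mxring.
Qed.

Lemma dGam_sym C p u v w : chart_img C p -> w *m dGam C p u v = v *m dGam C p u w.
Proof.
move=> hp; apply/rowP => k; rewrite !mxE.
have E v1 w1 : \sum_j w1 0 j * dGam C p u v1 j k =
   \sum_i u 0 i * \sum_j \sum_l w1 0 j * v1 0 l * partial i (fun q => christoffel C q k l j) p.
  under eq_bigr do rewrite mxE mulr_sumr; rewrite exchange_big /=; apply: eq_bigr => i _.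
  rewrite mulr_sumr; apply: eq_bigr => j _; rewrite !mulr_sumr; apply: eq_bigr => l _; ring.
rewrite !E; apply: eq_bigr => i _; congr (_ * _); rewrite exchange_big /=.
apply: eq_bigr => j _; apply: eq_bigr => l _.
have [d d0 hd] := chart_img_ball hp.
rewrite (@partial_near R n (fun q => christoffel C q k j l) (fun q => christoffel C q k l j) p i d d0).
- by ring.
- by move=> q /hd; apply: christoffel_sym.
- exact: christoffel_sdr.
Qed.

(** Only the symmetry of the Christoffel symbols, that is absence of torsion, makes the terms cancel
    in the cyclic sum. *)
Lemma bianchi C p u v w : chart_img C p ->
  w *m RU C p u v + u *m RU C p v w + v *m RU C p w u = 0.
Proof.
move=> hp; rewrite /RU; mxdistr.
rewrite (dGam_sym u v w hp) (dGam_sym v u w hp) (dGam_sym w u v hp).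
rewrite (GamU_sym v w hp) (GamU_sym u w hp) (GamU_sym u v hp).
by mxring.
Qed.

Lemma mx11_tr (A : 'M[R]_1) : A^T 0 0 = A 0 0.
Proof. by rewrite mxE. Qed.

Lemma dotC C p u v : chart_img C p -> dot (G C p) u v = dot (G C p) v u.
Proof.
by move=> hp; rewrite /dot -mx11_tr !trmx_mul trmxK mmetric_sym// mulmxA.
Qed.

Lemma dotDl (g : 'M[R]_n) u v w : dot g (u + v) w = dot g u w + dot g v w.
Proof. by rewrite /dot !mulmxDl mxE. Qed.

Lemma dotDr (g : 'M[R]_n) u v w : dot g u (v + w) = dot g u v + dot g u w.
Proof. by rewrite /dot linearD /= mulmxDr mxE. Qed.

Lemma dotZl (g : 'M[R]_n) (c : R) u v : dot g (c *: u) v = c * dot g u v.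
Proof. by rewrite /dot -!scalemxAl mxE. Qed.

Lemma dotZr (g : 'M[R]_n) (c : R) u v : dot g u (c *: v) = c * dot g u v.
Proof. by rewrite /dot linearZ /= -scalemxAr mxE. Qed.

Lemma dotNl (g : 'M[R]_n) u v : dot g (- u) v = - dot g u v.
Proof. by rewrite -scaleN1r dotZl mulN1r. Qed.

Lemma dotNr (g : 'M[R]_n) u v : dot g u (- v) = - dot g u v.
Proof. by rewrite -scaleN1r dotZr mulN1r. Qed.

Definition Rm C p u v w y : R := dot (G C p) (w *m RU C p u v) y.

Lemma Rm_skew34 C p u v w y : chart_img C p -> Rm C p u v w y = - Rm C p u v y w.
Proof.
move=> hp; rewrite /Rm dotC//; rewrite /dot.
have -> : (w *m RU C p u v)^T = (RU C p u v)^T *m w^T by rewrite trmx_mul.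
have /eqP := RU_skew u v hp; rewrite addrC addr_eq0 => /eqP E.
transitivity ((y *m (G C p *m (RU C p u v)^T) *m w^T) 0 0); first by rewrite !mulmxA.
by rewrite E mulmxN mulNmx mxE !mulmxA.
Qed.

Lemma Rm_skew12 C p u v w y : Rm C p u v w y = - Rm C p v u w y.
Proof.
rewrite /Rm -dotNl -mulmxN; congr (dot _ (_ *m _) _); rewrite /RU.
by move: (dGam _ _ _ _) (dGam _ _ _ _) (_ *m _) (_ *m _) => A B D E; mxring.
Qed.

Lemma Rm_bianchi C p u v w y : chart_img C p ->
  Rm C p u v w y + Rm C p v w u y + Rm C p w u v y = 0.
Proof.
move=> hp; rewrite /Rm -!dotDl bianchi//.
by rewrite /dot !mul0mx mxE.
Qed.

(** The case of the pair symmetry that makes the curvature operator of a geodesic, u to R(a, u) a,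
    self-adjoint. *)
Lemma Rm_pair C p a u v : chart_img C p -> Rm C p a u a v = Rm C p a v a u.
Proof.
move=> hp; have h := Rm_bianchi u v a a hp.
have e1 : Rm C p u v a a = 0 by have := Rm_skew34 u v a a hp; lra.
have e2 := Rm_skew12 C p v a u a; have e3 := Rm_skew34 a v u a hp.
have e4 := Rm_skew34 a u v a hp.
lra.
Qed.

Lemma Rm_diag C p a u : chart_img C p -> Rm C p a u a a = 0.
Proof. by move=> hp; have := Rm_skew34 a u a a hp; lra. Qed.

Lemma dot_ge0 C p u : chart_img C p -> 0 <= dot (G C p) u u.
Proof.
move=> hp; have [->|u0] := eqVneq u 0; first by rewrite /dot !mul0mx mxE.
exact/ltW/mmetric_pos.
Qed.

Lemma dot_eq0 C p u : chart_img C p -> dot (G C p) u u = 0 -> u = 0.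
Proof.
move=> hp; have [->//|u0] := eqVneq u 0 => h.
by have := mmetric_pos hp u0; rewrite -/(dot _ _ _) h ltxx.
Qed.

Lemma dot_cauchy C p u v : chart_img C p ->
  dot (G C p) u v ^+ 2 <= dot (G C p) u u * dot (G C p) v v.
Proof.
move=> hp; have [v0|v0] := eqVneq (dot (G C p) v v) 0.
  by rewrite (dot_eq0 hp v0) /dot !trmx0 !mulmx0 mxE expr0n /= mulr0.
have vp : 0 < dot (G C p) v v by rewrite lt_neqAle eq_sym v0 dot_ge0.
have := dot_ge0 (dot (G C p) v v *: u - dot (G C p) u v *: v) hp.
rewrite !(dotDl, dotDr, dotNl, dotNr, dotZl, dotZr) (dotC v u hp).
set a := dot _ u u; set b := dot _ u v; set c := dot _ v v => h.
rewrite (_ : _ + _ = c * (a * c - b ^+ 2)) in h; last by ring.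
by move: h; rewrite pmulr_rge0// subr_ge0.
Qed.

Lemma not_row_free2 u v : ~~ row_free (col_mx u v) ->
  exists a b : R, (a, b) != (0, 0) /\ a *: u + b *: v = 0.
Proof.
move=> h; have [w w0 hw] : exists2 w : 'rV[R]_(1 + 1), w != 0 & w *m col_mx u v = 0.
  apply: contrapT => H; move/negP: h; apply; apply: inj_row_free => w hw.
  by apply/eqP; apply: contraT => w0; case: H; exists w.
exists (lsubmx w 0 0), (rsubmx w 0 0).
have lw : w = row_mx (lsubmx w) (rsubmx w) by rewrite hsubmxK.
split.
  apply: contra w0 => /eqP[l r]; rewrite lw.
  have -> : lsubmx w = 0 by apply/matrixP => i j; rewrite !ord1 l mxE.
  have -> : rsubmx w = 0 by apply/matrixP => i j; rewrite !ord1 r mxE.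
  by rewrite row_mx0.
move: hw; rewrite [in X in X -> _]lw mul_row_col => <-; congr (_ + _).
  by rewrite -mul_scalar_mx; congr (_ *m _); apply/matrixP => i j; rewrite !ord1 mxE eqxx.
by rewrite -mul_scalar_mx; congr (_ *m _); apply/matrixP => i j; rewrite !ord1 mxE eqxx.
Qed.

Lemma RU_diag C p u : RU C p u u = 0.
Proof. by rewrite /RU subrr add0r subrr. Qed.

Lemma dGamZ C p u v (c d : R) : dGam C p (c *: u) (d *: v) = (c * d) *: dGam C p u v.
Proof.
apply/matrixP => j k; rewrite !mxE mulr_sumr; apply: eq_bigr => i _.
rewrite mulr_sumr; apply: eq_bigr => l _; rewrite !mxE; generalize (partial i (fun q => christoffel C q k l j) p) => ?.
ring.
Qed.

Lemma RU_scale C p u v (c d : R) : RU C p (c *: u) (d *: v) = (c * d) *: RU C p u v.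
Proof.
rewrite /RU !dGamZ !GamUZ -!scalemxAl -!scalemxAr !scalerA [d * c]mulrC.
by rewrite !scalerBr !scalerDr scalerN.
Qed.

Lemma RU_dependent C p u v (a b : R) : (a, b) != (0, 0) -> a *: u + b *: v = 0 -> RU C p u v = 0.
Proof.
move=> ab h; have [a0|a0] := eqVneq a 0.
  have b0 : b != 0 by apply: contra ab => /eqP ->; rewrite a0.
  move: h; rewrite a0 scale0r add0r => /eqP; rewrite scaler_eq0 (negPf b0) /= => /eqP ->.
  by rewrite -[u]scale1r -(scale0r u) RU_scale mulr0 scale0r.
have -> : u = (- a^-1 * b) *: v.
  move/eqP: h; rewrite addr_eq0 => /eqP h.
  by rewrite mulNr scaleNr -scalerA -scalerN -h scalerA mulVf// scale1r.
by rewrite -[v in RU _ _ _ v]scale1r RU_scale RU_diag scaler0.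
Qed.

(** Equality in the Cauchy-Schwarz inequality makes a and u dependent, and the curvature vanishes on
    dependent pairs. *)
Lemma gram_eq0_RU C p a u : chart_img C p ->
  dot (G C p) a a * dot (G C p) u u - dot (G C p) a u ^+ 2 = 0 -> RU C p a u = 0.
Proof.
move=> hp h; have [->|u0] := eqVneq u 0.
  by rewrite -[a]scale1r -(scale0r 0) RU_scale mulr0 scale0r.
have uu : dot (G C p) u u != 0 by apply: contra u0 => /eqP/(dot_eq0 hp) ->.
apply: (@RU_dependent C p a u (dot (G C p) u u) (- dot (G C p) a u)).
  by apply: contra uu => /eqP[->].
apply: (dot_eq0 hp); rewrite !(dotDl, dotDr, dotNl, dotNr, dotZl, dotZr) (dotC u a hp).
move: h; set A := dot _ a a; set B := dot _ u u; set c := dot _ a u => h.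
rewrite (_ : _ + _ = B * (A * B - c ^+ 2)); last by ring.
by rewrite h mulr0.
Qed.

(* The quadratic form <R(a, u) a, u> is minus a sectional curvature times a
   Gram determinant. *)
Lemma Rm_bounds x (a u : tangent x) (kmin : R) :
  all_sectional_curvatures M (fun K => kmin <= K <= 0) ->
  0 <= Rm (chart_at x) (mchart (chart_at x) x) a u a u <=
    `|kmin| * (inner x a a * inner x u u).
Proof.
move=> hK; set C := chart_at x; set p := mchart C x.
have hp : chart_img C p by apply: chart_img_in; exact: mem_chart_at.
have -> : inner x a a = dot (G C p) a a by [].
have -> : inner x u u = dot (G C p) u u by [].
have nn : 0 <= dot (G C p) a a * dot (G C p) u u by rewrite mulr_ge0// dot_ge0.
(* Sectional curvature is constrained on independent pairs only; on the other pairs the form is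
   0. *)
have zero : RU C p a u = 0 -> 0 <= Rm C p a u a u <= `|kmin| * (dot (G C p) a a * dot (G C p) u u).
  by move=> h; rewrite /Rm h mulmx0 /dot !mul0mx mxE lexx /= mulr_ge0.
have [hf|/not_row_free2[c [d [cd h]]]] := boolP (row_free (col_mx a u)); last first.
  exact/zero/(RU_dependent C p cd h).
have := hK x a u hf; rewrite /sectional_curvature curvatureE -/C -/p.
have -> : inner x (u *m RU C p a u) a = - Rm C p a u a u by rewrite (Rm_skew34 a u a u hp) opprK.
have -> : inner x a a = dot (G C p) a a by [].
have -> : inner x u u = dot (G C p) u u by [].
have -> : inner x a u = dot (G C p) a u by [].
have cs := dot_cauchy a u hp.
have [/(gram_eq0_RU hp)/zero //|g0] := eqVneq (dot (G C p) a a * dot (G C p) u u - dot (G C p) a u ^+ 2) 0.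
move: g0 cs nn; set q := Rm _ _ _ _ _ _; set A := _ * _; set B := dot _ a u ^+ 2 => g0 cs nn.
have B0 : 0 <= B by exact: sqr_ge0.
have gp : 0 < A - B by rewrite lt_neqAle eq_sym g0 subr_ge0.
rewrite ler_pdivlMr// ler_pdivrMr// mul0r oppr_le0 => /andP[h1 h2]; rewrite h2 /=.
have [k0|k0] := leP 0 kmin.
  have : 0 <= kmin * (A - B) by rewrite mulr_ge0// ltW.
  by have := mulr_ge0 (normr_ge0 kmin) nn; lra.
rewrite ltr0_norm//; have : 0 <= - kmin * B by rewrite mulr_ge0// oppr_ge0 ltW.
by move: h1; rewrite mulrBr; lra.
Qed.

End curvature_identities.

(** * Covariant differentiation along curves *)

Section covariant.
Context {R : realType} {n : nat} {M : riemannianManifold R n}.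
Implicit Types (C : mindex M) (x : M) (u v w : 'rV[R]_n).

Lemma geodesic_chart (g : R -> M) (t : R) C : geodesic g -> mdom C (g t) ->
  is_derive t 1 (fun s => mchart C (g s)) (velocity_in C g t) /\
  is_derive t 1 (velocity_in C g)
    (- (velocity_in C g t *m GamU C (mchart C (g t)) (velocity_in C g t))).
Proof.
move=> [cg hg] hC; split; apply/is_derive_mxP => i k; rewrite (ord1 i).
  have [h _ _] := hg t C hC k.
  rewrite mxE; exact: derivable1_is_derive.
have [_ h e] := hg t C hC k.
rewrite (_ : (fun s => _) = derive1 (curve_coord C g k)); last first.
  by apply/funext => s; rewrite mxE.
have -> : (- (velocity_in C g t *m GamU C (mchart C (g t)) (velocity_in C g t))) 0 k =
   derive1 (derive1 (curve_coord C g k)) t.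
  rewrite e !mxE; congr (- _); rewrite exchange_big /=; apply: eq_bigr => j _.
  rewrite GamUE mulr_sumr; apply: eq_bigr => l _; rewrite mulrC; congr (_ * _).
  by rewrite mulrC.
exact: derivable1_is_derive.
Qed.

Lemma geodesic_velocity (g : R -> M) (t : R) C : geodesic g -> mdom C (g t) ->
  tangent_in C (g t) (velocity g t) = velocity_in C g t.
Proof.
move=> hg hC; apply: tangent_in_velocity => //; first by have [cg _] := hg; exact: cg.
by have [] := geodesic_chart hg hC.
Qed.

(* The transformation law of the Christoffel symbols is read off the geodesic
   equation, written in two charts for the geodesic with a given velocity. *)
Lemma christoffel_transition C C' x u w : complete_manifold M -> mdom C x -> mdom C' x ->
  w *m djac C C' x u = (w *m GamU C (mchart C x) u) *m jac C C' x
    - (w *m jac C C' x) *m GamU C' (mchart C' x) (u *m jac C C' x).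
Proof.
move=> hM hC hC'.
have diag v : v *m djac C C' x v = (v *m GamU C (mchart C x) v) *m jac C C' x
    - (v *m jac C C' x) *m GamU C' (mchart C' x) (v *m jac C C' x).
  have [g [hg g0 gv]] := hM x (v *m jac C (chart_at x) x).
  have hgC : mdom C (g 0) by rewrite g0.
  have hgC' : mdom C' (g 0) by rewrite g0.
  have cg : {for 0, continuous g} by have [cg _] := hg; exact: cg.
  have [h1 h2] := geodesic_chart hg hgC; have [h1' h2'] := geodesic_chart hg hgC'.
  have vE : velocity_in C g 0 = v.
    rewrite -geodesic_velocity// gv g0 tangent_inE -mulmxA jacK ?mulmx1//.
    exact: mem_chart_at.
  have vE' : velocity_in C' g 0 = v *m jac C C' x.
    have := curve_transition cg hgC hgC' h1; rewrite vE g0.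
    exact: velocity_inE.
  have hj := jac_curve cg hgC hgC' h1.
  have := is_derive_mulmx h2 hj; rewrite vE g0 => h3.
  rewrite vE' g0 in h2'.
  have h4 : is_derive (0 : R) 1 (velocity_in C' g)
      (- (v *m GamU C (mchart C x) v) *m jac C C' x + v *m djac C C' x v).
    apply: near_is_derive h3; apply: filterS2 (near_dom cg hgC) (near_dom cg hgC') => s s1 s2.
    apply/esym/velocity_inE; apply: curve_transition => //.
      by have [cg' _] := hg; exact: cg'.
    by have [] := geodesic_chart hg s1.
  have := is_derive_uniq h2' h4; rewrite mulNmx => /eqP.
  by rewrite eq_sym addrC subr_eq addrC => /eqP.
have hp : chart_img C (mchart C x) by exact: chart_img_in.
have hp' : chart_img C' (mchart C' x) by exact: chart_img_in.
(* Polarisation: both sides are symmetric bilinear in u and w, so the diagonal determines them. *)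
have := diag (u + w); rewrite djacD !mulmxDl !GamUD.
have := djac_sym u w hC hC'.
have := GamU_sym u w hp; have := GamU_sym (u *m jac C C' x) (w *m jac C C' x) hp'.
rewrite !mulmxDr !mulmxDl (diag u) (diag w).
set T := jac C C' x; set D := djac C C' x; set g := GamU C _; set g' := GamU C' _.
move=> e1 e2 e3; rewrite -e1 -e2 -e3.
move: (w *m D u) (w *m g u *m T) (w *m T *m g' (u *m T)) => X Y Z h.
have h2 : 2 *: X = 2 *: (Y - Z).
  move: h; move: (u *m g u *m T) (w *m g w *m T) (u *m T *m g' (u *m T)) (w *m T *m g' (w *m T)) => a b c d.
  move=> /matrixP h; apply/matrixP => i j; have := h i j; rewrite !mxE => H; lra.
by apply: (scalerI _ h2); rewrite pnatr_eq0.
Qed.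

(* [W] is the covariant derivative along the curve [g] of the vector field [V]. *)
Definition has_cov (g : R -> M) (V W : R -> 'rV[R]_n) (t : R) := forall C u,
  mdom C (g t) -> is_derive t 1 (fun s => mchart C (g s)) u ->
  is_derive t 1 (fun s => tangent_in C (g s) (V s))
    (tangent_in C (g t) (W t) - tangent_in C (g t) (V t) *m GamU C (mchart C (g t)) u).

(** By the transformation law of the Christoffel symbols the defining formula in one chart implies
    it in all. *)
Lemma has_cov_chart C (g : R -> M) (V W : R -> 'rV[R]_n) (t : R) u :
  complete_manifold M -> {for t, continuous g} -> mdom C (g t) ->
  is_derive t 1 (fun s => mchart C (g s)) u ->
  is_derive t 1 (fun s => tangent_in C (g s) (V s))
    (tangent_in C (g t) (W t) - tangent_in C (g t) (V t) *m GamU C (mchart C (g t)) u) ->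
  has_cov g V W t.
Proof.
move=> hM cg hC hu hV C' u' hC' hu'.
have u'E : u' = u *m jac C C' (g t) := is_derive_uniq hu' (curve_transition cg hC hC' hu).
have E : (tangent_in C (g t) (W t) - tangent_in C (g t) (V t) *m GamU C (mchart C (g t)) u) *m
    jac C C' (g t) + tangent_in C (g t) (V t) *m djac C C' (g t) u =
  tangent_in C' (g t) (W t) - tangent_in C' (g t) (V t) *m GamU C' (mchart C' (g t)) u'.
  rewrite (christoffel_transition u (tangent_in C (g t) (V t)) hM hC hC') -u'E.
  rewrite -(tangent_in_jac (W t) hC hC') -(tangent_in_jac (V t) hC hC').
  by mxring.
have := is_derive_mulmx hV (jac_curve cg hC hC' hu); rewrite E.
apply: near_is_derive; apply: filterS2 (near_dom cg hC) (near_dom cg hC') => s s1 s2.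
exact: tangent_in_jac.
Qed.

Lemma has_cov_dot C (g : R -> M) (V W V' W' : R -> 'rV[R]_n) (t : R) u :
  {for t, continuous g} -> mdom C (g t) ->
  is_derive t 1 (fun s => mchart C (g s)) u ->
  has_cov g V V' t -> has_cov g W W' t ->
  is_derive t 1 (fun s => inner (g s) (V s) (W s))
    (inner (g t) (V' t) (W t) + inner (g t) (V t) (W' t)).
Proof.
move=> cg hC hu hV hW.
have := metric_dot_curve (chart_img_in hC) hu (hV C u hC hu) (hW C u hC hu).
rewrite !subrK -!innerE//.
apply: near_is_derive; apply: filterS (near_dom cg hC) => s s1.
exact/esym/innerE.
Qed.

End covariant.

(** * Induction over the real line *)

Section real_induction.
Context {R : realType}.

(** Consider the times up to which P holds throughout: their supremum is attained by the first
    hypothesis and is b by the second. *)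
Lemma real_induction (P : R -> Prop) (a b : R) :
  (forall t, a <= t <= b -> (forall s, a <= s < t -> P s) -> P t) ->
  (forall t, a <= t <= b -> (forall s, a <= s <= t -> P s) ->
     exists2 d : R, 0 < d & forall s, t < s < t + d -> s <= b -> P s) ->
  forall t, a <= t <= b -> P t.
Proof.
move=> hl hr t tab; have ab : a <= b by case/andP: tab; apply: le_trans.
pose S := [set t | a <= t <= b /\ forall s, a <= s <= t -> P s].
have Sa : S a.
  split=> [|s /andP[s1 s2]]; first by rewrite lexx.
  apply: hl => [|u /andP[u1 u2]]; first by rewrite s1 (le_trans s2).
  by have := lt_le_trans u2 s2; rewrite ltNge u1.
have uS : has_ubound S by exists b => x [/andP[]].
set tau := sup S.
have atau : a <= tau by apply: ub_le_sup.
have taub : tau <= b by apply: ge_sup => [|x [/andP[]]]; [exists a|].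
have below s : a <= s < tau -> P s.
  move=> /andP[as_ st].
  have ts : 0 < tau - s by rewrite subr_gt0.
  have [x Sx] := sup_adherent ts (conj (ex_intro _ a Sa) uS).
  rewrite -/tau subKr => sx.
  by apply: Sx.2; rewrite as_ ltW.
have Ptau s : a <= s <= tau -> P s.
  move=> /andP[as_]; rewrite le_eqVlt => /orP[/eqP ->|st].
    by apply: hl => //; rewrite atau.
  by apply: below; rewrite as_.
have tauab : a <= tau <= b by rewrite atau.
have [d d0 hd] := hr tau tauab Ptau.
have [taub'|btau] := ltP tau b; last first.
  apply: Ptau; case/andP: tab => -> /= tb; exact: le_trans btau.
exfalso; pose s := Num.min b (tau + d / 2).
have taus : tau < s by rewrite lt_min taub' ltrDl divr_gt0.
have Ss : S s.
  split=> [|u /andP[au us]]; first by rewrite (le_trans atau (ltW taus)) ge_min lexx.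
  have [ut|tu] := leP u tau; first by apply: Ptau; rewrite au.
  apply: hd; last by apply: le_trans us _; rewrite ge_min lexx.
  rewrite tu /=; apply: le_lt_trans us _; rewrite gt_min; apply/orP; right.
  by rewrite ltrD2l ltr_pdivrMr// ltr_pMr// ltr1n.
by have := ub_le_sup uS Ss; rewrite -/tau leNgt taus.
Qed.

(** Connectedness of R in the form used for geodesics and lifts: near every t, the property at one
    time implies it at any other. Times below t0 are reached by reflection. *)
Lemma real_propagate (P : R -> Prop) (t0 : R) : P t0 ->
  (forall t, exists2 d : R, 0 < d & forall s u, `|s - t| < d -> `|u - t| < d -> P s -> P u) ->
  forall t, P t.
Proof.
move=> P0 hP.
suff up (Q : R -> Prop) a : Q a ->
  (forall t, exists2 d : R, 0 < d & forall s u, `|s - t| < d -> `|u - t| < d -> Q s -> Q u) ->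
  forall t, a <= t -> Q t.
  move=> t; have [|t0t] := leP t0 t; first exact: up.
  have := up (fun s => P (- s)) (- t0); rewrite opprK => /(_ P0) H.
  rewrite -[t]opprK; apply: H; last by rewrite lerN2 ltW.
  move=> s; have [d d0 hd] := hP (- s); exists d => // x y xd yd; apply: hd;
    by rewrite -opprD normrN.
move=> Qa hQ t at_; apply: (@real_induction Q a t); last by rewrite at_ lexx.
- move=> s /andP[as_ st] hs; have [<-//|as'] := eqVneq a s.
  have las : a < s by rewrite lt_neqAle as' as_.
  have [d d0 hd] := hQ s; pose u := Num.max a (s - d / 2).
  have us : u < s by rewrite gt_max las gtrBl divr_gt0.
  apply: (hd u) => //; last by apply: hs; rewrite us le_max lexx.
    rewrite distrC gtr0_norm ?subr_gt0// ltrBlDr -ltrBlDl lt_max; apply/orP; right.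
    by rewrite ltrD2l ltrN2 ltr_pdivrMr// ltr_pMr// ltr1n.
  by rewrite subrr normr0.
- move=> s /andP[as_ st] hs; have [d d0 hd] := hQ s; exists d => // u /andP[su ud] _.
  apply: (hd s) => //; first by rewrite subrr normr0.
    by rewrite gtr0_norm ?subr_gt0// ltrBlDl.
  by apply: hs; rewrite as_ lexx.
Qed.

End real_induction.

(** * Geodesic flow and exponential map *)

Section spray.
Context {R : realType} {n : nat} {M : riemannianManifold R n}.
Implicit Types (C : mindex M) (x : M) (z h : 'rV[R]_(n + n)).

Definition phase C (g : R -> M) (t : R) : 'rV[R]_(n + n) :=
  row_mx (mchart C (g t)) (velocity_in C g t).

(** The geodesic equation as a first-order system for (position, velocity). *)
Definition spray C z : 'rV[R]_(n + n) :=
  row_mx (rsubmx z) (- (rsubmx z *m GamU C (lsubmx z) (rsubmx z))).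

Definition Dspray C z : 'M[R]_(n + n) :=
  \matrix_(i, j) partial i (fun q => spray C q 0 j) z.

Lemma sd_mul m k (A : 'M[R]_(m, k)) (p : 'rV[R]_m) : sd (fun y => y *m A) p A.
Proof.
move=> e e0; exists 1 => // y y' _ _.
by rewrite mulmxBl subrr normr0 mulr_ge0// ltW.
Qed.

Lemma lsubmx_mul z : lsubmx z = z *m (col_mx 1%:M 0).
Proof. by rewrite -[in RHS](hsubmxK z) mul_row_col mulmx1 mulmx0 addr0. Qed.

Lemma has_sdr_lsubmx (f : 'rV[R]_n -> R) z : has_sdr f (lsubmx z) ->
  has_sdr (fun q : 'rV[R]_(n + n) => f (lsubmx q)) z.
Proof.
move=> [g hg]; rewrite lsubmx_mul in hg.
have := sdr_comp (sd_mul (col_mx 1%:M 0) z) hg => h.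
by eexists; apply: sdr_near ltr01 _ h => q _ /=; rewrite -lsubmx_mul.
Qed.

Lemma has_sdr_coord m (i : 'I_m) (p : 'rV[R]_m) : has_sdr (fun y => y 0 i) p.
Proof. by eexists; apply: sdr_coord. Qed.

Lemma has_sdr_rsubmx z i : has_sdr (fun q : 'rV[R]_(n + n) => rsubmx q 0 i) z.
Proof. by apply: has_sdr_ext (has_sdr_coord (rshift n i) z) => q; rewrite mxE. Qed.

Lemma spray_sd C z : chart_img C (lsubmx z) -> sd (spray C) z (Dspray C z).
Proof.
move=> hz; apply/sdP => j.
suff h : has_sdr (fun q => spray C q 0 j) z.
  rewrite (_ : col j _ = \col_i partial i (fun q => spray C q 0 j) z); first exact: has_sdrP.
  by apply/colP => i; rewrite !mxE.
rewrite -[j]splitK; case: (fintype.split j) => k /=.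
  by apply: has_sdr_ext (has_sdr_rsubmx z k) => q; rewrite row_mxEl.
apply: (@has_sdr_ext _ _ (fun q : 'rV[R]_(n + n) => (-1) * \sum_j rsubmx q 0 j *
   \sum_i rsubmx q 0 i * christoffel C (lsubmx q) k i j)).
  move=> q; rewrite /spray row_mxEr [RHS]mxE mulN1r; congr (- _); rewrite [RHS]mxE.
  by apply: eq_bigr => l _; rewrite GamUE.
apply: has_sdrM; first exact: has_sdr_cst.
apply: has_sdr_sum => l; apply: has_sdrM; first exact: has_sdr_rsubmx.
apply: has_sdr_sum => i; apply: has_sdrM; first exact: has_sdr_rsubmx.
by apply: (@has_sdr_lsubmx (fun q => christoffel C q k i l)); apply: christoffel_sdr.
Qed.

Lemma lineP m (p u : 'rV[R]_m) (t : R) : is_derive t 1 (fun s => p + s *: u) u.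
Proof.
have := is_derive_add (is_derive_cst1 p t) (is_derive_scalev u (@is_derive_id _ _ t 1)).
by rewrite add0r scale1r.
Qed.

(** The linearised geodesic equation; its second component becomes the Jacobi equation once
    rewritten with covariant derivatives. *)
Lemma Dspray_mul C z (a b : 'rV[R]_n) : chart_img C (lsubmx z) ->
  let u := rsubmx z in let p := lsubmx z in
  row_mx a b *m Dspray C z =
  row_mx b (- (b *m GamU C p u + u *m (dGam C p a u + GamU C p b))).
Proof.
move=> hz u p; have z0 : z + 0 *: row_mx a b = z by rewrite scale0r addr0.
have hl := lineP z (row_mx a b) 0.
have hs : sd (spray C) (z + 0 *: row_mx a b) (Dspray C z) by rewrite z0; apply: spray_sd.
apply: is_derive_uniq (sd_curve hs hl) _.
have hu : is_derive (0 : R) 1 (fun s : R => u + s *: b) b := lineP u b 0.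
have hx : is_derive (0 : R) 1 (fun s : R => p + s *: a) a := lineP p a 0.
have p0 : p + 0 *: a = p by rewrite scale0r addr0.
have u0 : u + 0 *: b = u by rewrite scale0r addr0.
have hp : chart_img C (p + 0 *: a) by rewrite p0.
have hG := GamU_curve hp hx hu; rewrite p0 u0 in hG.
have h := is_derive_row_mx hu (is_derive_opp (is_derive_mulmx hu hG)).
rewrite p0 u0 in h.
rewrite (_ : (fun s : R => spray C _) =
  fun s : R => row_mx (u + s *: b) (- ((u + s *: b) *m GamU C (p + s *: a) (u + s *: b)))).
  exact: h.
apply/funext => s; rewrite /spray.
have -> : z + s *: row_mx a b = row_mx (p + s *: a) (u + s *: b).
  by rewrite -add_row_mx -scale_row_mx hsubmxK.
by rewrite row_mxKl row_mxKr.
Qed.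

Lemma phase_is_derive C (g : R -> M) (t : R) : geodesic g -> mdom C (g t) ->
  is_derive t 1 (phase C g) (spray C (phase C g t)).
Proof.
move=> hg hC; have [h1 h2] := geodesic_chart hg hC.
by rewrite /spray /phase row_mxKl row_mxKr; apply: is_derive_row_mx.
Qed.

Lemma norm_lsubmx_le m k (z : 'rV[R]_(m + k)) : `|lsubmx z| <= `|z|.
Proof.
apply: mx_norm_le => // i j; rewrite mxE.
exact: mx_entry_le.
Qed.

(* A ball in phase space, and a time during which the geodesics that start in
   the half-ball stay in the ball. *)
Record flow_box C (z1 : 'rV[R]_(n + n)) (rho L eta : R) : Prop := FlowBox {
  fb_rho : 0 < rho;
  fb_L : 0 <= L;
  fb_eta : 0 < eta;
  fb_small : L * eta <= 2^-1;
  fb_small' : (n + n)%:R * L * eta <= 2^-1;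
  fb_img : forall z, `|z - z1| < rho -> chart_img C (lsubmx z);
  fb_D : forall z, `|z - z1| < rho -> `|Dspray C z| <= L;
  fb_lip : forall z z', `|z - z1| < rho -> `|z' - z1| < rho ->
    `|spray C z - spray C z'| <= L * `|z - z'|;
  fb_stay : forall g (t0 : R), geodesic g -> mdom C (g t0) ->
    `|phase C g t0 - z1| < rho / 2 -> forall t, `|t - t0| <= eta ->
    mdom C (g t) /\ `|phase C g t - z1| < rho }.

(** The danger is that a geodesic leaves the chart. Real induction on the elapsed time excludes it:
    as long as the geodesic has been in the ball, its base points lie in a compact part of the
    chart. *)
Lemma exists_flow_box C z1 : chart_img C (lsubmx z1) ->
  exists rho L eta, flow_box C z1 rho L eta.
Proof.
move=> hz1.
have [d0 d00 hd0] := chart_img_ball hz1.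
have [L1 L10 [d1 d10 hd1]] := sd_lip (spray_sd hz1).
have [d2 d20 hd2] := spray_sd hz1 ltr01.
pose rho := Num.min d0 (Num.min d1 d2).
have rho0 : 0 < rho by rewrite !lt_min d00 d10 d20.
have rd0 : rho <= d0 by rewrite ge_min lexx.
have rd1 : rho <= d1 by rewrite !ge_min lexx /= orbT.
have rd2 : rho <= d2 by rewrite !ge_min lexx !orbT.
have img z : `|z - z1| < rho -> chart_img C (lsubmx z).
  move=> hz; apply: hd0; apply: lt_le_trans rd0; apply: le_lt_trans hz.
  by rewrite -linearB; apply: norm_lsubmx_le.
pose L := L1 + (`|Dspray C z1| + 1).
have L0 : 0 <= L by rewrite !addr_ge0// ltW.
have lip z z' : `|z - z1| < rho -> `|z' - z1| < rho -> `|spray C z - spray C z'| <= L * `|z - z'|.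
  move=> hx hy; apply: le_trans (hd1 z z' _ _) _; [exact: lt_le_trans rd1|exact: lt_le_trans rd1|].
  by apply: ler_wpM2r => //; rewrite lerDl addr_ge0.
have bD z : `|z - z1| < rho -> `|Dspray C z| <= L.
  move=> hz; rewrite -[Dspray C z](subrK (Dspray C z1)).
  apply: le_trans (ler_normD _ _) _.
  have := sd_grad_close_norm ler01 hd2 (lt_le_trans hz rd2) (spray_sd (img z hz)).
  by rewrite /L; lra.
pose B := `|spray C z1| + L * rho.
have B0 : 0 <= B by rewrite addr_ge0// mulr_ge0// ltW.
(* [B] bounds the spray on the ball. With eta = 1 / q the products of eta with L, (n + n) L and B /
   rho are at most 1/4, so a geodesic starting in the half-ball moves by at most rho / 4. *)
pose q := 4 * (L + (n + n)%:R * L + B / rho + 1).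
have nL0 : 0 <= (n + n)%:R * L by rewrite mulr_ge0.
have Br0 : 0 <= B / rho by rewrite divr_ge0// ltW.
have q0 : 0 < q by move: nL0 Br0; rewrite /q; lra.
pose eta := q^-1; have eta0 : 0 < eta by rewrite invr_gt0.
have Q a : 0 <= a -> 4 * a <= q -> a * eta <= 4^-1.
  move=> a0 aq; rewrite /eta ler_pdivrMr// -ler_pdivrMl//; lra.
have q1 : L * eta <= 4^-1 by apply: Q => //; move: nL0 Br0 L0; rewrite /q; lra.
have q2 : (n + n)%:R * L * eta <= 4^-1 by apply: Q => //; move: nL0 Br0 L0; rewrite /q; lra.
have q3 : B / rho * eta <= 4^-1 by apply: Q => //; move: nL0 Br0 L0; rewrite /q; lra.
have Be : B * eta <= rho / 4.
  by move: q3; rewrite mulrAC ler_pdivrMr// [rho / 4]mulrC.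
exists rho, L, eta; split=> //; [by lra|by lra|].
move=> g t0 hg hC hz t ht.
have cg s : {for s, continuous g} by have [cg _] := hg; exact: cg.
(* The sign of t - t0: forward and backward times are handled by one induction on |t - t0|. *)
pose sg : R := if t0 <= t then 1 else -1.
have sg2 : sg * sg = 1 by rewrite /sg; case: ifP => _; ring.
have sgn s : 0 <= s -> `|sg * s| = s.
  by move=> s0; rewrite normrM [X in _ * X]ger0_norm// /sg; case: ifP => _; rewrite ?normrN normr1 mul1r.
pose good s := mdom C (g (t0 + sg * s)) /\ `|phase C g (t0 + sg * s) - z1| < rho.
suff H : forall s, 0 <= s <= eta -> good s.
  have := H `|t - t0|; rewrite normr_ge0 ht => /(_ isT).
  rewrite /good; have -> : t0 + sg * `|t - t0| = t; last by [].
  rewrite /sg; case: leP => h; first by rewrite ger0_norm ?subr_ge0//; ring.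
  by rewrite ltr0_norm ?subr_lt0//; ring.
have bnd s : 0 <= s <= eta -> (forall u, 0 <= u <= s -> good u) ->
    `|phase C g (t0 + sg * s) - z1| <= `|phase C g t0 - z1| + rho / 4.
  move=> /andP[s0 se] hs.
  pose F u := phase C g (t0 + sg * u).
  have hF (u : R) : 0 <= u <= s -> is_derive u 1 F (sg *: spray C (F u)).
    move=> us; have [gu1 gu2] := hs u us.
    have hl : is_derive u 1 (fun u => t0 + sg * u) sg.
      have := is_derive_add (is_derive_cst1 t0 u) (is_derive_scalev sg (@is_derive_id _ _ u 1)).
      rewrite add0r scale1r (_ : (fun s => _) = (fun u => t0 + sg * u))//.
      by apply/funext => w; rewrite /GRing.scale /= mulrC.
    have /is_derive_epsP h1 := phase_is_derive hg gu1.
    apply/is_derive_mxP => i j; rewrite (ord1 i) mxE.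
    have h2 := is_derive_entry 0 j (phase_is_derive hg gu1).
    by have := @is_derive1_comp R (fun s => phase C g s 0 j) (fun u => t0 + sg * u) u _ _ h2 hl; rewrite mulrC.
  have bF u : 0 <= u <= s -> `|sg *: spray C (F u)| <= B.
    move=> us; have [gu1 gu2] := hs u us.
    rewrite normrZ (_ : `|sg| = 1) ?mul1r; last by rewrite -[sg]mulr1 sgn.
    rewrite -[spray C _](subrK (spray C z1)) addrC; apply: le_trans (ler_normD _ _) _.
    rewrite lerD2l; apply: le_trans (lip _ _ gu2 _) _; first by rewrite subrr normr0.
    by apply: ler_wpM2l => //; apply: ltW.
  have := mvt_curve s0 B0 hF bF; rewrite subr0 /F mulr0 addr0 => h.
  rewrite -[phase C g (t0 + sg * s)](subrK (phase C g t0)) -addrA.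
  apply: le_trans (ler_normD _ _) _.
  have : B * s <= B * eta by apply: ler_wpM2l.
  lra.
have cgs s : {for s, continuous (fun s => g (t0 + sg * s))}.
  apply: (@continuous_comp _ _ _ (fun s => t0 + sg * s) g); last exact: cg.
  apply: cvgD; first exact: cvg_cst.
  by apply: cvgM; [exact: cvg_cst|exact: cvg_id].
have left_point (s : R) (P : R -> Prop) : 0 < s -> (\forall u \near s, P u) ->
    exists2 u : R, 0 <= u < s & P u.
  move=> s0 /near_ball[r r0 hr]; pose u := Num.max 0 (s - r / 2).
  have us : u < s by rewrite gt_max s0 gtrBl divr_gt0.
  exists u; first by rewrite us le_max lexx.
  apply: hr; rewrite distrC gtr0_norm ?subr_gt0// ltrBlDr -ltrBlDl lt_max.
  by apply/orP; right; rewrite ltrD2l ltrN2 ltr_pdivrMr// ltr_pMr// ltr1n.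
pose c := `|phase C g t0 - z1| + rho / 4.
have crho : c < rho by rewrite /c; lra.
have cphase s : mdom C (g (t0 + sg * s)) -> {for s, continuous (fun s => phase C g (t0 + sg * s))}.
  move=> h; apply: (@continuous_comp _ _ _ (fun s => t0 + sg * s) (phase C g)).
    apply: cvgD; first exact: cvg_cst.
    by apply: cvgM; [exact: cvg_cst|exact: cvg_id].
  exact: is_derive_cont (phase_is_derive hg h).
apply: real_induction.
- move=> s /andP[s0 se] hs.
  have [->|sn0] := eqVneq s 0.
    by rewrite /good mulr0 addr0; split=> //; apply: lt_trans hz _; rewrite ltr_pdivrMr// ltr_pMr// ltr1n.
  have sp : 0 < s by rewrite lt_neqAle eq_sym sn0.
  have hb u : 0 <= u < s -> `|phase C g (t0 + sg * u) - z1| <= c.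
    move=> /andP[u0 us]; apply: bnd; first by rewrite u0 (le_trans (ltW us)).
    by move=> v /andP[v0 vu]; apply: hs; rewrite v0 (le_lt_trans vu).
  (* The image of this compact ball is closed because M is Hausdorff, so it contains the limit of
     the earlier points; hence the geodesic is still in the chart at time s. *)
  pose A := closed_ball_ Num.norm (lsubmx z1) c.
  have Aimg p : A p -> chart_img C p.
    rewrite /A /closed_ball_ /= => hp; apply: hd0; apply: lt_le_trans rd0.
    by rewrite distrC; apply: le_lt_trans crho.
  have cA : compact A.
    apply: bounded_closed_compact; last exact: closed_closed_ball_.
    exists (c + `|lsubmx z1|); split; first by rewrite num_real.
    move=> r hr p /=; rewrite /closed_ball_ /= => hp.
    apply: ltW; apply: le_lt_trans hr; rewrite -[p](subrK (lsubmx z1)).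
    by apply: le_trans (ler_normD _ _) _; rewrite lerD2r distrC.
  have cK : closed (minv C @` A).
    apply: compact_closed; first exact: mhausdorff.
    apply: continuous_compact => //; apply: continuous_in_subspaceT => p.
    by rewrite inE => /Aimg; apply: minv_continuous.
  have gK : (minv C @` A) (g (t0 + sg * s)).
    apply: contrapT => hn.
    have : \forall u \near s, (~` (minv C @` A)) (g (t0 + sg * u)).
      apply: (cgs s (~` (minv C @` A))); apply: open_nbhs_nbhs; split => //.
      exact: closed_openC.
    move=> /(left_point s _ sp)[u us]; apply.
    have [h1 _] := hs u us.
    exists (mchart C (g (t0 + sg * u))); last by rewrite mchartK.
    rewrite /A /closed_ball_ /= distrC; apply: le_trans (hb u us).
    rewrite /phase -[z1 in leRHS]hsubmxK opp_row_mx add_row_mx.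
    by have := norm_lsubmx_le (row_mx (mchart C (g (t0 + sg * u)) - lsubmx z1)
      (velocity_in C g (t0 + sg * u) - rsubmx z1)); rewrite row_mxKl.
  have hCs : mdom C (g (t0 + sg * s)).
    by have [p /Aimg/chart_imgP[h _] <-] := gK.
  split=> //; apply: le_lt_trans crho; rewrite leNgt; apply/negP => hlt.
  have c0 : 0 < `|phase C g (t0 + sg * s) - z1| - c by rewrite subr_gt0.
  have /cvgrPdist_lt/(_ _ c0)/(left_point s _ sp)[u us] := cphase s hCs.
  move=> h; have := hb u us; rewrite leNgt => /negP; apply.
  rewrite -(ltrD2l `|phase C g (t0 + sg * s) - phase C g (t0 + sg * u)|) -ltrBrDr.
  by apply: lt_le_trans h _; rewrite lerD2r; exact: ler_distD.
- move=> s /andP[s0 se] hs; have [h1 h2] : good s by apply: hs; rewrite s0 lexx.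
  have c0 : 0 < rho - `|phase C g (t0 + sg * s) - z1| by rewrite subr_gt0.
  have /cvgrPdist_lt/(_ _ c0) n1 := cphase s h1.
  have n2 : \forall u \near s, mdom C (g (t0 + sg * u)) by apply: (near_dom (cgs s)).
  have /near_ball[d d0' hd] : \forall u \near s, good u.
    apply: filterS2 n1 n2 => u u1 u2; split; first exact: u2.
    apply: le_lt_trans (ler_distD (phase C g (t0 + sg * s)) _ _) _.
    by rewrite -ltrBrDr distrC.
  exists d; first exact: d0'. move=> u /andP[su ud] _; apply: hd.
  by rewrite gtr0_norm ?subr_gt0// ltrBlDl.
Qed.

End spray.

Section geodesic_flow.
Context {R : realType} {n : nat} {M : riemannianManifold R n}.
Implicit Types (C : mindex M) (x : M).

Lemma geodesic_cont (g : R -> M) (t : R) : geodesic g -> {for t, continuous g}.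
Proof. by move=> [h _]; exact: h. Qed.

Lemma phase_cont C (g : R -> M) (t : R) : geodesic g -> mdom C (g t) ->
  {for t, continuous (phase C g)}.
Proof. by move=> hg hC; apply: is_derive_cont (phase_is_derive hg hC). Qed.

Lemma phase_img C (g : R -> M) (t : R) : mdom C (g t) -> chart_img C (lsubmx (phase C g t)).
Proof. by rewrite /phase row_mxKl => /chart_img_in. Qed.

Lemma velocity_in_transition C C' (g : R -> M) (t : R) : geodesic g -> mdom C (g t) ->
  mdom C' (g t) -> velocity_in C' g t = velocity_in C g t *m jac C C' (g t).
Proof.
by move=> hg h h'; rewrite -!geodesic_velocity// tangent_in_jac.
Qed.

Lemma phase_eq C (g g' : R -> M) (t : R) : geodesic g -> geodesic g' -> mdom C (g t) ->
  g t = g' t -> velocity g t = velocity g' t -> phase C g t = phase C g' t.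
Proof.
move=> hg hg' hC e ev; have hC' : mdom C (g' t) by rewrite -e.
by rewrite /phase -(geodesic_velocity hg)// -(geodesic_velocity hg')// ev e.
Qed.

Lemma phase_eq_inv C (g g' : R -> M) (t : R) : geodesic g -> geodesic g' -> mdom C (g t) -> mdom C (g' t) ->
  phase C g t = phase C g' t -> g t = g' t /\ velocity g t = velocity g' t.
Proof.
move=> hg hg' hC hC' /eq_row_mx[e1 e2].
have e : g t = g' t by rewrite -(mchartK hC) e1 mchartK.
split=> //; rewrite /velocity -e; have ha := mem_chart_at (g t).
rewrite (velocity_in_transition hg hC ha) (@velocity_in_transition C _ g')// -?e//.
by rewrite e2.
Qed.

(** With d <= eta / 2 any two times in the window are at most eta apart, so the box can be entered
    at either one. *)
Lemma flow_box_time C (g : R -> M) (t1 : R) : geodesic g -> mdom C (g t1) ->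
  exists rho L eta d, [/\ flow_box C (phase C g t1) rho L eta, 0 < d, d <= eta / 2 &
    forall s, `|s - t1| < d -> mdom C (g s) /\ `|phase C g s - phase C g t1| < rho / 2].
Proof.
move=> hg hC.
have [rho [L [eta fb]]] := exists_flow_box (phase_img hC).
have r2 : 0 < rho / 2 by rewrite divr_gt0// (fb_rho fb).
have /cvgrPdist_lt/(_ _ r2) n1 := phase_cont hg hC.
have [d d0 hd] := near_ball (filterI (near_dom (geodesic_cont hg) hC) n1).
exists rho, L, eta, (Num.min d (eta / 2)); split=> //.
- by rewrite lt_min d0 divr_gt0// (fb_eta fb).
- by rewrite ge_min lexx orbT.
- by move=> s; rewrite lt_min => /andP[/hd[s1 s2] _]; split; [exact: s1|rewrite distrC; exact: s2].
Qed.

Lemma half_time (s u t d eta : R) : d <= eta / 2 -> `|s - t| < d -> `|u - t| < d -> `|u - s| <= eta.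
Proof.
move=> de h1 h2; have -> : u - s = (u - t) - (s - t) by ring.
by apply: le_trans (ler_normB _ _) _; lra.
Qed.

(** In a flow box the phases differ by a curve with |d'| <= L |d| that vanishes at one time; the
    agreement then propagates from box to box. *)
Lemma geodesic_unique (g g' : R -> M) (t0 : R) : geodesic g -> geodesic g' ->
  g t0 = g' t0 -> velocity g t0 = velocity g' t0 -> forall t, g t = g' t.
Proof.
move=> hg hg' e ev t.
suff : g t = g' t /\ velocity g t = velocity g' t by case.
move: t; apply: (real_propagate (P := fun t => g t = g' t /\ velocity g t = velocity g' t) (conj e ev)).
move=> t1; set C := chart_at (g t1).
have [rho [L [eta [d [fb d0 de hd]]]]] := flow_box_time hg (mem_chart_at (g t1) : mdom C (g t1)).
exists d => // s u hs hu [es evs].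
have [hC hz] := hd s hs; have hC' : mdom C (g' s) by rewrite -es.
have hp : phase C g s = phase C g' s by apply: phase_eq.
have hz' : `|phase C g' s - phase C g t1| < rho / 2 by rewrite -hp.
have us := half_time de hs hu.
have st := fb_stay fb hg hC hz; have st' := fb_stay fb hg' hC' hz'.
have [hCu _] := st u us; have [hCu' _] := st' u us.
apply: (phase_eq_inv hg hg' hCu hCu').
have := @short_time_bound R (n + n) (fun t => phase C g t - phase C g' t)
  (fun t => spray C (phase C g t) - spray C (phase C g' t)) s eta L 0 (fb_eta fb) (fb_L fb) (fb_small fb) (lexx 0).
rewrite hp subrr normr0 !mulr0 addr0 => H; have := H _ _ u us.
move=> H'; apply/eqP; rewrite -subr_eq0 -normr_le0; apply: H'.
- move=> t ht; have [h1 _] := st t ht; have [h2 _] := st' t ht.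
  by apply: is_derive_sub; apply: phase_is_derive.
- move=> t ht; have [_ h1] := st t ht; have [_ h2] := st' t ht.
  by rewrite addr0; apply: (fb_lip fb).
Qed.

End geodesic_flow.

(** * Dependence of geodesics on the initial velocity *)

Section exponential.
Context {R : realType} {n : nat} {M : riemannianManifold R n}.
Hypothesis hM : complete_manifold M.
Variable p : M.
Implicit Types (C : mindex M) (v w : 'rV[R]_n).

(** Completeness provides the geodesic with initial velocity v for all times; [geodesic_unique]
    makes the choice harmless. *)
Definition geo v : R -> M := projT1 (cid (@hM p v)).

Lemma geoP v : [/\ geodesic (geo v), geo v 0 = p & velocity (geo v) 0 = v :> 'rV_n].
Proof. by rewrite /geo; case: cid. Qed.

Lemma geo_geodesic v : geodesic (geo v). Proof. by have [] := geoP v. Qed.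
Lemma geo0 v : geo v 0 = p. Proof. by have [] := geoP v. Qed.
Lemma geo_velocity0 v : velocity (geo v) 0 = v :> 'rV_n. Proof. by have [] := geoP v. Qed.

Lemma geo_unique (g : R -> M) v : geodesic g -> g 0 = p -> velocity g 0 = v :> 'rV_n ->
  forall t, g t = geo v t.
Proof.
move=> hg g0 gv; have [h1 h2 h3] := geoP v.
by apply: (@geodesic_unique R n M g (geo v) 0) => //; rewrite ?g0 ?h2// gv h3.
Qed.

(** The middle clause keeps neighbouring geodesics inside the chart at time t: outside of it [phase]
    is meaningless and a change of chart could not be justified. *)
Definition SDin C (D : 'M[R]_(n, n + n)) v0 (t : R) :=
  [/\ mdom C (geo v0 t),
      (exists2 d : R, 0 < d & forall v, `|v - v0| < d -> mdom C (geo v t)) &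
      sd (fun v => phase C (geo v) t) v0 D].

Lemma has_sdr_sd m k (F : 'rV[R]_m -> 'rV[R]_k) q : (forall j, has_sdr (fun y => F y 0 j) q) ->
  exists D, sd F q D.
Proof.
move=> h; exists (\matrix_(i, j) projT1 (cid (h j)) i 0); apply/sdP => j.
have -> : col j (\matrix_(i, j0) projT1 (cid (h j0)) i 0) = projT1 (cid (h j)).
  by apply/colP => i; rewrite !mxE.
by case: cid.
Qed.

(** The coordinate change of the tangent bundle. *)
Definition phase_transition C C' (z : 'rV[R]_(n + n)) : 'rV[R]_(n + n) :=
  row_mx (transition C C' (lsubmx z)) (rsubmx z *m jacobian_mx (transition C C') (lsubmx z)).

Lemma phase_transition_sd C C' z : transition_dom C C' (lsubmx z) ->
  exists D, sd (phase_transition C C') z D.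
Proof.
move=> hz; apply: has_sdr_sd => j; rewrite -[j]splitK; case: (fintype.split j) => k /=.
  apply: (@has_sdr_ext _ _ (fun q : 'rV[R]_(n + n) => transition C C' (lsubmx q) 0 k)).
    by move=> q; rewrite row_mxEl.
  apply: (@has_sdr_lsubmx R n (fun q => transition C C' q 0 k)).
  by have /sdP/(_ k) h := transition_sd hz; eexists; exact: h.
apply: (@has_sdr_ext _ _ (fun q : 'rV[R]_(n + n) =>
   \sum_i rsubmx q 0 i * partial i (fun q => transition C C' q 0 k) (lsubmx q))).
  by move=> q; rewrite row_mxEr [RHS]mxE; apply: eq_bigr => i _; congr (_ * _); rewrite [RHS]mxE.
apply: has_sdr_sum => i; apply: has_sdrM; first exact: has_sdr_rsubmx.
apply: (@has_sdr_lsubmx R n (partial i (fun q => transition C C' q 0 k))).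
have [h1 h2 h3] := transition_domP hz.
by rewrite -h3; eexists; apply: jac_entry_sdr.
Qed.

Lemma phase_transitionE C C' (g : R -> M) (t : R) : geodesic g -> mdom C (g t) -> mdom C' (g t) ->
  phase_transition C C' (phase C g t) = phase C' g t.
Proof.
move=> hg h h'; rewrite /phase_transition /phase row_mxKl row_mxKr /transition mchartK//.
by rewrite (velocity_in_transition hg h h').
Qed.

Lemma SDin_change C C' D v0 t : SDin C D v0 t -> mdom C' (geo v0 t) -> exists D', SDin C' D' v0 t.
Proof.
move=> [hC [d d0 hd] hsd] hC'.
have [r r0 hr] := transition_near hC hC'.
have [L L0 [d1 d10 hL]] := sd_lip hsd.
have near : exists2 d : R, 0 < d & forall v, `|v - v0| < d -> mdom C (geo v t) /\ mdom C' (geo v t).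
  exists (Num.min d (Num.min d1 (r / L))); first by rewrite !lt_min d0 d10 divr_gt0.
  move=> v; rewrite !lt_min => /and3P[vd vd1 vr]; have hv := hd v vd; split=> //.
  have : transition_dom C C' (mchart C (geo v t)).
    apply: hr; have := hL v v0 vd1; rewrite subrr normr0 => /(_ d10) H.
    rewrite ltr_pdivlMr// mulrC in vr; apply: le_lt_trans vr; apply: le_trans H.
    rewrite /phase opp_row_mx add_row_mx.
    have := norm_lsubmx_le (row_mx (mchart C (geo v t) - mchart C (geo v0 t))
      (velocity_in C (geo v) t - velocity_in C (geo v0) t)).
    by rewrite row_mxKl.
  by move=> /transition_domP[_]; rewrite mchartK.
have [E hE] : exists E, sd (phase_transition C C') (phase C (geo v0) t) E.
  by apply: phase_transition_sd; rewrite /phase row_mxKl; apply: transition_dom_in.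
have [d2 d20 hd2] := near.
exists (D *m E); split=> //; first by exists d2 => // v /hd2[].
apply: sd_near d20 _ (sd_comp hsd hE) => v /hd2[h1 h2] /=.
by apply: phase_transitionE => //; exact: geo_geodesic.
Qed.

(** Chain rule: the differential at time s is followed by the differential [Y] of the flow from s to
    u. *)
Lemma SDin_step C v0 (t1 rho L eta d s : R) D :
  flow_box C (phase C (geo v0) t1) rho L eta ->
  mdom C (geo v0 s) -> `|phase C (geo v0) s - phase C (geo v0) t1| < rho / 2 ->
  SDin C D v0 s ->
  exists Y : R -> 'M[R]_(n + n), [/\ Y s = 1%:M,
    forall u, `|u - s| <= eta -> is_derive u 1 Y (Y u *m Dspray C (phase C (geo v0) u)) &
    forall u, `|u - s| <= eta -> SDin C (D *m Y u) v0 u].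
Proof.
move=> fb hCs hz [_ [d0 d00 hd0] hsd].
have st0 := fb_stay fb (geo_geodesic v0) hCs hz.
have sol v : mdom C (geo v s) -> `|phase C (geo v) s - phase C (geo v0) t1| < rho / 2 ->
    forall t, `|t - s| <= eta -> `|phase C (geo v) t - phase C (geo v0) t1| < rho /\
      is_derive t 1 (phase C (geo v)) (spray C (phase C (geo v) t)).
  move=> h1 h2 t ht; have [h3 h4] := fb_stay fb (geo_geodesic v) h1 h2 ht.
  by split=> //; apply: phase_is_derive => //; exact: geo_geodesic.
have [Y [Y0 hY flow]] := @flow_sd R (n + n) (spray C) (Dspray C) (phase C (geo v0) t1) rho L s eta
  (phase C (geo v0)) (fb_eta fb) (fb_L fb) (fb_small fb) (fb_small' fb)
  (fun z hz => spray_sd (fb_img fb hz)) (fb_D fb) (fb_lip fb) (sol v0 hCs hz).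
exists Y; split=> // u hu.
have [L1 L10 [d1 d10 hL1]] := sd_lip hsd.
pose r := rho / 2 - `|phase C (geo v0) s - phase C (geo v0) t1|.
have r0 : 0 < r by rewrite subr_gt0.
have nb (d' : R) : 0 < d' -> exists2 d2 : R, 0 < d2 & forall v, `|v - v0| < d2 ->
    [/\ mdom C (geo v s), `|v - v0| < d1, `|phase C (geo v) s - phase C (geo v0) s| < d' &
     `|phase C (geo v) s - phase C (geo v0) t1| < rho / 2].
  move=> d'0; exists (Num.min (Num.min d0 d1) (Num.min (r / L1) (d' / L1))).
    by rewrite !lt_min d00 d10 !divr_gt0.
  move=> v; rewrite !lt_min -andbA => /and4P[v1 v2 v3 v4].
  have := hL1 v v0 v2; rewrite subrr normr0 => /(_ d10) H.
  have {}v3 : L1 * `|v - v0| < r by rewrite mulrC -(ltr_pdivlMr _ _ L10).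
  have {}v4 : L1 * `|v - v0| < d' by rewrite mulrC -(ltr_pdivlMr _ _ L10).
  split; [exact: hd0|exact: v2|exact: le_lt_trans v4|].
  rewrite -[phase C (geo v) s](subrK (phase C (geo v0) s)) -addrA.
  by apply: le_lt_trans (ler_normD _ _) _; rewrite -ltrBrDr; apply: le_lt_trans v3.
have hCu : mdom C (geo v0 u) by have [] := st0 u hu.
split=> //.
  have [d2 d20 hd2] := nb 1 ltr01; exists d2 => // v /hd2[v1 _ _ v4].
  by have [] := fb_stay fb (geo_geodesic v) v1 v4 hu.
move=> e e0.
have [d' d'0 hd'] := flow (e / 2 / L1) (divr_gt0 (divr_gt0 e0 (ltr0Sn _ 1)) L10).
pose K := (n + n)%:R * `|Y u|.
have K0 : 0 <= K by rewrite mulr_ge0.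
have [d3 d30 hd3] := hsd (e / 2 / (K + 1)) (divr_gt0 (divr_gt0 e0 (ltr0Sn _ 1)) (ltr_wpDl K0 ltr01)).
have [d2 d20 hd2] := nb d' d'0.
exists (Num.min d2 d3); first by rewrite lt_min d20.
move=> v1 v2; rewrite !lt_min => /andP[/hd2[a1 a2 a3 a4] a5] /andP[/hd2[b1 b2 b3 b4] b5].
have F := hd' _ _ (sol v1 a1 a4) (sol v2 b1 b4) a3 b3 u hu.
have S := hd3 v1 v2 a5 b5; have L' := hL1 v1 v2 a2 b2.
rewrite (_ : _ - _ = (phase C (geo v1) u - phase C (geo v2) u -
  (phase C (geo v1) s - phase C (geo v2) s) *m Y u) +
  (phase C (geo v1) s - phase C (geo v2) s - (v1 - v2) *m D) *m Y u); last first.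
  move: (phase C (geo v1) u) (phase C (geo v2) u) (phase C (geo v1) s) (phase C (geo v2) s) => w1 w2 w3 w4.
  by mxring.
apply: le_trans (ler_normD _ _) _; rewrite (splitr e) mulrDl; apply: lerD.
  apply: le_trans F _; apply: le_trans (ler_wpM2l _ L') _; first by rewrite !divr_ge0 ?(ltW e0) ?(ltW L10).
  by rewrite mulrA divfK// gt_eqF.
apply: le_trans (mulmx_norm_le _ _) _; rewrite mulrAC -/K.
apply: le_trans (ler_wpM2l K0 S) _; rewrite mulrA ler_wpM2r//.
by rewrite absorb_le// divr_ge0// ltW.
Qed.

Lemma SDin0 v0 : exists C D, SDin C D v0 0.
Proof.
set C := chart_at p; have hp : mdom C p by exact: mem_chart_at.
exists C, (row_mx 0 1%:M); split; first by rewrite geo0.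
  by exists 1 => // v _; rewrite geo0.
have E v : phase C (geo v) 0 = row_mx (mchart C p) v.
  rewrite /phase -geodesic_velocity ?geo0//; last exact: geo_geodesic.
  by rewrite geo_velocity0 -/C tangent_in_at.
move=> e e0; exists 1 => // v v' _ _; rewrite !E.
rewrite mul_mx_row mulmx0 mulmx1 opp_row_mx add_row_mx subrr opp_row_mx add_row_mx !subrr.
by rewrite row_mx0 normr0 mulr_ge0// ltW.
Qed.

(** From time 0, where position is constant and velocity is v, differentiability is carried across
    flow boxes with a change of chart in each. *)
Lemma exists_SDin C v0 t : mdom C (geo v0 t) -> exists D, SDin C D v0 t.
Proof.
suff : exists C D, SDin C D v0 t.
  by move=> [C' [D hD]]; apply: SDin_change hD.
move: t; apply: (real_propagate (P := fun t => exists C D, SDin C D v0 t) (SDin0 v0)) => t1.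
set C1 := chart_at (geo v0 t1).
have [rho [L [eta [d [fb d0 de hd]]]]] :=
  flow_box_time (geo_geodesic v0) (mem_chart_at (geo v0 t1) : mdom C1 (geo v0 t1)).
exists d; first exact: d0.
move=> s u hs hu [C' [D hD]]; have [h1 h2] := hd s hs.
have [D' hD'] := SDin_change hD h1.
have [Y [_ _ hY]] := SDin_step d fb h1 h2 hD'.
by exists C1, (D' *m Y u); apply: hY; apply: half_time de hs hu.
Qed.

Definition dphase C v0 t : 'M[R]_(n, n + n) := xget 0 [set D | sd (fun v => phase C (geo v) t) v0 D].

Lemma dphaseE C D v0 t : SDin C D v0 t -> dphase C v0 t = D.
Proof.
move=> [_ _ h]; apply: sd_uniq (h).
exact: (@xgetPex _ 0 [set D | sd (fun v => phase C (geo v) t) v0 D] (ex_intro _ D h)).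
Qed.

Lemma dphaseP C v0 t : mdom C (geo v0 t) -> SDin C (dphase C v0 t) v0 t.
Proof. by move=> /exists_SDin[D hD]; rewrite (dphaseE hD). Qed.

Lemma dphase_is_derive C v0 t : mdom C (geo v0 t) ->
  is_derive t 1 (dphase C v0) (dphase C v0 t *m Dspray C (phase C (geo v0) t)).
Proof.
move=> hC; have [rho [L [eta [d [fb d0 de hd]]]]] := flow_box_time (geo_geodesic v0) hC.
have tt : `|t - t| < d by rewrite subrr normr0.
have [h1 h2] := hd t tt.
have [Y [Y0 hY hSD]] := SDin_step d fb h1 h2 (dphaseP hC).
have eta0 := fb_eta fb.
have tt' : `|t - t| <= eta by rewrite subrr normr0 ltW.
have := is_derive_mulmx (is_derive_cst1 (dphase C v0 t) t) (hY t tt').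
rewrite mul0mx add0r Y0 mul1mx; apply: near_is_derive.
by apply: ball_near eta0 _ => s hs; rewrite (dphaseE (hSD s (ltW hs))).
Qed.

End exponential.

Lemma lsubmx_mulmx {R : realType} {m k l r : nat} (w : 'M[R]_(m, k)) (D : 'M[R]_(k, l + r)) :
  lsubmx (w *m D) = w *m lsubmx D.
Proof. by rewrite -{1}[D]hsubmxK mul_mx_row row_mxKl. Qed.

Lemma rsubmx_mulmx {R : realType} {m k l r : nat} (w : 'M[R]_(m, k)) (D : 'M[R]_(k, l + r)) :
  rsubmx (w *m D) = w *m rsubmx D.
Proof. by rewrite -{1}[D]hsubmxK mul_mx_row row_mxKr. Qed.

Lemma is_derive_row_mxK {R : realType} {m l r : nat} (A : R -> 'M[R]_(m, l + r)) (t : R)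
    (L : 'M[R]_(m, l)) (K : 'M[R]_(m, r)) :
  is_derive t 1 A (row_mx L K) ->
  is_derive t 1 (fun s => lsubmx (A s)) L /\ is_derive t 1 (fun s => rsubmx (A s)) K.
Proof.
move=> h; split.
  have := is_derive_mulmx h (is_derive_cst1 (col_mx 1%:M 0) t).
  rewrite mulmx0 addr0 mul_row_col mulmx1 mulmx0 addr0.
  by congr (is_derive _ _ _ _); apply/funext => s; rewrite -{1}[A s]hsubmxK mul_row_col mulmx1 mulmx0 addr0.
have := is_derive_mulmx h (is_derive_cst1 (col_mx 0 1%:M) t).
rewrite mulmx0 addr0 mul_row_col mulmx1 mulmx0 add0r.
by congr (is_derive _ _ _ _); apply/funext => s; rewrite -{1}[A s]hsubmxK mul_row_col mulmx1 mulmx0 add0r.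
Qed.

(** * Jacobi fields as variations of geodesics *)

Section jacobi.
Context {R : realType} {n : nat} {M : riemannianManifold R n}.
Hypothesis hM : complete_manifold M.
Implicit Types (C : mindex M) (v w : 'rV[R]_n).

Lemma geodesic_curve C (g : R -> M) (t : R) : geodesic g -> mdom C (g t) ->
  is_derive t 1 (fun s => mchart C (g s)) (velocity_in C g t).
Proof. by move=> hg hC; have [] := geodesic_chart hg hC. Qed.

Lemma cov_dot (g : R -> M) (V V' W W' : R -> 'rV[R]_n) (t : R) : geodesic g ->
  has_cov g V V' t -> has_cov g W W' t ->
  is_derive t 1 (fun s => inner (g s) (V s) (W s))
    (inner (g t) (V' t) (W t) + inner (g t) (V t) (W' t)).
Proof.
move=> hg; have hC := mem_chart_at (g t).
exact: has_cov_dot (geodesic_cont hg) hC (geodesic_curve hg hC).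
Qed.

Lemma tangent_in0 C (x : M) : tangent_in C x 0 = 0.
Proof. by rewrite tangent_inE mul0mx. Qed.

Lemma velocity_cov (g : R -> M) (t : R) : geodesic g ->
  has_cov g (fun s => velocity g s) (fun=> 0) t.
Proof.
move=> hg C u hC hu; have uE := velocity_inE hu.
rewrite tangent_in0 sub0r geodesic_velocity// -uE.
have [_ h] := geodesic_chart hg hC.
apply: near_is_derive h; apply: filterS (near_dom (geodesic_cont hg) hC) => s hs.
by rewrite geodesic_velocity.
Qed.

Variable p : M.
Notation geo := (geo hM p).
Notation dphase := (dphase hM p).

Lemma sd_lsubmx C v0 t : mdom C (geo v0 t) ->
  sd (fun v => mchart C (geo v t)) v0 (lsubmx (dphase C v0 t)).
Proof.
move=> hC; have [_ _ h] := dphaseP hC.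
have := sd_comp h (sd_mul (col_mx 1%:M 0) (phase C (geo v0) t)).
have -> : dphase C v0 t *m col_mx 1%:M 0 = lsubmx (dphase C v0 t).
  by rewrite -[dphase C v0 t in LHS]hsubmxK mul_row_col mulmx1 mulmx0 addr0.
by apply: sd_near ltr01 _ => v _ /=; rewrite -lsubmx_mul /phase row_mxKl.
Qed.

(** The derivative at v0 in the direction w of the point reached at time t: the Jacobi field along
    the geodesic that vanishes at 0 with initial covariant derivative w. *)
Definition Jac v0 w t : 'rV[R]_n := lsubmx (w *m dphase (chart_at (geo v0 t)) v0 t).

(** The covariant derivative of [Jac]: the ordinary derivative in the preferred chart plus the
    Christoffel correction. *)
Definition JacV v0 w t : 'rV[R]_n :=
  let C := chart_at (geo v0 t) in
  rsubmx (w *m dphase C v0 t) + lsubmx (w *m dphase C v0 t) *m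
    GamU C (mchart C (geo v0 t)) (velocity_in C (geo v0) t).

(** The differentials in two charts are related by the Jacobian of the coordinate change, by
    uniqueness of strict derivatives; so the preferred chart, which jumps along the curve, does no
    harm. *)
Lemma Jac_chart C v0 w t : mdom C (geo v0 t) ->
  tangent_in C (geo v0 t) (Jac v0 w t) = lsubmx (w *m dphase C v0 t).
Proof.
move=> hC; have ha : mdom (chart_at (geo v0 t)) (geo v0 t) := mem_chart_at _.
have E : lsubmx (dphase (chart_at (geo v0 t)) v0 t) *m jac (chart_at (geo v0 t)) C (geo v0 t) =
    lsubmx (dphase C v0 t).
  have h2 := sd_comp (sd_lsubmx ha) (jac_sd ha hC).
  have [_ [d d0 hd] _] := dphaseP ha.
  apply: sd_uniq (sd_lsubmx hC); apply: sd_near d0 _ h2 => v /hd hv /=.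
  by rewrite /transition mchartK.
by rewrite lsubmx_mulmx -E mulmxA -lsubmx_mulmx tangent_inE.
Qed.

Lemma wdphase_is_derive C v0 w t : mdom C (geo v0 t) ->
  let J := lsubmx (w *m dphase C v0 t) in let K := rsubmx (w *m dphase C v0 t) in
  let u := velocity_in C (geo v0) t in let q := mchart C (geo v0 t) in
  is_derive t 1 (fun s => lsubmx (w *m dphase C v0 s)) K /\
  is_derive t 1 (fun s => rsubmx (w *m dphase C v0 s))
    (- (K *m GamU C q u + u *m (dGam C q J u + GamU C q K))).
Proof.
move=> hC J K u q.
have h : is_derive t 1 (fun s => w *m dphase C v0 s)
    (row_mx K (- (K *m GamU C q u + u *m (dGam C q J u + GamU C q K)))).
  have := is_derive_mulmx (is_derive_cst1 w t) (dphase_is_derive hC).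
  rewrite mul0mx add0r mulmxA -[w *m dphase C v0 t in X in is_derive _ _ _ X -> _]hsubmxK.
  by rewrite Dspray_mul ?row_mxKl ?row_mxKr//; rewrite /phase ?row_mxKl; exact: chart_img_in.
exact: is_derive_row_mxK h.
Qed.

Lemma Jac_cov v0 w t : has_cov (geo v0) (Jac v0 w) (JacV v0 w) t.
Proof.
have hg := geo_geodesic hM p v0; set C := chart_at (geo v0 t).
have hC : mdom C (geo v0 t) := mem_chart_at _.
apply: (has_cov_chart hM (geodesic_cont hg) hC (geodesic_curve hg hC)).
have [h _] := wdphase_is_derive w hC.
rewrite Jac_chart// tangent_in_at /JacV addrK; apply: near_is_derive h.
by apply: filterS (near_dom (geodesic_cont hg) hC) => s hs; rewrite Jac_chart.
Qed.

Lemma JacV_chart C v0 w t : mdom C (geo v0 t) ->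
  tangent_in C (geo v0 t) (JacV v0 w t) = rsubmx (w *m dphase C v0 t) +
    lsubmx (w *m dphase C v0 t) *m GamU C (mchart C (geo v0 t)) (velocity_in C (geo v0) t).
Proof.
move=> hC; have hg := geo_geodesic hM p v0.
have h1 := @Jac_cov v0 w t C _ hC (geodesic_curve hg hC).
have [h2 _] := wdphase_is_derive w hC.
have h3 : is_derive t 1 (fun s => tangent_in C (geo v0 s) (Jac v0 w s)) (rsubmx (w *m dphase C v0 t)).
  apply: near_is_derive h2; apply: filterS (near_dom (geodesic_cont hg) hC) => s hs.
  by rewrite Jac_chart.
by have := is_derive_uniq h3 h1; rewrite Jac_chart// => ->; rewrite subrK.
Qed.

Definition curv_along (g : R -> M) (V : R -> 'rV[R]_n) (t : R) : 'rV[R]_n :=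
  let C := chart_at (g t) in
  velocity g t *m RU C (mchart C (g t)) (velocity g t) (V t).

(** The Jacobi equation J'' = R(g', J) g': the linearised spray, the derivative of the Christoffel
    correction and the geodesic equation combine to the curvature. *)
Lemma JacV_cov v0 w t : has_cov (geo v0) (JacV v0 w) (curv_along (geo v0) (Jac v0 w)) t.
Proof.
have hg := geo_geodesic hM p v0; set C := chart_at (geo v0 t).
have hC : mdom C (geo v0 t) := mem_chart_at _.
have hu := geodesic_curve hg hC.
apply: (has_cov_chart hM (geodesic_cont hg) hC hu).
have [hJ hK] := wdphase_is_derive w hC.
have [_ hv] := geodesic_chart hg hC.
have hG := GamU_curve (chart_img_in hC) hu hv.
have h := is_derive_add hK (is_derive_mulmx hJ hG).
have E : tangent_in C (geo v0 t) (curv_along (geo v0) (Jac v0 w) t) -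
   tangent_in C (geo v0 t) (JacV v0 w t) *m GamU C (mchart C (geo v0 t)) (velocity_in C (geo v0) t) =
  - (rsubmx (w *m dphase C v0 t) *m GamU C (mchart C (geo v0 t)) (velocity_in C (geo v0) t) +
       velocity_in C (geo v0) t *m
       (dGam C (mchart C (geo v0 t)) (lsubmx (w *m dphase C v0 t)) (velocity_in C (geo v0) t) +
        GamU C (mchart C (geo v0 t)) (rsubmx (w *m dphase C v0 t)))) +
   (rsubmx (w *m dphase C v0 t) *m GamU C (mchart C (geo v0 t)) (velocity_in C (geo v0) t) +
     lsubmx (w *m dphase C v0 t) *m
     (dGam C (mchart C (geo v0 t)) (velocity_in C (geo v0) t) (velocity_in C (geo v0) t) +
      GamU C (mchart C (geo v0 t))
        (- (velocity_in C (geo v0) t *m GamU C (mchart C (geo v0 t)) (velocity_in C (geo v0) t))))).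
  rewrite JacV_chart// tangent_in_at /curv_along /Jac.
  rewrite -[velocity (geo v0) t]tangent_in_at geodesic_velocity// -/C.
  move: (velocity_in C (geo v0) t) (lsubmx (w *m dphase C v0 t)) (rsubmx (w *m dphase C v0 t)) => u J K.
  have hq := chart_img_in hC; move: (mchart C (geo v0 t)) hq => q hq.
  have -> : - (u *m GamU C q u) = (-1) *: (u *m GamU C q u) by rewrite scaleN1r.
  rewrite /RU GamUZ// scaleN1r; mxdistr.
  rewrite (dGam_sym u J u hq) (GamU_sym J u hq) (GamU_sym K u hq).
  have -> : u *m GamU C q u *m GamU C q J = J *m GamU C q (u *m GamU C q u) by rewrite (GamU_sym _ J hq).
  by mxring.
rewrite E; apply: near_is_derive h.
by apply: filterS (near_dom (geodesic_cont hg) hC) => s hs; rewrite JacV_chart.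
Qed.

Lemma dphase0 v0 : dphase (chart_at p) v0 0 = row_mx 0 1%:M.
Proof.
set C := chart_at p.
apply: dphaseE; split; first by rewrite geo0; exact: mem_chart_at.
  by exists 1 => // v _; rewrite geo0; exact: mem_chart_at.
have E v : phase C (geo v) 0 = row_mx (mchart C p) v.
  rewrite /phase -geodesic_velocity ?geo0; [|exact: geo_geodesic|exact: mem_chart_at].
  by rewrite geo_velocity0 -/C tangent_in_at.
move=> e e0; exists 1 => // v v' _ _; rewrite !E.
rewrite mul_mx_row mulmx0 mulmx1 opp_row_mx add_row_mx subrr opp_row_mx add_row_mx !subrr.
by rewrite row_mx0 normr0 mulr_ge0// ltW.
Qed.

Lemma Jac0 v0 w : Jac v0 w 0 = 0.
Proof. by rewrite /Jac geo0 dphase0 mul_mx_row row_mxKl mulmx0. Qed.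

Lemma JacV0 v0 w : JacV v0 w 0 = w.
Proof.
by rewrite /JacV geo0 dphase0 mul_mx_row row_mxKr row_mxKl mulmx0 mulmx1 mul0mx addr0.
Qed.

End jacobi.

(** * Parallel transport and Jacobi fields *)

Section gluing.
Context {R : realType} {T : Type}.
Variables (good : (R -> T) -> R -> Prop) (t0 : R) (x0 : T).
Hypothesis germ : forall V V' r, (\forall s \near r, V s = V' s) -> good V r -> good V' r.
Hypothesis uniq : forall V V' a b s r, a < s < b -> a < r < b ->
  (forall u, a < u < b -> good V u /\ good V' u) -> V s = V' s -> V r = V' r.

Definition solves (V : R -> T) (a b : R) := forall r, a < r < b -> good V r.

(** Solvability up to r, on an unspecified open interval that contains both t0 and r; no maximal
    solution is ever formed. *)
Definition reaches (r : R) := exists V a b,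
  [/\ a < t0 < b, a < r < b, V t0 = x0 & solves V a b].

Lemma near_itv (a b r : R) : a < r < b -> exists2 d : R, 0 < d & forall s, `|s - r| < d -> a < s < b.
Proof.
move=> /andP[ar rb]; exists (Num.min (r - a) (b - r)); first by rewrite lt_min !subr_gt0 ar.
move=> s; rewrite lt_min ltr_norml => /andP[/andP[h1 h2]]; rewrite ltr_norml => /andP[h3 h4].
by apply/andP; split; lra.
Qed.

Lemma itv_meet (a b a' b' u v s : R) : a < s < b -> a < u < b -> a' < s < b' -> a' < v < b' ->
  [/\ Num.max a a' < s < Num.min b b',
      (a < v < b -> Num.max a a' < v < Num.min b b') &
      forall r, Num.max a a' < r < Num.min b b' -> a < r < b /\ a' < r < b'].
Proof.
move=> /andP[h1 h2] /andP[h3 h4] /andP[h5 h6] /andP[h7 h8]; split.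
- by rewrite gt_max lt_min h1 h2 h5.
- by move=> /andP[h9 h10]; rewrite gt_max lt_min h9 h10 h7.
- by move=> r; rewrite gt_max lt_min => /andP[/andP[-> ->] /andP[-> ->]].
Qed.

Lemma solves_agree V V' a b a' b' s r : solves V a b -> solves V' a' b' ->
  a < s < b -> a' < s < b' -> a < r < b -> a' < r < b' -> V s = V' s -> V r = V' r.
Proof.
move=> hV hV' s1 s2 r1 r2 e; have [h1 h2 h3] := itv_meet s1 s1 s2 r2.
apply: (uniq h1 (h2 r1)) e => u /h3[u1 u2]; split; [exact: hV|exact: hV'].
Qed.

(** A solution is chosen for each r separately. By uniqueness the values do not depend on the
    choice, so near each point the glued function agrees with one solution, and [good] depends on
    germs only. *)
Lemma glue_choice (I : R -> Prop) : (forall r, I r -> reaches r) ->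
  (forall r, I r -> exists2 d : R, 0 < d & forall s, `|s - r| < d -> I s) -> I t0 ->
  exists2 V, V t0 = x0 & forall r, I r -> good V r.
Proof.
move=> h I_open It0.
pose V r := if pselect (I r) is left p then projT1 (cid (h r p)) r else x0.
have VE r : I r -> forall W a b, a < t0 < b -> a < r < b -> W t0 = x0 -> solves W a b -> V r = W r.
  move=> Ir W a b ab rab W0 sW; rewrite /V; case: pselect => // p.
  case: cid => W' /= [a' [b' [h1 h2 h3 h4]]].
  by apply: (solves_agree h4 sW h1 ab h2 rab); rewrite h3.
exists V.
  by have [W [a [b [h1 h2 h3 h4]]]] := h t0 It0; rewrite (VE t0 It0 W a b).
move=> r Ir; have [W [a [b [h1 h2 h3 h4]]]] := h r Ir.
apply: germ (h4 r h2); have [d d0 hd] := I_open r Ir; have [d1 d10 hd1] := near_itv h2.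
apply: (@ball_near _ r (Num.min d d1)); first by rewrite lt_min d0.
by move=> s; rewrite lt_min => /andP[/hd Is /hd1 sab]; apply/esym/(VE s Is W a b).
Qed.

(** Two solutions that agree at one common time agree on the overlap, hence paste to a solution on
    the union. *)
Lemma glue_extend V a b V' a' b' s : a < t0 < b -> V t0 = x0 -> solves V a b ->
  solves V' a' b' -> a < s < b -> a' < s < b' -> V s = V' s ->
  forall r, a' < r < b' -> reaches r.
Proof.
move=> t0ab V0 hV hV' s1 s2 e r r2.
pose W u := if a < u < b then V u else V' u.
have WV u : a < u < b -> \forall v \near u, V v = W v.
  move=> /near_itv[d d0 hd]; apply: (ball_near d0) => v /hd vab.
  by rewrite /W vab.
have WV' u : a' < u < b' -> \forall v \near u, V' v = W v.
  move=> /near_itv[d d0 hd]; apply: (ball_near d0) => v /hd vab.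
  rewrite /W; case: ifP => // vab'.
  by apply/esym; apply: (solves_agree hV hV' s1 s2 vab' vab e).
exists W, (Num.min a a'), (Num.max b b'); split.
- by rewrite gt_min lt_max; case/andP: t0ab => -> ->.
- by rewrite gt_min lt_max; case/andP: r2 => -> ->; rewrite !orbT.
- by rewrite /W t0ab.
- move=> u; rewrite gt_min lt_max => uW.
  have [u1|u1] := boolP (a < u < b); first by apply: germ (WV _ u1) (hV u u1).
  have u2 : a' < u < b'.
    move: s1 s2 u1 uW => /andP[s1 s1'] /andP[s2 s2']; rewrite negb_and -!leNgt => /orP[ua|bu].
      by rewrite [a < u]ltNge ua /= => /andP[-> _] /=; apply: le_lt_trans ua (lt_trans s1 s2').
    by rewrite [u < b]ltNge bu /= => /andP[_ ->]; rewrite andbT; apply: lt_le_trans bu; apply: lt_trans s2 s1'.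
  by apply: germ (WV' _ u2) (hV' u u2).
Qed.

End gluing.

Section glue_global.
Context {R : realType} {T : Type}.

Lemma glue_right (good : (R -> T) -> R -> Prop) (t0 c : R) (x0 : T) :
  (forall V V' r, (\forall s \near r, V s = V' s) -> good V r -> good V' r) ->
  (forall V V' a b s r, a < s < b -> a < r < b ->
    (forall u, a < u < b -> good V u /\ good V' u) -> V s = V' s -> V r = V' r) ->
  (exists V a b, [/\ a < t0 < b, V t0 = x0 & solves good V a b]) ->
  (forall V a t, a < t0 < t -> t <= c -> V t0 = x0 -> solves good V a t ->
     exists V' a' b' s, [/\ solves good V' a' b', a' < t < b', a' < s < b', t0 < s < t & V s = V' s]) ->
  forall t, t0 <= t <= c -> reaches good t0 x0 t.
Proof.
move=> germ uniq base ext.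
apply: real_induction.
- move=> t /andP[]; rewrite le_eqVlt => /orP[/eqP <- _ _|t0t tc ht].
    by have [V [a [b [h1 h2 h3]]]] := base; exists V, a, b.
  have [V0 [a0 [b0 [h1 h2 h3]]]] := base.
  have a0t0 : a0 < t0 by case/andP: h1.
  have [|r /andP[r1 r2]||V V0' hV] := @glue_choice R T good t0 x0 germ uniq (fun r => a0 < r < t).
  + move=> r /andP[r1 r2]; have [rt0|t0r] := ltP r t0.
      exists V0, a0, b0; split=> //; rewrite r1 /=; apply: lt_trans rt0 _; by case/andP: h1.
    by apply: ht; rewrite t0r.
  + by have [|d d0 hd] := @near_itv R a0 t r; [rewrite r1|exists d].
  + by rewrite a0t0.
  have [V' [a' [b' [s [k1 k2 k3 k4 k5]]]]] := ext V a0 t (introT andP (conj a0t0 t0t)) tc V0' hV.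
  apply: (glue_extend germ uniq _ V0' hV k1 _ k3 k5 k2); first by rewrite a0t0.
  by case/andP: k4 => k4 ->; rewrite (lt_trans a0t0).
- move=> t /andP[t0t _] ht; have [V [a [b [h1 h2 h3 h4]]]] : reaches good t0 x0 t by apply: ht; rewrite t0t lexx.
  exists (b - t); first by case/andP: h2 => _; rewrite subr_gt0.
  move=> s /andP[s1 s2] _; exists V, a, b; split=> //.
  by case/andP: h2 => h2 _; rewrite (lt_trans h2 s1) -(subrK t b) addrC.
Qed.

(** [adm] says from which values a local solution can start: any vector for parallel fields, any
    point above the curve for lifts. The window of length d is uniform in that value, which lets
    every solution be continued past t. *)
Lemma glue_global (good : (R -> T) -> R -> Prop) (adm : R -> T -> Prop) (t0 : R) (x0 : T) :
  (forall V V' r, (\forall s \near r, V s = V' s) -> good V r -> good V' r) ->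
  (forall V V' a b s r, a < s < b -> a < r < b ->
    (forall u, a < u < b -> good V u /\ good V' u) -> V s = V' s -> V r = V' r) ->
  (forall V r, good V r -> adm r (V r)) ->
  (forall t, exists2 d : R, 0 < d & forall s x, `|s - t| < d -> adm s x ->
     exists V, V s = x /\ solves good V (t - d) (t + d)) ->
  adm t0 x0 ->
  exists2 V, V t0 = x0 & forall r, good V r.
Proof.
move=> germ uniq gadm loc a0.
have right (g : (R -> T) -> R -> Prop) (ad : R -> T -> Prop) (u0 : R) :
    (forall V V' r, (\forall s \near r, V s = V' s) -> g V r -> g V' r) ->
    (forall V V' a b s r, a < s < b -> a < r < b ->
      (forall u, a < u < b -> g V u /\ g V' u) -> V s = V' s -> V r = V' r) ->
    (forall V r, g V r -> ad r (V r)) ->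
    (forall t, exists2 d : R, 0 < d & forall s x, `|s - t| < d -> ad s x ->
       exists V, V s = x /\ solves g V (t - d) (t + d)) ->
    ad u0 x0 -> forall t, u0 <= t -> reaches g u0 x0 t.
  move=> g1 g2 g3 g4 g5 t ut; apply: (glue_right g1 g2 (c := t)); last by rewrite ut lexx.
    have [d d0 hd] := g4 u0; have [|V [V0 hV]] := hd u0 x0 _ g5; first by rewrite subrr normr0.
    by exists V, (u0 - d), (u0 + d); split=> //; rewrite gtrBl ltrDl d0.
  move=> V a v /andP[au uv] vt V0 hV; have [d d0 hd] := g4 v.
  (* A restart time inside the given solution and within the window around v; the midpoint keeps it
     to the right of u0. *)
  pose s := Num.max ((u0 + v) / 2) (v - d / 2).
  have s1 : u0 < s < v.
    rewrite lt_max gt_max; apply/andP; split; last by apply/andP; split; lra.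
    by apply/orP; left; lra.
  have s2 : v - d < s < v + d.
    case/andP: s1 => _ sv; apply/andP; split; last by lra.
    by rewrite lt_max; apply/orP; right; lra.
  have [||V' [V's hV']] := hd s (V s).
  - by rewrite ltr_norml; case/andP: s2 => ? ?; apply/andP; split; lra.
  - by apply/g3/hV; case/andP: s1 => s1 ->; rewrite (lt_trans au s1).
  exists V', (v - d), (v + d), s; split=> //.
  by rewrite gtrBl ltrDl d0.
have [|r _||V V0 hV] := @glue_choice R T good t0 x0 germ uniq (fun=> True); [|by exists 1|by []|by exists V => // r; exact: hV].
  move=> r _.
have [/(right good adm)|rt0] := leP t0 r; first exact.
(* Negative times are obtained by reversing time. *)
have H := right (fun V u => good (fun s => V (- s)) (- u)) (fun s => adm (- s)) (- t0).
have : reaches (fun V u => good (fun s => V (- s)) (- u)) (- t0) x0 (- r).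
  apply: H.
  - move=> V V' u hV; apply: germ; have [d d1 hd] := near_ball hV.
    by apply: (ball_near d1) => s; rewrite opprK -normrN opprD => /hd.
  - move=> V V' a b s u s1 u1 hV e.
    have := uniq (fun v => V (- v)) (fun v => V' (- v)) (- b) (- a) (- s) (- u).
    rewrite !opprK; apply=> //; try by rewrite !ltrN2 andbC.
    by move=> v v1; have := hV (- v); rewrite !opprK; apply; rewrite ltrNl ltrNr andbC.
  - by move=> V u /gadm; rewrite opprK.
  - move=> t; have [d d1 hd] := loc (- t); exists d => // s x sd /hd[|V [V1 hV]].
      by rewrite -normrN opprB opprK addrC.
    exists (fun v => V (- v)); split=> // u u1.
    rewrite (_ : (fun s0 => _) = V); last by apply/funext => ?; rewrite opprK.
    by apply: hV; case/andP: u1 => ? ?; apply/andP; split; lra.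
  - by rewrite opprK.
  - by rewrite lerN2 ltW.
move=> [V [a [b [h1 h2 h3 h4]]]]; exists (fun s => V (- s)), (- b), (- a); split=> //.
- by rewrite ltrNl ltrNr andbC.
- by rewrite ltrNl ltrNr andbC.
- by move=> u u1; have := h4 (- u); rewrite opprK; apply; rewrite ltrNl ltrNr andbC.
Qed.

End glue_global.

Section monotone.
Context {R : realType}.

Lemma derive_ge0_le (f f' : R -> R) (a b : R) : a <= b ->
  (forall s, a <= s <= b -> is_derive s 1 f (f' s)) ->
  (forall s, a <= s <= b -> 0 <= f' s) -> f a <= f b.
Proof.
move=> ab hf h0; have [||c] := @MVT_segment R f f' a b ab.
- by move=> x; rewrite in_itv/= => /andP[ax xb]; apply: hf; rewrite !ltW.
- apply: continuous_in_subspaceT => x; rewrite inE /= in_itv/= => xab.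
  exact: is_derive_cont (hf x xab).
rewrite in_itv /= => cab e; rewrite -subr_ge0 e mulr_ge0// ?subr_ge0//.
exact: h0.
Qed.

Lemma derive0_cst (f : R -> R) (a b s r : R) : a < s < b -> a < r < b ->
  (forall u, a < u < b -> is_derive u 1 f 0) -> f s = f r.
Proof.
move=> hs hr hf; wlog sr : s r hs hr / s <= r.
  by move=> H; have [/H|/ltW/H] := leP s r; [exact|move=> h; exact/esym/h].
have h u : s <= u <= r -> a < u < b.
  move: hs hr => /andP[h1 _] /andP[_ h2] /andP[h3 h4].
  by rewrite (lt_le_trans h1 h3) (le_lt_trans h4 h2).
have l1 : f s <= f r by apply: (@derive_ge0_le f (fun=> 0)) => // u /h/hf.
have l2 : - f s <= - f r.
  apply: (@derive_ge0_le (fun u => - f u) (fun=> - 0) s r sr) => u h0.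
    exact: is_derive_opp (hf u (h u h0)).
  by rewrite oppr0.
by apply/eqP; rewrite eq_le l1 -lerN2.
Qed.

Lemma right_derive_le0 (f : R -> R) (d : R) : is_derive (0 : R) 1 f d -> f 0 = 0 ->
  (forall s, 0 < s -> s <= 1 -> f s <= 0) -> d <= 0.
Proof.
move=> /is_derive_epsP hf f0 h; apply/ler_addgt0Pr => e e0; rewrite add0r.
have [r r0 hr] := hf e e0; pose s := Num.min (r / 2) 1.
have s0 : 0 < s by rewrite lt_min ltr01 divr_gt0.
have sr : `|s| < r by rewrite gtr0_norm// gt_min ltr_pdivrMr// ltr_pMr// ltr1n.
have s1 : s <= 1 by rewrite ge_min lexx orbT.
have := hr s sr; rewrite add0r f0 subr0 (_ : s *: 1 = s); last exact: mulr1.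
rewrite (_ : s *: d = s * d)// [`|s|]gtr0_norm// ler_norml => /andP[h1 _].
by rewrite -(ler_pM2l s0); have := h s s0 s1; lra.
Qed.

End monotone.

Section inner_product.
Context {R : realType} {n : nat} {M : riemannianManifold R n}.
Implicit Types (x : M) (u v w : 'rV[R]_n).

Lemma innerC x u v : inner x u v = inner x v u.
Proof. exact/dotC/chart_img_in/mem_chart_at. Qed.
Lemma innerDl x u v w : inner x (u + v) w = inner x u w + inner x v w.
Proof. exact: dotDl. Qed.
Lemma innerDr x u v w : inner x u (v + w) = inner x u v + inner x u w.
Proof. exact: dotDr. Qed.
Lemma innerZl x (c : R) u v : inner x (c *: u) v = c * inner x u v.
Proof. exact: dotZl. Qed.
Lemma innerZr x (c : R) u v : inner x u (c *: v) = c * inner x u v.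
Proof. exact: dotZr. Qed.
Lemma innerNl x u v : inner x (- u) v = - inner x u v.
Proof. exact: dotNl. Qed.
Lemma innerNr x u v : inner x u (- v) = - inner x u v.
Proof. exact: dotNr. Qed.
Lemma inner0l x v : inner x 0 v = 0.
Proof. by rewrite -(scale0r 0) innerZl mul0r. Qed.
Lemma inner0r x v : inner x v 0 = 0.
Proof. by rewrite innerC inner0l. Qed.
Lemma inner_ge0 x u : 0 <= inner x u u.
Proof. exact/dot_ge0/chart_img_in/mem_chart_at. Qed.
Lemma inner_eq0 x u : inner x u u = 0 -> u = 0.
Proof. exact/dot_eq0/chart_img_in/mem_chart_at. Qed.
Lemma inner_cauchy x u v : inner x u v ^+ 2 <= inner x u u * inner x v v.
Proof. exact/dot_cauchy/chart_img_in/mem_chart_at. Qed.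

Definition innerE_ := (innerDl, innerDr, innerNl, innerNr, innerZl, innerZr, inner0l, inner0r).

Lemma tnorm_ge0 x u : 0 <= tnorm x u. Proof. exact: sqrtr_ge0. Qed.
Lemma tnorm_sqr x u : tnorm x u ^+ 2 = inner x u u.
Proof. by rewrite /tnorm sqr_sqrtr// inner_ge0. Qed.
Lemma tnormN x u : tnorm x (- u) = tnorm x u.
Proof. by rewrite /tnorm innerNl innerNr opprK. Qed.
Lemma tnorm0 x : tnorm x (0 : 'rV_n) = 0.
Proof. by rewrite /tnorm inner0l sqrtr0. Qed.
Lemma tnorm_eq0 x u : tnorm x u = 0 -> u = 0.
Proof. by move=> h; apply: (@inner_eq0 x); rewrite -tnorm_sqr h expr0n. Qed.
Lemma tnormZ x (c : R) u : tnorm x (c *: u) = `|c| * tnorm x u.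
Proof.
by rewrite /tnorm innerZl innerZr mulrA -expr2 sqrtrM ?sqr_ge0// sqrtr_sqr.
Qed.

Lemma inner_le x u v : inner x u v <= tnorm x u * tnorm x v.
Proof.
apply: le_trans (ler_norm _) _; rewrite -ler_sqr ?nnegrE ?mulr_ge0 ?tnorm_ge0//.
by rewrite real_normK ?num_real// exprMn !tnorm_sqr inner_cauchy.
Qed.

Lemma inner_norm_le x u v : `|inner x u v| <= tnorm x u * tnorm x v.
Proof.
by rewrite ler_norml inner_le andbT lerNl -innerNl -(tnormN x u) inner_le.
Qed.

Lemma tnorm_triangle x u v : tnorm x (u + v) <= tnorm x u + tnorm x v.
Proof.
rewrite -ler_sqr ?nnegrE ?addr_ge0 ?tnorm_ge0// sqrrD !tnorm_sqr innerDl !innerDr [inner x v u]innerC.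
by have := inner_le x u v; rewrite mulr2n; lra.
Qed.

End inner_product.

(** * Parallel fields along geodesics *)

Section parallel.
Context {R : realType} {n : nat} {M : riemannianManifold R n}.
Hypothesis hM : complete_manifold M.
Implicit Types (C : mindex M) (g : R -> M) (V W : R -> 'rV[R]_n).

Lemma has_cov_germ g V V' W (t : R) : (\forall s \near t, V s = V' s) ->
  has_cov g V W t -> has_cov g V' W t.
Proof.
move=> e h C u hC hu; have e0 := nbhs_singleton e; rewrite -e0.
by apply: near_is_derive (h C u hC hu); apply: filterS e => s ->.
Qed.

Lemma has_cov_eq g V W W' (t : R) : W t = W' t -> has_cov g V W t -> has_cov g V W' t.
Proof. by move=> e h C u hC hu; rewrite -e; exact: h. Qed.

Lemma tangent_inD C (x : M) (u v : 'rV_n) : tangent_in C x (u + v) = tangent_in C x u + tangent_in C x v.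
Proof. by rewrite !tangent_inE mulmxDl. Qed.

Lemma tangent_inZ C (x : M) (c : R) (u : 'rV_n) : tangent_in C x (c *: u) = c *: tangent_in C x u.
Proof. by rewrite !tangent_inE -scalemxAl. Qed.

Lemma has_cov_add g V V' W W' (t : R) : has_cov g V V' t -> has_cov g W W' t ->
  has_cov g (fun s => V s + W s) (fun s => V' s + W' s) t.
Proof.
move=> hV hW C u hC hu; have := is_derive_add (hV C u hC hu) (hW C u hC hu).
rewrite !tangent_inD mulmxDl opprD addrACA; congr (is_derive _ _ _ _).
by apply/funext => s; rewrite tangent_inD.
Qed.

Lemma has_cov_scale (phi : R -> R) (phi' : R) g V V' (t : R) : is_derive t 1 phi phi' ->
  has_cov g V V' t -> has_cov g (fun s => phi s *: V s) (fun s => phi' *: V s + phi s *: V' s) t.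
Proof.
move=> hp hV C u hC hu.
have hp1 : is_derive t 1 (fun s => (phi s)%:M : 'M[R]_1) phi'%:M.
  apply/is_derive_mxP => i j; rewrite (_ : (fun s => _) = phi); last first.
    by apply/funext => s; rewrite !ord1 mxE eqxx.
  by rewrite !ord1 mxE eqxx.
have := is_derive_mulmx hp1 (hV C u hC hu).
rewrite !mul_scalar_mx tangent_inD !tangent_inZ -scalemxAl scalerBr addrA.
by congr (is_derive _ _ _ _); apply/funext => s; rewrite mul_scalar_mx tangent_inZ.
Qed.

Lemma has_cov_scaleN g V V' (t : R) :
  has_cov g V V' t -> has_cov g (fun s => - V s) (fun s => - V' s) t.
Proof.
move=> h; have h1 := has_cov_scale (@is_derive_cst1 R R (-1) t) h.
have h2 := has_cov_germ (filterE (nbhs_filter t) (fun s => scaleN1r (V s))) h1.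
by apply: has_cov_eq h2; rewrite scale0r add0r scaleN1r.
Qed.

Definition parallel_at g V (t : R) := has_cov g V (fun=> 0) t.

Lemma cov_inner g V V' W W' (t : R) : geodesic g -> has_cov g V V' t -> has_cov g W W' t ->
  is_derive t 1 (fun s => inner (g s) (V s) (W s)) (inner (g t) (V' t) (W t) + inner (g t) (V t) (W' t)).
Proof. exact: cov_dot. Qed.

Lemma parallel_inner g V W (a b s r : R) : geodesic g -> a < s < b -> a < r < b ->
  (forall u, a < u < b -> parallel_at g V u /\ parallel_at g W u) ->
  inner (g s) (V s) (W s) = inner (g r) (V r) (W r).
Proof.
move=> hg hs hr h; apply: (derive0_cst (f := fun s => inner (g s) (V s) (W s)) hs hr) => u /h[h1 h2].
by have := cov_inner hg h1 h2; rewrite inner0l inner0r addr0.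
Qed.

Lemma parallel_add g V W (t : R) : parallel_at g V t -> parallel_at g W t ->
  parallel_at g (fun s => V s + W s) t.
Proof. by move=> h1 h2; have := has_cov_add h1 h2; apply: has_cov_eq; rewrite addr0. Qed.

Lemma parallel_opp g V (t : R) : parallel_at g V t -> parallel_at g (fun s => - V s) t.
Proof. by move=> /has_cov_scaleN; apply: has_cov_eq; rewrite oppr0. Qed.

(** The difference is parallel, so its norm is constant, and it vanishes once. *)
Lemma parallel_uniq g V W (a b s r : R) : geodesic g -> a < s < b -> a < r < b ->
  (forall u, a < u < b -> parallel_at g V u /\ parallel_at g W u) ->
  V s = W s -> V r = W r.
Proof.
move=> hg hs hr h e; apply/eqP; rewrite -subr_eq0; apply/eqP/(@inner_eq0 _ _ _ (g r)).
have H u : a < u < b -> parallel_at g (fun s => V s - W s) u /\ parallel_at g (fun s => V s - W s) u.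
  by move=> /h[h1 h2]; split; apply: parallel_add => //; apply: parallel_opp.
by rewrite -(parallel_inner hg hs hr H) e subrr inner0l.
Qed.

(** In a chart the equation is linear. It is solved on the interval of radius 2 d about s, which
    contains the interval of radius d about t; this makes d independent of s and x. *)
Lemma parallel_local g (t : R) : geodesic g -> exists2 d : R, 0 < d & forall s (x : 'rV_n), `|s - t| < d ->
  exists V, V s = x /\ solves (parallel_at g) V (t - d) (t + d).
Proof.
move=> hg; set C := chart_at (g t); have hC : mdom C (g t) := mem_chart_at _.
pose A s := - GamU C (mchart C (g s)) (velocity_in C g s).
have cA s : mdom C (g s) -> {for s, continuous A}.
  move=> hs; have [h1 h2] := geodesic_chart hg hs.
  exact: is_derive_cont (is_derive_opp (GamU_curve (chart_img_in hs) h1 h2)).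
have [d0 d00 hd0] := near_ball (near_dom (geodesic_cont hg) hC).
have /cvgrPdist_le/(_ _ ltr01)/near_ball[d1 d10 hd1] := cA t hC.
pose L := `|A t| + 1.
have L0 : 0 < L by rewrite ltr_wpDl.
pose c := n%:R * L + 1; have c0 : 0 < c by rewrite ltr_wpDl// mulr_ge0// ltW.
pose d := Num.min (Num.min d0 d1) c^-1 / 4.
have dpos : 0 < d by rewrite divr_gt0// !lt_min d00 d10 invr_gt0.
have d4 : 4 * d = Num.min (Num.min d0 d1) c^-1 by rewrite /d mulrC divfK.
have [l1 l2 l3] : [/\ 4 * d <= d0, 4 * d <= d1 & 4 * d <= c^-1].
  by rewrite d4; split; rewrite !ge_min lexx ?orbT.
exists d => // s x sd.
have tri u : `|u - s| <= 2 * d -> `|u - t| < 4 * d.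
  move=> us; apply: le_lt_trans (ler_distD s u t) _.
  by apply: le_lt_trans (lerD us (lexx _)) _; rewrite -ltrBrDl; apply: lt_trans sd _; lra.
have small : n%:R * L * (2 * d) <= 2^-1.
  have cd : c * (4 * d) <= 1 by rewrite -ler_pdivlMl// mulr1.
  have : 0 <= d by rewrite ltW.
  rewrite /c in cd; move: cd; set X := n%:R * L => cd ?.
  by move: cd; rewrite mulrDl mul1r mulrCA => cd; rewrite mulrCA; move: cd; set Y := X * d; lra.
have [|||G [G0 hG]] := @linear_ode_exists R n 1 A s (2 * d) L (tangent_in C (g s) x) _ (ltW L0) small.
- by rewrite mulr_gt0.
- by move=> u /tri ut; apply/cA/hd0/(lt_le_trans ut).
- move=> u /tri ut; have := hd1 u (lt_le_trans ut l2) => h.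
  rewrite -[A u](subrK (A t)) addrC /L; apply: le_trans (ler_normD _ _) _.
  by rewrite lerD2l distrC.
pose V u := G u *m jac C (chart_at (g u)) (g u).
have TV u : mdom C (g u) -> tangent_in C (g u) (V u) = G u.
  by move=> hu; rewrite tangent_inE /V -mulmxA jacK ?mulmx1//; exact: mem_chart_at.
exists V; split.
  have hCs : mdom C (g s).
    by apply/hd0/(lt_le_trans _ l1)/tri; rewrite subrr normr0 mulr_ge0// ltW.
  by rewrite /V G0 tangent_inE -mulmxA jacK ?mulmx1//; exact: mem_chart_at.
move=> u /andP[u1 u2].
have us : `|u - s| <= 2 * d.
  by move: sd; rewrite ltr_norml ler_norml => /andP[h1 h2]; apply/andP; split; lra.
have hCu : mdom C (g u) by apply/hd0/(lt_le_trans (tri _ us)).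
have [h1 _] := geodesic_chart hg hCu.
apply: (has_cov_chart hM (geodesic_cont hg) hCu h1).
rewrite tangent_in0 sub0r TV// -mulmxN; apply: near_is_derive (hG u us).
by apply: filterS (near_dom (geodesic_cont hg) hCu) => v hv; rewrite TV.
Qed.

Lemma exists_parallel g (t0 : R) (x : 'rV_n) : geodesic g ->
  exists2 V, V t0 = x & forall t, parallel_at g V t.
Proof.
move=> hg; apply: (@glue_global _ _ (parallel_at g) (fun _ _ => True)) => //.
- by move=> V V' r; exact: has_cov_germ.
- by move=> V V' a b s r hs hr h; exact: (parallel_uniq hg hs hr h).
- by move=> t; have [d d0 hd] := parallel_local t hg; exists d => // s y sd _; exact: hd.
Qed.

Lemma parallel_inner_cst g V W (s r : R) : geodesic g -> (forall t, parallel_at g V t) ->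
  (forall t, parallel_at g W t) -> inner (g s) (V s) (W s) = inner (g r) (V r) (W r).
Proof.
move=> hg hV hW; pose m := `|s| + `|r| + 1.
have h u : `|u| <= `|s| + `|r| -> - m < u < m.
  by rewrite /m ler_norml => /andP[h1 h2]; apply/andP; split; lra.
by apply: (@parallel_inner g V W (- m) m) => //; apply: h; rewrite ?lerDl ?lerDr.
Qed.

End parallel.

(** * Comparison estimates for Jacobi fields *)

Section jacobi_estimates.
Context {R : realType} {n : nat} {M : riemannianManifold R n}.
Hypothesis hM : complete_manifold M.
Variable p : M.
Notation geo := (geo hM p).
Notation Jac := (Jac hM p).
Notation JacV := (JacV hM p).
Implicit Types (v w : 'rV[R]_n).

(** <R(g', a) g', b>, the curvature part of the index form; nonnegative on the diagonal when the
    curvature is nonpositive. *)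
Definition curv_form (g : R -> M) (t : R) a b : R :=
  Rm (chart_at (g t)) (mchart (chart_at (g t)) (g t)) (velocity g t) a (velocity g t) b.

Lemma curv_formE (g : R -> M) (t : R) V b : inner (g t) (curv_along g V t) b = curv_form g t (V t) b.
Proof. by []. Qed.

Lemma curv_formC (g : R -> M) (t : R) a b : curv_form g t a b = curv_form g t b a.
Proof. exact/Rm_pair/chart_img_in/mem_chart_at. Qed.

Lemma curv_formDr (g : R -> M) (t : R) a b c : curv_form g t a (b + c) = curv_form g t a b + curv_form g t a c.
Proof. exact: innerDr. Qed.

Lemma curv_formZr (g : R -> M) (t : R) a b (c : R) : curv_form g t a (c *: b) = c * curv_form g t a b.
Proof. exact: innerZr. Qed.

Lemma curv_form_velocity (g : R -> M) (t : R) a : curv_form g t a (velocity g t) = 0.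
Proof. exact/Rm_diag/chart_img_in/mem_chart_at. Qed.

Lemma curv_form_sub (g : R -> M) (t : R) a b (c : R) :
  curv_form g t (a - c *: b) (a - c *: b) =
  curv_form g t a a - 2 * c * curv_form g t a b + c ^+ 2 * curv_form g t b b.
Proof.
rewrite -scaleNr curv_formDr curv_formZr [curv_form g t _ a]curv_formC [curv_form g t _ b]curv_formC.
by rewrite !curv_formDr !curv_formZr [curv_form g t b a]curv_formC; ring.
Qed.

Lemma inner_sub_sqr (x : M) a b (c : R) :
  inner x (a - c *: b) (a - c *: b) = inner x a a - 2 * c * inner x a b + c ^+ 2 * inner x b b.
Proof. by rewrite -scaleNr !innerE_ [inner x b a]innerC; ring. Qed.

Lemma speed_cst v (t : R) : inner (geo v t) (velocity (geo v) t) (velocity (geo v) t) = inner p v v.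
Proof.
have hg := geo_geodesic hM p v.
have par s : parallel_at (geo v) (velocity (geo v)) s := velocity_cov hg.
by rewrite (@parallel_inner_cst _ _ _ _ _ _ t 0 hg par par) geo0 geo_velocity0.
Qed.

Lemma JacV_Jac_derive v w (P : R -> 'rV[R]_n) (t : R) : parallel_at (geo v) P t ->
  is_derive t 1 (fun s => inner (geo v s) (JacV v w s) (Jac v w s))
    (curv_form (geo v) t (Jac v w t) (Jac v w t) + inner (geo v t) (JacV v w t) (JacV v w t)) /\
  is_derive t 1 (fun s => inner (geo v s) (Jac v w s) (P s)) (inner (geo v t) (JacV v w t) (P t)) /\
  is_derive t 1 (fun s => inner (geo v s) (JacV v w s) (P s)) (curv_form (geo v) t (Jac v w t) (P t)).
Proof.
move=> hP; have hg := geo_geodesic hM p v.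
have hJ := @Jac_cov R n M hM p v w t; have hW := @JacV_cov R n M hM p v w t.
split; first exact: cov_inner hg hW hJ.
by split; [have := cov_inner hg hJ hP|have := cov_inner hg hW hP]; rewrite inner0r addr0.
Qed.

(** <g', J'> is constant because the curvature term is orthogonal to g', hence <g', J> is linear in
    time. *)
Lemma gauss v w : inner (geo v 1) (velocity (geo v) 1) (Jac v w 1) = inner p v w.
Proof.
have hg := geo_geodesic hM p v.
have hW (t : R) : inner (geo v t) (velocity (geo v) t) (JacV v w t) = inner p v w.
  pose f (s : R) := inner (geo v s) (velocity (geo v) s) (JacV v w s).
  have -> : inner p v w = f 0 by rewrite /f geo_velocity0 JacV0 geo0.
  rewrite -/(f t); apply: (@derive0_cst _ f (- `|t| - 1) (`|t| + 1)).
  - by have := ler_norm t; have := ler_norm (- t); rewrite normrN => ? ?; apply/andP; split; lra.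
  - by have := normr_ge0 t => ?; apply/andP; split; lra.
  - move=> u _; have := cov_inner hg (velocity_cov hg) (@JacV_cov R n M hM p v w u).
    by rewrite inner0l add0r innerC curv_formE curv_form_velocity.
pose f (s : R) := inner (geo v s) (velocity (geo v) s) (Jac v w s) - s * inner p v w.
have hf (u : R) : is_derive u 1 f 0.
  have h1 := cov_inner hg (velocity_cov hg) (@Jac_cov R n M hM p v w u).
  have h2 := is_derive_mulr (@is_derive_id _ _ u 1) (is_derive_cst1 (inner p v w) u).
  have := is_derive_sub h1 h2; by rewrite inner0l add0r hW mulr0 addr0 mul1r subrr.
have : f 1 = f 0 by apply: (@derive0_cst _ f (-1) 2) => //; apply/andP; split; lra.
by rewrite /f Jac0 inner0r !mul1r mul0r subr0 => /eqP; rewrite subr_eq0 => /eqP.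
Qed.

(** The curvature operator is self-adjoint, so <J', K> - <J, K'> is constant for two Jacobi fields,
    and both vanish at 0. This is the symmetry of the Hessian of the squared distance. *)
Lemma wronskian v w w' : inner (geo v 1) (JacV v w 1) (Jac v w' 1) = inner (geo v 1) (JacV v w' 1) (Jac v w 1).
Proof.
have hg := geo_geodesic hM p v.
pose f (s : R) := inner (geo v s) (JacV v w s) (Jac v w' s) - inner (geo v s) (JacV v w' s) (Jac v w s).
have hf (u : R) : is_derive u 1 f 0.
  have h1 := cov_inner hg (@JacV_cov R n M hM p v w u) (@Jac_cov R n M hM p v w' u).
  have h2 := cov_inner hg (@JacV_cov R n M hM p v w' u) (@Jac_cov R n M hM p v w u).
  have := is_derive_sub h1 h2.
  by rewrite !curv_formE curv_formC [inner _ (JacV v w' u) (JacV v w u)]innerC subrr.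
have : f 1 = f 0 by apply: (@derive0_cst _ f (-1) 2) => //; apply/andP; split; lra.
by rewrite /f !Jac0 !inner0r subrr => /eqP; rewrite subr_eq0 => /eqP.
Qed.

Variable kmin : R.
Hypothesis hK : all_sectional_curvatures M (fun K => kmin <= K <= 0).

Lemma curv_form_bounds v (t : R) a :
  0 <= curv_form (geo v) t a a <= `|kmin| * (inner p v v * inner (geo v t) a a).
Proof. by rewrite -(speed_cst v t); exact: Rm_bounds. Qed.

(** Index comparison with the flat field u P, where P is parallel and s P(s) = J(s): the derivative
    of [m] is the curvature form plus |J' - P|^2. *)
Lemma Jac_le_JacV v w (s : R) : 0 < s ->
  inner (geo v s) (Jac v w s) (Jac v w s) <= s * inner (geo v s) (JacV v w s) (Jac v w s).
Proof.
move=> s0; have hg := geo_geodesic hM p v.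
have [P Ps hP] := exists_parallel hM s (s^-1 *: Jac v w s) hg.
pose m (u : R) := inner (geo v u) (JacV v w u) (Jac v w u) - 2 * inner (geo v u) (Jac v w u) (P u)
  + u * inner (geo v u) (P u) (P u).
pose m' (u : R) := (curv_form (geo v) u (Jac v w u) (Jac v w u) + inner (geo v u) (JacV v w u) (JacV v w u))
  - 2 * inner (geo v u) (JacV v w u) (P u) + inner (geo v u) (P u) (P u).
have hm (u : R) : is_derive u 1 m (m' u).
  have [h1 [h2 _]] := JacV_Jac_derive w (hP u).
  have h3 := cov_inner hg (hP u) (hP u).
  have h4 := is_derive_mulr (is_derive_cst1 (2 : R) u) h2.
  have h5 := is_derive_mulr (@is_derive_id _ _ u 1) h3.
  have := is_derive_add (is_derive_sub h1 h4) h5.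
  by rewrite inner0l inner0r addr0 mulr0 addr0 mul0r add0r mul1r.
have : m 0 <= m s.
  apply: (derive_ge0_le (ltW s0) (fun u _ => hm u)) => u _.
  have := inner_ge0 (geo v u) (JacV v w u - 1 *: P u); rewrite inner_sub_sqr /m'.
  by have /andP[h _] := curv_form_bounds v u (Jac v w u); move: h; lra.
rewrite /m Jac0 !inner0r inner0l Ps !innerZr !innerZl mulr0 subr0 mul0r addr0.
set A := inner _ (JacV v w s) _; set B := inner _ (Jac v w s) _.
rewrite (_ : _ + _ = A - B / s); last by field; rewrite gt_eqF.
by rewrite subr_ge0 ler_pdivrMr// mulrC.
Qed.

(** |J(u)|^2 / u^2 is nondecreasing, since its derivative has the sign of u <J', J> - |J|^2. *)
Lemma Jac_growth v w (s : R) : 0 < s -> s <= 1 ->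
  inner (geo v s) (Jac v w s) (Jac v w s) <= s ^+ 2 * inner (geo v 1) (Jac v w 1) (Jac v w 1).
Proof.
move=> s0 s1; have hg := geo_geodesic hM p v.
pose f (u : R) := inner (geo v u) (Jac v w u) (Jac v w u).
pose W (u : R) := inner (geo v u) (JacV v w u) (Jac v w u).
have hf (u : R) : is_derive u 1 f (2 * W u).
  have := cov_inner hg (@Jac_cov R n M hM p v w u) (@Jac_cov R n M hM p v w u).
  by rewrite [inner _ (Jac v w u) (JacV v w u)]innerC -mulr2n mulr_natl.
have hle (u : R) : 0 < u -> f u <= u * W u by exact: Jac_le_JacV.
rewrite -[inner _ (Jac v w s) _]/(f s) -[inner _ (Jac v w 1) _]/(f 1).
move: f W hf hle => f W hf hle; clear hg.
have h (u : R) : s <= u <= 1 ->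
    is_derive u 1 (fun u => f u * (u^-1 * u^-1)) (2 * W u * (u^-1 * u^-1) + f u * (- 2 * u^-1 ^+ 3)).
  move=> /andP[su _]; have u0 : u != 0 by rewrite gt_eqF// (lt_le_trans s0).
  have hi : is_derive u 1 (fun u : R => u^-1) (- u^-1 ^+ 2).
    have := @is_deriveV R id u 1 1 u0 (@is_derive_id _ _ u 1).
    by rewrite /GRing.scale /= mulr1 exprVn.
  have := is_derive_mulr (hf u) (is_derive_mulr hi hi).
  rewrite (_ : - u^-1 ^+ 2 * u^-1 + u^-1 * - u^-1 ^+ 2 = - 2 * u^-1 ^+ 3)//; ring.
have : f s * (s^-1 * s^-1) <= f 1 * (1^-1 * 1^-1).
  apply: (derive_ge0_le s1 h) => u /andP[su _]; have u0 : 0 < u by apply: lt_le_trans su.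
  rewrite (_ : _ + _ = 2 * u^-1 ^+ 3 * (u * W u - f u)); last by field; rewrite gt_eqF.
  by rewrite mulr_ge0 ?subr_ge0 ?hle// mulr_ge0// exprn_ge0// invr_ge0 ltW.
by rewrite invr1 !mulr1 -invfM -expr2 ler_pdivrMr ?exprn_gt0// mulrC.
Qed.

(** By [Jac_growth], <J, P> <= s |J(1)| |w| for the parallel field P with P(0) = w; comparing
    derivatives at s = 0 gives |w|^2 <= |J(1)| |w|. *)
Lemma Jac_expands v w : tnorm p w <= tnorm (geo v 1) (Jac v w 1).
Proof.
have hg := geo_geodesic hM p v; have [P P0 hP] := exists_parallel hM 0 w hg.
have PP (s : R) : inner (geo v s) (P s) (P s) = inner p w w.
  by rewrite (@parallel_inner_cst _ _ _ _ _ _ s 0 hg hP hP) P0 geo0.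
set j := tnorm (geo v 1) _; pose f (s : R) := inner (geo v s) (Jac v w s) (P s) - s * (j * tnorm p w).
have hf : is_derive (0 : R) 1 f (tnorm p w ^+ 2 - j * tnorm p w).
  have [_ [h1 _]] := JacV_Jac_derive w (hP 0).
  have h2 := is_derive_mulr (@is_derive_id _ _ (0 : R) 1) (is_derive_cst1 (j * tnorm p w) (0 : R)).
  by have := is_derive_sub h1 h2; rewrite JacV0 P0 geo0 tnorm_sqr mulr0 addr0 mul1r.
have [->|w0] := eqVneq (tnorm p w) 0; first exact: tnorm_ge0.
have wp : 0 < tnorm p w by rewrite lt_neqAle eq_sym w0 tnorm_ge0.
rewrite -(ler_pM2r wp) -expr2 -subr_le0; apply: right_derive_le0 hf _ _.
  by rewrite /f Jac0 inner0l mul0r subrr.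
move=> s s0 s1; rewrite /f subr_le0; apply: le_trans (inner_le _ _ _) _.
have -> : tnorm (geo v s) (P s) = tnorm p w by rewrite /tnorm PP.
rewrite mulrA ler_wpM2r ?tnorm_ge0// -ler_sqr ?nnegrE ?mulr_ge0 ?tnorm_ge0 ?(ltW s0)//.
rewrite exprMn; have := Jac_growth v w s0 s1.
by rewrite -[inner (geo v s) _ _]tnorm_sqr -[inner (geo v 1) _ _]tnorm_sqr.
Qed.

(** Index lemma against phi P, with P parallel and P(1) = J(1). The derivative of [m] is |J' - psi
    P|^2, plus the curvature form of J - phi P, plus phi^2 times k2 |P|^2 minus the curvature form
    of P; all are nonnegative. *)
Lemma JacV_upper v w (phi psi : R -> R) (k2 : R) :
  (forall t : R, is_derive t 1 phi (psi t)) -> (forall t : R, is_derive t 1 psi (k2 * phi t)) ->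
  phi 0 = 0 -> phi 1 = 1 -> `|kmin| * inner p v v <= k2 ->
  inner (geo v 1) (JacV v w 1) (Jac v w 1) <= psi 1 * inner (geo v 1) (Jac v w 1) (Jac v w 1).
Proof.
move=> hphi hpsi phi0 phi1 hk; have hg := geo_geodesic hM p v.
have [P P1 hP] := exists_parallel hM 1 (Jac v w 1) hg.
pose m (u : R) := inner (geo v u) (JacV v w u) (Jac v w u) - 2 * (phi u * inner (geo v u) (JacV v w u) (P u))
  + (phi u * psi u) * inner (geo v u) (P u) (P u).
pose m' (u : R) := (curv_form (geo v) u (Jac v w u) (Jac v w u) + inner (geo v u) (JacV v w u) (JacV v w u))
  - 2 * (psi u * inner (geo v u) (JacV v w u) (P u) + phi u * curv_form (geo v) u (Jac v w u) (P u))
  + (psi u * psi u + phi u * (k2 * phi u)) * inner (geo v u) (P u) (P u).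
have hm (u : R) : is_derive u 1 m (m' u).
  have [h1 [_ h2]] := JacV_Jac_derive w (hP u).
  have h3 := cov_inner hg (hP u) (hP u).
  have h4 := is_derive_mulr (is_derive_cst1 (2 : R) u) (is_derive_mulr (hphi u) h2).
  have h5 := is_derive_mulr (is_derive_mulr (hphi u) (hpsi u)) h3.
  have := is_derive_add (is_derive_sub h1 h4) h5.
  by rewrite inner0l inner0r addr0 mulr0 addr0 mul0r add0r.
have : m 0 <= m 1.
  apply: (derive_ge0_le ler01 (fun u _ => hm u)) => u _.
  have := inner_ge0 (geo v u) (JacV v w u - psi u *: P u); rewrite inner_sub_sqr.
  have /andP[h1 _] := curv_form_bounds v u (Jac v w u - phi u *: P u); move: h1; rewrite curv_form_sub.
  have /andP[_ h2] := curv_form_bounds v u (P u).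
  have h3 : curv_form (geo v) u (P u) (P u) <= k2 * inner (geo v u) (P u) (P u).
    by apply: le_trans h2 _; rewrite mulrA ler_wpM2r// inner_ge0.
  have := ler_wpM2l (sqr_ge0 (phi u)) h3; rewrite /m'.
  move: (curv_form _ _ _ _) (curv_form _ _ _ _) (curv_form _ _ _ _) => a b c.
  move: (inner _ _ _) (inner _ _ _) (inner _ _ _) (phi u) (psi u) => d e f x y.
  lra.
rewrite /m Jac0 !inner0r P1 phi0 phi1 !mul0r mulr0 subr0 addr0 !mul1r.
by lra.
Qed.

End jacobi_estimates.

(** * The Cartan-Hadamard theorem *)

Section local_inverse.
Context {R : realType} {n : nat}.
Implicit Types (f : 'rV[R]_n -> 'rV[R]_n) (D : 'M[R]_n).

(** An invertible strict derivative makes f injective near v0 with Lipschitz inverse, and z - f(z)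
    D^{-1} a contraction. *)
Lemma sd_unit_expands f v0 D : sd f v0 D -> D \in unitmx ->
  exists2 K : R, 0 < K & exists2 r : R, 0 < r & forall z z', `|z - v0| < r -> `|z' - v0| < r ->
    `|z - z' - (f z - f z') *m invmx D| <= 2^-1 * `|z - z'| /\ `|z - z'| <= K * `|f z - f z'|.
Proof.
move=> hf hD; pose k := n%:R * `|invmx D| + 1.
have k0 : 0 < k by rewrite ltr_wpDl// mulr_ge0.
have hk2 : 0 < 2^-1 / k by rewrite divr_gt0// invr_gt0.
have [r r0 hr] := hf _ hk2.
exists (2 * k); first by rewrite mulr_gt0.
exists r => // z z' hz hz'; have := hr z z' hz hz'.
have -> : z - z' - (f z - f z') *m invmx D = - ((f z - f z' - (z - z') *m D) *m invmx D).
  by rewrite [in RHS]mulmxBl -[in RHS]mulmxA mulmxV// mulmx1 opprB.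
rewrite normrN => h; have h1 := mulmx_norm_le (f z - f z' - (z - z') *m D) (invmx D).
have l1 : `|(f z - f z' - (z - z') *m D) *m invmx D| <= 2^-1 * `|z - z'|.
  apply: le_trans h1 _; rewrite mulrAC.
  have : n%:R * `|invmx D| <= k by rewrite lerDl.
  move: h (normr_ge0 (f z - f z' - (z - z') *m D)) (normr_ge0 (z - z')).
  move: `|_ - _| `|z - z'| (n%:R * _) => A B c hA A0 B0 ck.
  apply: le_trans (ler_wpM2r A0 ck) _.
  by rewrite -ler_pdivlMl// mulrA [_^-1 * _]mulrC.
split => //; have e : z - z' = - ((f z - f z' - (z - z') *m D) *m invmx D) + (f z - f z') *m invmx D.
  by rewrite mulmxBl -[_ *m D *m _]mulmxA mulmxV// mulmx1 opprB subrK.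
have := ler_normD (- ((f z - f z' - (z - z') *m D) *m invmx D)) ((f z - f z') *m invmx D).
rewrite -e normrN => h2; have h3 := mulmx_norm_le (f z - f z') (invmx D).
have h4 : n%:R * `|f z - f z'| * `|invmx D| <= k * `|f z - f z'|.
  by rewrite mulrAC ler_wpM2r// lerDl.
rewrite -mulrA.
by move: l1 h2 (le_trans h3 h4); move: `|_ *m _| `|(f z - f z') *m _| (k * _) `|z - z'| => A B c X; lra.
Qed.

(** Newton's iteration with the derivative frozen at v0; its fixed point solves f z = y. *)
Lemma sd_unit_onto f v0 D : sd f v0 D -> D \in unitmx -> exists2 r : R, 0 < r &
  forall rho : R, 0 < rho -> rho <= r -> exists2 sg : R, 0 < sg & forall y, `|y - f v0| < sg ->
    exists2 z, `|z - v0| < rho & f z = y.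
Proof.
move=> hf hD; have [K K0 [r r0 hr]] := sd_unit_expands hf hD.
exists r => // rho rho0 rhor; pose k := n%:R * `|invmx D| + 1.
have k0 : 0 < k by rewrite ltr_wpDl// mulr_ge0.
exists (rho / 4 / k); first by rewrite !divr_gt0.
move=> y hy; pose T z := z + (y - f z) *m invmx D.
pose del := `|T v0 - v0|.
have del0 : 0 <= del by exact: normr_ge0.
have hdel : del < rho / 4.
  rewrite /del /T addrC addKr; apply: le_lt_trans (mulmx_norm_le _ _) _.
  rewrite mulrAC; apply: (@le_lt_trans _ _ (k * `|y - f v0|)); first by rewrite ler_wpM2r// lerDl.
  by rewrite mulrC -ltr_pdivlMr.
have con z z' : `|z - v0| < r -> `|z' - v0| < r -> `|T z - T z'| <= 2^-1 * `|z - z'|.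
  move=> hz hz'; have [h _] := hr z z' hz hz'; rewrite (_ : T z - T z' = z - z' - (f z - f z') *m invmx D)//.
  by rewrite /T !mulmxBl !opprD !opprK; mxring.
pose u j := iter j T v0.
(* The factor 1 - 2^{-j} keeps every iterate within 2 del of v0, where the contraction estimate is
   valid. *)
have hu j : `|u j.+1 - u j| <= del / 2 ^+ j /\ `|u j - v0| <= 2 * del * (1 - (2 ^+ j)^-1).
  elim: j => [|j [IH1 IH2]]; first by rewrite /u /= expr0 divr1 invr1 !subrr mulr0 normr0 lexx.
  have near1 : `|u j.+1 - v0| <= 2 * del * (1 - (2 ^+ j.+1)^-1).
    apply: le_trans (ler_distD (u j) _ _) _; apply: le_trans (lerD IH1 IH2) _.
    by rewrite exprS invfM; move: (2 ^+ j)^-1 => x; lra.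
  have lt1 (i : nat) : 2 * del * (1 - (2 ^+ i)^-1) < r.
    apply: (@le_lt_trans _ _ (2 * del)); last by lra.
    by rewrite ler_piMr ?mulr_ge0// gerBl invr_ge0 exprn_ge0.
  split => //; apply: le_trans (con _ _ (le_lt_trans near1 (lt1 _)) (le_lt_trans IH2 (lt1 _))) _.
  by rewrite exprS invfM mulrCA ler_wpM2l// invr_ge0.
have [l hl] := geometric_limit_mx del0 (fun j => (hu j).1).
have ln : `|l - v0| < rho.
  by have := hl 0%N; rewrite expr0 divr1 /u /= distrC; move: hdel; lra.
exists l => //; have Tl : T l = l.
  apply/eqP; rewrite -subr_eq0 -normr_le0; apply/ler_addgt0Pr => e e0; rewrite add0r.
  have [j hj] := @exp2_small R (2 * del * 2) e (mulr_ge0 (mulr_ge0 (ler0n _ _) del0) (ler0n _ _)) e0.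
  apply: le_trans (ler_distD (u j.+1) _ _) _.
  have uj : `|u j - v0| < r.
    apply: le_lt_trans (hu j).2 _; apply: (@le_lt_trans _ _ (2 * del)); last by lra.
    by rewrite ler_piMr ?mulr_ge0// gerBl invr_ge0 exprn_ge0.
  have c1 := con l (u j) (lt_le_trans ln rhor) uj.
  have h1 := hl j; have h2 := hl j.+1; rewrite distrC in h1; rewrite -[T (u j)]/(u j.+1) in c1.
  have E1 : 2 * del / 2 ^+ j = 2 * (del / 2 ^+ j) by rewrite mulrA.
  have E2 : 2 * del / 2 ^+ j.+1 = del / 2 ^+ j by rewrite exprS; field; rewrite expf_neq0.
  have E3 : 2 * del * 2 / 2 ^+ j = 4 * (del / 2 ^+ j) by field; rewrite expf_neq0.
  have x0 : 0 <= del / 2 ^+ j by rewrite divr_ge0// exprn_ge0.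
  rewrite E1 in h1; rewrite E2 in h2; rewrite E3 in hj.
  by move: c1 h1 h2 hj x0; move: `|_ - _| `|_ - _| `|_ - _| (del / _) => a b c X; lra.
have : (y - f l) *m invmx D *m D = 0.
  by move/eqP: Tl; rewrite /T addrC -subr_eq0 addrK => /eqP ->; rewrite mul0mx.
by rewrite mulmxKV// => /eqP; rewrite subr_eq0 => /eqP.
Qed.

End local_inverse.

Section propagation.
Context {R : realType}.

Lemma clamp_lip (t0 eta u w : R) : `|clamp t0 eta u - clamp t0 eta w| <= `|u - w|.
Proof.
wlog uw : u w / u <= w.
  by move=> H; have [/H//|/ltW/H] := leP u w; rewrite distrC [`|w - u|]distrC.
rewrite [leRHS]distrC [leRHS]ger0_norm ?subr_ge0// ler_norml /clamp.
by case: (leP (t0 + eta) u) => ?; case: (leP (t0 + eta) w) => ?;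
  rewrite /Order.max; repeat case: ifPn; rewrite -?leNgt => *; apply/andP; split; lra.
Qed.

(** Clamping to the segment between s and r reduces propagation on an open interval to propagation
    on R. *)
Lemma itv_propagate (P : R -> Prop) (a b s r : R) : a < s < b -> a < r < b -> P s ->
  (forall t, a < t < b -> exists2 d : R, 0 < d & forall u w : R, `|u - t| < d -> `|w - t| < d -> P u -> P w) ->
  P r.
Proof.
move=> sab rab Ps hP; pose c := (s + r) / 2; pose eta := `|s - r| / 2.
have eta0 : 0 <= eta by rewrite divr_ge0.
have half : `|(s - r) / 2| <= eta by rewrite normrM [`|2^-1|]gtr0_norm// invr_gt0.
have sc : clamp c eta s = s by rewrite clamp_id// (_ : s - c = (s - r) / 2)// /c; field.
have rc : clamp c eta r = r.
  by rewrite clamp_id// (_ : r - c = - ((s - r) / 2)) ?normrN// /c; field.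
have cab u : a < clamp c eta u < b.
  have := clamp_ball c u eta0; rewrite /c /eta ler_norml.
  case/andP: sab => ? ?; case/andP: rab => ? ?.
  by case: (ger0P (s - r)) => ? /andP[? ?]; apply/andP; split; lra.
rewrite -rc; apply: (@real_propagate R (fun u => P (clamp c eta u)) s); first by rewrite sc.
move=> t; have [d d0 hd] := hP _ (cab t); exists d => // u w ut wt; apply: hd.
  by apply: le_lt_trans ut; exact: clamp_lip.
by apply: le_lt_trans wt; exact: clamp_lip.
Qed.

End propagation.

(** * The exponential map is a local diffeomorphism *)

Section exponential_map.
Context {R : realType} {n : nat} {M : riemannianManifold R n}.
Hypothesis hM : complete_manifold M.
Variables (p : M) (kmin : R).
Hypothesis hK : all_sectional_curvatures M (fun K => kmin <= K <= 0).
Implicit Types (C : mindex M) (v w z : 'rV[R]_n).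

Definition expm v : M := geo hM p v 1.
Definition dexp C v : 'M[R]_n := lsubmx (dphase hM p C v 1).

Lemma expm0 : expm 0 = p.
Proof.
suff h : geodesic (fun=> p : M).
  rewrite /expm -(geo_unique hM h) //; apply/rowP => k; rewrite !mxE.
  by rewrite (_ : curve_coord _ _ _ = fun=> mchart (chart_at p) p 0 k)// derive1_cst.
split; first by move=> t; exact: cvg_cst.
move=> t c hc k.
have -> : curve_coord c (fun=> p) k = fun=> mchart c p 0 k by [].
have e : derive1 (fun=> mchart c p 0 k : R) = fun=> 0 by apply/funext => s; rewrite derive1_cst.
rewrite e derive1_cst; split; [exact: derivable_cst|exact: derivable_cst|].
rewrite big1 ?oppr0// => i _; rewrite big1// => j _; rewrite !mxE.
by rewrite [derive1 _ t](_ : _ = 0) ?mulr0 ?mul0r// /curve_coord derive1_cst.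
Qed.

Lemma expm_near C v : mdom C (expm v) -> exists2 d : R, 0 < d & forall z, `|z - v| < d -> mdom C (expm z).
Proof. by move=> /(dphaseP)[]. Qed.

Lemma expm_sd C v : mdom C (expm v) -> sd (fun z => mchart C (expm z)) v (dexp C v).
Proof. exact: sd_lsubmx. Qed.

Lemma dexp_Jac C v w : mdom C (expm v) -> w *m dexp C v = tangent_in C (expm v) (Jac hM p v w 1).
Proof. by move=> hC; rewrite Jac_chart// -lsubmx_mulmx. Qed.

(** A kernel vector would give a Jacobi field vanishing at time 1, which [Jac_expands] forbids. *)
Lemma dexp_unit C v : mdom C (expm v) -> dexp C v \in unitmx.
Proof.
move=> hC; rewrite -row_free_unit; apply: inj_row_free => w.
rewrite dexp_Jac// => h; apply: (@tnorm_eq0 _ _ _ p); apply/eqP; rewrite eq_le tnorm_ge0 andbT.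
have J0 : Jac hM p v w 1 = 0.
  rewrite -[LHS](@tangent_in_at _ _ _ (expm v)).
  by rewrite -(tangent_in_jac (Jac hM p v w 1 : tangent (expm v)) hC (mem_chart_at _)) h mul0mx.
by have := @Jac_expands R n M hM p kmin hK v w; rewrite J0 tnorm0.
Qed.

(** Openness is stated for all small radii at once: it is what makes local lifts continuous. *)
Lemma expm_local v : exists2 r : R, 0 < r &
  (forall z z', `|z - v| < r -> `|z' - v| < r -> expm z = expm z' -> z = z') /\
  forall rho : R, 0 < rho -> rho <= r -> nbhs (expm v) (expm @` [set z | `|z - v| < rho]).
Proof.
set C := chart_at (expm v); have hC : mdom C (expm v) := mem_chart_at _.
have [d d0 hd] := expm_near hC.
have [K K0 [r1 r10 hr1]] := sd_unit_expands (expm_sd hC) (dexp_unit hC).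
have [r2 r20 hr2] := sd_unit_onto (expm_sd hC) (dexp_unit hC).
exists (Num.min (Num.min r1 r2) d); first by rewrite !lt_min r10 r20.
split=> [z z'|rho rho0].
  rewrite !lt_min => /andP[/andP[h1 _] _] /andP[/andP[h1' _] _] e.
  have [_ h] := hr1 z z' h1 h1'; apply/eqP; rewrite -subr_eq0 -normr_le0.
  by rewrite e subrr normr0 mulr0 in h.
rewrite !le_min => /andP[/andP[_ rr2] rd]; have [sg sg0 hs] := hr2 rho rho0 rr2.
have n1 : nbhs (expm v) (mdom C) by apply: open_nbhs_nbhs; split => //; exact: mdom_open.
have n2 : \forall x \near expm v, `|mchart C (expm v) - mchart C x| < sg.
  have := mchart_continuous hC; move=> /(@cvgrPdist_lt _ _ _ _ (nbhs_filter _)); exact.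
apply: filterS2 n1 n2 => x x1 x2; rewrite distrC in x2; have [z zv e] := hs _ x2.
exists z => //; rewrite -(mchartK x1) -e mchartK//.
by apply: hd; apply: lt_le_trans zv rd.
Qed.

Lemma expm_cont v : {for v, continuous expm}.
Proof.
set C := chart_at (expm v); have hC : mdom C (expm v) := mem_chart_at _.
have [d d0 hd] := expm_near hC; have cC := sd_cont (expm_sd hC).
have ci := minv_continuous (chart_img_in hC).
have c : {for v, continuous (minv C \o (fun z => mchart C (expm z)))} by apply: continuous_comp.
move=> U; rewrite -{1}(mchartK hC) => /c h.
have n1 : nbhs v [set z : 'rV[R]_n | `|z - v| < d].
  by apply/(@nbhs_normP _ _ v); exists d => //= z; rewrite /= distrC.
by apply: filterS2 n1 h => z /hd hz /=; rewrite mchartK.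
Qed.

Definition lifts (g : R -> M) (L : R -> 'rV[R]_n) (t : R) := {for t, continuous L} /\ expm (L t) = g t.

Lemma lifts_germ g (L L' : R -> 'rV[R]_n) (t : R) : (\forall s \near t, L s = L' s) -> lifts g L t -> lifts g L' t.
Proof.
move=> e [h1 h2]; have e0 := nbhs_singleton e; split; last by rewrite -e0.
move=> U; rewrite -{1}e0 => /h1 h; apply: filterS2 e h => s /= es; by rewrite es.
Qed.

(** Both agreement and disagreement are open in time: the first by local injectivity of the
    exponential map, the second by continuity. *)
Lemma lifts_uniq g (L L' : R -> 'rV[R]_n) (a b s r : R) : a < s < b -> a < r < b ->
  (forall u, a < u < b -> lifts g L u /\ lifts g L' u) -> L s = L' s -> L r = L' r.
Proof.
move=> sab rab h e; have [//|/eqP ne] := EM (L r = L' r).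
pose P t := a < t < b -> L t = L' t.
have : P r; last by apply.
apply: (itv_propagate sab rab (P := P)) => // t tab.
have [[c1 e1] [c2 e2]] := h t tab; have [d1 d10 hd1] := near_itv tab.
(* If the lifts differ at t they differ nearby, so the hypothesis at u is contradictory. *)
have [eq|neq] := eqVneq (L t) (L' t).
  have [r1 r10 [inj _]] := expm_local (L t).
  have /cvgrPdist_lt/(_ _ r10) n1 := c1; have /cvgrPdist_lt/(_ _ r10) n2 := c2.
  have [d d0 hd] := near_ball (filterI n1 n2).
  exists (Num.min d d1); first by rewrite lt_min d0.
  move=> u w _; rewrite lt_min => /andP[/hd[/= w1 w2] /hd1 wab] _ _.
  have [[_ ew1] [_ ew2]] := h w wab; apply: inj; rewrite ?ew1 ?ew2//; first by rewrite distrC.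
  by rewrite distrC eq.
have dd : 0 < `|L t - L' t| / 2 by rewrite divr_gt0// normr_gt0 subr_eq0.
have /cvgrPdist_lt/(_ _ dd) n1 := c1; have /cvgrPdist_lt/(_ _ dd) n2 := c2.
have [d d0 hd] := near_ball (filterI n1 n2).
exists (Num.min d d1); first by rewrite lt_min d0.
move=> u w; rewrite lt_min => /andP[/hd[/= w1 w2] /hd1 uab] _ /(_ uab) eu _.
exfalso; move: w1 w2; rewrite eu.
have := ler_distD (L' u) (L t) (L' t); rewrite [`|L' u - _|]distrC.
by move: `|_ - _| `|_ - _| `|_ - _| => A B D; lra.
Qed.

(** Where the exponential map is injective preimages can be chosen pointwise; continuity then
    follows from openness. *)
Lemma lift_in_ball g (l : 'rV[R]_n) (r a b : R) :
  (forall z z', `|z - l| < r -> `|z' - l| < r -> expm z = expm z' -> z = z') ->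
  (forall s, a < s < b -> {for s, continuous g}) ->
  (forall s, a < s < b -> (expm @` [set z | `|z - l| < r]) (g s)) ->
  exists V, forall s, a < s < b -> lifts g V s /\ `|V s - l| < r.
Proof.
move=> inj cg hg.
pose V s := if pselect ((expm @` [set z | `|z - l| < r]) (g s)) is left h then projT1 (cid2 h) else 0.
have hV s : a < s < b -> expm (V s) = g s /\ `|V s - l| < r.
  by move=> /hg h; rewrite /V; case: pselect => // h'; case: (cid2 h') => z /=.
exists V => s sab; have [e hl] := hV s sab; split => //; split => //.
have [r1 r10 [_ onto]] := expm_local (V s); have [d d0 hd] := near_itv sab.
apply/cvgrPdist_lt => e1 e10.
pose rho := Num.min (Num.min r1 e1) (r - `|V s - l|).
have rho0 : 0 < rho by rewrite !lt_min r10 e10 subr_gt0.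
have [l1 l2 l3] : [/\ rho <= r1, rho <= e1 & rho <= r - `|V s - l|].
  by rewrite /rho; split; rewrite !ge_min lexx ?orbT.
have h : \forall u \near s, (expm @` [set z | `|z - V s| < rho]) (g u).
  by apply: (cg s sab); rewrite -e; exact: onto.
suff : \forall u \near s, `|V s - V u| < e1 by [].
apply: filterS2 h (ball_near d0 hd) => u [z /= zV ez] uab.
have [eu hu] := hV u uab.
suff <- : z = V u by rewrite distrC; apply: lt_le_trans zV l2.
apply: inj => //; last by rewrite ez eu.
apply: le_lt_trans (ler_distD (V s) _ _) _; rewrite -ltrBrDr; exact: lt_le_trans zV l3.
Qed.

End exponential_map.

(** * Stability of lifts and expansion in charts *)

Section covering.
Context {R : realType} {n : nat} {M : riemannianManifold R n}.
Hypothesis hM : complete_manifold M.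
Variables (p : M) (kmin : R).
Hypothesis hK : all_sectional_curvatures M (fun K => kmin <= K <= 0).
Implicit Types (C : mindex M) (v w z : 'rV[R]_n).
Notation expm := (expm hM p).
Notation lifts := (lifts hM p).

(** Near each time the lifts run in a ball where the exponential map is injective, so closeness to
    the lift of [F y0] at one time forces it at neighbouring times. The parameter is the end point
    of a segment in one use and the homotopy parameter in the other. *)
Lemma lift_stable (Y : topologicalType) (F : Y -> R -> M) (L : Y -> R -> 'rV[R]_n) (y0 : Y) (t0 : R) :
  (\forall y \near y0, forall t : R, {for t, continuous (F y)} /\ lifts (F y) (L y) t) ->
  (forall (t : R) N, nbhs (F y0 t) N -> exists N', exists2 d : R, 0 < d &
     nbhs y0 N' /\ forall y s, N' y -> `|s - t| < d -> N (F y s)) ->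
  (forall e : R, 0 < e -> \forall y \near y0, `|L y t0 - L y0 t0| < e) ->
  forall t (e : R), 0 < e -> \forall y \near y0, `|L y t - L y0 t| < e.
Proof.
move=> hL cF h0 t; have nI (A B : set Y) : nbhs y0 A -> nbhs y0 B -> nbhs y0 (A `&` B) := @filterI _ _ (nbhs_filter y0) A B.
have nS (A B : set Y) : A `<=` B -> nbhs y0 A -> nbhs y0 B := @filterS _ _ (nbhs_filter y0) A B.
have L0 := nbhs_singleton hL.
apply: (@real_propagate R (fun t => forall e : R, 0 < e -> \forall y \near y0, `|L y t - L y0 t| < e) t0) => // t1.
have [r r0 [inj onto]] := @expm_local R n M hM p kmin hK (L y0 t1).
have := onto r r0 (lexx _); rewrite (L0 t1).2.2 => /(cF t1)[N [d1 d10 [hN hd1]]].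
have r2 : 0 < r / 2 by rewrite divr_gt0.
have /cvgrPdist_lt/(_ _ r2)/near_ball[d2 d20 hd2] := (L0 t1).2.1.
exists (Num.min d1 d2); first by rewrite lt_min d10.
set d := Num.min d1 d2 => s u sd ud Ps e e0.
have [dd1 dd2] : d <= d1 /\ d <= d2 by rewrite /d !ge_min !lexx orbT.
have dist_itv (w : R) : t1 - d < w < t1 + d <-> `|w - t1| < d.
  by rewrite ltr_norml; split=> /andP[? ?]; apply/andP; split; lra.
have in0 (w : R) : `|w - t1| < d -> `|L y0 w - L y0 t1| < r / 2.
  by move=> /lt_le_trans/(_ dd2)/hd2; rewrite distrC.
have key : \forall y \near y0, forall w : R, `|w - t1| < d -> `|L y w - L y0 t1| < r.
  have n3 := Ps _ r2; have n4 := nI _ _ hL (nI _ _ hN n3).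
  apply: nS n4 => y [hy [Ny ly]] w wd.
  have [||V hV] := @lift_in_ball R n M hM p kmin hK (F y) (L y0 t1) r (t1 - d) (t1 + d) inj.
  - by move=> v _; exact: (hy v).1.
  - by move=> v /dist_itv/lt_le_trans/(_ dd1); exact: hd1.
  have VL (v : R) : `|v - t1| < d -> `|V v - L y0 t1| < r by move=> /dist_itv/hV[].
  have Vs : V s = L y s.
    apply: inj; [exact: VL| |].
      by apply: le_lt_trans (ler_distD (L y0 s) _ _) _; have := in0 s sd; move: ly; move: `|_ - _| `|_ - _| => A B; lra.
    by rewrite (hV s _).1.2 ?(hy s).2.2//; exact/dist_itv.
  have <- : V w = L y w; last exact: VL.
  apply: (@lifts_uniq R n M hM p kmin hK (F y) V (L y) (t1 - d) (t1 + d) s w _ _ _ Vs); try exact/dist_itv.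
  by move=> v hv; split; [exact: (hV v hv).1|exact: (hy v).2].
have [r1 r10 [_ onto1]] := @expm_local R n M hM p kmin hK (L y0 u).
pose rho := Num.min (Num.min r1 e) (r / 2).
have rho0 : 0 < rho by rewrite !lt_min r10 e0.
have [l1 l2 l3] : [/\ rho <= r1, rho <= e & rho <= r / 2].
  by rewrite /rho; split; rewrite !ge_min lexx ?orbT.
have := onto1 rho rho0 l1; rewrite (L0 u).2.2 => /(cF u)[N1 [d3 d30 [hN1 hd3]]].
apply: nS (nI _ _ (nI _ _ hN1 key) hL) => y [[Ny ky] hy].
have [|z zu ez] := hd3 y u Ny; first by rewrite subrr normr0.
suff <- : z = L y u by apply: lt_le_trans zu l2.
apply: inj; [|exact: ky|by rewrite ez (hy u).2.2].
apply: le_lt_trans (ler_distD (L y0 u) _ _) _; have := in0 u ud; have := lt_le_trans zu l3.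
by move: `|_ - _| `|_ - _| => A B; lra.
Qed.

(** The coordinates of w are recovered from its inner products with the basis by inverting the Gram
    matrix. *)
Lemma norm_le_tnorm (x : M) : exists2 K : R, 0 < K & forall w, `|w| <= K * tnorm x w.
Proof.
set G := mmetric (chart_at x) (mchart (chart_at x) x).
have hG : G \in unitmx by apply: metric_unit; apply: chart_img_in; exact: mem_chart_at.
have [B B0 hB] : exists2 B : R, 0 <= B & forall j, tnorm x (delta_mx 0 j : 'rV_n) <= B.
  exists (\sum_j tnorm x (delta_mx 0 j : 'rV_n)); first by apply: sumr_ge0 => j _; exact: tnorm_ge0.
  by move=> j; rewrite (bigD1 j)//= lerDl; apply: sumr_ge0 => i _; exact: tnorm_ge0.
have wG w : `|w *m G| <= B * tnorm x w.
  apply: mx_norm_le => [|i j]; first by rewrite mulr_ge0// tnorm_ge0.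
  rewrite (ord1 i) (_ : (w *m G) 0 j = inner x w (delta_mx 0 j : 'rV_n)).
    apply: le_trans (inner_norm_le _ _ _) _; rewrite mulrC.
    by rewrite ler_wpM2r ?tnorm_ge0.
  by rewrite /inner -/G trmx_delta -colE [RHS]mxE.
exists (n%:R * B * `|invmx G| + 1); first by rewrite ltr_wpDl// !mulr_ge0.
move=> w; rewrite -{1}[w](mulmxK hG).
apply: le_trans (mulmx_norm_le _ _) _; rewrite mulrDl mul1r.
apply: (@le_trans _ _ (n%:R * B * `|invmx G| * tnorm x w)); last by rewrite lerDl tnorm_ge0.
rewrite -!mulrA ler_wpM2l//.
rewrite [`|invmx G| * _]mulrC mulrA ler_wpM2r//; exact: wG.
Qed.

(* In a chart, the metric is locally bounded, so that [expm] is expanding with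
   a constant that depends on the image point only. *)
Lemma expm_expands C (q : M) : mdom C q -> exists2 r : R, 0 < r & exists2 K : R, 0 < K &
  (forall y, `|y - mchart C q| < r -> chart_img C y) /\
  forall v, mdom C (expm v) -> `|mchart C (expm v) - mchart C q| < r ->
    exists2 d : R, 0 < d & forall z z', `|z - v| < d -> `|z' - v| < d ->
      `|z - z'| <= K * `|mchart C (expm z) - mchart C (expm z')|.
Proof.
move=> hC; have hq := chart_img_in hC.
have [r0 r00 hr0] := chart_img_ball hq.
have [B B0 [r1 r10 hr1]] : exists2 B : R, 0 < B & exists2 r : R, 0 < r & forall y,
    `|y - mchart C q| < r -> `|mmetric C y| <= B.
  have h i j : exists2 d : R, 0 < d & forall y : 'rV[R]_n, `|y - mchart C q| < d ->
      `|mmetric C y i j| <= `|mmetric C (mchart C q) i j| + 1.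
    have [G hG] := metric_sdr i j hq.
    have := sdr_cont hG => /(@cvgrPdist_le _ _ _ _ (nbhs_filter _))/(_ _ ltr01)/(@nbhs_normP _ _ (mchart C q))[d /= d0 hd].
    exists d => // y yd; have := hd y; rewrite /= distrC => /(_ yd) h1.
    rewrite -[mmetric C y i j](subrK (mmetric C (mchart C q) i j)) addrC.
    by apply: le_trans (ler_normD _ _) _; rewrite lerD2l distrC.
  have h' i : exists2 d : R, 0 < d & forall j (y : 'rV[R]_n), `|y - mchart C q| < d ->
      `|mmetric C y i j| <= `|mmetric C (mchart C q) i j| + 1.
    apply: (@fin_min_pos R n (fun j d => forall y : 'rV[R]_n, `|y - mchart C q| < d ->
      `|mmetric C y i j| <= `|mmetric C (mchart C q) i j| + 1)) => [j d d' d0 dd hd y yd|j]; last exact: h.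
    exact/hd/(lt_le_trans yd).
  have [d d0 hd] := @fin_min_pos R n (fun i d => forall j (y : 'rV[R]_n), `|y - mchart C q| < d ->
      `|mmetric C y i j| <= `|mmetric C (mchart C q) i j| + 1)
      (fun i d d' d0 dd hd j y yd => hd j y (lt_le_trans yd dd)) h'.
  exists (`|mmetric C (mchart C q)| + 1); first by rewrite ltr_wpDl.
  exists d => // y yd; apply: mx_norm_le => [|i j]; first by rewrite addr_ge0.
  by apply: le_trans (hd i j y yd) _; rewrite lerD2r mx_entry_le.
have [K1 K10 hK1] := norm_le_tnorm p.
pose r := Num.min r0 r1; pose K2 := K1 * Num.sqrt (n%:R * (n%:R * B)) + 1.
have K20 : 0 < K2 by rewrite ltr_wpDl// mulr_ge0 ?sqrtr_ge0// ltW.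
exists r; first by rewrite lt_min r00.
exists (2 * K2); first by rewrite mulr_gt0.
split=> [y|v hv]; first by rewrite lt_min => /andP[/hr0].
rewrite lt_min => /andP[_ /hr1 hB].
have expw w : `|w| <= K2 * `|w *m dexp hM p C v|.
  apply: le_trans (hK1 w) _; have h1 := @Jac_expands R n M hM p kmin hK v w.
  apply: (@le_trans _ _ (K1 * (Num.sqrt (n%:R * (n%:R * B)) * `|w *m dexp hM p C v|))); last first.
    by rewrite [leLHS]mulrA ler_wpM2r// lerDl.
  rewrite ler_wpM2l ?(ltW K10)//; apply: le_trans h1 _.
  rewrite -[`|w *m _|]ger0_norm// -sqrtr_sqr -sqrtrM ?mulr_ge0 ?(ltW B0)//.
  apply: ler_wsqrtr; rewrite (innerE _ _ hv) -dexp_Jac//; move: (w *m _) => u.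
  apply: le_trans (ler_norm _) _; rewrite /dot.
  apply: le_trans (mx_entry_le _ 0 0) _; apply: le_trans (mulmx_norm_le _ _) _.
  have -> : `|u^T| = `|u|.
    apply/eqP; rewrite eq_le; apply/andP; split; apply: mx_norm_le => // i j.
      by rewrite mxE mx_entry_le.
    by have := mx_entry_le u^T j i; rewrite mxE.
  rewrite expr2 mulrA ler_wpM2r// -!mulrA ler_wpM2l//.
  apply: le_trans (mulmx_norm_le _ _) _; rewrite -mulrA ler_wpM2l// mulrC ler_wpM2r//.
have e0 : 0 < (2 * K2)^-1 by rewrite invr_gt0 mulr_gt0.
have [d d0 hd] := expm_sd hv e0; exists d => // z z' zv zv'.
have h1 := hd z z' zv zv'; have h2 := expw (z - z').
have h3 : `|(z - z') *m dexp hM p C v| <= `|mchart C (expm z) - mchart C (expm z')| + (2 * K2)^-1 * `|z - z'|.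
  rewrite -[_ *m _](subKr (mchart C (expm z) - mchart C (expm z'))).
  by apply: le_trans (ler_normB _ _) _; rewrite lerD2l.
have := le_trans h2 (ler_wpM2l (ltW K20) h3).
rewrite mulrDr [K2 * (_ * _)]mulrA invfM mulrCA mulfV ?gt_eqF// mulr1.
by move: `|z - z'| => X; rewrite -mulrA; move: (K2 * _) => Y; lra.
Qed.

(** Local Lipschitz bounds with a common constant add up; real induction replaces a subdivision. *)
Lemma lip_global (V : R -> 'rV[R]_n) (K a b : R) : 0 <= K ->
  (forall u, a <= u <= b -> exists2 d : R, 0 < d & forall w w' : R, `|w - u| < d -> `|w' - u| < d ->
     `|V w - V w'| <= K * `|w - w'|) ->
  a <= b -> `|V b - V a| <= K * (b - a).
Proof.
move=> K0 h ab; apply: (@real_induction R (fun u => `|V u - V a| <= K * (u - a)) a b); last by rewrite ab lexx.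
- move=> t /andP[at_ tb] IH; have [<-|at'] := eqVneq a t; first by rewrite !subrr normr0 mulr0.
  have lat : a < t by rewrite lt_neqAle at' at_.
  have [|d d0 hd] := h t; first by rewrite at_.
  pose w := Num.max a (t - d / 2).
  have wt : w < t by rewrite gt_max lat gtrBl divr_gt0.
  have wd : `|w - t| < d.
    rewrite distrC gtr0_norm ?subr_gt0// ltrBlDr -ltrBlDl lt_max; apply/orP; right.
    by rewrite ltrD2l ltrN2 ltr_pdivrMr// ltr_pMr// ltr1n.
  apply: le_trans (ler_distD (V w) _ _) _.
  have h1 := IH w; rewrite wt le_max lexx in h1.
  have := hd t w; rewrite subrr normr0 => /(_ d0 wd) h2.
  apply: le_trans (lerD h2 (h1 isT)) _.
  by rewrite gtr0_norm ?subr_gt0// -mulrDr addrA subrK.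
- move=> t /andP[at_ tb] IH; have [|d d0 hd] := h t; first by rewrite at_.
  exists d => // s /andP[ts sd] _; apply: le_trans (ler_distD (V t) _ _) _.
  have h1 := IH t; rewrite at_ lexx in h1.
  have := hd s t; rewrite subrr normr0 gtr0_norm ?subr_gt0// ltrBlDl => /(_ sd d0) h2.
  by apply: le_trans (lerD h2 (h1 isT)) _; rewrite -mulrDr addrA subrK.
Qed.

End covering.

(** * Lifting of segments in a chart *)

Section path_lifting.
Context {R : realType} {n : nat} {M : riemannianManifold R n}.
Hypothesis hM : complete_manifold M.
Variables (p : M) (kmin : R).
Hypothesis hK : all_sectional_curvatures M (fun K => kmin <= K <= 0).
Implicit Types (C : mindex M) (v w z y : 'rV[R]_n).
Notation expm := (expm hM p).
Notation lifts := (lifts hM p).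
Let expm_loc v := @expm_local R n M hM p kmin hK v.

(** Curves on [0, 1] are prolonged by constants, so that paths, segments and homotopies are
    continuous at all real times. *)
Definition cl01 : R -> R := clamp 2^-1 2^-1.

Lemma cl01_in (t : R) : 0 <= cl01 t <= 1.
Proof.
have h : (0 : R) <= 2^-1 by rewrite invr_ge0.
by have := interval_ball (clamp_ball 2^-1 t h); rewrite -/(cl01 t) subrr (_ : 2^-1 + 2^-1 = 1 :> R)//; field.
Qed.

Lemma cl01_id (t : R) : 0 <= t <= 1 -> cl01 t = t.
Proof.
move=> /andP[t0 t1]; apply: clamp_id; apply: ball_interval.
by rewrite subrr t0 /= (_ : 2^-1 + 2^-1 = 1 :> R)//; field.
Qed.

Lemma cl01_cont (t : R) : {for t, continuous cl01}.
Proof. exact: clamp_cont. Qed.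

Lemma cl01_lip (u w : R) : `|cl01 u - cl01 w| <= `|u - w|.
Proof. exact: clamp_lip. Qed.

Definition segm y y' (t : R) : 'rV[R]_n := y + cl01 t *: (y' - y).

Lemma segm0 y y' : segm y y' 0 = y.
Proof. by rewrite /segm cl01_id ?lexx ?ler01// scale0r addr0. Qed.

Lemma segm1 y y' : segm y y' 1 = y'.
Proof. by rewrite /segm cl01_id ?lexx ?ler01// scale1r addrC subrK. Qed.

Lemma segm_ball c (r : R) y y' (t : R) : `|y - c| < r -> `|y' - c| < r -> `|segm y y' t - c| < r.
Proof.
move=> h h'; have /andP[s0 s1] := cl01_in t; rewrite /segm; set s := cl01 t in s0 s1 *.
have -> : y + s *: (y' - y) - c = (1 - s) *: (y - c) + s *: (y' - c).
  by apply/rowP => i; rewrite !mxE; ring.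
apply: le_lt_trans (ler_normD _ _) _; rewrite !normrZ !ger0_norm ?subr_ge0//.
have [->|sn] := eqVneq s 0; first by rewrite subr0 mul1r mul0r addr0.
have sp : 0 < s by rewrite lt_neqAle eq_sym sn.
have l1 : (1 - s) * `|y - c| <= (1 - s) * r by rewrite ler_wpM2l ?subr_ge0// ltW.
have l2 : s * `|y' - c| < s * r by rewrite ltr_pM2l.
by move: l1 l2; move: (_ * `|_|) (_ * `|_|) => A B; lra.
Qed.

Lemma segm_lip y y' (s t : R) : `|segm y y' s - segm y y' t| <= `|y' - y| * `|s - t|.
Proof.
rewrite /segm opprD addrACA subrr add0r -scalerBl normrZ mulrC ler_wpM2l//.
exact: cl01_lip.
Qed.

Lemma segm_lip2 y y' y2 (t : R) : `|segm y y' t - segm y y2 t| <= `|y' - y2|.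
Proof.
have -> : segm y y' t - segm y y2 t = cl01 t *: (y' - y2).
  by rewrite /segm; apply/rowP => i; rewrite !mxE; ring.
rewrite normrZ.
by have /andP[s0 s1] := cl01_in t; rewrite ger0_norm// ler_piMl.
Qed.

Lemma ball_segm_chart C c (r : R) y y' : (forall y, `|y - c| < r -> chart_img C y) ->
  `|y - c| < r -> `|y' - c| < r ->
  (forall t : R, mdom C (minv C (segm y y' t)) /\ mchart C (minv C (segm y y' t)) = segm y y' t) /\
  forall t : R, {for t, continuous (fun s => minv C (segm y y' s))}.
Proof.
move=> hr h h'; have hi (t : R) : chart_img C (segm y y' t) by apply/hr/segm_ball.
split=> t; first exact: chart_imgP.
apply: (@continuous_comp _ _ _ (segm y y') (minv C)); last by apply: minv_continuous; exact: hi.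
apply/cvgrPdist_le => e e0; have [y0|y0] := eqVneq y' y.
  by apply: filterE => s; rewrite /segm y0 subrr !scaler0 subrr normr0 ltW.
have d0 : 0 < `|y' - y| by rewrite normr_gt0 subr_eq0.
apply: (@ball_near _ t (e / `|y' - y|)) => [|s st]; first exact: divr_gt0.
apply: le_trans (segm_lip _ _ _ _) _; rewrite mulrC -ler_pdivlMr// distrC.
exact: ltW.
Qed.

(** The lift cannot escape to infinity: the exponential map expands, so a lift of a segment is
    Lipschitz, has a limit in the tangent space at the end of its interval, and continues from
    there. *)
Lemma line_lift C (q : M) (r K : R) : 0 < K ->
  (forall y, `|y - mchart C q| < r -> chart_img C y) ->
  (forall v, mdom C (expm v) -> `|mchart C (expm v) - mchart C q| < r ->
    exists2 d : R, 0 < d & forall z z', `|z - v| < d -> `|z' - v| < d ->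
      `|z - z'| <= K * `|mchart C (expm z) - mchart C (expm z')|) ->
  forall v y, mdom C (expm v) -> `|mchart C (expm v) - mchart C q| < r -> `|y - mchart C q| < r ->
  exists2 L, L 0 = v & forall t : R, lifts (fun s => minv C (segm (mchart C (expm v)) y s)) L t.
Proof.
move=> K0 hr hexp v y hv hvr hy; set y0 := mchart C (expm v) in hvr *.
have [hg cg] := ball_segm_chart hr hvr hy; set g := fun s => minv C (segm y0 y s).
have g0 : expm v = g 0 by rewrite /g segm0 mchartK.
have germ := @lifts_germ R n M hM p g.
have uniq (V V' : R -> 'rV[R]_n) (a b s u : R) := @lifts_uniq R n M hM p kmin hK g V V' a b s u.
have loc l (t : R) : expm l = g t -> exists r1 : R, [/\ 0 < r1,
     forall z z', `|z - l| < r1 -> `|z' - l| < r1 -> expm z = expm z' -> z = z' &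
     exists2 d : R, 0 < d & exists V : R -> 'rV[R]_n, forall s, t - d < s < t + d -> lifts g V s /\ `|V s - l| < r1].
  move=> el; have [r1 r10 [inj onto]] := expm_loc l; exists r1; split=> //.
  have := onto r1 r10 (lexx _); rewrite el => /(cg t)/near_ball[d d0 hd].
  exists d => //; apply: (@lift_in_ball R n M hM p kmin hK g l r1 (t - d) (t + d)) => //.
  by move=> s /andP[h1 h2]; apply: hd; rewrite ltr_norml; apply/andP; split; lra.
have base (t : R) l : expm l = g t -> exists V a b, [/\ a < t < b, V t = l & solves (lifts g) V a b].
  move=> el; have [r1 [r10 inj [d d0 [V hV]]]] := loc l t el.
  have td : t - d < t < t + d by rewrite gtrBl ltrDl d0.
  exists V, (t - d), (t + d); split=> //; last by move=> s /hV[].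
  by have [[_ e] ln] := hV t td; apply: inj; rewrite ?subrr ?normr0// e el.
have : reaches (lifts g) 0 v 1; last first.
  move=> [V [a [b [/andP[a0 b0] /andP[a1 b1] V0 hV]]]].
  have in01 (t : R) : a < cl01 t < b by have /andP[h1 h2] := cl01_in t; rewrite (lt_le_trans a0 h1) (le_lt_trans h2 b1).
  exists (V \o cl01); first by rewrite /= cl01_id ?lexx ?ler01.
  move=> t; have [h1 h2] := hV _ (in01 t); split.
    by apply: continuous_comp => //; exact: cl01_cont.
  by rewrite /= h2 /g /segm cl01_id// cl01_in.
apply: (@glue_right _ _ (lifts g) 0 1 v germ uniq); [exact: base| |by rewrite lexx ler01].
move=> V a t /andP[a0 t0] t1 V0 hV.
have K'0 : 0 <= K * `|y - y0| by rewrite mulr_ge0// ltW.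
(* The Lipschitz constant does not depend on how close s' is to the end t. *)
have lipV (s s' : R) : 0 <= s -> s <= s' -> s' < t -> `|V s' - V s| <= K * `|y - y0| * (s' - s).
  move=> s0 ss' s't; apply: lip_global => // u /andP[su us'].
  have uat : a < u < t by rewrite (lt_le_trans a0 (le_trans s0 su)) (le_lt_trans us' s't).
  have [cV eV] := hV u uat.
  have [||d d0 hd] := hexp (V u); rewrite ?eV; [exact: (hg u).1| |].
    by rewrite (hg u).2; exact: segm_ball.
  have /cvgrPdist_lt/(_ _ d0)/near_ball[d1 d10 hd1] := cV.
  have [d2 d20 hd2] := near_itv uat.
  exists (Num.min d1 d2); first by rewrite lt_min d10.
  move=> w w'; rewrite !lt_min => /andP[/hd1 h1 /hd2 h2] /andP[/hd1 h1' /hd2 h2'].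
  rewrite distrC in h1; rewrite distrC in h1'.
  apply: le_trans (hd _ _ h1 h1') _; rewrite (hV w h2).2 (hV w' h2').2 (hg w).2 (hg w').2.
  by rewrite -mulrA ler_wpM2l ?(ltW K0)// segm_lip.
pose u j := t - t / 2 / 2 ^+ j.
have u_in j : [/\ 0 <= u j, u j < t & u j <= u j.+1].
  have x0 : 0 < (2 ^+ j)^-1 :> R by rewrite invr_gt0 exprn_gt0.
  have x1 : (2 ^+ j)^-1 <= 1 :> R by rewrite invf_le1 ?exprn_gt0// exprn_ege1// ler1n.
  have := mulr_gt0 t0 x0; have := ler_wpM2l (ltW t0) x1; rewrite mulr1.
  have E : t / 2 / 2 ^+ j = t * (2 ^+ j)^-1 / 2 by rewrite mulrAC.
  have E' : t / 2 / 2 ^+ j.+1 = t * (2 ^+ j)^-1 / 4 by rewrite exprS; field; rewrite expf_neq0.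
  by rewrite /u E E'; move: (t * _) => X; split; lra.
have D0 : 0 <= K * `|y - y0| * t by rewrite mulr_ge0// ltW.
have [|l hl] := @geometric_limit_mx R 1 n (fun j => V (u j)) _ D0.
  move=> j; have [h1 h2 h3] := u_in j; have [_ h4 _] := u_in j.+1.
  apply: le_trans (lipV _ _ h1 h3 h4) _; rewrite -[leRHS]mulrA ler_wpM2l//.
  have x0 : 0 < (2 ^+ j)^-1 :> R by rewrite invr_gt0 exprn_gt0.
  have := mulr_gt0 t0 x0.
  have E : t / 2 / 2 ^+ j = t * (2 ^+ j)^-1 / 2 by rewrite mulrAC.
  have E' : t / 2 / 2 ^+ j.+1 = t * (2 ^+ j)^-1 / 4 by rewrite exprS; field; rewrite expf_neq0.
  by rewrite /u E E'; move: (t * _) => X; lra.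
have ul : (fun j => V (u j)) @ \oo --> l.
  apply/cvgrPdist_lt => e e0; have [N hN] := @exp2_small R (2 * (K * `|y - y0| * t)) e (mulr_ge0 (ler0n _ _) D0) e0.
  exists N => // j /= Nj; rewrite distrC; apply: le_lt_trans (hl j) _; apply: le_lt_trans hN.
  apply: ler_wpM2l; first exact: mulr_ge0.
  by rewrite lef_pV2 ?posrE ?exprn_gt0// ler_weXn2l// ler1n.
have ut : u @ \oo --> t.
  apply/cvgrPdist_lt => e e0; have [N hN] := @exp2_small R (t / 2) e (divr_ge0 (ltW t0) (ler0n _ _)) e0.
  exists N => // j /= Nj; rewrite /u subKr ger0_norm; last by rewrite !divr_ge0// ?exprn_ge0// ltW.
  apply: le_lt_trans hN.
  apply: ler_wpM2l; first by rewrite divr_ge0// ltW.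
  by rewrite lef_pV2 ?posrE ?exprn_gt0// ler_weXn2l// ler1n.
(* The limit lies over g t because limits in the Hausdorff space M are unique. *)
have el : expm l = g t.
  have c1 : (fun j => g (u j)) @ \oo --> expm l.
    have -> : (fun j => g (u j)) = (fun j => expm (V (u j))).
      apply/funext => j; have [h1 h2 _] := u_in j; rewrite (hV (u j) _).2// h2 (lt_le_trans a0 h1)//.
    by apply: (@cvg_comp _ _ _ (fun j => V (u j)) expm _ _ _ ul); exact: (@expm_cont R n M hM p).
  have c2 : (fun j => g (u j)) @ \oo --> g t by apply: (@cvg_comp _ _ _ u g _ _ _ ut); exact: cg.
  exact: (cvg_unique (@mhausdorff R n M) c1 c2).
have [r1 [r10 inj [d d0 [V' hV']]]] := loc l t el.
have [N1 _ hN1] : \forall j \near \oo, `|l - V (u j)| < r1 by move/cvgrPdist_lt: ul; exact.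
have [N2 _ hN2] : \forall j \near \oo, `|t - u j| < d by move/cvgrPdist_lt: ut; exact.
pose j := maxn N1 N2; have h1 := hN1 j (leq_maxl _ _); have h2 := hN2 j (leq_maxr _ _).
have [k1 k2 _] := u_in j.
have jd : t - d < u j < t + d.
  by move: h2; rewrite ltr_norml => /andP[? ?]; apply/andP; split; lra.
have [k3 _ _] := u_in j.+1; have [k4 k5 k6] := u_in j.
have u0 : 0 < u j.+1.
  rewrite /u subr_gt0 -mulrA -[ltRHS]mulr1 ltr_pM2l// -invfM invf_lt1 ?mulr_gt0 ?exprn_gt0//.
  by apply: (@lt_le_trans _ _ 2); rewrite ?ltr1n// ler_peMr// exprn_ege1// ler1n.
have [h1' h2'] : `|l - V (u j.+1)| < r1 /\ `|t - u j.+1| < d.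
  by split; [apply: hN1|apply: hN2]; rewrite /= leqW// ?leq_maxl ?leq_maxr.
have [_ k8 _] := u_in j.+1.
have jd' : t - d < u j.+1 < t + d.
  by move: h2'; rewrite ltr_norml => /andP[? ?]; apply/andP; split; lra.
exists V', (t - d), (t + d), (u j.+1); split=> //.
- by move=> s /hV'[].
- by rewrite gtrBl ltrDl d0.
- by rewrite u0.
- have [[_ e1] e2] := hV' _ jd'; apply: inj => //; first by rewrite distrC.
  by rewrite e1 (hV _ _).2// k8 andbT (lt_trans a0 u0).
Qed.

End path_lifting.

(** * Covering property and bijectivity of the exponential map *)

Section cartan_hadamard.
Context {R : realType} {n : nat} {M : riemannianManifold R n}.
Hypothesis hM : complete_manifold M.
Variables (p : M) (kmin : R).
Hypothesis hK : all_sectional_curvatures M (fun K => kmin <= K <= 0).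
Implicit Types (C : mindex M) (v w z y : 'rV[R]_n).
Notation expm := (expm hM p).
Notation lifts := (lifts hM p).

(** The section maps y to the end of the lift of the segment from the image of v to y; [lift_stable]
    makes it continuous. The radius does not depend on the sheet v, which is the covering
    property. *)
Lemma local_section C (q : M) : mdom C q -> exists2 r : R, 0 < r &
  forall v, mdom C (expm v) -> `|mchart C (expm v) - mchart C q| < r ->
  exists2 S : 'rV[R]_n -> 'rV[R]_n, S (mchart C (expm v)) = v &
    forall y, `|y - mchart C q| < r -> {for y, continuous S} /\ expm (S y) = minv C y.
Proof.
move=> hC; have [r r0 [K K0 [hr hexp]]] := @expm_expands R n M hM p kmin hK C q hC.
exists r => // v hv hvr; have ll := @line_lift R n M hM p kmin hK C q r K K0 hr hexp v _ hv hvr.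
set y0 := mchart C (expm v) in hvr ll *.
pose F y s := minv C (segm y0 y s).
pose L y := if pselect (`|y - mchart C q| < r) is left h then projT1 (cid2 (ll y h)) else fun=> 0.
have hL y : `|y - mchart C q| < r -> L y 0 = v /\ forall t : R, lifts (F y) (L y) t.
  by move=> h; rewrite /L; case: pselect => // h'; case: (cid2 _).
have cF y : `|y - mchart C q| < r -> forall t : R, {for t, continuous (F y)}.
  by move=> h; have [_] := ball_segm_chart hr hvr h.
have inr y (h : `|y - mchart C q| < r) : exists2 d : R, 0 < d & forall z, `|z - y| < d -> `|z - mchart C q| < r.
  exists (r - `|y - mchart C q|); first by rewrite subr_gt0.
  by move=> z; rewrite ltrBrDr => hz; apply: le_lt_trans (ler_distD y _ _) hz.
exists (fun y => L y 1).
  have [h0 h1] := hL y0 hvr.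
  have H := @lifts_uniq R n M hM p kmin hK (F y0) (L y0) (fun=> v) (-1) 2 0 1.
  apply: H => //.
  - by apply/andP; split; lra.
  - by apply/andP; split; lra.
  - move=> u _; split; first exact: h1.
    split; first exact: cvg_cst.
    by rewrite /F /segm subrr scaler0 addr0 mchartK.
move=> y hy; split; last by have [_ /(_ 1)[_ ->]] := hL y hy; rewrite /F segm1.
have [d d0 hd] := inr y hy.
have nb : nbhs y [set z : 'rV[R]_n | `|z - y| < d].
  by apply/(@nbhs_normP _ _ y); exists d => //= z; rewrite /= distrC.
have := @lift_stable R n M hM p kmin hK ('rV[R]_n : topologicalType) F L y 0.
move=> H; apply/(@cvgrPdist_lt _ _ _ _ (nbhs_filter y)) => e e0.
have {H} := H _ _ _ 1 e e0 => H.
suff : \forall z \near y, `|L z 1 - L y 1| < e.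
  by apply: filterS => z; rewrite distrC.
apply: H.
- by apply: filterS nb => z /hd hz t; split; [exact: cF|have [_] := hL z hz; exact].
- move=> t N hN.
  have hi : chart_img C (segm y0 y t) by apply/hr/segm_ball.
  have /(@nbhs_normP _ _ (segm y0 y t))[rho /= rho0 hrho] := minv_continuous hi hN.
  exists [set z : 'rV[R]_n | `|z - y| < rho / 2], (rho / 2 / (`|y - y0| + 1)).
    by rewrite !divr_gt0// ltr_wpDl.
  split.
    apply/(@nbhs_normP _ _ y); exists (rho / 2); first by rewrite /= divr_gt0.
    by move=> z; rewrite /= distrC.
  move=> z s zy st; apply: hrho; rewrite /= distrC.
  apply: le_lt_trans (ler_distD (segm y0 y s) _ _) _.
  have l1 := segm_lip2 y0 z y s; have l2 := segm_lip y0 y s t.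
  have l3 : `|y - y0| * `|s - t| <= rho / 2.
    have h : `|s - t| * (`|y - y0| + 1) < rho / 2 by rewrite -ltr_pdivlMr// ltr_wpDl.
    by apply: le_trans (ltW h); rewrite mulrDr mulr1 mulrC lerDl.
  have l4 := le_lt_trans l1 zy; have l5 := le_trans l2 l3.
  by move: l4 l5; move: `|_ - _| `|_ - _| => A B; lra.
- move=> e1 e10; apply: filterS nb => z /hd hz.
  by rewrite (hL z hz).1 (hL y hy).1 subrr normr0.
Qed.

(** Composing g with a local section gives a local lift through any prescribed point above it, on a
    time window independent of that point; these glue. *)
Lemma path_lift (g : R -> M) v : (forall t : R, {for t, continuous g}) -> expm v = g 0 ->
  exists2 L, L 0 = v & forall t : R, lifts g L t.
Proof.
move=> cg ev.
apply: (@glue_global R _ (lifts g) (fun s x => expm x = g s)) => //.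
- exact: lifts_germ.
- by move=> V V' a b s u; exact: (@lifts_uniq R n M hM p kmin hK).
- by move=> V r [].
- move=> t; have hC : mdom (chart_at (g t)) (g t) := mem_chart_at _.
  set C := chart_at (g t) in hC; have [r r0 hr] := local_section hC.
  have cC : {for t, continuous (fun s => mchart C (g s))}.
    by apply: (@continuous_comp _ _ _ g (mchart C)); [exact: cg|exact: mchart_continuous].
  have /cvgrPdist_lt/(_ _ r0) n1 := cC.
  have [d d0 hd] := near_ball (filterI n1 (near_dom (@cg t) hC)).
  exists d => // s x sd ex; have [/= h1 h2] := hd s sd.
  have [||S Sx hS] := hr x; rewrite ?ex//; first by rewrite distrC.
  exists (fun u => S (mchart C (g u))); split; first by rewrite -ex.
  move=> u /andP[u1 u2]; have ud : `|u - t| < d by rewrite ltr_norml; apply/andP; split; lra.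
  have [/= h3 h4] := hd u ud; rewrite distrC in h3; have [h5 h6] := hS _ h3; split.
    apply: (@continuous_comp _ _ _ (fun u => mchart C (g u)) S) => //.
    apply: (@continuous_comp _ _ _ g (mchart C)); [exact: cg|exact: mchart_continuous].
  by rewrite h6 mchartK.
Qed.

(** Simple connectedness gives continuity within the square only; composition with a retraction onto
    it makes it unconditional. *)
Lemma within_comp (S T U : topologicalType) (A : set T) (f : T -> U) (h : S -> T) (s : S) :
  {within A, continuous f} -> (forall s, A (h s)) -> {for s, continuous h} ->
  {for s, continuous (f \o h)}.
Proof.
move=> cf hA ch; have /subspace_continuousP/(_ _ (hA s)) := cf => cfs N /cfs hN.
have := ch _ hN; rewrite /= => H; have := @filterS _ _ (nbhs_filter s) _ _ _ H; apply.
by move=> x /=; apply.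
Qed.

Hypothesis hS : @simply_connected R M.

(** The segment from v0 to v1 projects to a loop, which contracts. The end points of the lifted
    loops all lie over one point and vary continuously, hence are constant: v1 = v0. *)
Lemma expm_inj : injective expm.
Proof.
move=> v0 v1 e01; pose g (t : R) := expm (v0 + t *: (v1 - v0)).
have cseg (t : R) : {for t, continuous (fun t : R => v0 + t *: (v1 - v0))}.
  exact: is_derive_cont (lineP v0 (v1 - v0) t).
have cg (t : R) : {for t, continuous g}.
  apply: (@continuous_comp _ _ _ (fun t : R => v0 + t *: (v1 - v0)) expm); first exact: cseg.
  exact: expm_cont.
have g0 : g 0 = expm v0 by rewrite /g scale0r addr0.
have g1 : g 1 = expm v0 by rewrite /g scale1r addrC subrK.
have [H [cH H0 H1 Hb]] := hS.2 g (continuous_subspaceT cg) (etrans g0 (esym g1)).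
pose F (s t : R) := H (cl01 s, cl01 t).
have cl_in (t : R) : cl01 t \in `[0, 1] by rewrite in_itv /= cl01_in.
have cF2 (st : R * R) : {for st, continuous (fun st => F st.1 st.2)}.
  apply: (@within_comp (R * R)%type (R * R)%type M (`[0, 1] `*` `[0, 1]) H (fun st => (cl01 st.1, cl01 st.2))) => //.
    by move=> st' /=; split; rewrite /= cl_in.
  have c1 : (fun st : R * R => cl01 st.1) @ st --> cl01 st.1.
    by apply: (@continuous_comp _ _ _ fst (@cl01 R)); [exact: cvg_fst|exact: cl01_cont].
  have c2 : (fun st : R * R => cl01 st.2) @ st --> cl01 st.2.
    by apply: (@continuous_comp _ _ _ snd (@cl01 R)); [exact: cvg_snd|exact: cl01_cont].
  exact: cvg_pair c1 c2.
have cF (s t : R) : {for t, continuous (F s)}.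
  apply: (@continuous_comp _ _ _ (fun t => (s, t)) (fun st => F st.1 st.2)); last exact: cF2.
  have c1 : (fun _ : R => s) @ t --> s by exact: cvg_cst.
  have c2 : (fun u : R => u) @ t --> t by exact: cvg_id.
  exact: cvg_pair c1 c2.
have F0 (s : R) : F s 0 = expm v0.
  by rewrite /F [cl01 0]cl01_id ?lexx ?ler01// (Hb _ (cl_in s)).1.
have F1 (s : R) : F s 1 = expm v0.
  by rewrite /F [cl01 1]cl01_id ?lexx ?ler01// (Hb _ (cl_in s)).2.
pose L s := projT1 (cid2 (path_lift (cF s) (esym (F0 s)))).
have L0 s : L s 0 = v0 by rewrite /L; case: cid2.
have hL s (t : R) : lifts (F s) (L s) t by rewrite /L; case: cid2.
have in12 : (-1 < (0 : R) < 2) /\ (-1 < (1 : R) < 2) by split; apply/andP; split; lra.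
have uniq g' L1 L2 := @lifts_uniq R n M hM p kmin hK g' L1 L2 (-1) 2.
have E0 : L 0 1 = v1.
  have -> : v1 = v0 + cl01 (1 : R) *: (v1 - v0).
    by rewrite cl01_id ?lexx ?ler01// scale1r addrC subrK.
  apply: (uniq (F 0) (L 0) (fun t => v0 + cl01 t *: (v1 - v0)) 0 1 in12.1 in12.2).
    move=> u _; split; [exact: hL|split].
      apply: (@continuous_comp _ _ _ (@cl01 R) (fun t : R => v0 + t *: (v1 - v0))); [exact: cl01_cont|exact: cseg].
    by rewrite /F [cl01 0]cl01_id ?lexx ?ler01// H0.
  by rewrite L0 [cl01 0]cl01_id ?lexx ?ler01// scale0r addr0.
have E1 : L 1 1 = v0.
  apply: (uniq (F 1) (L 1) (fun=> v0) 0 1 in12.1 in12.2); last exact: L0.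
  move=> u _; split; [exact: hL|split; first exact: cvg_cst].
  by rewrite /F [cl01 1]cl01_id ?lexx ?ler01// H1 ?g0.
rewrite -E1 -E0.
apply: esym; apply: (uniq (fun=> expm v0) (fun s => L s 1) (fun=> L 1 1) 1 0 in12.2 in12.1) => // s _.
split; last by split; [exact: cvg_cst|rewrite E1].
split; last by rewrite (hL s 1).2 F1.
apply/cvgrPdist_lt => e e0.
suff : \forall u \near s, `|L u 1 - L s 1| < e by apply: filterS => u; rewrite distrC.
apply: (@lift_stable R n M hM p kmin hK (R : topologicalType) F L s 0) => //.
- by apply: filterE => u t.
- move=> t N /(cF2 (s, t))[[A B] /= [hA hB] hAB].
  have [d d0 hd] := near_ball hB; exists A, d => //; split=> // y u Ay ut.
  by apply: (hAB (y, u)); split=> //=; exact: hd.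
- by move=> e1 e10; apply: filterE => u; rewrite !L0 subrr normr0.
Qed.

(** A path from p to q lifts to a path starting at 0; its end point is a preimage of q. *)
Lemma expm_onto (q : M) : exists v, expm v = q.
Proof.
have [g [cg g0 g1]] := hS.1 p q.
have c (t : R) : {for t, continuous (g \o cl01)}.
  apply: (@within_comp R R M `[0, 1]%classic g) => //; last exact: cl01_cont.
  by move=> s /=; rewrite in_itv /= cl01_in.
have [|L L0 hL] := @path_lift (g \o cl01) 0 c.
  by rewrite expm0 /= cl01_id ?lexx ?ler01.
exists (L 1); rewrite (hL 1).2 /= cl01_id ?lexx ?ler01//.
Qed.

End cartan_hadamard.

(** * Affine reparametrization of geodesics *)

Section reparametrization.
Context {R : realType} {n : nat} {M : riemannianManifold R n}.
Implicit Types (C : mindex M).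

(** A geodesic can be recognised from a candidate velocity [U] in every chart, without computing
    [derive1] of its coordinates. *)
Lemma geodesic_intro (g : R -> M) (U : mindex M -> R -> 'rV[R]_n) :
  continuous g ->
  (forall t C, mdom C (g t) -> is_derive t 1 (fun s => mchart C (g s)) (U C t)) ->
  (forall t C, mdom C (g t) -> is_derive t 1 (U C) (- (U C t *m GamU C (mchart C (g t)) (U C t)))) ->
  geodesic g.
Proof.
move=> cg h1 h2; split=> // t C hC k.
have vE : velocity_in C g t = U C t := velocity_inE (h1 t C hC).
have d1 : is_derive t 1 (curve_coord C g k) (U C t 0 k).
  by have /is_derive_mxP := h1 t C hC; exact.
have near1 : \forall s \near t, U C s 0 k = derive1 (curve_coord C g k) s.
  apply: filterS (near_dom (cg t) hC) => s hs; apply/esym/is_derive1E.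
  by have /is_derive_mxP := h1 s C hs; exact.
have d2 : is_derive t 1 (derive1 (curve_coord C g k)) ((- (U C t *m GamU C (mchart C (g t)) (U C t))) 0 k).
  apply: near_is_derive near1 _; have /is_derive_mxP := h2 t C hC; exact.
split; [by case: d1|by case: d2|rewrite (is_derive1E d2) vE [LHS]mxE].
rewrite mxE exchange_big /=; congr (- _); apply: eq_bigr => j _.
rewrite GamUE mulr_sumr; apply: eq_bigr => l _; rewrite mulrC; congr (_ * _).
by rewrite mulrC.
Qed.

Lemma geodesic_affine (g : R -> M) (a b : R) : geodesic g ->
  geodesic (fun s => g (a + b * s)) /\
  forall t : R, velocity (fun s => g (a + b * s)) t = b *: velocity g (a + b * t) :> 'rV_n.
Proof.
move=> hg; have da (t : R) : is_derive t 1 (fun s : R => a + b * s) b.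
  have h := is_derive_add (is_derive_cst1 a t) (is_derive_mulr (is_derive_cst1 b t) (@is_derive_id _ _ t 1)).
  by rewrite mul0r add0r mulr1 add0r in h.
have comp (W : normedModType R) (F : R -> W) (F' : W) (t : R) :
    is_derive (a + b * t) 1 F F' -> is_derive t 1 (fun s => F (a + b * s)) (b *: F').
  move=> hF; apply/is_derive_epsP => e e0.
  have b1 : 0 < `|b| + 1 by rewrite ltr_wpDl.
  have /is_derive_epsP/(_ (e / (`|b| + 1)) (divr_gt0 e0 b1))[d d0 hd] := hF.
  exists (d / (`|b| + 1)); first exact: divr_gt0.
  move=> h hh; rewrite -[h *: 1]/(h * 1) mulr1.
  have bh : `|b * h| <= (`|b| + 1) * `|h| by rewrite normrM ler_wpM2r// lerDl.
  have := hd (b * h); rewrite -[b * h *: 1]/(b * h * 1) mulr1 mulrDr addrA scalerA [h * b]mulrC.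
  move=> H; have hl : `|b * h| < d by apply: le_lt_trans bh _; rewrite mulrC -ltr_pdivlMr.
  apply: le_trans (H hl) _; apply: le_trans (ler_wpM2l (ltW (divr_gt0 e0 b1)) bh) _.
  by rewrite mulrA divfK ?gt_eqF.
have h1 (t : R) C : mdom C (g (a + b * t)) ->
    is_derive t 1 (fun s => mchart C (g (a + b * s))) (b *: velocity_in C g (a + b * t)).
  by move=> hC; have [h _] := geodesic_chart hg hC; exact: (comp _ _ _ _ h).
split.
  apply: (@geodesic_intro _ (fun C t => b *: velocity_in C g (a + b * t)) _ h1).
  - move=> t; apply: (@continuous_comp _ _ _ (fun s : R => a + b * s) g); last exact: geodesic_cont.
    exact: is_derive_cont (da t).
  - move=> t C hC; have [_ h] := geodesic_chart hg hC.
    have H := comp _ _ _ _ h.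
    have -> : - (b *: velocity_in C g (a + b * t) *m
        GamU C (mchart C (g (a + b * t))) (b *: velocity_in C g (a + b * t))) =
      b *: (b *: (- (velocity_in C g (a + b * t) *m GamU C (mchart C (g (a + b * t))) (velocity_in C g (a + b * t))))).
      by rewrite GamUZ -scalemxAl -scalemxAr !scalerN.
    have := is_derive_mulmx (is_derive_cst1 (b%:M : 'M[R]_1) t) H.
    rewrite mul0mx add0r mul_scalar_mx; congr (is_derive _ _ _ _).
    by apply/funext => s; rewrite mul_scalar_mx.
move=> t; have ha := mem_chart_at (g (a + b * t)).
rewrite [LHS](velocity_inE (h1 t _ ha)).
by rewrite -[velocity g _ in RHS]tangent_in_at geodesic_velocity.
Qed.

End reparametrization.

(** * The logarithm and its derivative along curves *)

Section logarithm.
Context {R : realType} {n : nat} {M : riemannianManifold R n}.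
Hypothesis hM : complete_manifold M.
Variable kmin : R.
Hypothesis hK : all_sectional_curvatures M (fun K => kmin <= K <= 0).
Hypothesis hS : @simply_connected R M.
Implicit Types (C : mindex M) (p q : M) (u v w : 'rV[R]_n).

Lemma rexpE p v : rexp p v = expm hM p v.
Proof.
have h : [set y | exists g, [/\ geodesic g, g 0 = p, velocity g 0 = v :> 'rV_n & g 1 = y]] (expm hM p v).
  by exists (geo hM p v); have [h1 h2 h3] := geoP hM p v.
have [g [h1 h2 h3 h4]] := @xgetPex _ p _ (ex_intro _ _ h).
apply: (etrans (esym h4)); exact: (geo_unique hM h1).
Qed.

Lemma rexp_rlog p q : rexp p (rlog p q) = q.
Proof.
have [v hv] := @expm_onto R n M hM p kmin hK hS q.
rewrite -rexpE in hv.
exact: (@xgetPex _ (0 : 'rV[R]_n) [set v : 'rV[R]_n | rexp p v = q] (ex_intro _ v hv)).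
Qed.

Lemma rexp_inj p v w : rexp p v = rexp p w -> v = w.
Proof. by rewrite !rexpE; exact: (@expm_inj R n M hM p kmin hK hS). Qed.

Lemma rlog_rexp p v : rlog p (rexp p v) = v.
Proof. by apply: (@rexp_inj p); rewrite rexp_rlog. Qed.

Lemma expm_rlog p q : expm hM p (rlog p q) = q.
Proof. by rewrite -rexpE rexp_rlog. Qed.

Lemma rlog_eq p q v : rexp p v = q -> rlog p q = v.
Proof. by move=> <-; rewrite rlog_rexp. Qed.

Lemma rexp0 p : rexp p (0 : 'rV[R]_n) = p.
Proof. by rewrite rexpE expm0. Qed.

Lemma rlog_self p : rlog p p = 0.
Proof. by apply: rlog_eq; rewrite rexp0. Qed.

Lemma geodesic_rlog (g : R -> M) : geodesic g -> rlog (g 0) (g 1) = velocity g 0.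
Proof.
move=> hg; apply: rlog_eq; rewrite rexpE /expm.
by rewrite -(@geo_unique R n M hM (g 0) g (velocity g 0) hg).
Qed.

Lemma geo_affine p v (a b : R) : geo hM p v a = rexp p (a *: v) /\
  rlog (geo hM p v a) (geo hM p v b) = (b - a) *: velocity (geo hM p v) a.
Proof.
have hg := geo_geodesic hM p v; split.
  have [h1 h2] := geodesic_affine 0 a hg.
  transitivity (geo hM p v (0 + a * 1)); first by rewrite mulr1 add0r.
  rewrite rexpE; apply: (@geo_unique R n M hM p _ _ h1); first by rewrite mulr0 addr0 geo0.
  by rewrite h2 mulr0 addr0 geo_velocity0.
have [h1 h2] := geodesic_affine a (b - a) hg.
have := geodesic_rlog h1; rewrite mulr0 addr0 mulr1 addrC subrK => ->.
by rewrite h2 mulr0 addr0.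
Qed.

(** The geodesic from p to q, run backwards, leaves q with the opposite of its final velocity. *)
Lemma rlog_rev p q : rlog q p = - velocity (geo hM p (rlog p q)) 1 :> 'rV_n.
Proof.
have [_] := geo_affine p (rlog p q) 1 0.
by rewrite geo0 -/(expm hM p _) expm_rlog sub0r scaleN1r.
Qed.

Lemma tnorm_rlogC p q : tnorm q (rlog q p) = tnorm p (rlog p q).
Proof.
rewrite rlog_rev tnormN /tnorm -(@speed_cst R n M hM p (rlog p q) 1).
by rewrite -/(expm hM p _) expm_rlog.
Qed.

(** Inverse function theorem for strict derivatives: the expansion estimate turns an error relative
    to |z - z'| into one relative to |y - y'|. *)
Lemma rlog_sd C p q : mdom C q ->
  sd (fun y => rlog p (minv C y)) (mchart C q) (invmx (dexp hM p C (rlog p q))).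
Proof.
move=> hC; set v := rlog p q; have ev : expm hM p v = q := expm_rlog p q.
have hCv : mdom C (expm hM p v) by rewrite ev.
set A := dexp hM p C v; have hA : A \in unitmx by exact: (@dexp_unit R n M hM p kmin hK).
have hf := expm_sd hCv; have [K K0 [r r0 hr]] := sd_unit_expands hf hA.
have [r1 r10 [_ onto]] := @expm_local R n M hM p kmin hK v.
move=> e e0; pose k := n%:R * `|invmx A| * K + 1.
have k0 : 0 < k by rewrite ltr_wpDl// !mulr_ge0// ltW.
have [r2 r20 hr2] := hf (e / k) (divr_gt0 e0 k0).
pose rho := Num.min (Num.min r r2) r1.
have rho0 : 0 < rho by rewrite !lt_min r0 r20.
have := onto rho rho0; rewrite ge_min lexx orbT => /(_ isT); rewrite ev -{1}(mchartK hC).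
move=> /(minv_continuous (chart_img_in hC))/(@nbhs_normP _ _ (mchart C q))[d /= d0 hd].
have [d1 d10 hd1] := chart_img_ball (chart_img_in hC).
have hl y : `|y - mchart C q| < Num.min d d1 ->
    [/\ mchart C (expm hM p (rlog p (minv C y))) = y, `|rlog p (minv C y) - v| < r &
        `|rlog p (minv C y) - v| < r2].
  rewrite lt_min => /andP[yd /hd1/chart_imgP[y1 y2]].
  have [|z zv ez] := hd y; first by rewrite /= distrC.
  have -> : rlog p (minv C y) = z by apply: rlog_eq; rewrite rexpE.
  by move: zv; rewrite /= ez !lt_min => /andP[/andP[-> ->] _]; split.
exists (Num.min d d1); first by rewrite lt_min d0.
move=> y y' /hl[h1 h2 h3] /hl[h1' h2' h3'].
set z := rlog p (minv C y) in h1 h2 h3 *; set z' := rlog p (minv C y') in h1' h2' h3' *.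
have [_ hb] := hr z z' h2 h2'; have := hr2 z z' h3 h3'; rewrite h1 h1' in hb *.
have -> : z - z' - (y - y') *m invmx A = - ((y - y' - (z - z') *m A) *m invmx A).
  by rewrite [in RHS]mulmxBl -[in RHS]mulmxA mulmxV// mulmx1 opprB.
rewrite normrN => hc; apply: le_trans (mulmx_norm_le _ _) _.
have X0 : 0 <= n%:R * `|invmx A| by rewrite mulr_ge0.
rewrite mulrAC; apply: le_trans (ler_wpM2l X0 hc) _.
rewrite mulrCA; apply: le_trans (ler_wpM2l (ltW (divr_gt0 e0 k0)) (ler_wpM2l X0 hb)) _.
rewrite [X in _ * X]mulrA -/k -[e / k * _]mulrA ler_wpM2l ?(ltW e0)// mulrA ler_piMl//.
by rewrite ler_pdivrMl// mulr1 lerDl.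
Qed.

(* A curve that is differentiable at t; its derivative in a chart is then
   given by the velocity. *)
Definition diff_at (g : R -> M) (t : R) := {for t, continuous g} /\ forall C, mdom C (g t) ->
  is_derive t 1 (fun s => mchart C (g s)) (tangent_in C (g t) (velocity g t)).

Lemma geodesic_diff (g : R -> M) (t : R) : geodesic g -> diff_at g t.
Proof.
move=> hg; split=> [|C hC]; first exact: geodesic_cont.
by rewrite geodesic_velocity//; have [] := geodesic_chart hg hC.
Qed.

(** [w] is the derivative of the logarithm along g, characterised as the initial slope of the Jacobi
    field that arrives with the velocity of g. *)
Lemma rlog_curve p (g : R -> M) (t : R) : diff_at g t -> exists2 w,
  is_derive t 1 (fun s => rlog p (g s)) w &
  Jac hM p (rlog p (g t)) w 1 = velocity g t.
Proof.
move=> [cg dg]; set C := chart_at (g t); have hC : mdom C (g t) := mem_chart_at _.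
set v := rlog p (g t); set A := dexp hM p C v.
have ev : expm hM p v = g t := expm_rlog p (g t).
have hA : A \in unitmx by apply: (@dexp_unit R n M hM p kmin hK); rewrite ev.
exists (velocity g t *m invmx A).
  have := sd_curve (rlog_sd p hC) (dg C hC); rewrite tangent_in_at.
  by apply: near_is_derive; apply: filterS (near_dom cg hC) => s hs; rewrite mchartK.
have h := @dexp_Jac R n M hM p C v (velocity g t *m invmx A).
have hC' : mdom C (expm hM p v) by rewrite ev.
have e (x : M) (J : 'rV_n) : x = g t -> tangent_in C x J = J by move=> ->; exact: tangent_in_at.
by have := h hC'; rewrite mulmxKV// (e _ _ ev) => <-.
Qed.

(** First variation: the Gauss lemma moves <log p, w> from p to the point g t. *)
Lemma sqr_rlog_derive p (g : R -> M) (t : R) : diff_at g t ->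
  is_derive t 1 (fun s => inner p (rlog p (g s)) (rlog p (g s)))
    (- (2 * inner (g t) (rlog (g t) p) (velocity g t))).
Proof.
move=> dg; have [w hw Jw] := rlog_curve p dg.
have hi : is_derive t 1 (fun s => inner p (rlog p (g s)) (rlog p (g s)))
    (inner p w (rlog p (g t)) + inner p (rlog p (g t)) w).
  set G := mmetric (chart_at p) (mchart (chart_at p) p).
  have h1 := is_derive_mulmx (is_derive_mulmx hw (is_derive_cst1 G t)) (is_derive_trmx hw).
  have := is_derive_entry 0 0 h1; rewrite mulmx0 addr0 mxE; exact.
rewrite [inner p w _]innerC -mulr2n -mulr_natl -(gauss hM) Jw in hi.
rewrite -mulrN -innerNl rlog_rev opprK.
by move: hi; rewrite -/(expm hM p _) expm_rlog.
Qed.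

Lemma rlog_lip p (g : R -> M) (t : R) w : diff_at g t ->
  is_derive t 1 (fun s => rlog p (g s)) w -> tnorm p w <= tnorm (g t) (velocity g t).
Proof.
move=> dg hw; have [w' hw' Jw] := rlog_curve p dg.
have -> : w = w' := is_derive_uniq hw hw'.
have := @Jac_expands R n M hM p kmin hK (rlog p (g t)) w'.
by rewrite Jw -/(expm hM p _) expm_rlog.
Qed.

End logarithm.

(** * Distance and comparison *)

Section unit_interval_integral.
Context {R : realType}.

(** The larger interval gives two-sided derivatives at the end points 0 and 1. *)
Lemma integral_derive01 (f F : R -> R) : (forall t, {for t, continuous f}) ->
  (forall t : R, -1 < t < 2 -> is_derive t 1 F (f t)) ->
  (\int[@lebesgue_measure R]_(t in `[0, 1]%classic) f t)%R = F 1 - F 0.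
Proof.
move=> cf hF; have cF (t : R) : -1 < t < 2 -> {for t, continuous F} by move=> /hF/is_derive_cont.
rewrite /Rintegral (@continuous_FTC2 R f F 0 1 ltr01)//.
- exact: continuous_subspaceT.
- split.
  + by move=> x; rewrite in_itv /= => /andP[x0 x1]; have [|h _] := hF x; [apply/andP; split; lra|].
  + by apply: cvg_at_right_filter; apply: cF; apply/andP; split; lra.
  + by apply: cvg_at_left_filter; apply: cF; apply/andP; split; lra.
- move=> x; rewrite in_itv /= => /andP[x0 x1].
  by apply: is_derive1E; apply: hF; apply/andP; split; lra.
Qed.

End unit_interval_integral.

(** * Riemannian distance as the norm of the logarithm *)

Section distance.
Context {R : realType} {n : nat} {M : riemannianManifold R n}.
Hypothesis hM : complete_manifold M.
Variable kmin : R.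
Hypothesis hK : all_sectional_curvatures M (fun K => kmin <= K <= 0).
Hypothesis hS : @simply_connected R M.
Implicit Types (C : mindex M) (p q x y z : M).
Let rlog_self := @rlog_self R n M hM kmin hK hS.
Let expm_rlog := @expm_rlog R n M hM kmin hK hS.

Lemma C1_curve_diff (g : R -> M) (t : R) : C1_curve g -> diff_at g t.
Proof.
move=> [cg hg]; split; first exact: cg.
have h C : mdom C (g t) -> is_derive t 1 (fun s => mchart C (g s)) (velocity_in C g t).
  move=> hC; apply/is_derive_mxP => i k; rewrite (ord1 i) mxE.
  have [h _] := hg t C hC k; exact: derivable1_is_derive h.
by move=> C hC; have hu := h C hC; rewrite (tangent_in_velocity (cg t) hC hu).
Qed.

Lemma speed_cont (g : R -> M) (t : R) : C1_curve g ->
  {for t, continuous (fun s => tnorm (g s) (velocity g s))}.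
Proof.
move=> hg; have [cg dg] := hg; set C := chart_at (g t); have hC : mdom C (g t) := mem_chart_at _.
pose f s := dot (mmetric C (mchart C (g s))) (velocity_in C g s) (velocity_in C g s).
have cv i : {for t, continuous (fun s => velocity_in C g s 0 i)}.
  rewrite (_ : (fun s => _) = derive1 (curve_coord C g i)); first by have [_] := dg t C hC i.
  by apply/funext => s; rewrite mxE.
have cG i j : {for t, continuous (fun s => mmetric C (mchart C (g s)) i j)}.
  have [_ h] := C1_curve_diff t hg.
  have h1 := metric_curve (chart_img_in hC) (h C hC).
  exact: is_derive_cont (is_derive_entry i j h1).
have cf : {for t, continuous f}.
  rewrite /f /dot (_ : (fun s => _) = fun s => \sum_j (\sum_i velocity_in C g s 0 i *
     mmetric C (mchart C (g s)) i j) * velocity_in C g s 0 j); last first.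
    by apply/funext => s; rewrite mxE; apply: eq_bigr => j _; rewrite mxE [X in _ * X]mxE.
  apply: cvg_big => [|j _]; first exact: add_continuous.
  apply: cvgM; last exact: cv.
  by apply: cvg_big => [|i _]; [exact: add_continuous|apply: cvgM; [exact: cv|exact: cG]].
have nf : \forall s \near t, Num.sqrt (f s) = tnorm (g s) (velocity g s).
  apply: filterS (near_dom (cg t) hC) => s hs; rewrite /tnorm (innerE _ _ hs) /f.
  have [_ h] := C1_curve_diff s hg.
  by rewrite (velocity_inE (h C hs)).
have cs : {for t, continuous (fun s => Num.sqrt (f s))}.
  by apply: (@continuous_comp _ _ _ f Num.sqrt); [exact: cf|exact: sqrt_continuous].
have e0 := nbhs_singleton nf.
move=> U; rewrite -{1}e0 => /cs h; apply: filterS2 nf h => s /= es; by rewrite es.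
Qed.

(** Along a C^1 curve |e| times the arc length minus <log_p g, e> is nondecreasing, where e is the
    total displacement of log_p: the logarithm does not increase speeds. Concatenation is the
    triangle inequality in the tangent space. *)
Lemma rlog_nonexpansive p y z (l : R) : joined_by_length y z l ->
  tnorm p (rlog p z - rlog p y) <= l.
Proof.
elim=> [g hg|x1 y1 z1 l1 l2 _ IH1 _ IH2]; last first.
  have -> : rlog p z1 - rlog p x1 = (rlog p z1 - rlog p y1) + (rlog p y1 - rlog p x1) :> 'rV_n.
    by rewrite addrA subrK.
  by apply: le_trans (tnorm_triangle _ _ _) _; rewrite addrC lerD.
set e := rlog p (g 1) - rlog p (g 0) : 'rV_n.
have [F hF] := @exists_primitive R (fun t => tnorm (g t) (velocity g t)) (-1) 2 (fun t => @speed_cont g t hg).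
have lE : curve_length g = F 1 - F 0.
  by apply: integral_derive01 => // t; exact: speed_cont.
pose f (t : R) := tnorm p e * F t - inner p (rlog p (g t)) e.
pose w (t : R) := projT1 (cid2 (@rlog_curve R n M hM kmin hK hS p g t (C1_curve_diff t hg))).
have hw (t : R) : is_derive t 1 (fun s => rlog p (g s)) (w t) by rewrite /w; case: cid2.
have hf (t : R) : -1 < t < 2 -> is_derive t 1 f (tnorm p e * tnorm (g t) (velocity g t) - inner p (w t) e).
  move=> ht; have h1 := is_derive_mulr (is_derive_cst1 (tnorm p e) t) (hF t ht).
  set G := mmetric (chart_at p) (mchart (chart_at p) p).
  have h2 := is_derive_entry 0 0 (is_derive_mulmx (is_derive_mulmx (hw t) (is_derive_cst1 G t)) (is_derive_cst1 e^T t)).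
  rewrite mulmx0 addr0 mulmx0 addr0 in h2.
  by have := is_derive_sub h1 h2; rewrite mul0r add0r.
have : f 0 <= f 1.
  apply: (@derive_ge0_le _ f (fun t => tnorm p e * tnorm (g t) (velocity g t) - inner p (w t) e)) => // t /andP[t0 t1].
    by apply: hf; apply/andP; split; lra.
  rewrite subr_ge0; apply: le_trans (inner_le _ _ _) _; rewrite mulrC ler_wpM2l ?tnorm_ge0//.
  exact: (@rlog_lip R n M hM kmin hK hS p g t _ (C1_curve_diff t hg) (hw t)).
have ee : inner p (rlog p (g 1)) e - inner p (rlog p (g 0)) e = tnorm p e ^+ 2.
  by rewrite tnorm_sqr -innerNl -innerDl.
rewrite /f lE => h; have h' : tnorm p e ^+ 2 <= tnorm p e * (F 1 - F 0) by rewrite mulrBr -ee; lra.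
have l0 : 0 <= F 1 - F 0.
  rewrite subr_ge0; apply: (@derive_ge0_le _ F (fun t => tnorm (g t) (velocity g t))) => // t /andP[t0 t1].
    by apply: hF; apply/andP; split; lra.
  exact: tnorm_ge0.
have [->//|e0] := eqVneq (tnorm p e) 0.
have ep : 0 < tnorm p e by rewrite lt_neqAle eq_sym e0 tnorm_ge0.
by rewrite -(ler_pM2l ep) -expr2.
Qed.

Lemma geodesic_C1 (g : R -> M) : geodesic g -> C1_curve g.
Proof.
move=> [cg hg]; split; first exact: cg.
move=> t C hC k; have [h1 h2 _] := hg t C hC k; split; first exact: h1.
exact: is_derive_cont (derivable1_is_derive h2).
Qed.

Lemma joined_geodesic x y : joined_by_length x y (tnorm x (rlog x y)).
Proof.
set v := rlog x y; have hg := geo_geodesic hM x v.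
have -> : tnorm x v = curve_length (geo hM x v).
  have sp (t : R) : tnorm (geo hM x v t) (velocity (geo hM x v) t) = tnorm x v.
    by rewrite /tnorm (speed_cst hM).
  rewrite -[LHS]mul1r -[LHS]subr0 -[X in _ - X](mul0r (tnorm x v)); apply/esym.
  apply: (@integral_derive01 R _ (fun t => t * tnorm x v)).
  - by move=> t; apply: speed_cont; exact: geodesic_C1.
  - move=> t _; rewrite sp.
    have := is_derive_mulr (@is_derive_id _ _ t 1) (is_derive_cst1 (tnorm x v) t).
    by rewrite mul1r mulr0 addr0.
by have := joined_C1 _ (geodesic_C1 hg); rewrite geo0 -/(expm hM x v) expm_rlog.
Qed.

(** The radial geodesic attains the norm of the logarithm, and [rlog_nonexpansive] with p = x shows
    that no joining curve is shorter. *)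
Lemma distE x y : dist x y = tnorm x (rlog x y).
Proof.
have lb : lbound [set l | joined_by_length x y l] (tnorm x (rlog x y)).
  by move=> l /= /(rlog_nonexpansive x); rewrite rlog_self subr0.
apply/eqP; rewrite eq_le; apply/andP; split.
  apply: ge_inf; last exact: joined_geodesic.
  by exists (tnorm x (rlog x y)).
by apply: lb_le_inf => //; exists (tnorm x (rlog x y)); exact: joined_geodesic.
Qed.

Lemma distC x y : dist x y = dist y x.
Proof. by rewrite !distE -(@tnorm_rlogC R n M hM kmin hK hS). Qed.

Lemma dist_ge0 x y : 0 <= dist x y.
Proof. by rewrite distE tnorm_ge0. Qed.

Lemma dist_rexp x (v : 'rV_n) : dist x (rexp x v) = tnorm x v.
Proof. by rewrite distE (@rlog_rexp R n M hM kmin hK hS). Qed.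

Lemma rlog_dist_le p y z : tnorm p (rlog p z - rlog p y) <= dist y z.
Proof. by rewrite distE; apply: rlog_nonexpansive; exact: joined_geodesic. Qed.

Lemma dist_triangle x y z : dist x z <= dist x y + dist y z.
Proof.
have := tnorm_triangle x (rlog x y) (rlog x z - rlog x y); rewrite addrC subrK -!distE => h.
by apply: le_trans h _; rewrite lerD2l rlog_dist_le.
Qed.

End distance.

(** * Hessian comparison for the squared distance *)

Section comparison.
Context {R : realType} {n : nat} {M : riemannianManifold R n}.
Hypothesis hM : complete_manifold M.
Variable kmin : R.
Hypothesis hK : all_sectional_curvatures M (fun K => kmin <= K <= 0).
Hypothesis hS : @simply_connected R M.
Implicit Types (C : mindex M) (p q x y z : M).
Let expm_rlog := @expm_rlog R n M hM kmin hK hS.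
Let rlog_rev := @rlog_rev R n M hM kmin hK hS.

(** log_{g s} p is minus the final velocity of the geodesic from p to g s. Its covariant derivative
    along g is minus that of the Jacobi field in time, by symmetry of the connection. *)
Lemma rlog_cov p (g : R -> M) (t : R) (w : 'rV[R]_n) : diff_at g t ->
  is_derive t 1 (fun s => rlog p (g s)) w -> Jac hM p (rlog p (g t)) w 1 = velocity g t ->
  has_cov g (fun s => rlog (g s) p) (fun=> - JacV hM p (rlog p (g t)) w 1) t.
Proof.
move=> [cg dg] hw Jw; set C := chart_at (g t); have hC : mdom C (g t) := mem_chart_at _.
set v := rlog p (g t); have ev : geo hM p v 1 = g t := expm_rlog p (g t).
suff h : has_cov g (fun s => velocity (geo hM p (rlog p (g s))) 1) (fun=> JacV hM p v w 1) t.
  have h1 := has_cov_scaleN h; apply: has_cov_germ h1; apply: filterE => s.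
  exact/esym/rlog_rev.
have hCv : mdom C (geo hM p v 1) by rewrite ev.
have u_ := dg C hC; apply: (has_cov_chart hM cg hC u_).
have [_ _ hsd] := dphaseP hCv.
have hp := sd_curve hsd hw.
have hp' : is_derive t 1 (fun s => phase C (geo hM p (rlog p (g s))) 1)
    (row_mx (lsubmx (w *m dphase hM p C v 1)) (rsubmx (w *m dphase hM p C v 1))) by rewrite hsubmxK.
have [_ hr] := is_derive_row_mxK hp'.
have E : tangent_in C (g t) (JacV hM p v w 1) - tangent_in C (g t) (velocity (geo hM p v) 1) *m
    GamU C (mchart C (g t)) (tangent_in C (g t) (velocity g t)) = rsubmx (w *m dphase hM p C v 1).
  have h1 := @JacV_chart R n M hM p C v w 1 hCv; have h2 := @Jac_chart R n M hM p C v w 1 hCv.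
  have h3 := geodesic_velocity (geo_geodesic hM p v) hCv.
  have e (x : M) (J : 'rV_n) : x = g t -> tangent_in C x J = tangent_in C (g t) J by move=> ->.
  rewrite (e _ _ ev) in h1; rewrite (e _ _ ev) Jw in h2; rewrite (e _ _ ev) in h3.
  rewrite h1 h2 h3 ev (GamU_sym _ _ (chart_img_in hC)); exact: addrK.
rewrite E; apply: near_is_derive hr; apply: filterS (near_dom cg hC) => s hs.
have hCs : mdom C (geo hM p (rlog p (g s)) 1) by rewrite -/(expm hM p _) expm_rlog.
rewrite /phase row_mxKr -(geodesic_velocity (geo_geodesic hM p _) hCs).
by rewrite -/(expm hM p _) expm_rlog.
Qed.

Lemma JacE p v w (t : R) : Jac hM p v w t = w *m lsubmx (dphase hM p (chart_at (geo hM p v t)) v t).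
Proof. by rewrite /Jac lsubmx_mulmx. Qed.

Lemma JacVE p v (t : R) : exists A, forall w, JacV hM p v w t = w *m A.
Proof.
exists (rsubmx (dphase hM p (chart_at (geo hM p v t)) v t) +
  lsubmx (dphase hM p (chart_at (geo hM p v t)) v t) *m
  GamU (chart_at (geo hM p v t)) (mchart (chart_at (geo hM p v t)) (geo hM p v t))
     (velocity_in (chart_at (geo hM p v t)) (geo hM p v) t)).
by move=> w; rewrite /JacV rsubmx_mulmx lsubmx_mulmx mulmxDr mulmxA.
Qed.

Variables (k2 : R) (phi psi : R -> R).
Hypothesis dphi : forall t : R, is_derive t 1 phi (psi t).
Hypothesis dpsi : forall t : R, is_derive t 1 psi (k2 * phi t).
Hypothesis phi0 : phi 0 = 0.
Hypothesis phi1 : phi 1 = 1.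
Hypothesis psi1 : 1 <= psi 1.

Lemma JacV_bounds p v w : `|kmin| * inner p v v <= k2 ->
  let J := Jac hM p v w 1 in let W := JacV hM p v w 1 in let x := geo hM p v 1 in
  inner x J J <= inner x W J <= psi 1 * inner x J J.
Proof.
move=> hv /=; rewrite (@JacV_upper R n M hM p kmin hK v w phi psi k2)// andbT.
by have := @Jac_le_JacV R n M hM p kmin hK v w 1 ltr01; rewrite mul1r.
Qed.

Lemma psd_cauchy (a b c : R) : (forall s, 0 <= a + 2 * s * b + s ^+ 2 * c) -> 0 <= c -> b ^+ 2 <= a * c.
Proof.
move=> h c0; have [ce|cn] := eqVneq c 0.
  have [->|bn] := eqVneq b 0; first by rewrite expr0n ce mulr0.
  have := h (- (a + 1) / (2 * b)); rewrite ce mulr0 addr0.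
  rewrite (_ : a + _ = -1); last by field.
  by rewrite lerNr oppr0 ler10.
have cp : 0 < c by rewrite lt_neqAle eq_sym cn.
have := h (- (b / c)); rewrite (_ : a + _ + _ = (a * c - b ^+ 2) / c); last by field.
by rewrite pmulr_lge0 ?invr_gt0// subr_ge0.
Qed.

(** By [JacV_bounds] the form <J_a, J_b'> - <J_a, J_b> at time 1 lies between 0 and (psi 1 - 1)
    times the metric, and by [wronskian] it is symmetric; Cauchy-Schwarz for it bounds the mixed
    values. *)
Lemma hess_bound p v w (U : 'rV[R]_n) : `|kmin| * inner p v v <= k2 ->
  let J := Jac hM p v w 1 in let W := JacV hM p v w 1 in let x := geo hM p v 1 in
  `|inner x U W - inner x U J| <= (psi 1 - 1) * (tnorm x U * tnorm x J).
Proof.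
move=> hv /=; set x := geo hM p v 1; have hx : mdom (chart_at x) x := mem_chart_at x.
have hA : dexp hM p (chart_at x) v \in unitmx by exact: (@dexp_unit R n M hM p kmin hK).
(* Every vector at the end point is the value of a Jacobi field, since the differential of the
   exponential map is onto. *)
have [w' w'E] : exists w', Jac hM p v w' 1 = U.
  by exists (U *m invmx (dexp hM p (chart_at x) v)); rewrite JacE -/x mulmxKV.
rewrite -w'E; have [A hA'] := JacVE p v 1.
pose J w := Jac hM p v w 1; pose W w := JacV hM p v w 1.
have JD (a b : 'rV[R]_n) (s : R) : J (a + s *: b) = J a + s *: J b.
  by rewrite /J !JacE mulmxDl scalemxAl.
have WD (a b : 'rV[R]_n) (s : R) : W (a + s *: b) = W a + s *: W b.
  by rewrite /W !hA' mulmxDl scalemxAl.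
pose B a b := inner x (J a) (W b) - inner x (J a) (J b).
have Bsym a b : B a b = B b a.
  by rewrite /B [inner x (J a) (J b)]innerC; congr (_ - _); rewrite innerC [RHS]innerC; exact: wronskian.
have Bb a : 0 <= B a a <= (psi 1 - 1) * tnorm x (J a) ^+ 2.
  have /andP[h1 h2] := @JacV_bounds p v a hv; rewrite tnorm_sqr /B [inner x (J a) (W a)]innerC.
  by rewrite subr_ge0 h1 /= mulrBl mul1r lerD2r.
have key (ja jb wa wb : 'rV[R]_n) (s : R) :
    inner x (ja + s *: jb) (wa + s *: wb) - inner x (ja + s *: jb) (ja + s *: jb) =
    (inner x ja wa - inner x ja ja) + s * (inner x ja wb - inner x ja jb)
    + s * (inner x jb wa - inner x jb ja) + s ^+ 2 * (inner x jb wb - inner x jb jb).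
  rewrite !innerDl !innerDr !innerZl !innerZr; ring.
have Bexp a b (s : R) : B (a + s *: b) (a + s *: b) = B a a + 2 * s * B b a + s ^+ 2 * B b b.
  rewrite /B JD WD key -/(B a a) -/(B a b) -/(B b a) -/(B b b) (Bsym a b); ring.
have := psd_cauchy (a := B w w) (b := B w' w) (c := B w' w'); rewrite -/(J w') -/(W w) -/(J w) -/(B w' w) => h.
have hb : B w' w ^+ 2 <= B w w * B w' w'.
  by apply: h => [s|]; [rewrite -Bexp; case/andP: (Bb (w + s *: w'))|case/andP: (Bb w')].
have k0 : 0 <= psi 1 - 1 by rewrite subr_ge0.
rewrite -ler_sqr ?nnegrE ?mulr_ge0 ?tnorm_ge0// real_normK ?num_real//.
apply: le_trans hb _; have /andP[a0 a1] := Bb w; have /andP[c0 c1] := Bb w'.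
apply: le_trans (ler_pM a0 c0 a1 c1) _; rewrite le_eqVlt; apply/orP; left; apply/eqP.
by move: (tnorm x (J w)) (tnorm x (J w')) => X Y; ring.
Qed.

Section along_geodesic.
Variables (x y p : M).
Let g := geo hM x (rlog x y).
Let hg : geodesic g := geo_geodesic hM x (rlog x y).
Hypothesis hd : forall t, 0 <= t <= 1 -> `|kmin| * dist p (rexp x (t *: rlog x y)) ^+ 2 <= k2.

Lemma segment_start : g 0 = x. Proof. exact: geo0. Qed.
Lemma segment_end : g 1 = y. Proof. exact: expm_rlog. Qed.
Lemma segment_velocity : velocity g 0 = rlog x y :> 'rV_n. Proof. exact: geo_velocity0. Qed.

Lemma segment_dist (t : R) : 0 <= t <= 1 ->
  `|kmin| * inner p (rlog p (g t)) (rlog p (g t)) <= k2.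
Proof.
move=> /hd; rewrite (@distE R n M hM kmin hK hS) tnorm_sqr.
by have [<- _] := @geo_affine R n M hM kmin hK hS x (rlog x y) t 0.
Qed.

Lemma segment_speed (t : R) : inner (g t) (velocity g t) (velocity g t) = dist x y ^+ 2.
Proof. by rewrite (speed_cst hM) (@distE R n M hM kmin hK hS) tnorm_sqr. Qed.

Definition seg_w (t : R) : 'rV[R]_n :=
  projT1 (cid2 (@rlog_curve R n M hM kmin hK hS p g t (geodesic_diff t hg))).

Lemma seg_wP (t : R) : is_derive t 1 (fun s => rlog p (g s)) (seg_w t) /\
  Jac hM p (rlog p (g t)) (seg_w t) 1 = velocity g t.
Proof. by rewrite /seg_w; case: cid2. Qed.

Definition seg_W (t : R) : 'rV[R]_n := JacV hM p (rlog p (g t)) (seg_w t) 1.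

Lemma seg_cov (t : R) : has_cov g (fun s => rlog (g s) p) (fun=> - seg_W t) t.
Proof. by have [h1 h2] := seg_wP t; apply: rlog_cov => //; exact: geodesic_diff. Qed.

Lemma seg_hess (t : R) (U : 'rV[R]_n) : 0 <= t <= 1 ->
  `|inner (g t) U (seg_W t) - inner (g t) U (velocity g t)| <=
    (psi 1 - 1) * (tnorm (g t) U * tnorm (g t) (velocity g t)) /\
  dist x y ^+ 2 <= inner (g t) (seg_W t) (velocity g t) <= psi 1 * dist x y ^+ 2.
Proof.
move=> ht; have [_ h] := seg_wP t; have hv := segment_dist ht.
have := @hess_bound p (rlog p (g t)) (seg_w t) U hv; have := @JacV_bounds p (rlog p (g t)) (seg_w t) hv.
by rewrite /= h -/(seg_W t) -/(expm hM p _) expm_rlog segment_speed.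
Qed.

Let E (t : R) := inner p (rlog p (g t)) (rlog p (g t)).
Let E1 (t : R) := - (2 * inner (g t) (rlog (g t) p) (velocity g t)).
Let E2 (t : R) := 2 * inner (g t) (seg_W t) (velocity g t).

Lemma seg_dE (t : R) : is_derive t 1 E (E1 t).
Proof. exact: (@sqr_rlog_derive R n M hM kmin hK hS p g t (geodesic_diff t hg)). Qed.

(** The second derivative of the squared distance along a geodesic: velocity is parallel, so only
    the logarithm is differentiated. *)
Lemma seg_dE1 (t : R) : is_derive t 1 E1 (E2 t).
Proof.
have h := cov_inner hg (@seg_cov t) (velocity_cov hg).
have := is_derive_opp (is_derive_mulr (is_derive_cst1 (2 : R) t) h).
by rewrite inner0r addr0 innerNl mul0r add0r mulrN opprK.
Qed.

Lemma taylor2_le (F F1 F2 : R -> R) (c : R) :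
  (forall t : R, is_derive t 1 F (F1 t)) -> (forall t : R, is_derive t 1 F1 (F2 t)) ->
  (forall t : R, 0 <= t <= 1 -> 2 * c <= F2 t) -> F 0 + F1 0 + c <= F 1.
Proof.
move=> d1 d2 h.
have l1 (t : R) : 0 <= t <= 1 -> F1 0 + 2 * c * t <= F1 t.
  move=> /andP[t0 t1]; have hh (u : R) : is_derive u 1 (fun u => F1 u - 2 * c * u) (F2 u - 2 * c).
    have := is_derive_sub (d2 u) (is_derive_mulr (is_derive_cst1 (2 * c) u) (@is_derive_id _ _ u 1)).
    by rewrite mul0r add0r mulr1.
  have := @derive_ge0_le _ _ _ 0 t t0 (fun u _ => hh u); rewrite mulr0 subr0.
  have p0 (u : R) : 0 <= u <= t -> 0 <= F2 u - 2 * c.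
    by move=> /andP[u0 ut]; rewrite subr_ge0 h// u0 (le_trans ut).
  by move=> /(_ p0); rewrite lerBrDr.
have hh (u : R) : is_derive u 1 (fun u => F u - F1 0 * u - c * (u * u)) (F1 u - F1 0 - c * (u + u)).
  have i := @is_derive_id _ _ u 1.
  have := is_derive_sub (is_derive_sub (d1 u) (is_derive_mulr (is_derive_cst1 (F1 0) u) i))
     (is_derive_mulr (is_derive_cst1 c u) (is_derive_mulr i i)).
  by rewrite !mul0r !add0r !mulr1 mul1r.
have := @derive_ge0_le _ _ _ 0 1 ler01 (fun u _ => hh u).
have p0 (u : R) : 0 <= u <= 1 -> 0 <= F1 u - F1 0 - c * (u + u) by move=> /l1; lra.
by move=> /(_ p0); rewrite !mulr0 !subr0 !mulr1; lra.
Qed.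

Lemma segment_E1_0 : E1 0 = - (2 * inner x (rlog x p) (rlog x y)).
Proof. by rewrite /E1 segment_start segment_velocity. Qed.

Lemma segment_E : E 0 = dist x p ^+ 2 /\ E 1 = dist y p ^+ 2.
Proof.
rewrite /E segment_start segment_end ![dist _ p](@distC R n M hM kmin hK hS).
by rewrite !(@distE R n M hM kmin hK hS) !tnorm_sqr.
Qed.

Lemma cosine_upper : dist y p ^+ 2 <=
  psi 1 * dist x y ^+ 2 + dist x p ^+ 2 - 2 * inner x (rlog x p) (rlog x y).
Proof.
have [e0 e1] := segment_E.
have := @taylor2_le (fun t => - E t) (fun t => - E1 t) (fun t => - E2 t) (- (psi 1 * dist x y ^+ 2))
  (fun t => is_derive_opp (seg_dE t)) (fun t => is_derive_opp (seg_dE1 t)).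
have h (t : R) : 0 <= t <= 1 -> 2 * - (psi 1 * dist x y ^+ 2) <= - E2 t.
  by move=> /(seg_hess (velocity g t))[_ /andP[_ h]]; rewrite /E2; lra.
by move=> /(_ h); rewrite e0 e1 segment_E1_0; lra.
Qed.

Lemma cosine_lower_aux : dist x y ^+ 2 + dist x p ^+ 2 - 2 * inner x (rlog x p) (rlog x y) <= dist y p ^+ 2.
Proof.
have [e0 e1] := segment_E.
have := @taylor2_le E E1 E2 (dist x y ^+ 2) seg_dE seg_dE1.
have h (t : R) : 0 <= t <= 1 -> 2 * (dist x y ^+ 2) <= E2 t.
  by move=> /(seg_hess (velocity g t))[_ /andP[h _]]; rewrite /E2; lra.
by move=> /(_ h); rewrite e0 e1 segment_E1_0; lra.
Qed.

(** <U, log p> has derivative - <U, W>, which differs from the constant - <U, g'> by at most (psi 1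
    - 1) |U| |g'|; integrate over [0, 1]. *)
Lemma parallel_rlog_bound (U : R -> 'rV[R]_n) : (forall t, parallel_at g U t) ->
  `|inner y (U 1) (rlog y p) - inner x (U 0) (rlog x p) + inner x (U 0) (rlog x y)| <=
  (psi 1 - 1) * (tnorm x (U 0) * dist x y).
Proof.
move=> hU; have U0 (t : R) : tnorm (g t) (U t) = tnorm x (U 0).
  by rewrite /tnorm (parallel_inner_cst t 0 hg hU hU) segment_start.
have UV (t : R) : inner (g t) (U t) (velocity g t) = inner x (U 0) (rlog x y).
  have hV s : parallel_at g (velocity g) s := velocity_cov hg.
  by rewrite (parallel_inner_cst t 0 hg hU hV) segment_start segment_velocity.
have sp (t : R) : tnorm (g t) (velocity g t) = dist x y.
  by rewrite /tnorm segment_speed sqrtr_sqr ger0_norm// (@dist_ge0 R n M hM kmin hK hS).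
have hf (t : R) : is_derive t 1 (fun s => inner (g s) (U s) (rlog (g s) p)) (- inner (g t) (U t) (seg_W t)).
  by have := cov_inner hg (hU t) (@seg_cov t); rewrite inner0l add0r innerNr.
set K := (psi 1 - 1) * _.
have b (t : R) : 0 <= t <= 1 -> `|inner (g t) (U t) (seg_W t) - inner x (U 0) (rlog x y)| <= K.
  by move=> ht; have [h _] := seg_hess (U t) ht; rewrite -(UV t) /K -(sp t) -(U0 t).
set c := inner x (U 0) (rlog x y) in b *.
have lin (a t : R) : is_derive t 1 (fun s => s * a) a.
  by have := is_derive_mulr (@is_derive_id _ _ t 1) (is_derive_cst1 a t); rewrite mul1r mulr0 addr0.
have h1 : inner (g 0) (U 0) (rlog (g 0) p) + 0 * (c + K) <= inner (g 1) (U 1) (rlog (g 1) p) + 1 * (c + K).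
  apply: (derive_ge0_le ler01 (fun t _ => is_derive_add (hf t) (lin (c + K) t))) => t /b.
  by rewrite ler_norml => /andP[? ?]; lra.
have h2 : 0 * (K - c) - inner (g 0) (U 0) (rlog (g 0) p) <= 1 * (K - c) - inner (g 1) (U 1) (rlog (g 1) p).
  apply: (derive_ge0_le ler01 (fun t _ => is_derive_sub (lin (K - c) t) (hf t))) => t /b.
  by rewrite ler_norml => /andP[? ?]; lra.
rewrite segment_start segment_end !mul0r !mul1r in h1 h2.
by rewrite ler_norml; apply/andP; split; lra.
Qed.

End along_geodesic.

End comparison.

(** * Parallel transport as defined in the algorithm *)

Section transport.
Context {R : realType} {n : nat} {M : riemannianManifold R n}.
Hypothesis hM : complete_manifold M.
Variable kmin : R.
Hypothesis hK : all_sectional_curvatures M (fun K => kmin <= K <= 0).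
Hypothesis hS : @simply_connected R M.

Lemma parallel_alongP (g : R -> M) (V : R -> 'rV[R]_n) : geodesic g ->
  parallel_along g V <-> forall t, parallel_at g V t.
Proof.
move=> hg; have E C (t : R) k : mdom C (g t) ->
    - \sum_i \sum_j christoffel C (mchart C (g t)) k i j * velocity_in C g t 0 i * tangent_in C (g t) (V t) 0 j =
    (tangent_in C (g t) 0 - tangent_in C (g t) (V t) *m GamU C (mchart C (g t)) (velocity_in C g t)) 0 k.
  move=> hC; rewrite tangent_in0 sub0r mxE [in RHS]mxE; congr (- _).
  rewrite exchange_big; apply: eq_bigr => j _; rewrite GamUE mulr_sumr; apply: eq_bigr => i _.
  by rewrite mulrC [christoffel _ _ _ _ _ * _]mulrC.
split=> [h t C u hC hu|h t C hC k].
  have uE := velocity_inE hu; apply/is_derive_mxP => i k; rewrite (ord1 i) -uE -E//.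
  by have [h1 <-] := h t C hC k; exact: derivable1_is_derive.
have hu := geodesic_curve hg hC; have /is_derive_mxP/(_ 0 k) h1 := h t C _ hC hu.
by rewrite -E// in h1; split; [case: h1|exact: is_derive1E].
Qed.

Lemma ptransport_parallel (x y : M) (u : 'rV[R]_n) : exists2 U : R -> 'rV[R]_n,
  (forall t, parallel_at (geo hM x (rlog x y)) U t) & U 0 = u /\ ptransport x y u = U 1.
Proof.
have hg := geo_geodesic hM x (rlog x y); have [U U0 hU] := exists_parallel hM 0 u hg.
exists U => //; split=> //.
have ey : geo hM x (rlog x y) 1 = y := @expm_rlog R n M hM kmin hK hS x y.
have h : exists w : 'rV[R]_n, exists g (V : R -> 'rV[R]_n),
    [/\ geodesic g, g 0 = x, g 1 = y, parallel_along g V & V 0 = u /\ V 1 = w].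
  exists (U 1), (geo hM x (rlog x y)), U; split=> //; first exact: geo0.
  exact/parallel_alongP.
have [g [V [hg' g0 g1 hV [V0 V1]]]] := xgetPex (0 : 'rV[R]_n) h.
apply: (etrans (esym V1)).
have vg : velocity g 0 = rlog x y :> 'rV_n.
  by rewrite -(@geodesic_rlog R n M hM kmin hK hS g hg') g0 g1.
have gE : g = geo hM x (rlog x y) by apply/funext => t; exact: (geo_unique hM hg' g0 vg).
have hV' t : parallel_at g V t by move: t; apply/(parallel_alongP V hg').
rewrite gE in hV'.
apply: (@parallel_uniq _ _ _ _ V U (-1) 2 0 1 hg).
- by apply/andP; split; lra.
- by apply/andP; split; lra.
- by move=> t _.
- by rewrite V0 U0.
Qed.

End transport.

(** * The function zeta *)

Section zeta_function.
Context {R : realType}.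
Implicit Types (k D : R).

Lemma expR_comp_derive (c t : R) : is_derive t 1 (fun s => expR (c * s)) (c * expR (c * t)).
Proof.
have h := is_derive_mulr (is_derive_cst1 c t) (@is_derive_id _ _ t 1).
rewrite mul0r add0r mulr1 in h.
by have := @is_derive1_comp R expR (fun s => c * s) t (expR (c * t)) c (is_derive_expR _) h; rewrite mulrC.
Qed.

(** t cosh t - sinh t vanishes at 0 and has derivative t sinh t. *)
Lemma zeta_ge1 (kmin D : R) : 0 <= D -> 1 <= zeta kmin D.
Proof.
move=> D0; rewrite /zeta; set r := D * _; have r0 : 0 <= r by rewrite mulr_ge0// sqrtr_ge0.
have [//|rn] := eqVneq r 0; have rp : 0 < r by rewrite lt_neqAle eq_sym rn.
have d0 : 0 < expR r - expR (- r) by rewrite subr_gt0 ltr_expR; lra.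
rewrite /coth mulrA ler_pdivlMr// mul1r -subr_ge0.
pose f (t : R) := t * (expR (1 * t) + expR (- 1 * t)) - (expR (1 * t) - expR (- 1 * t)).
have hf (t : R) : is_derive t 1 f (t * (expR (1 * t) - expR (- 1 * t))).
  have h1 := @expR_comp_derive 1 t; have h2 := @expR_comp_derive (- 1) t.
  have := is_derive_sub (is_derive_mulr (@is_derive_id _ _ t 1) (is_derive_add h1 h2)) (is_derive_sub h1 h2).
  by congr (is_derive _ _ _ _); ring.
have : f 0 <= f r.
  apply: (derive_ge0_le r0 (fun t _ => hf t)) => t /andP[t0 _].
  by rewrite mulr_ge0// subr_ge0 ler_expR; lra.
by rewrite /f mulr0 mulr0 mul0r subrr subrr mul1r mulN1r.
Qed.

(** coth(2 r) <= coth r; with a = e^r and b = e^{-r} this reduces to a^2 + b^2 <= (a + b)^2. *)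
Lemma zeta_double (kmin D : R) : 0 <= D -> zeta kmin (2 * D) <= 2 * zeta kmin D.
Proof.
move=> D0; rewrite /zeta -mulrA; set r := D * _; have r0 : 0 <= r by rewrite mulr_ge0// sqrtr_ge0.
have [->|rn] := eqVneq r 0; first by rewrite mulr0 eqxx; lra.
have rp : 0 < r by rewrite lt_neqAle eq_sym rn.
rewrite ifF; last by apply/negbTE; rewrite mulf_neq0// gt_eqF.
have E1 : expR (2 * r) = expR r ^+ 2 by rewrite expr2 -expRD; congr expR; ring.
have E2 : expR (- (2 * r)) = expR (- r) ^+ 2 by rewrite expr2 -expRD; congr expR; ring.
rewrite /coth E1 E2; have : expR (- r) < expR r by rewrite ltr_expR; lra.
have := expR_gt0 r; have := expR_gt0 (- r); move: (expR r) (expR (- r)) => a b b0 a0 ab.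
rewrite -[2 * r * _]mulrA ler_wpM2l// ler_wpM2l//.
have ab0 : 0 < a - b by rewrite subr_gt0.
have sb0 : 0 < a + b by rewrite addr_gt0.
have ab2 : 0 < a ^+ 2 - b ^+ 2 by rewrite subr_sqr mulr_gt0.
rewrite ler_pdivrMr//.
have -> : (a + b) / (a - b) * (a ^+ 2 - b ^+ 2) = (a + b) ^+ 2 by field; rewrite gt_eqF.
have : 0 < a * b by rewrite mulr_gt0.
by rewrite sqrrD mulr2n; lra.
Qed.

(** phi(t) = sinh(r t) / sinh r with r = D sqrt|kmin|, whose slope at 1 is r coth r; in the
    degenerate case r = 0 it is the identity. *)
Lemma zeta_solution (kmin D : R) : 0 <= D -> exists phi psi : R -> R,
  [/\ forall t : R, is_derive t 1 phi (psi t),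
      forall t : R, is_derive t 1 psi (`|kmin| * D ^+ 2 * phi t),
      phi 0 = 0, phi 1 = 1 & psi 1 = zeta kmin D].
Proof.
move=> D0; rewrite /zeta; set r := D * _; have r0 : 0 <= r by rewrite mulr_ge0// sqrtr_ge0.
have r2 : `|kmin| * D ^+ 2 = r ^+ 2 by rewrite /r exprMn sqr_sqrtr// mulrC.
rewrite r2; have [->|rn] := eqVneq r 0.
  exists id, (fun=> 1); split=> // t; first exact: is_derive_id.
  by rewrite expr0n mul0r; exact: is_derive_cst1.
have rp : 0 < r by rewrite lt_neqAle eq_sym rn.
have d0 : expR r - expR (- r) != 0 by rewrite gt_eqF// subr_gt0 ltr_expR; lra.
set d := expR r - _ in d0.
exists (fun t => (expR (r * t) - expR (- r * t)) * d^-1), (fun t => r * (expR (r * t) + expR (- r * t)) * d^-1).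
split.
- move=> t; have := is_derive_mulr (is_derive_sub (@expR_comp_derive r t) (@expR_comp_derive (- r) t)) (is_derive_cst1 d^-1 t).
  by congr (is_derive _ _ _ _); ring.
- move=> t; have := is_derive_mulr (is_derive_mulr (is_derive_cst1 r t)
    (is_derive_add (@expR_comp_derive r t) (@expR_comp_derive (- r) t))) (is_derive_cst1 d^-1 t).
  by congr (is_derive _ _ _ _); ring.
- by rewrite !mulr0 subrr mul0r.
- by rewrite !mulr1 mulfV.
- by rewrite !mulr1 /coth mulrA.
Qed.

End zeta_function.

(** * Cosine inequalities, transport and bounded sets *)

Section hadamard_geometry.
Context {R : realType} {n : nat} {M : riemannianManifold R n}.
Hypothesis hM : complete_manifold M.
Variable kmin : R.
Hypothesis hK : all_sectional_curvatures M (fun K => kmin <= K <= 0).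
Hypothesis hS : @simply_connected R M.
Implicit Types (p q x y z : M).
Let distE_ := @distE R n M hM kmin hK hS.
Let distC_ := @distC R n M hM kmin hK hS.
Let dist_ge0_ := @dist_ge0 R n M hM kmin hK hS.
Let dist_triangle_ := @dist_triangle R n M hM kmin hK hS.

Lemma dist_along x y p (t : R) : 0 <= t <= 1 ->
  dist p (rexp x (t *: rlog x y)) <= dist p x + dist x y.
Proof.
move=> /andP[t0 t1]; apply: le_trans (dist_triangle_ p x _) _; rewrite lerD2l.
by rewrite (@dist_rexp R n M hM kmin hK hS) tnormZ -distE_ ger0_norm// ler_piMl// dist_ge0_.
Qed.

Lemma along_bound x y p (D : R) : 0 <= D ->
  (forall t : R, 0 <= t <= 1 -> dist p (rexp x (t *: rlog x y)) <= D) ->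
  forall t : R, 0 <= t <= 1 -> `|kmin| * dist p (rexp x (t *: rlog x y)) ^+ 2 <= `|kmin| * D ^+ 2.
Proof.
by move=> D0 h t ht; rewrite ler_wpM2l// ler_sqr ?nnegrE// ?h.
Qed.

(** The conclusion contains no zeta, so the bound on the distances along the segment may be as crude
    as d(p, x) + d(x, y). *)
Lemma cosine_lower x y p :
  dist x y ^+ 2 + dist x p ^+ 2 - 2 * inner x (rlog x p) (rlog x y) <= dist y p ^+ 2.
Proof.
have D0 : 0 <= dist p x + dist x y by rewrite addr_ge0.
have [phi [psi [h1 h2 h3 h4 h5]]] := zeta_solution kmin D0.
apply: (@cosine_lower_aux R n M hM kmin hK hS _ phi psi h1 h2 h3 h4) => [|t ht].
  by rewrite h5 zeta_ge1.
by apply: along_bound => // u hu; exact: dist_along.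
Qed.

Lemma cosine_zeta x y p (D : R) : 0 <= D ->
  (forall t : R, 0 <= t <= 1 -> dist p (rexp x (t *: rlog x y)) <= D) ->
  dist y p ^+ 2 <= zeta kmin D * dist x y ^+ 2 + dist x p ^+ 2 - 2 * inner x (rlog x p) (rlog x y).
Proof.
move=> D0 h; have [phi [psi [h1 h2 h3 h4 h5]]] := zeta_solution kmin D0.
rewrite -h5; apply: (@cosine_upper R n M hM kmin hK hS _ phi psi h1 h2 h3 h4) => [|t ht].
  by rewrite h5 zeta_ge1.
exact: along_bound.
Qed.

Lemma transport_zeta x y p (D : R) (u : 'rV_n) : 0 <= D ->
  (forall t : R, 0 <= t <= 1 -> dist p (rexp x (t *: rlog x y)) <= D) ->
  `|inner y (ptransport x y u) (rlog y p) - inner x u (rlog x p) + inner x u (rlog x y)| <=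
    (zeta kmin D - 1) * (tnorm x u * dist x y).
Proof.
move=> D0 h; have [phi [psi [h1 h2 h3 h4 h5]]] := zeta_solution kmin D0.
have [U hU [U0 ->]] := @ptransport_parallel R n M hM kmin hK hS x y u.
rewrite -h5 -{1 2 3}U0; apply: (@parallel_rlog_bound R n M hM kmin hK hS _ phi psi h1 h2 h3 h4) => // [|t ht].
  by rewrite h5 zeta_ge1.
exact: along_bound.
Qed.

Lemma ptransport_inner x y (u w : 'rV_n) :
  inner y (ptransport x y u) (ptransport x y w) = inner x u w.
Proof.
have [U hU [U0 ->]] := @ptransport_parallel R n M hM kmin hK hS x y u.
have [W hW [W0 ->]] := @ptransport_parallel R n M hM kmin hK hS x y w.
have := parallel_inner_cst 1 0 (geo_geodesic hM x (rlog x y)) hU hW.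
by rewrite (@segment_start R n M hM x y) (@segment_end R n M hM kmin hK hS x y) U0 W0.
Qed.

(** Additivity follows from preservation of inner products: the defect has norm 0. *)
Lemma ptransport_add x y (u w : 'rV_n) :
  ptransport x y (u + w) = ptransport x y u + ptransport x y w :> 'rV_n.
Proof.
apply/eqP; rewrite -subr_eq0; apply/eqP; apply: (@inner_eq0 _ _ _ y).
set a : 'rV_n := ptransport x y (u + w); set b : 'rV_n := ptransport x y u; set c : 'rV_n := ptransport x y w.
rewrite !innerE_ !ptransport_inner !innerE_ [inner x w u]innerC; ring.
Qed.

Lemma ptransport_rlog x y : ptransport x y (rlog x y) = - rlog y x :> 'rV_n.
Proof.
have [U hU [U0 ->]] := @ptransport_parallel R n M hM kmin hK hS x y (rlog x y).
have hg := geo_geodesic hM x (rlog x y).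
rewrite (@rlog_rev R n M hM kmin hK hS) opprK.
apply: (@parallel_uniq _ _ _ _ U _ (-1) 2 0 1 hg).
- by apply/andP; split; lra.
- by apply/andP; split; lra.
- by move=> t _; split=> //; exact: velocity_cov hg.
- by rewrite U0 geo_velocity0.
Qed.

(** The lower cosine inequality at the intermediate point towards x and towards y, with weights 1 -
    t and t: the two gradient terms cancel. *)
Lemma dist_convex x y p (t : R) : 0 <= t <= 1 ->
  dist p (rexp x (t *: rlog x y)) ^+ 2 <= (1 - t) * dist p x ^+ 2 + t * dist p y ^+ 2.
Proof.
move=> /andP[t0 t1]; set v := rlog x y.
have [e _] := @geo_affine R n M hM kmin hK hS x v t 0.
have [_ ex] := @geo_affine R n M hM kmin hK hS x v t 0.
have [_ ey] := @geo_affine R n M hM kmin hK hS x v t 1.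
rewrite e geo0 in ex; rewrite e -/(expm hM x v) (@expm_rlog R n M hM kmin hK hS) in ey.
set q := rexp x (t *: v) in ex ey *; set u := velocity _ _ in ex ey.
have hx := cosine_lower q x p; have hy := cosine_lower q y p.
rewrite ex in hx; rewrite ey in hy; rewrite innerZr in hx; rewrite innerZr in hy.
rewrite ![dist _ p]distC_ in hx hy; move: hx hy; set c := inner q _ _.
have := sqr_ge0 (dist q x); have := sqr_ge0 (dist q y).
move: (dist q x ^+ 2) (dist q y ^+ 2) (dist p x ^+ 2) (dist p y ^+ 2) (dist p q ^+ 2) => a b X Y Z b0 a0 hx hy.
have k1 : (1 - t) * (a + Z - 2 * ((0 - t) * c)) <= (1 - t) * X by rewrite ler_wpM2l// subr_ge0.
have k2 : t * (b + Z - 2 * ((1 - t) * c)) <= t * Y by rewrite ler_wpM2l.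
have k3 : 0 <= (1 - t) * a by rewrite mulr_ge0// subr_ge0.
have k4 : 0 <= t * b by rewrite mulr_ge0.
have := lerD k1 k2.
rewrite (_ : _ + t * (b + _ - _) = Z + (1 - t) * a + t * b); last by ring.
by move: k3 k4; move: (_ * a) (_ * b) => P Q; lra.
Qed.

Lemma dist_convex_max x y p (D t : R) : 0 <= D -> 0 <= t <= 1 -> dist p x <= D -> dist p y <= D ->
  dist p (rexp x (t *: rlog x y)) <= D.
Proof.
move=> D0 ht hx hy; rewrite -ler_sqr ?nnegrE//.
apply: le_trans (dist_convex x y p ht) _; case/andP: ht => t0 t1.
have h1 : dist p x ^+ 2 <= D ^+ 2 by rewrite ler_sqr ?nnegrE.
have h2 : dist p y ^+ 2 <= D ^+ 2 by rewrite ler_sqr ?nnegrE.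
have k1 : (1 - t) * dist p x ^+ 2 <= (1 - t) * D ^+ 2 by rewrite ler_wpM2l// subr_ge0.
have k2 := ler_wpM2l t0 h2; have := lerD k1 k2; rewrite -mulrDl subrK mul1r; exact.
Qed.

Lemma rlog_cont x y : {for y, continuous (rlog x)}.
Proof.
set C := chart_at y; have hy : mdom C y := mem_chart_at y.
have cl := sd_cont (@rlog_sd R n M hM kmin hK hS C x y hy).
have cm := mchart_continuous hy.
have c : {for y, continuous ((fun q : 'rV[R]_n => rlog x (minv C q)) \o mchart C)} by apply: continuous_comp.
have hd : nbhs y (mdom C) by apply: open_nbhs_nbhs; split => //; exact: mdom_open.
move=> U; rewrite -{1}(mchartK hy) => /c h.
by apply: filterS2 hd h => z hz /=; rewrite mchartK.
Qed.

(** The image of X under the continuous map log_x is compact, hence bounded, and coordinates bound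
    the tangent norm. *)
Lemma dist_bounded (X : set M) x : compact X -> exists B, forall y, X y -> dist x y <= B.
Proof.
move=> cX; have h : compact (rlog x @` X).
  by apply: continuous_compact => //; apply: continuous_subspaceT => y; exact: rlog_cont.
have [B [_ hB]] := compact_bounded h.
set G := mmetric (chart_at x) (mchart (chart_at x) x).
pose b := `|B| + 1; exists (Num.sqrt (n%:R * (n%:R * b * `|G|) * b)) => y Xy.
rewrite distE_; apply: ler_wsqrtr.
have yb : `|rlog x y : 'rV_n| <= b.
  apply: hB; last by exists y.
  by rewrite /b; apply: le_lt_trans (ler_norm _) _; rewrite ltrDl.
apply: le_trans (ler_norm _) _; apply: le_trans (mx_entry_le _ 0 0) _.
apply: le_trans (mulmx_norm_le _ _) _.
have yT : `|trmx (rlog x y : 'rV_n)| <= b.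
  apply: mx_norm_le => [|i j]; first exact: le_trans yb.
  by rewrite mxE; apply: le_trans yb; exact: mx_entry_le.
have b0 : 0 <= b by apply: le_trans yb.
apply: ler_pM => //.
rewrite ler_wpM2l//; apply: le_trans (mulmx_norm_le _ _) _.
by rewrite ler_wpM2r// ler_wpM2l.
Qed.

(** [diam] is a supremum, which bounds its set only if that set is bounded; compactness provides
    this. *)
Lemma dist_le_diam (X : set M) x y : compact X -> X x -> X y -> dist x y <= diam X.
Proof.
move=> cX Xx Xy; apply: ub_le_sup; last by exists x, y.
have [B hB] := dist_bounded x cX; exists (B + B) => r [x1 [y1 [Xx1 Xy1 ->]]].
apply: le_trans (dist_triangle_ x1 x y1) _.
by rewrite distC_ lerD// hB.
Qed.

End hadamard_geometry.

(** * Riemacon *)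

Section riemacon_step_numbers.
Context {R : realType}.

(** The cross terms amount to 5 s |V| B, split by Young's inequality between s tau |V|^2 and (25/4)
    (s / tau) B^2. Here s / tau = s + s A / a, and s A / a is at most (10/512) A / lam because a >=
    12.8 lam xi and 4 s <= xi. The multiples of s B^2 are absorbed by - 3 rho s B^2. *)
Lemma penalty_bound (s tau rho A a lam xi vN B Vb bb N : R) :
  0 <= s -> xi = 1 + 4 * s -> 0 < lam -> 0 < A -> 0 < a -> tau = a / (A + a) ->
  rho = a / (lam * xi) -> 128 / 10 * lam * xi <= a ->
  0 <= vN -> 0 <= B -> bb = B ^+ 2 -> - (vN * B) <= Vb -> N <= vN + (rho - 1) * B ->
  - 4 * s * (Vb + rho * bb) + 5 / 2 * s * bb + s * (N * B) <=
  s * tau * vN ^+ 2 + 8^-1 * (A / lam) * bb.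
Proof.
move=> s0 xiE l0 A0 a0 tE rE ha v0 B0 bE hV hN.
have xi1 : 1 <= xi by rewrite xiE lerDl mulr_ge0.
have xp : 0 < xi by apply: lt_le_trans xi1.
have hr : 128 / 10 <= rho by rewrite rE ler_pdivlMr ?mulr_gt0// mulrA.
have k1 : s * (N * B) <= s * ((vN + (rho - 1) * B) * B) by rewrite ler_wpM2l// ler_wpM2r.
have k2 : s * (- (vN * B)) <= s * Vb by rewrite ler_wpM2l.
have t0 : 0 < tau by rewrite tE divr_gt0// addr_gt0.
have k3 : 5 * s * (vN * B) <= s * tau * vN ^+ 2 + 25 / 4 * (s / tau) * bb.
  have := mulr_ge0 (divr_ge0 s0 (ltW t0)) (sqr_ge0 (tau * vN - 5 / 2 * B)).
  rewrite (_ : s / tau * _ = s * tau * vN ^+ 2 - 5 * s * (vN * B) + 25 / 4 * (s / tau) * B ^+ 2); last first.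
    by field; rewrite gt_eqF.
  by rewrite bE; lra.
have st : s / tau = s + s * A / a.
  by rewrite tE; field; rewrite !gt_eqF// addr_gt0.
have k4 : s * A / a <= A / lam * (10 / 512).
  rewrite ler_pdivrMr//.
  have h : A / lam * (10 / 512) * (128 / 10 * lam * xi) <= A / lam * (10 / 512) * a.
    apply: ler_wpM2l ha; apply: mulr_ge0; last by lra.
    by apply: divr_ge0; exact: ltW.
  apply: le_trans h; rewrite (_ : A / lam * (10 / 512) * _ = A * xi / 4); last by field; rewrite gt_eqF.
  by rewrite xiE; have := mulr_ge0 (ltW A0) s0; lra.
have b0 : 0 <= bb by rewrite bE sqr_ge0.
have k5 : s / tau * bb <= (s + A / lam * (10 / 512)) * bb by rewrite ler_wpM2r// st lerD2l.
have sb0 : 0 <= s * bb by rewrite mulr_ge0.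
have k6 : s * bb * (128 / 10) <= s * bb * rho by rewrite ler_wpM2l.
have Ab : 0 <= A / lam * bb by rewrite mulr_ge0// divr_ge0// ltW.
have e1 : s * ((vN + (rho - 1) * B) * B) = s * (vN * B) + (rho - 1) * (s * bb) by rewrite bE; ring.
rewrite e1 in k1; move: k1 k2 k3 k5 k6 sb0 Ab.
rewrite (_ : (s + A / lam * (10 / 512)) * bb = s * bb + 10 / 512 * (A / lam * bb)); last by ring.
rewrite (_ : 25 / 4 * (s / tau) * bb = 25 / 4 * (s / tau * bb)); last by ring.
rewrite (_ : 5 * s * (vN * B) = 5 * (s * (vN * B))) ?mulrN; last by ring.
rewrite (_ : - 4 * s * (Vb + rho * bb) = - 4 * (s * Vb) - 4 * (s * bb * rho)); last by ring.
rewrite (_ : 5 / 2 * s * bb = 5 / 2 * (s * bb)); last by ring.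
rewrite (_ : (rho - 1) * (s * bb) = s * bb * rho - s * bb); last by ring.
rewrite (_ : 8^-1 * (A / lam) * bb = 8^-1 * (A / lam * bb)); last by ring.
move: (s * (N * B)) (s * Vb) (s * (vN * B)) (s * tau * _) (s / tau * bb) (s * bb * rho) (s * bb) (A / lam * bb).
move=> a1 a2 a3 a4 a5 a6 a7 a8; lra.
Qed.

(** Young's inequality with weight Del: the factor 1 / Del cancels against the Del in the bound on
    e^2, which is how the accuracy of the proximal step is tuned; 9/780 = (9/10) / 78. *)
Lemma error_bound (rho e xi Px Del dS A lam a G : R) :
  0 < Del -> 0 < lam -> 0 < xi -> 0 <= rho -> rho = a / (lam * xi) -> 0 <= e -> 0 <= Px ->
  e ^+ 2 <= Del * dS ^+ 2 / 39 -> a ^+ 2 <= 9 / 10 * A * lam * xi ->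
  0 <= G -> G ^+ 2 <= xi * (2 * Px) ->
  rho * (e * G) <= Del * Px + 9 / 780 * (A / lam) * dS ^+ 2.
Proof.
move=> D0 l0 x0 r0 rE e0 P0 he ha G0 hG.
have k1 : rho * (e * G) <= Del / (2 * xi) * G ^+ 2 + rho ^+ 2 * xi / (2 * Del) * e ^+ 2.
  have h := mulr_ge0 (divr_ge0 (ltW D0) (ltW (mulr_gt0 (ltr0Sn R 1) x0))) (sqr_ge0 (G - rho * xi / Del * e)).
  rewrite (_ : Del / (2 * xi) * _ = Del / (2 * xi) * G ^+ 2 - rho * (e * G) + rho ^+ 2 * xi / (2 * Del) * e ^+ 2) in h; last first.
    by field; rewrite !gt_eqF.
  by lra.
have k2 : Del / (2 * xi) * G ^+ 2 <= Del * Px.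
  have h := ler_wpM2l (divr_ge0 (ltW D0) (ltW (mulr_gt0 (ltr0Sn R 1) x0))) hG.
  by rewrite (_ : Del / (2 * xi) * (xi * (2 * Px)) = Del * Px) in h; last by field; rewrite gt_eqF.
have c0 : 0 <= rho ^+ 2 * xi / (2 * Del) by rewrite divr_ge0// ?mulr_ge0// ?sqr_ge0// ltW// ltW.
have k3 := ler_wpM2l c0 he.
have k4 : rho ^+ 2 * xi / (2 * Del) * (Del * dS ^+ 2 / 39) = a ^+ 2 * (dS ^+ 2 / (78 * lam ^+ 2 * xi)).
  by rewrite rE; field; rewrite !gt_eqF.
have c1 : 0 <= dS ^+ 2 / (78 * lam ^+ 2 * xi).
  by rewrite divr_ge0 ?sqr_ge0// !mulr_ge0// ?sqr_ge0// ltW.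
have k5 := ler_wpM2r c1 ha.
have k6 : 9 / 10 * A * lam * xi * (dS ^+ 2 / (78 * lam ^+ 2 * xi)) = 9 / 780 * (A / lam) * dS ^+ 2.
  by field; rewrite !gt_eqF.
by rewrite k4 in k3; rewrite k6 in k5; lra.
Qed.

(* Ak stands for A + a / xi; Es for the value of the linear form of the mirror
   step at the exact proximal point. *)
Lemma potential_descent (A Ak a lam xi Del Py Px Pk fy fk fst fs dS B Es err pen sl : R) :
  0 < lam -> 0 < A -> A <= Ak -> 0 < xi -> 0 < Del -> Del <= 1 ->
  a ^+ 2 <= 9 / 10 * A * lam * xi -> Ak = A + a / xi ->
  0 <= dS -> 0 <= B -> B <= 7 / 6 * dS ->
  Px <= Py - sl -> 0 <= Px -> 0 <= sl -> fs <= fy ->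
  Es <= A * fy + a / xi * fs - Ak * fst - Ak / lam * dS ^+ 2 ->
  fk <= fst + (dS ^+ 2 - B ^+ 2) / (2 * lam) + Del * dS ^+ 2 / (78 * lam) ->
  err <= Del * Px + 9 / 780 * (A / lam) * dS ^+ 2 ->
  pen <= sl + 8^-1 * (A / lam) * B ^+ 2 ->
  Pk <= Px + Es + err + a ^+ 2 / (2 * xi * lam ^+ 2) * B ^+ 2 + pen ->
  Ak * (fk - fs) + Pk <= (1 + Del) * (A * (fy - fs) + Py).
Proof.
move=> l0 A0 AAk x0 D0 D1 ha AkE dS0 B0 hB hPx P0 sl0 hf hE hfk herr hpen hPk.
have Ak0 : 0 < Ak by apply: lt_le_trans AAk.
set d2 := dS ^+ 2 in hE hfk herr *; set b2 := B ^+ 2 in hfk hpen hPk *.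
have hb : b2 <= 49 / 36 * d2.
  have : B ^+ 2 <= (7 / 6 * dS) ^+ 2 by rewrite ler_sqr ?nnegrE// mulr_ge0.
  by rewrite exprMn -/b2 -/d2 (_ : (7 / 6) ^+ 2 = 49 / 36)//; field.
have d20 : 0 <= d2 by exact: sqr_ge0.
have b20 : 0 <= b2 by exact: sqr_ge0.
have q : a ^+ 2 / (2 * xi * lam ^+ 2) * b2 <= 9 / 20 * (A / lam) * b2.
  rewrite ler_wpM2r// ler_pdivrMr ?mulr_gt0 ?exprn_gt0//.
  by rewrite (_ : 9 / 20 * (A / lam) * _ = 9 / 10 * A * lam * xi)//; field; rewrite gt_eqF.
have h1 := ler_wpM2l (ltW Ak0) hfk.
have e1 : Ak * (fst + (d2 - b2) / (2 * lam) + Del * d2 / (78 * lam)) =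
   Ak * fst + 2^-1 * (Ak / lam * (d2 - b2)) + 78^-1 * (Ak / lam * (Del * d2)).
  by field; rewrite gt_eqF.
rewrite e1 in h1.
have g0 : 0 < Ak / lam by rewrite divr_gt0.
have g1 : A / lam <= Ak / lam by rewrite ler_pM2r ?invr_gt0.
have h2 : Ak / lam * (Del * d2) <= Ak / lam * d2 by rewrite ler_wpM2l ?(ltW g0)// ler_piMl.
(* Per unit of Ak / lam the proximal step yields (1/2 - 1/78) dS^2 + B^2 / 2. The costs, per unit of
   A / lam, are (9/780) dS^2 + (9/20 + 1/8) B^2; they exceed the yield in B^2 only, and B <= (7/6)
   dS closes the gap. *)
have c : 0 <= (2^-1 - 78^-1) * d2 + 2^-1 * b2 by rewrite addr_ge0// mulr_ge0//; lra.
have h3 := ler_wpM2r c g1.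
have Al : 0 < A / lam by rewrite divr_gt0.
have h4 := ler_wpM2l (ltW Al) hb; have h5 := mulr_ge0 (ltW Al) d20; have h6 := mulr_ge0 (ltW Al) b20.
have e2 : Ak * fs = A * fs + a / xi * fs by rewrite AkE; ring.
have h7 : Del * Px <= Del * (A * (fy - fs) + Py).
  rewrite ler_wpM2l ?(ltW D0)//; apply: le_trans (_ : _ <= Py) _; first by lra.
  by rewrite lerDr mulr_ge0 ?(ltW A0)// subr_ge0.
rewrite mulrDl mul1r mulrBr e2 [A * (fy - fs)]mulrBr.
rewrite [A * (fy - fs)]mulrBr in h7.
move: h1 h2 h3 h4 h5 h6 q hE herr hpen hPk hPx h7.
rewrite ![Ak / lam * (_ - _)]mulrBr ![_ * (_ * d2 + _ * b2)]mulrDr.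
rewrite (_ : A / lam * ((2^-1 - 78^-1) * d2) = (2^-1 - 78^-1) * (A / lam * d2)); last by ring.
rewrite (_ : Ak / lam * ((2^-1 - 78^-1) * d2) = (2^-1 - 78^-1) * (Ak / lam * d2)); last by ring.
rewrite (_ : A / lam * (2^-1 * b2) = 2^-1 * (A / lam * b2)); last by ring.
rewrite (_ : Ak / lam * (2^-1 * b2) = 2^-1 * (Ak / lam * b2)); last by ring.
rewrite (_ : A / lam * (49 / 36 * d2) = 49 / 36 * (A / lam * d2)); last by ring.
rewrite (_ : 9 / 20 * (A / lam) * b2 = 9 / 20 * (A / lam * b2)); last by ring.
rewrite (_ : 9 / 780 * (A / lam) * d2 = 9 / 780 * (A / lam * d2)); last by ring.
rewrite (_ : 8^-1 * (A / lam) * b2 = 8^-1 * (A / lam * b2)); last by ring.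
move: (A / lam * d2) (A / lam * b2) (Ak / lam * d2) (Ak / lam * b2) (_ / _ * b2) (Ak / lam * (Del * d2)).
move: (Ak * fk) (Ak * fst) (A * fy) (A * fs) (a / xi * fs) (Del * Px) (Del * _).
move=> *; lra.
Qed.

Lemma rc_A_closed (kmin D lam : R) (k : nat) : rc_xi kmin D != 0 ->
  rc_A kmin D lam k = 200 * lam * rc_xi kmin D + lam * (k%:R * (k%:R + 1)) / (5 * rc_xi kmin D)
    + 64 / 5 * lam * k%:R.
Proof.
move=> x0; elim: k => [|k IH]; first by rewrite /= mul0r mulr0 mul0r mulr0 !addr0.
rewrite /= IH /rc_a -[k.+1]addn1 natrD; set K := k%:R; set x := rc_xi _ _ in x0 *.
by field.
Qed.

End riemacon_step_numbers.

(** * Estimates for the individual operations of the algorithm *)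

Section algorithm.
Context {R : realType} {n : nat} {M : riemannianManifold R n}.
Hypothesis hM : complete_manifold M.
Variable kmin : R.
Hypothesis hK : all_sectional_curvatures M (fun K => kmin <= K <= 0).
Hypothesis hS : @simply_connected R M.
Variables (X : set M) (f : M -> R) (D lam : R) (p : M).
Hypothesis gX : gconvex_set X.
Hypothesis D0 : 0 <= D.
Hypothesis hD : forall x y, X x -> X y -> dist x y <= D.
Hypothesis gf : gconvex X f.
Hypothesis l0 : 0 < lam.
Hypothesis hp : argmin X f p.
Implicit Types (x y q : M).
Let distE_ := @distE R n M hM kmin hK hS.
Let distC_ := @distC R n M hM kmin hK hS.
Let dist_ge0_ := @dist_ge0 R n M hM kmin hK hS.
Let dist_triangle_ := @dist_triangle R n M hM kmin hK hS.
Let cosine_lower_ := @cosine_lower R n M hM kmin hK hS.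
Let cosine_zeta_ := @cosine_zeta R n M hM kmin hK hS.
Let Xp : X p := hp.1.

Let z2 := zeta kmin (2 * D).
Let s := z2 - 1.
Let xi := rc_xi kmin D.

Lemma rc_s_ge0 : 0 <= s.
Proof. by rewrite subr_ge0 zeta_ge1// mulr_ge0. Qed.

Lemma rc_xiE : xi = 1 + 4 * s.
Proof. by rewrite /xi /rc_xi -/z2 /s; ring. Qed.

Lemma rc_xi_ge1 : 1 <= xi.
Proof. by rewrite rc_xiE lerDl mulr_ge0// rc_s_ge0. Qed.

Definition pot x (z : 'rV[R]_n) : R :=
  2^-1 * inner x (z - rlog x p) (z - rlog x p) + (xi - 1) / 2 * inner x z z.

Lemma potE x z : pot x z = xi / 2 * inner x z z - inner x z (rlog x p) + 2^-1 * dist x p ^+ 2.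
Proof.
rewrite /pot distE_ tnorm_sqr !innerDl !innerDr !innerNl !innerNr [inner x (rlog x p) z]innerC.
by field.
Qed.

Lemma pot_ge0 x z : 0 <= pot x z.
Proof.
rewrite /pot addr_ge0// mulr_ge0 ?inner_ge0// divr_ge0// subr_ge0; exact: rc_xi_ge1.
Qed.

(** u is the velocity at x of the geodesic from y along z, and (1 - tau) u is what remains of z
    there. The upper cosine inequalities between x and y in both directions bound the change of <z,
    log p>; the shrinking of (xi - 1) |z|^2 / 2 leaves the gain s tau |u|^2. *)
Lemma extrapolation y (z : 'rV[R]_n) (tau : R) : X y -> tnorm y z <= D -> 0 < tau -> tau <= 1 ->
  let x := rexp y (tau *: z) in
  dist p x <= 2 * D /\
  exists u : 'rV[R]_n, [/\ rlog x y = - tau *: u :> 'rV_n, rlog x (rexp y z) = (1 - tau) *: u :> 'rV_n,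
    inner x u u = inner y z z & pot x ((1 - tau) *: u) <= pot y z - s * tau * inner x u u].
Proof.
move=> Xy zD t0 t1 x; have s0 := rc_s_ge0.
have D20 : 0 <= 2 * D by rewrite mulr_ge0.
have yx : dist y x = tau * tnorm y z.
  by rewrite (@dist_rexp R n M hM kmin hK hS) tnormZ gtr0_norm.
have yxD : dist y x <= D.
  by rewrite yx; apply: le_trans zD; rewrite ler_piMl ?tnorm_ge0.
have px : dist p x <= 2 * D.
  apply: le_trans (dist_triangle_ p y x) _; rewrite mulr_natl mulr2n; exact: lerD (hD Xp Xy) yxD.
split=> //; have [ex _] := @geo_affine R n M hM kmin hK hS y z tau 0.
have [_ e0] := @geo_affine R n M hM kmin hK hS y z tau 0.
have [_ e1] := @geo_affine R n M hM kmin hK hS y z tau 1.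
rewrite ex geo0 sub0r -/x in e0; rewrite ex -/(expm hM y z) -(@rexpE R n M hM) -/x in e1.
have eu := @speed_cst R n M hM y z tau; rewrite ex -/x in eu.
exists (velocity (geo hM y z) tau); split=> //.
set u := velocity _ _ in e0 e1 eu *.
have lyx : rlog y x = tau *: z by exact: (@rlog_rexp R n M hM kmin hK hS).
have a : dist x p ^+ 2 <= z2 * dist y x ^+ 2 + dist y p ^+ 2 - 2 * inner y (rlog y p) (rlog y x).
  apply: cosine_zeta_ => // t ht; apply: (@dist_convex_max R n M hM kmin hK hS) => //.
  by apply: le_trans (hD Xp Xy) _; rewrite mulr_natl mulr2n lerDl.
have b : dist y p ^+ 2 <= z2 * dist x y ^+ 2 + dist x p ^+ 2 - 2 * inner x (rlog x p) (rlog x y).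
  apply: cosine_zeta_ => // t ht; apply: (@dist_convex_max R n M hM kmin hK hS) => //.
  by apply: le_trans (hD Xp Xy) _; rewrite mulr_natl mulr2n lerDl.
have c := cosine_lower_ x y p.
rewrite lyx innerZr in a; rewrite e0 innerZr in b; rewrite e0 innerZr in c.
have d2 : dist y x ^+ 2 = tau ^+ 2 * inner y z z by rewrite yx exprMn tnorm_sqr.
rewrite [dist x y]distC_ d2 in b; rewrite [dist x y]distC_ d2 in c; rewrite d2 in a.
rewrite !potE innerZl innerZr innerZl eu [inner y z (rlog _ _)]innerC [inner x u _]innerC.
move: a b c (inner_ge0 y z); rewrite /s rc_xiE /s -/z2.
move: s0; rewrite /s; move: (inner y z z) (inner y (rlog y p) z) (inner x (rlog x p) u) (dist x p ^+ 2) (dist y p ^+ 2) => Z P Q Ex Ey s0 a b c Z0.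
have h : P - Q <= z2 * tau * Z.
  have : tau * (P - Q) <= tau * (z2 * tau * Z).
    by rewrite (_ : tau * (z2 * tau * Z) = z2 * (tau ^+ 2 * Z)); [lra|ring].
  by rewrite ler_pM2l.
have g : 0 <= 2 * (z2 - 1) * (tau * (1 - tau)) * Z.
  by rewrite !mulr_ge0// ?(ltW t0)// subr_ge0.
rewrite -subr_ge0.
rewrite (_ : _ - _ = 2 * (z2 - 1) * (tau * (1 - tau)) * Z + (z2 * tau * Z - (P - Q))
   + 2^-1 * (Ey - (tau ^+ 2 * Z + Ex - 2 * (- tau * Q)))); last by field.
rewrite addr_ge0 ?mulr_ge0 ?subr_ge0// addr_ge0// subr_ge0; exact: h.
Qed.

(** The new vector is the transport of zx - b with b = log_x y. Expanding (xi - 1) / 2 = 2 s times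
    its square gives - 4 s <zx, b> + 2 s |b|^2; the cosine inequality adds s |b|^2 / 2, and the
    variation of <., log p> under transport the last term. *)
Lemma transport_pot x y (zx : 'rV[R]_n) : dist p x <= 2 * D -> dist p y <= D ->
  pot y (ptransport x y zx + rlog y x) <=
  pot x zx + (- 4 * s * inner x zx (rlog x y) + 5 / 2 * s * dist x y ^+ 2 +
    s * (tnorm x (zx - rlog x y) * dist x y)).
Proof.
move=> pxD pyD; set b : 'rV[R]_n := rlog x y; set w := zx - b; have s0 := rc_s_ge0.
have D20 : 0 <= 2 * D by rewrite mulr_ge0.
have pyD2 : dist p y <= 2 * D by apply: le_trans pyD _; rewrite mulr_natl mulr2n lerDl.
have -> : (ptransport x y zx + rlog y x : 'rV_n) = ptransport x y w.
  have -> : zx = w + b by rewrite subrK.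
  rewrite (@ptransport_add R n M hM kmin hK hS) (@ptransport_rlog R n M hM kmin hK hS).
  by rewrite -addrA addNr addr0.
have along (t : R) : 0 <= t <= 1 -> dist p (rexp x (t *: rlog x y)) <= 2 * D.
  by move=> ht; exact: (@dist_convex_max R n M hM kmin hK hS).
have a := cosine_zeta_ D20 along; rewrite -/z2 -/b in a.
have := @transport_zeta R n M hM kmin hK hS x y p (2 * D) w D20 along; rewrite -/z2 -/s -/b.
rewrite ler_norml => /andP[h _].
rewrite !potE (@ptransport_inner R n M hM kmin hK hS).
have bb : inner x b b = dist x y ^+ 2 by rewrite distE_ tnorm_sqr.
have ez : zx = w + b by rewrite subrK.
clearbody w.
have e1 : inner x zx zx = inner x w w + 2 * inner x w b + dist x y ^+ 2.
  by rewrite ez !innerDl !innerDr [inner x b w]innerC bb; ring.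
have e2 : inner x zx b = inner x w b + dist x y ^+ 2 by rewrite ez innerDl bb.
have e3 : inner x zx (rlog x p) = inner x w (rlog x p) + inner x (rlog x p) b.
  by rewrite ez innerDl [inner x b _]innerC.
rewrite e1 e2 e3 rc_xiE; move: h a.
rewrite (_ : z2 = 1 + s); last by rewrite /s; ring.
move: (inner y _ _) (inner x w (rlog x p)) (inner x w b) (inner x (rlog x p) b) (inner x w w) (tnorm x w * _) => P Q W L ww T h a.
move: h a; move: (dist x y ^+ 2) (dist y p ^+ 2) (dist x p ^+ 2) => d2 e f2 h a; lra.
Qed.

(** First-order optimality without gradients: compare ys with points at parameter t towards u,
    divide by t and let t tend to 0. The upper cosine inequality makes the error of order t^2. *)
Lemma prox_optimal x ys u : argmin X (rc_h lam f x) ys -> X u ->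
  f ys + lam^-1 * inner ys (rlog ys x) (rlog ys u) <= f u.
Proof.
move=> [Xys hmin] Xu; set c := inner ys _ _.
pose B := dist x ys + dist ys u; have B0 : 0 <= B by rewrite addr_ge0.
pose K := zeta kmin B * dist ys u ^+ 2 / (2 * lam).
have K0 : 0 <= K.
  by rewrite divr_ge0 ?mulr_ge0 ?sqr_ge0 ?(ltW l0)// (le_trans ler01)// zeta_ge1.
have h (t : R) : 0 < t -> t <= 1 -> f ys - f u + lam^-1 * c <= t * K.
  move=> t0 t1; set q := rexp ys (t *: rlog ys u).
  have lq : rlog ys q = t *: rlog ys u by exact: (@rlog_rexp R n M hM kmin hK hS).
  have dq : dist ys q = t * dist ys u.
    by rewrite (@dist_rexp R n M hM kmin hK hS) tnormZ gtr0_norm// distE_.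
  have Xq : X q by apply: gX => //; rewrite in_itv /= t1 ltW.
  have h1 : f q <= (1 - t) * f ys + t * f u.
    have := @gf ys u (1 - t) Xys Xu; rewrite in_itv /= !subr_ge0 t1 gerBl (ltW t0) subKr.
    by move=> /(_ isT); rewrite mulr0 mul0r mul0r subr0.
  have h2 := hmin q Xq; rewrite /rc_h in h2.
  have h3 : dist q x ^+ 2 <= zeta kmin B * dist ys q ^+ 2 + dist ys x ^+ 2 - 2 * inner ys (rlog ys x) (rlog ys q).
    apply: cosine_zeta_ => // r hr; apply: le_trans (@dist_along R n M hM kmin hK hS _ _ _ _ hr) _.
    by rewrite lerD2l dq ler_piMl.
  rewrite lq innerZr -/c dq [dist q x]distC_ [dist ys x]distC_ exprMn in h3.
  have h4 : 1 / (2 * lam) * dist x q ^+ 2 <= 1 / (2 * lam) * (zeta kmin B * (t ^+ 2 * dist ys u ^+ 2) + dist x ys ^+ 2 - 2 * (t * c)).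
    by rewrite ler_wpM2l// divr_ge0// mulr_ge0// ltW.
  have h5 : t * (f ys - f u + lam^-1 * c) <= t * (t * K).
    rewrite (_ : t * (t * K) = 1 / (2 * lam) * (zeta kmin B * (t ^+ 2 * dist ys u ^+ 2))); last first.
      by rewrite /K; field; rewrite gt_eqF.
    move: h4; rewrite mulrBr mulrDr (_ : 1 / (2 * lam) * (2 * (t * c)) = t * (lam^-1 * c)); last first.
      by field; rewrite gt_eqF.
    move: h1 h2; rewrite mulrDr mulrBr mulrBl mul1r.
    rewrite ?div1r; move: ((2 * lam)^-1 * dist x ys ^+ 2) ((2 * lam)^-1 * dist x q ^+ 2) ((2 * lam)^-1 * _) (t * (lam^-1 * c)) (t * f ys) (t * f u).
    by move=> a1 a2 a3 a4 a5 a6; lra.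
  by rewrite ler_pM2l in h5.
have : f ys - f u + lam^-1 * c <= 0; last by lra.
apply/ler_addgt0Pr => e e0; rewrite add0r.
pose t := Num.min 1 (e / (K + 1)).
have k1 : 0 < K + 1 by rewrite ltr_wpDl.
have t0 : 0 < t by rewrite lt_min ltr01 divr_gt0.
have t1 : t <= 1 by rewrite ge_min lexx.
apply: le_trans (h t t0 t1) _.
apply: (@le_trans _ _ (e / (K + 1) * K)); first by rewrite ler_wpM2r// ge_min lexx orbT.
by rewrite mulrAC -mulrA ler_piMr ?(ltW e0)// ler_pdivrMr// mul1r lerDl.
Qed.

(** The sum of the lower cosine inequalities at x and at ys moves the optimality condition to the
    tangent space at x, where the algorithm makes its mirror step. *)
Lemma prox_base x ys u : argmin X (rc_h lam f x) ys -> X u ->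
  f ys + lam^-1 * (dist x ys ^+ 2 - inner x (rlog x ys) (rlog x u)) <= f u.
Proof.
move=> hys Xu; apply: le_trans (prox_optimal hys Xu); rewrite lerD2l ler_wpM2l ?invr_ge0 ?(ltW l0)//.
have c1 := cosine_lower_ ys x u; have c2 := cosine_lower_ x ys u.
rewrite [dist ys x]distC_ [inner ys (rlog ys u) _]innerC in c1.
rewrite [inner x (rlog x u) _]innerC in c2; lra.
Qed.

(** In nonpositive curvature half the squared distance is at least as convex as in flat space, so h
    grows quadratically away from its minimizer. *)
Lemma prox_growth x ys u : argmin X (rc_h lam f x) ys -> X u ->
  rc_h lam f x ys + (2 * lam)^-1 * dist ys u ^+ 2 <= rc_h lam f x u.
Proof.
move=> hys Xu; have h := prox_optimal hys Xu; have c := cosine_lower_ ys u x.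
rewrite [dist ys x]distC_ [dist u x]distC_ in c.
have k0 : 0 <= (2 * lam)^-1 by rewrite invr_ge0 mulr_ge0// ltW.
have := ler_wpM2l k0 c; rewrite /rc_h mulrBr mulrDr.
rewrite (_ : (2 * lam)^-1 * (2 * _) = lam^-1 * inner ys (rlog ys x) (rlog ys u)); last first.
  by field; rewrite gt_eqF.
rewrite div1r; move: h; move: (_^-1 * _) (_^-1 * _) (_^-1 * _) (_^-1 * _) => a b d e; lra.
Qed.

(** Quadratic growth at rate 1 / (2 lam) turns the tolerance Delta dS^2 / (78 lam) into a squared
    distance Delta dS^2 / 39. *)
Lemma approx_prox_spec k x yk : approx_prox lam X f k x yk -> exists ys, let dS := dist x ys in
  [/\ argmin X (rc_h lam f x) ys, X yk,
      dist ys yk ^+ 2 <= rc_Delta k * dS ^+ 2 / 39 &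
      f yk <= f ys + (dS ^+ 2 - dist x yk ^+ 2) / (2 * lam) + rc_Delta k * dS ^+ 2 / (78 * lam)].
Proof.
move=> [ys hys [Xyk [m hm hle]]]; exists ys; split=> //.
  have e : rc_h lam f x m <= rc_h lam f x ys := hm.2 _ hys.1.
  have g := prox_growth hys Xyk.
  have : (2 * lam)^-1 * dist ys yk ^+ 2 <= rc_Delta k * dist x ys ^+ 2 / (78 * lam).
    by move: hle e g; move: (rc_h _ _ _ _) (rc_h _ _ _ _) (rc_h _ _ _ _) (_^-1 * _) (_ / _) => a b c d e; lra.
  rewrite mulrC ler_pdivrMr ?mulr_gt0//.
  by rewrite (_ : _ / (78 * lam) * (2 * lam) = rc_Delta k * dist x ys ^+ 2 / 39)//; field; rewrite gt_eqF.
have e : rc_h lam f x m <= rc_h lam f x ys := hm.2 _ hys.1.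
move: (le_trans hle (lerD e (lexx _))); rewrite /rc_h.
rewrite mulrBl !div1r [_ / (2 * lam)]mulrC [dist x yk ^+ 2 / _]mulrC; move: (_^-1 * _) (_^-1 * _) (_ / (78 * lam)) => a b c; lra.
Qed.

(** Projection onto a convex ball brings the point closer to each element of the ball, in particular
    to log_y p, which lies in it as d(y, p) <= D, and to 0: both parts of the potential decrease. *)
Lemma projection_pot y (z zb : 'rV[R]_n) : X y -> @ball_projection R n M D y z zb -> pot y zb <= pot y z.
Proof.
move=> Xy [zbD hmin].
have var (w : 'rV[R]_n) : tnorm y w <= D -> inner y (z - zb) (w - zb) <= 0.
  move=> wD; apply/ler_addgt0Pr => e e0; rewrite add0r.
  pose K := inner y (w - zb) (w - zb); have K0 : 0 <= K := inner_ge0 _ _.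
  have k1 : 0 < K + 1 by rewrite ltr_wpDl.
  pose t := Num.min 1 (e / (K + 1)).
  have t0 : 0 < t by rewrite lt_min ltr01 divr_gt0.
  have t1 : t <= 1 by rewrite ge_min lexx.
  pose q := zb + t *: (w - zb).
  have qD : tnorm y q <= D.
    have -> : q = (1 - t) *: zb + t *: w by rewrite /q; apply/rowP => i; rewrite !mxE; ring.
    apply: le_trans (tnorm_triangle _ _ _) _; rewrite !tnormZ (gtr0_norm t0) ger0_norm ?subr_ge0//.
    have h1 : (1 - t) * tnorm y zb <= (1 - t) * D by rewrite ler_wpM2l// subr_ge0.
    have h2 := ler_wpM2l (ltW t0) wD; have := lerD h1 h2; rewrite -mulrDl subrK mul1r; exact.
  have := hmin q qD; rewrite -ler_sqr ?nnegrE ?tnorm_ge0// !tnorm_sqr.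
  have -> : z - q = (z - zb) - t *: (w - zb) by rewrite /q opprD addrA.
  rewrite inner_sub_sqr -/K; move=> h.
  have h1 : inner y (z - zb) (w - zb) <= t * K.
    have : t * (2 * inner y (z - zb) (w - zb)) <= t * (t * K) by move: h; rewrite expr2; lra.
    rewrite ler_pM2l// => h2; apply: le_trans (_ : _ <= 2^-1 * (t * K)) _; first by lra.
    by rewrite ler_piMl ?mulr_ge0 ?(ltW t0)//; lra.
  apply: le_trans h1 _; apply: (@le_trans _ _ (e / (K + 1) * K)); first by rewrite ler_wpM2r// ge_min lexx orbT.
  by rewrite mulrAC -mulrA ler_piMr ?(ltW e0)// ler_pdivrMr// mul1r lerDl.
have far (w : 'rV[R]_n) : tnorm y w <= D -> inner y (zb - w) (zb - w) <= inner y (z - w) (z - w).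
  move=> /var h; have -> : z - w = (zb - w) - (-1) *: (z - zb).
    by rewrite scaleN1r opprK [RHS]addrC addrA subrK.
  rewrite inner_sub_sqr [inner y (zb - w) (z - zb)]innerC.
  have -> : zb - w = - (w - zb) by rewrite opprB.
  rewrite !innerNr !innerNl opprK sqrrN expr1n mul1r.
  by have := inner_ge0 y (z - zb); move: h; move: (inner y (z - zb) (w - zb)) (inner y (z - zb) (z - zb)) (inner y (w - zb) (w - zb)) => a b c; lra.
rewrite /pot lerD//.
  rewrite ler_wpM2l//; apply: far; rewrite -distE_; exact: hD.
rewrite ler_wpM2l ?divr_ge0 ?subr_ge0 ?rc_xi_ge1//.
by have := far 0; rewrite tnorm0 !subr0; apply.
Qed.

End algorithm.

(** * Descent of the potential in one iteration *)

Section descent.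
Context {R : realType} {n : nat} {M : riemannianManifold R n}.
Hypothesis hM : complete_manifold M.
Variable kmin : R.
Hypothesis hK : all_sectional_curvatures M (fun K => kmin <= K <= 0).
Hypothesis hS : @simply_connected R M.
Variables (X : set M) (f : M -> R) (D lam : R) (p : M).
Hypothesis gX : gconvex_set X.
Hypothesis D0 : 0 <= D.
Hypothesis hD : forall x y, X x -> X y -> dist x y <= D.
Hypothesis gf : gconvex X f.
Hypothesis l0 : 0 < lam.
Hypothesis hp : argmin X f p.
Implicit Types (x y q : M).
Let distE_ := @distE R n M hM kmin hK hS.
Let dist_ge0_ := @dist_ge0 R n M hM kmin hK hS.
Let dist_triangle_ := @dist_triangle R n M hM kmin hK hS.
Let xi := rc_xi kmin D.
Let s := zeta kmin (2 * D) - 1.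
Let A := rc_A kmin D lam.
Let a := rc_a kmin D lam.
Notation pot := (pot kmin D p).
Let s0 : 0 <= s := rc_s_ge0 kmin D0.
Let xiE : xi = 1 + 4 * s := rc_xiE kmin D.
Let xi1 : 1 <= xi := rc_xi_ge1 kmin D0.
Let xp : 0 < xi := lt_le_trans ltr01 xi1.

Lemma rc_a_ge k : 128 / 10 * lam * xi <= a k.
Proof.
rewrite /a /rc_a -/xi -subr_ge0 (_ : _ - _ = 2 / 5 * (lam * k%:R)); last by field.
by apply: mulr_ge0; [lra|rewrite mulr_ge0// ltW].
Qed.

Lemma rc_a_gt0 k : 0 < a k.
Proof. by apply: lt_le_trans (rc_a_ge k); rewrite !mulr_gt0//; lra. Qed.

Lemma rc_A_lower k : lam * (200 * xi + k%:R ^+ 2 / (5 * xi) + 64 / 5 * k%:R) <= A k.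
Proof.
rewrite /A rc_A_closed ?gt_eqF// -/xi -subr_ge0.
rewrite (_ : _ - _ = lam * k%:R / (5 * xi)); last by field; rewrite gt_eqF.
by rewrite divr_ge0// ?mulr_ge0// ltW.
Qed.

Lemma rc_A_gt0 k : 0 < A k.
Proof.
apply: lt_le_trans (rc_A_lower k); apply: mulr_gt0 => //.
have h1 : 0 <= k%:R ^+ 2 / (5 * xi) by rewrite divr_ge0 ?sqr_ge0// mulr_ge0// ltW.
have h2 : 0 <= k%:R :> R by [].
by have h3 := xp; move: h1 h2 h3; move: (k%:R ^+ 2 / (5 * xi)) (k%:R : R) xi => c1 c2 c3; lra.
Qed.

(** The difference of the sides is lam^2 times an explicit polynomial in k and xi, nonnegative
    because xi >= 1. *)
Lemma rc_a_sqr k : a k.+1 ^+ 2 <= 9 / 10 * A k * lam * xi.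
Proof.
have Al : A k = 200 * lam * xi + lam * (k%:R * (k%:R + 1)) / (5 * xi) + 64 / 5 * lam * k%:R.
  by rewrite /A rc_A_closed ?gt_eqF.
rewrite Al /a /rc_a -/xi -[k.+1]addn1 natrD; have K0 : 0 <= k%:R :> R by [].
move: (k%:R : R) K0 => K K0; rewrite -subr_ge0.
rewrite (_ : _ - _ = lam ^+ 2 * (1616 / 100 * xi ^+ 2 - 1024 / 100 * xi - 16 / 100 + 2 / 100 * K ^+ 2
   + 128 / 100 * (K * (xi - 1)) + 114 / 100 * K)); last by field; rewrite gt_eqF.
apply: mulr_ge0; first exact: sqr_ge0.
have h1 : 0 <= K * (xi - 1) by rewrite mulr_ge0// subr_ge0.
have h2 : xi <= xi ^+ 2 by rewrite expr2 ler_peMl// ltW.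
by have h3 := sqr_ge0 K; have h4 := xi1; move: h1 h2 h3 h4 K0; move: (K * (xi - 1)) (xi ^+ 2) (K ^+ 2) xi => b c d e; lra.
Qed.

Lemma rc_Delta_in k : 0 < rc_Delta k :> R /\ rc_Delta k <= 1 :> R.
Proof.
have h : 0 < (k%:R + 1) ^+ 2 :> R by rewrite exprn_gt0// ltr_wpDl.
rewrite /rc_Delta; split; first exact: divr_gt0.
by rewrite ler_pdivrMr// mul1r expr_ge1// ?lerDr// addr_ge0.
Qed.

(** 39 exceeds 6^2; the resulting sixth is the source of every 7/6. *)
Lemma dist_prox_le x ys yk (Del : R) : Del <= 1 ->
  dist ys yk ^+ 2 <= Del * dist x ys ^+ 2 / 39 -> dist ys yk <= dist x ys / 6.
Proof.
move=> D1 h; rewrite -ler_sqr ?nnegrE ?divr_ge0 ?dist_ge0_//; apply: le_trans h _.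
have := sqr_ge0 (dist x ys); rewrite exprMn; move: (dist x ys ^+ 2) => d d0.
have h : Del * d <= d by rewrite ler_piMl.
rewrite (_ : (6^-1 : R) ^+ 2 = 36^-1); last by field.
by lra.
Qed.

(** The base point moves from y to x at a gain, the mirror step is made in the tangent space at x,
    its result is transported to yk at the cost [pen], and the projection is free. Optimality is
    known at the exact proximal point ys; using yk instead costs [err]. *)
Lemma riemacon_descent k y (z : tangent y) x yk (zk : tangent yk) :
  X y -> tnorm y z <= D -> riemacon_step kmin D lam X f k.+1 y z x yk zk ->
  [/\ X yk, tnorm yk zk <= D &
    A k.+1 * (f yk - f p) + pot yk zk <= (1 + rc_Delta k.+1) * (A k * (f y - f p) + pot y z)].
Proof.
move=> Xy zD [xE hprox hproj].
have [ys [hys Xyk he hfk]] := @approx_prox_spec R n M hM kmin hK hS X f lam gX gf l0 _ _ _ hprox.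
split=> //; first by have [] := hproj.
have Ap := rc_A_gt0 k; have ap := rc_a_gt0 k.+1.
pose tau := a k.+1 / (A k + a k.+1).
have Aa0 : 0 < A k + a k.+1 by rewrite addr_gt0.
have t0 : 0 < tau by rewrite divr_gt0.
have t1 : tau <= 1 by rewrite ler_pdivrMr// mul1r lerDr ltW.
have := @extrapolation R n M hM kmin hK hS X f D p D0 hD hp y z tau Xy zD t0 t1.
rewrite /= -[rexp y (tau *: z)]xE => -[pxD [u [e0 e1 uu hpx]]].
have [V VE] : exists V : 'rV[R]_n, V = (1 - tau) *: u by exists ((1 - tau) *: u).
rewrite -VE in e1 hpx.
pose b : 'rV[R]_n := rlog x yk; pose bs : 'rV[R]_n := rlog x ys; pose L : 'rV[R]_n := rlog x p.
pose rho := a k.+1 / (lam * xi).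
have r0 : 0 <= rho by apply: divr_ge0; [exact: ltW|apply: mulr_ge0; exact: ltW].
have [De0 De1] := rc_Delta_in k.+1; set Del := rc_Delta k.+1 in hfk he De0 De1 *.
set dS := dist x ys in hfk he *; set B := dist x yk in hfk *.
have dS0 : 0 <= dS := dist_ge0_ _ _; have B0 : 0 <= B := dist_ge0_ _ _.
have bb : inner x b b = B ^+ 2 by rewrite /B distE_ tnorm_sqr.
have nb : tnorm x b = B by rewrite /B distE_.
have zxE : (rlog x (rexp y z) - rc_eta kmin D lam k.+1 *: - (lam^-1 *: rlog x yk) : 'rV_n) = V + rho *: b.
  rewrite e1 scalerN opprK scalerA /rho /rc_eta -/a -/xi; congr (_ + _ *: _).
  by field; rewrite !gt_eqF.
have hPk : pot yk zk <= pot yk (ptransport x yk (V + rho *: b) + rlog yk x).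
  rewrite -zxE; exact: (@projection_pot R n M hM kmin hK hS X f D p D0 hD hp).
have htr := @transport_pot R n M hM kmin hK hS D p D0 x yk (V + rho *: b) pxD (hD hp.1 Xyk).
rewrite -/b -/B -/s in htr.
have Px0 : 0 <= pot x V := @pot_ge0 R n M kmin D p D0 x V.
set err := rho * (dist ys yk * tnorm x (xi *: V - L)).
(* The first-order change of the potential caused by adding rho log_x ys to V. *)
pose Es := lam^-1 * (a k.+1 * inner x bs V - a k.+1 / xi * inner x bs L).
set pen := - 4 * s * _ + _ + _ in htr.
have VV : tnorm x V ^+ 2 <= inner x u u.
  rewrite tnorm_sqr VE innerZl innerZr mulrA -expr2 ler_piMl ?inner_ge0//.
  by rewrite expr_le1// ?subr_ge0// gerBl ltW.
apply: (@potential_descent R (A k) (A k.+1) (a k.+1) lam xi Del (pot y z) (pot x V) (pot yk zk)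
  (f y) (f yk) (f ys) (f p) dS B Es err pen (s * tau * inner x u u)) => //.
- by rewrite /A /= lerDl divr_ge0// ltW// -/xi.
- exact: rc_a_sqr.
- apply: le_trans (dist_triangle_ x ys yk) _; have := dist_prox_le De1 he; rewrite -/dS; lra.
- apply: mulr_ge0; last exact: inner_ge0.
  by apply: mulr_ge0; [exact: s0|exact: ltW].
- exact: hp.2.
- have h1 := @prox_base R n M hM kmin hK hS X f lam gX gf l0 x ys y hys Xy.
  have h2 := @prox_base R n M hM kmin hK hS X f lam gX gf l0 x ys p hys hp.1.
  rewrite e0 innerZr -/bs -/dS in h1; rewrite -/bs -/L -/dS in h2.
  have k1 := ler_wpM2l (ltW Ap) h1; have k2 := ler_wpM2l (ltW (divr_gt0 ap xp)) h2.
  (* The choice of tau: y and the mirror point lie in opposite directions from x, at distances in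
     the ratio tau to 1 - tau, so the u-component of A f(y) matches that of the mirror step. *)
  have E : A k * tau = a k.+1 * (1 - tau) by rewrite /tau; field; rewrite gt_eqF.
  have AkE : A k.+1 = A k + a k.+1 / xi by [].
  rewrite /Es AkE VE innerZr.
  have E1 : A k * (f ys + lam^-1 * (dS ^+ 2 - - tau * inner x bs u)) =
    A k * f ys + A k / lam * dS ^+ 2 + lam^-1 * (a k.+1 * ((1 - tau) * inner x bs u)).
    transitivity (A k * f ys + A k / lam * dS ^+ 2 + lam^-1 * (A k * tau * inner x bs u)).
      by field; rewrite gt_eqF.
    by rewrite E; ring.
  have E2 : a k.+1 / xi * (f ys + lam^-1 * (dS ^+ 2 - inner x bs L)) =
    a k.+1 / xi * f ys + a k.+1 / xi / lam * dS ^+ 2 - lam^-1 * (a k.+1 / xi * inner x bs L) by ring.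
  rewrite E1 in k1; rewrite E2 in k2; move: k1 k2; rewrite mulrBr !mulrDl.
  move: (A k * f ys) (A k / lam * _) (lam^-1 * _) (A k * f y) (a k.+1 / xi * f ys) (a k.+1 / xi / lam * _)
    (lam^-1 * _) (a k.+1 / xi * f p) => c1 c2 c3 c4 c5 c6 c7 c8; lra.
- apply: (error_bound De0 l0 xp r0 erefl (dist_ge0_ _ _) Px0 he (rc_a_sqr k) (tnorm_ge0 _ _)).
  rewrite tnorm_sqr /pot -/xi -/L -subr_ge0.
  (* Hence |xi V - L|^2 <= 2 xi times the potential at V: the error is measured in the potential
     itself. *)
  rewrite (_ : _ - _ = (xi - 1) * inner x L L); first by rewrite mulr_ge0 ?inner_ge0// subr_ge0.
  rewrite !innerDl !innerDr !innerNl !innerNr !innerZl !innerZr [inner x L V]innerC.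
  by move: (inner x V V) (inner x V L) (inner x L L) => c1 c2 c3; field.
- rewrite /pen innerDl innerZl bb.
  have h : tnorm x (V + rho *: b - b) <= tnorm x V + (rho - 1) * B.
    have -> : V + rho *: b - b = V + (rho - 1) *: b by rewrite scalerBl scale1r addrA.
    apply: le_trans (tnorm_triangle _ _ _) _; rewrite lerD2l tnormZ nb ger0_norm//.
    rewrite subr_ge0 /rho ler_pdivlMr ?mulr_gt0// mul1r; apply: le_trans (rc_a_ge k.+1).
    by rewrite -[128 / 10 * lam * xi]mulrA ler_peMl ?mulr_ge0 ?(ltW l0) ?(ltW xp)//; lra.
  apply: le_trans (@penalty_bound R s tau rho (A k) (a k.+1) lam xi (tnorm x V) B (inner x V b) (B ^+ 2) _ _ _ _ _ _ _ _ _ _ _ _ _ h) _ => //.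
  + exact: rc_a_ge.
  + exact: tnorm_ge0.
  + by rewrite lerNl -innerNl -nb; apply: le_trans (inner_le _ _ _) _; rewrite tnormN.
  + by rewrite lerD2r ler_wpM2l// mulr_ge0// ltW.
- apply: le_trans hPk _; apply: le_trans htr _; rewrite lerD2r.
  have pE w := @potE R n M hM kmin hK hS D p x w; rewrite -/xi -/L in pE.
  rewrite !pE !innerDl !innerDr !innerZl !innerZr bb [inner x b V]innerC.
  (* The logarithm at x is nonexpansive, so |log_x yk - log_x ys| <= d(ys, yk). *)
  have hb : inner x (b - bs) (xi *: V - L) <= dist ys yk * tnorm x (xi *: V - L).
    apply: le_trans (inner_le _ _ _) _; rewrite ler_wpM2r ?tnorm_ge0//.
    exact: (@rlog_dist_le R n M hM kmin hK hS).
  have := ler_wpM2l r0 hb; rewrite -/err /Es.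
  rewrite innerDl !innerDr !innerNl !innerNr !innerZr [inner x b V]innerC.
  have rE : rho = a k.+1 / (lam * xi) by [].
  move: err (inner x V V) (inner x V b) (inner x V L) (inner x b L) (inner x bs V) (inner x bs L) (dist x p ^+ 2) (B ^+ 2).
  move=> er c1 c2 c3 c4 c5 c6 c7 c8 h.
  rewrite -subr_ge0 (_ : _ - _ = er - rho * (xi * c2 - c4 - (xi * c5 - c6))); first by rewrite subr_ge0; move: h; rewrite opprB addrA; lra.
  by rewrite rE; field; rewrite !gt_eqF.
Qed.

End descent.

Lemma sqr_div_eighth (K : realFieldType) (a r b : K) : b != 0 ->
  a * (r / b) ^+ 2 / 8 = a * r ^+ 2 / (8 * b ^+ 2).
Proof. by move=> b0; field. Qed.

(** From e^{-1/2} >= 1/2. The bound 4 matches the factor by which one stage divides the squared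
    distance bound. *)
Lemma expR1_le4 (R : realType) : expR 1 <= 4 :> R.
Proof.
have h1 : 2^-1 <= expR (- 2^-1) :> R.
  by apply: le_trans (expR_ge1Dx _); lra.
have h2 : expR 2^-1 <= 2 :> R.
  by rewrite expRN in h1; rewrite -(lef_pV2) ?posrE ?expR_gt0.
have -> : expR 1 = expR 2^-1 * expR 2^-1 :> R by rewrite -expRD; congr expR; field.
apply: le_trans (ler_pM (expR_ge0 _) (expR_ge0 _) h2 h2) _; lra.
Qed.

(** * Convergence rate and restarts *)

Section convergence.
Context {R : realType} {n : nat} {M : riemannianManifold R n}.
Hypothesis hM : complete_manifold M.
Variable kmin : R.
Hypothesis hK : all_sectional_curvatures M (fun K => kmin <= K <= 0).
Hypothesis hS : @simply_connected R M.
Variables (X : set M) (f : M -> R) (D lam : R) (p : M).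
Hypothesis gX : gconvex_set X.
Hypothesis D0 : 0 <= D.
Hypothesis hD : forall x y, X x -> X y -> dist x y <= D.
Hypothesis gf : gconvex X f.
Hypothesis l0 : 0 < lam.
Hypothesis hp : argmin X f p.
Let distC_ := @distC R n M hM kmin hK hS.
Let dist_ge0_ := @dist_ge0 R n M hM kmin hK hS.
Let dist_triangle_ := @dist_triangle R n M hM kmin hK hS.
Let xi := rc_xi kmin D.
Let A := rc_A kmin D lam.
Let xi1 : 1 <= xi := rc_xi_ge1 kmin D0.
Let xp : 0 < xi := lt_le_trans ltr01 xi1.
Let A_gt0 k : 0 < A k := @rc_A_gt0 R kmin D lam D0 l0 k.

Let pot_ge0_ := @pot_ge0 R n M kmin D p D0.

(** Comparison of h_0 at its minimizer and at p gives 1/2, the tolerance with Delta_0 = 1 adds 1/78,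
    in total 20/39; for the distance, 7/6 = 1 + 1/6. *)
Lemma start_bound (x0 y0 : M) : approx_prox lam X f 0 x0 y0 ->
  [/\ X y0, f y0 - f p <= 20 / 39 * (dist x0 p ^+ 2 / lam) & dist y0 p <= 7 / 6 * dist x0 p].
Proof.
move=> /(@approx_prox_spec R n M hM kmin hK hS X f lam gX gf l0)[ys [hys Xy0 he hfy]].
have D1 : rc_Delta 0 = 1 :> R by rewrite /rc_Delta add0r expr1n divr1.
rewrite D1 mul1r in he hfy.
have g := @prox_growth R n M hM kmin hK hS X f lam gX gf l0 x0 ys p hys hp.1.
rewrite /rc_h div1r in g; have hf := hp.2 _ hys.1.
have k0 : 0 < (2 * lam)^-1 by rewrite invr_gt0 mulr_gt0.
have pyth : dist x0 ys ^+ 2 + dist ys p ^+ 2 <= dist x0 p ^+ 2.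
  rewrite -(ler_pM2l k0) mulrDr; move: g hf; move: (_^-1 * _) (_^-1 * _) (_^-1 * _) => a b c; lra.
have hys' : dist ys p <= dist x0 p.
  rewrite -ler_sqr ?nnegrE ?dist_ge0_//; apply: le_trans pyth; rewrite lerDr; exact: sqr_ge0.
have hxs : dist x0 ys <= dist x0 p.
  rewrite -ler_sqr ?nnegrE ?dist_ge0_//; apply: le_trans pyth; rewrite lerDl; exact: sqr_ge0.
split=> //.
  move: g hfy; rewrite mulrBl [_ / (2 * lam)]mulrC [_ ^+ 2 / (2 * lam)]mulrC.
  have h1 : 0 <= (2 * lam)^-1 * dist x0 y0 ^+ 2 by rewrite mulr_ge0 ?sqr_ge0// ltW.
  have h2 : 0 <= (2 * lam)^-1 * dist ys p ^+ 2 by rewrite mulr_ge0 ?sqr_ge0// ltW.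
  have h3 : dist x0 ys ^+ 2 / (78 * lam) <= 78^-1 * (dist x0 p ^+ 2 / lam).
    rewrite invfM mulrCA ler_wpM2l// ler_wpM2r ?invr_ge0 ?(ltW l0)//.
    by rewrite ler_sqr ?nnegrE ?dist_ge0_.
  have h4 : (2 * lam)^-1 * dist x0 p ^+ 2 = 2^-1 * (dist x0 p ^+ 2 / lam) by rewrite invfM; ring.
  rewrite h4; move: h1 h2 h3; move: (_^-1 * _) (_^-1 * _) (_ / (78 * lam)) (_^-1 * _) (dist x0 p ^+ 2 / lam) => a b c d e; lra.
apply: le_trans (dist_triangle_ y0 ys p) _.
have := @dist_prox_le R n M hM kmin hK hS x0 ys y0 1 (lexx _); rewrite mul1r => /(_ he).
rewrite [dist y0 ys]distC_; move: hys' hxs; lra.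
Qed.

(** 2 (k + 1) / (k + 2) is a majorant of the product of the 1 + Delta_j: it equals 1 at k = 0 and
    stays below 2. *)
Lemma descent_product (k : nat) : (1 + rc_Delta k.+1) * (2 * (k%:R + 1) / (k%:R + 2)) <=
  2 * (k.+1%:R + 1) / (k.+1%:R + 2) :> R.
Proof.
rewrite /rc_Delta -[k.+1]addn1 natrD; have K0 : 0 <= k%:R :> R by []; move: (k%:R : R) K0 => K K0.
have h1 : K + 1 + 1 != 0 by rewrite gt_eqF//; lra.
have h2 : K + 2 != 0 by rewrite gt_eqF//; lra.
have h3 : K + 1 + 2 != 0 by rewrite gt_eqF//; lra.
rewrite -subr_ge0 (_ : _ - _ = 2 / ((K + 2) ^+ 3 * (K + 3))); last first.
  by field; rewrite !gt_eqF//; lra.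
by apply: divr_ge0 => //; apply: mulr_ge0; [apply: exprn_ge0|]; lra.
Qed.

(** Besides the rate for T > 0 the bound at y_0 is recorded for T = 0: the iteration bound has no
    additive constant, so a run without iterations must be covered. *)
Lemma riemacon_rate (T : nat) (x0 yT : M) (r : R) : riemacon kmin D lam X f T x0 yT ->
  dist x0 p <= r ->
  [/\ X yT, f yT - f p <= 20 / 39 * (r ^+ 2 / lam) \/ (0 < T)%N &
     (0 < T)%N -> f yT - f p <= 1040 * xi ^+ 2 * r ^+ 2 / (lam * T%:R ^+ 2)].
Proof.
move=> [x [y [z [x00 hprox z0 hstep ->]]]] hr.
have [Xy0 hf0 hd0] := start_bound hprox.
have r0 : 0 <= r by apply: le_trans hr.
have hr2 : dist x0 p ^+ 2 <= r ^+ 2 by rewrite ler_sqr ?nnegrE ?dist_ge0_.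
have hf0r : f (y 0%N) - f p <= 20 / 39 * (r ^+ 2 / lam).
  apply: le_trans hf0 _; apply: ler_wpM2l; first by lra.
  by rewrite ler_wpM2r// invr_ge0 ltW.
pose Psi k := A k * (f (y k) - f p) + pot kmin D p (y k) (z k).
have Psi0 : 0 <= Psi 0%N.
  by apply: addr_ge0 (pot_ge0_ _ _); rewrite mulr_ge0 ?(ltW (A_gt0 _))// subr_ge0 hp.2.
have inv k : (k <= T)%N -> [/\ X (y k), tnorm (y k) (z k) <= D &
    Psi k <= 2 * (k%:R + 1) / (k%:R + 2) * Psi 0%N].
  elim: k => [_|k IH kT].
    by split=> //; [rewrite z0 tnorm0|rewrite !add0r mulr1 mulfV// mul1r].
  have [Xk zk hk] := IH (ltnW kT).
  have [X' z' h'] := @riemacon_descent R n M hM kmin hK hS X f D lam p gX D0 hD gf l0 hp k (y k) (z k) _ _ _ Xk zk (hstep k.+1 kT).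
  split=> //; apply: le_trans h' _; have [De0 _] := @rc_Delta_in R k.+1.
  have d1 : 0 <= 1 + rc_Delta k.+1 :> R by rewrite addr_ge0// ltW.
  apply: le_trans (ler_wpM2l d1 hk) _; rewrite mulrA ler_wpM2r//; exact: descent_product.
have [XT zT hT] := inv T (leqnn T).
split=> //; first by case: (T) => [|m]; [left|right].
move=> T0; have K0 : 0 < T%:R :> R by rewrite ltr0n.
have pot0 : pot kmin D p (y 0%N) (z 0%N) <= 49 / 72 * r ^+ 2.
  rewrite (@potE R n M hM kmin hK hS) z0 !inner0l mulr0 subr0 add0r.
  have c0 : 0 <= 7 / 6 :> R by rewrite divr_ge0.
  have : dist (y 0%N) p ^+ 2 <= (7 / 6 * r) ^+ 2.
    rewrite ler_sqr ?nnegrE ?dist_ge0_ ?mulr_ge0//.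
    exact: le_trans hd0 (ler_wpM2l c0 hr).
  rewrite exprMn (_ : (7 / 6 : R) ^+ 2 = 49 / 36); last by field.
  by move: (dist _ _ ^+ 2) (r ^+ 2) => a b; lra.
(* 200 times 20/39 is below 103, and the potential of z = 0 is half of (7/6)^2; then 1040 = 104
   times 2 for the product times 5 from A_T. *)
have P0 : Psi 0%N <= 104 * xi * r ^+ 2.
  rewrite /Psi {1}/A /= -/xi.
  have h1 : 200 * lam * xi * (f (y 0%N) - f p) <= 200 * lam * xi * (20 / 39 * (r ^+ 2 / lam)).
    by apply: ler_wpM2l => //; exact: mulr_ge0 (mulr_ge0 (ler0n _ _) (ltW l0)) (ltW xp).
  have E : 200 * lam * xi * (20 / 39 * (r ^+ 2 / lam)) = 4000 / 39 * (xi * r ^+ 2) by field; rewrite gt_eqF.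
  have h2 : r ^+ 2 <= xi * r ^+ 2 by rewrite ler_peMl// sqr_ge0.
  have h3 := sqr_ge0 r.
  rewrite E in h1; apply: le_trans (lerD h1 pot0) _; rewrite -[104 * _ * _]mulrA.
  by move: h2 h3; move: (r ^+ 2) (xi * _) => a b; lra.
have PT : A T * (f (y T) - f p) <= 2 * Psi 0%N.
  apply: (@le_trans _ _ (Psi T)); first by rewrite lerDl; exact: pot_ge0_.
  apply: le_trans hT _; rewrite ler_wpM2r// ler_pdivrMr ?ltr_wpDl//.
  by apply: ler_wpM2l => //; lra.
have hA : lam * (T%:R ^+ 2 / (5 * xi)) <= A T.
  apply: le_trans (@rc_A_lower R kmin D lam D0 l0 T); rewrite ler_wpM2l ?(ltW l0)// -/xi.
  rewrite addrAC lerDr; apply: addr_ge0; apply: mulr_ge0 => //; exact: ltW.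
have g0 : 0 <= f (y T) - f p by rewrite subr_ge0 hp.2.
have h1 := le_trans (ler_wpM2r g0 hA) (le_trans PT (ler_wpM2l (ler0n R 2) P0)).
have c0 : 0 < lam * T%:R ^+ 2 by rewrite mulr_gt0 ?exprn_gt0.
rewrite ler_pdivlMr// mulrC.
have := ler_wpM2l (ltW (mulr_gt0 (ltr0Sn R 4) xp)) h1.
rewrite (_ : 5 * xi * (2 * _) = 1040 * xi ^+ 2 * r ^+ 2); last by ring.
rewrite (_ : 5 * xi * (lam * _ * _) = lam * T%:R ^+ 2 * (f (y T) - f p))//.
by field; rewrite gt_eqF.
Qed.

Lemma argmin_eq m : argmin X f m -> f m = f p.
Proof. by move=> hm; apply/eqP; rewrite eq_le (hm.2 _ hp.1) (hp.2 _ hm.1). Qed.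

(** Compare p with the point of weight 1 - t towards x, use minimality there, divide by 1 - t and
    let t tend to 1. *)
Lemma strong_growth mu x : 0 < mu -> strongly_gconvex mu X f -> X x ->
  f p + mu / 2 * dist x p ^+ 2 <= f x.
Proof.
move=> mu0 hs Xx; set K := mu / 2 * _; have K0 : 0 <= K by rewrite mulr_ge0 ?sqr_ge0// divr_ge0// ltW.
have h (t : R) : 0 <= t -> t < 1 -> f p + t * K <= f x.
  move=> t0 t1; have t01 : t \in `[0, 1] by rewrite in_itv /= t0 ltW.
  have t01' : 1 - t \in `[0, 1] by rewrite in_itv /= subr_ge0 gerBl t0 ltW.
  have h1 := hp.2 _ (gX hp.1 Xx t01'); have := hs p x t hp.1 Xx t01; rewrite [dist p x]distC_.
  have s0 : 0 < 1 - t by rewrite subr_gt0.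
  move=> h2; have h3 := le_trans h1 h2; rewrite -(ler_pM2l s0).
  have E : t * (1 - t) * mu / 2 * dist x p ^+ 2 = (1 - t) * (t * K) by rewrite /K; ring.
  by move: h3; rewrite E mulrDr !mulrBl !mul1r; lra.
apply/ler_addgt0Pr => e e0; have k1 : 0 < K + 1 by rewrite ltr_wpDl.
pose d := Num.min 1 (e / (K + 1)).
have d0 : 0 < d by rewrite lt_min ltr01 divr_gt0.
have d1 : d <= 1 by rewrite ge_min lexx.
have := h (1 - d); rewrite subr_ge0 d1 gtrBl d0 => /(_ isT isT).
have dK : d * K <= e.
  apply: (@le_trans _ _ (e / (K + 1) * K)); first by rewrite ler_wpM2r// ge_min lexx orbT.
  by rewrite mulrAC -mulrA ler_piMr ?(ltW e0)// ler_pdivrMr// mul1r lerDl.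
rewrite mulrBl mul1r; lra.
Qed.

Let zD := zeta kmin D.

(** Doubling the radius at most doubles zeta, which replaces zeta_{2D} by zeta_D in the final
    bounds. *)
Lemma rc_xi_le : xi <= 8 * zD.
Proof. by rewrite /xi /rc_xi; have := zeta_double kmin D0; rewrite -/zD; lra. Qed.

Lemma zD1 : 1 <= zD. Proof. exact: zeta_ge1. Qed.

Lemma rc_xi_sqr : xi ^+ 2 <= 64 * zD ^+ 2.
Proof.
have z0 : 0 <= zD by apply: le_trans zD1.
have : xi ^+ 2 <= (8 * zD) ^+ 2.
  rewrite ler_sqr ?nnegrE ?rc_xi_le ?(ltW xp)//; exact: mulr_ge0.
by rewrite exprMn (_ : 8 ^+ 2 = 64 :> R)//; ring.
Qed.

Lemma convex_case (x0 : M) (R0 eps : R) : R0 = dist x0 p -> 0 < eps ->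
  exists2 T : nat, T%:R <= 544 * (zD * Num.sqrt (R0 ^+ 2 / (lam * eps))) &
    forall yT, riemacon kmin D lam X f T x0 yT -> approx_minimizer X f eps yT.
Proof.
move=> R0E e0; set w := Num.sqrt _; have w0 : 0 <= w := sqrtr_ge0 _.
have le0 : 0 < lam * eps by rewrite mulr_gt0.
have ww : w ^+ 2 * (lam * eps) = R0 ^+ 2.
  by rewrite /w sqr_sqrtr ?divr_ge0 ?sqr_ge0 ?(ltW le0)// divfK// gt_eqF.
have z1 := zD1; have z0 : 0 <= zD by apply: le_trans z1.
have zw : 0 <= zD * w by exact: mulr_ge0.
have q0 : 0 <= 544 * (zD * w) := mulr_ge0 (ler0n _ _) zw.
have /andP[t1 t2] := Num.Theory.truncn_itv q0; set T := Num.truncn _ in t1 t2.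
exists T => // yT hy.
have [XT h1 h2] : [/\ X yT, _ \/ _ & _ -> _] := riemacon_rate hy (eq_ind _ (fun u => u <= R0) (lexx R0) _ R0E).
split=> //; exists p => //; rewrite -lerBlDl.
(* If T = 0 then 544 zeta w < 1, so w <= 1, which says R_0^2 <= lam eps, and y_0 is accurate
   enough. *)
have [T0|T0] := posnP T.
  case: h1 => [h1|]; last by rewrite T0.
  apply: le_trans h1 _; rewrite T0 in t2.
  have w1 : w <= 1.
    have : w <= zD * w by rewrite ler_peMl.
    by lra.
  have w2 : w ^+ 2 <= 1 by rewrite expr_le1.
  rewrite -ww (_ : w ^+ 2 * (lam * eps) / lam = w ^+ 2 * eps); last by field; rewrite gt_eqF.
  have : w ^+ 2 * eps <= eps by rewrite ler_piMl// ltW.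
  by move: (w ^+ 2 * eps) => a; lra.
have K1 : 1 <= T%:R :> R by rewrite ler1n.
have K0 : 0 < T%:R :> R by apply: lt_le_trans K1.
apply: le_trans (h2 T0) _; rewrite ler_pdivrMr ?mulr_gt0 ?exprn_gt0//.
(* T >= (T + 1) / 2 >= 272 zeta w, and 272^2 = 289 times 256 exceeds 1040 times 64. *)
have hq : 17 * (16 * (zD * w)) <= T%:R by move: t2; rewrite -addn1 natrD; lra.
have hq2 : (17 * (16 * (zD * w))) ^+ 2 <= T%:R ^+ 2.
  by rewrite ler_sqr ?nnegrE ?(ltW K0)//; exact: mulr_ge0 (ler0n _ _) (mulr_ge0 (ler0n _ _) zw).
have h3 := ler_wpM2r (ltW le0) hq2.
have E : (17 * (16 * (zD * w))) ^+ 2 * (lam * eps) = 289 * (256 * (zD ^+ 2 * R0 ^+ 2)).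
  by rewrite -ww; ring.
have h4 : xi ^+ 2 * R0 ^+ 2 <= 64 * (zD ^+ 2 * R0 ^+ 2).
  by rewrite mulrA ler_wpM2r ?sqr_ge0// rc_xi_sqr.
have h5 : 0 <= zD ^+ 2 * R0 ^+ 2 by rewrite mulr_ge0 ?sqr_ge0.
rewrite E in h3; have E2 : eps * (lam * T%:R ^+ 2) = T%:R ^+ 2 * (lam * eps) by ring.
rewrite E2 -mulrA; move: h3 h4 h5.
by move: (_ * (lam * eps)) (xi ^+ 2 * _) (zD ^+ 2 * _) => a b c; lra.
Qed.

Lemma stage_guarantee mu (N : nat) : 0 < mu ->
  744 * (zD * Num.sqrt (1 / (lam * mu))) <= N%:R -> (0 < N)%N ->
  forall r, 0 <= r -> riemacon_guarantees kmin D lam X f p r (mu * r ^+ 2 / 8) N.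
Proof.
move=> mu0 hN N0 r r0 x0 yT Xx0 hr hy; have [XT _ h] := riemacon_rate hy hr.
split=> //; exists p => //; rewrite -lerBlDl; apply: le_trans (h N0) _.
have K0 : 0 < N%:R :> R by rewrite ltr0n.
have lm : 0 < lam * mu by rewrite mulr_gt0.
rewrite ler_pdivrMr ?mulr_gt0 ?exprn_gt0//.
set w := Num.sqrt _ in hN; have w0 : 0 <= w := sqrtr_ge0 _.
have ww : w ^+ 2 * (lam * mu) = 1.
  by rewrite /w sqr_sqrtr ?divr_ge0 ?(ltW lm)// divfK// gt_eqF.
have z0 : 0 <= zD by apply: le_trans zD1.
have zw : 0 <= 24 * (31 * (zD * w)).
  exact: mulr_ge0 (ler0n _ _) (mulr_ge0 (ler0n _ _) (mulr_ge0 z0 w0)).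
(* 744 = 24 times 31, and 744^2 exceeds 1040 times 64 times 8, the last 8 being that of the stage
   accuracy. *)
have hq2 : (24 * (31 * (zD * w))) ^+ 2 <= N%:R ^+ 2.
  rewrite ler_sqr ?nnegrE ?(ltW K0)//; apply: le_trans hN.
  by rewrite [24 * _]mulrA ler_wpM2r ?mulr_ge0// -natrM.
have h3 := ler_wpM2r (ltW lm) hq2.
have E : (24 * (31 * (zD * w))) ^+ 2 * (lam * mu) = 576 * (961 * zD ^+ 2).
  rewrite -[RHS]mulr1 -[X in _ = _ * X]ww; ring.
rewrite E in h3; have hx := rc_xi_sqr; have zz := sqr_ge0 zD.
have k1 : 1040 * xi ^+ 2 <= 8^-1 * (N%:R ^+ 2 * (lam * mu)).
  by move: h3 hx zz; move: (_ * (lam * mu)) (xi ^+ 2) (zD ^+ 2) => a b c; lra.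
have := ler_wpM2r (sqr_ge0 r) k1; congr (_ <= _); ring.
Qed.

(** Every stage has the same length, since the bound for one stage is scale invariant: the target
    accuracy shrinks with the square of the distance bound. *)
Lemma strongly_convex_case mu (x0 : M) (R0 eps : R) : R0 = dist x0 p -> X x0 -> 0 < eps -> 0 < mu ->
  strongly_gconvex mu X f ->
  exists (J : nat) (T : nat -> nat),
    [/\ (forall j, (j < J)%N -> let Rj := R0 / 2 ^+ j in
          riemacon_guarantees kmin D lam X f p Rj (mu * Rj ^+ 2 / 8) (T j)),
        ((\sum_(j < J) T j)%N)%:R <= 1488 * ((zD * Num.sqrt (1 / (lam * mu)) + 1) *
           Num.max 1 (ln (mu * R0 ^+ 2 / eps))) &
        forall y, restarted_riemacon kmin D lam X f J T x0 y -> approx_minimizer X f eps y].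
Proof.
move=> R0E Xx0 e0 mu0 hs; set w := zD * Num.sqrt _; set L := Num.max 1 _.
have R00 : 0 <= R0 by rewrite R0E.
have w0 : 0 <= w by rewrite mulr_ge0 ?sqrtr_ge0// (le_trans ler01 zD1).
have L1 : 1 <= L by rewrite le_max lexx.
have L0 : 0 <= L by apply: le_trans L1.
have q0 : 0 <= 744 * w := mulr_ge0 (ler0n _ _) w0.
have /andP[n1 n2] := Num.Theory.truncn_itv q0; set N := Num.truncn _ in n1 n2.
have /andP[j1 j2] := Num.Theory.truncn_itv L0; set J := Num.truncn _ in j1 j2.
have hg := stage_guarantee mu0 (ltW n2) (ltn0Sn N).
have Rj0 j : 0 <= R0 / 2 ^+ j by rewrite divr_ge0// exprn_ge0.
exists J.+1, (fun=> N.+1); split.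
(* Since L >= 1, J + 1 <= 2 L; this factor 2 makes 1488 out of 744. *)
- by move=> j _ Rj; apply: hg; exact: Rj0.
- rewrite sum_nat_const card_ord natrM -[J.+1]addn1 -[N.+1]addn1 !natrD.
  have h1 : J%:R + 1 <= 2 * L by lra.
  have h2 : N%:R + 1 <= 744 * (w + 1) by lra.
  have h3 := ler_pM (addr_ge0 (ler0n R J) ler01) (addr_ge0 (ler0n R N) ler01) h1 h2.
  by apply: le_trans h3 _; rewrite le_eqVlt; apply/orP; left; apply/eqP; ring.
- move=> y [q [q0E hq ->]].
  have inv j : (j <= J.+1)%N -> X (q j) /\ dist (q j) p <= R0 / 2 ^+ j.
    elim: j => [_|j IH jJ]; first by rewrite q0E expr0 divr1 R0E.
    have [Xq dq] := IH (ltnW jJ).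
    have [Xq' [m hm hle]] := hg _ (Rj0 j) _ _ Xq dq (hq j jJ).
    split=> //; rewrite (argmin_eq hm) in hle.
    have h := strong_growth mu0 hs Xq'; set r := R0 / 2 ^+ j in dq hle.
    have rE : R0 / 2 ^+ j.+1 = r / 2 by rewrite /r exprS invfM; ring.
    rewrite rE -ler_sqr ?nnegrE ?dist_ge0_ ?divr_ge0 ?Rj0//.
    have k1 : mu * dist (q j.+1) p ^+ 2 <= mu * (r / 2) ^+ 2.
      rewrite (_ : mu * (r / 2) ^+ 2 = 2 * (mu * r ^+ 2 / 8)); last by field.
      by move: h hle; rewrite mulrAC; move: (mu * _) (mu * r ^+ 2 / 8) => a b; lra.
    by rewrite ler_pM2l in k1.
  have [Xq dq] := inv J (leqnSn J).
  have [Xq' [m hm hle]] := hg _ (Rj0 J) _ _ Xq dq (hq J (ltnSn J)).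
  split=> //; exists m => //; apply: le_trans hle _; rewrite lerD2l.
  (* The logarithm is below J + 1 and e <= 4. Stage J has accuracy mu R_0^2 / (8 times 4^J), so a
     factor 2 is to spare. *)
  have hx : mu * R0 ^+ 2 / eps <= 4 ^+ J.+1.
    have [x0'|x0'] := leP (mu * R0 ^+ 2 / eps) 0; first by apply: le_trans x0' _; exact: exprn_ge0.
    rewrite -[leLHS]lnK ?posrE//; apply: (@le_trans _ _ (expR (J.+1%:R * 1))).
      by rewrite ler_expR mulr1; apply: le_trans (ltW j2); rewrite /L le_max lexx orbT.
    by rewrite expRM_natl; apply: lerXn2r; rewrite ?nnegrE ?expR_ge0 ?expR1_le4.
  rewrite ler_pdivrMr// in hx.
  have p2 : 2 ^+ J != 0 :> R by rewrite expf_neq0.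
  have E : mu * (R0 / 2 ^+ J) ^+ 2 / 8 = mu * R0 ^+ 2 / (8 * 4 ^+ J).
    have -> : 4 ^+ J = (2 ^+ J) ^+ 2 :> R by rewrite -exprM mulnC exprM; congr (_ ^+ _); ring.
    exact: sqr_div_eighth.
  have p4 : 0 < 4 ^+ J :> R by rewrite exprn_gt0.
  rewrite E ler_pdivrMr ?mulr_gt0//; apply: le_trans hx _.
  rewrite exprS; have := mulr_gt0 p4 e0.
  by move=> /ltW h4; rewrite [leRHS]mulrC -!mulrA; apply: (ler_wpM2r h4); rewrite ler_nat.
Qed.

End convergence.

Theorem theorem4 (R : realType) :
  exists2 C : R, 0 < C &
  forall (n : nat) (M : riemannianManifold R n) (kmin kmax : R)
    (N X : set M) (f : M -> R) (D lam : R) (x0 xstar : M) (R0 eps : R),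
  hadamard M ->
  kmin <= kmax -> kmax <= 0 ->
  all_sectional_curvatures M (fun K => kmin <= K <= kmax) ->
  open N -> X `<=` N ->
  compact X -> gconvex_set X -> D = diam X ->
  gconvex X f ->
  0 < lam ->
  X x0 -> argmin X f xstar -> R0 = dist x0 xstar ->
  0 < eps ->
  (exists2 T : nat,
     T%:R <= C * (zeta kmin D * Num.sqrt (R0 ^+ 2 / (lam * eps))) &
     forall yT, riemacon kmin D lam X f T x0 yT ->
       approx_minimizer X f eps yT)
  /\
  (forall mu : R, 0 < mu -> strongly_gconvex mu X f ->
     exists (J : nat) (T : nat -> nat),
       [/\ (forall j, (j < J)%N ->
              let Rj := R0 / 2 ^+ j in
              riemacon_guarantees kmin D lam X f xstar
                Rj (mu * Rj ^+ 2 / 8) (T j)),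
           ((\sum_(j < J) T j)%N)%:R <=
             C * ((zeta kmin D * Num.sqrt (1 / (lam * mu)) + 1) *
                  Num.max 1 (ln (mu * R0 ^+ 2 / eps))) &
           forall y, restarted_riemacon kmin D lam X f J T x0 y ->
             approx_minimizer X f eps y]).
Proof.
exists 1488; first by rewrite ltr0n.
move=> n M kmin kmax N X f D lam x0 xstar R0 eps [hM hS _] _ hkmax hK0 _ _ cX gX DE gf l0 Xx0 hp R0E e0.
have hK : all_sectional_curvatures M (fun K => kmin <= K <= 0).
  by move=> x u v /(hK0 x)/andP[-> h] /=; exact: le_trans hkmax.
have hD x y : X x -> X y -> dist x y <= D.
  by move=> Xx Xy; rewrite DE; exact: (@dist_le_diam R n M hM kmin hK hS).
have D0 : 0 <= D by apply: le_trans (hD x0 x0 Xx0 Xx0); exact: (@dist_ge0 R n M hM kmin hK hS).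
split; last first.
  by move=> mu mu0 hs; exact: (@strongly_convex_case R n M hM kmin hK hS X f D lam xstar).
have [T hT h] := @convex_case R n M hM kmin hK hS X f D lam xstar gX D0 hD gf l0 hp x0 R0 eps R0E e0.
exists T => //; apply: le_trans hT _; rewrite ler_wpM2r//; last by lra.
by rewrite mulr_ge0 ?sqrtr_ge0// (le_trans ler01)// zeta_ge1.
Qed.
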